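(* Let $\mathcal{B}_4$ be the Engel group and let $A=-\left(X_1^2+X_2^2+X_3^2+X_4^2+X_4^{-2}\right)$, where $X_1,\dots,X_4$ are the left-invariant vector fields on $\mathcal{B}_4$ given in the context. Let $1<p\le 2\le q<\infty$ and set $\frac1r=\frac1p-\frac1q$. (i) There is a constant $C>0$, depending only on $p,q$, such that for every monotonically decreasing continuous function $\phi$ on $[0,\infty)$ with $\phi(0)=1$ and $\lim_{s\to\infty}\phi(s)=0$, $$\|\phi(A)\|_{L^p(\mathcal{B}_4)\to L^q(\mathcal{B}_4)}\le C\,\sup_{s>0}\phi(s)\,s^{\frac3r},$$ in the sense that if the right-hand side is finite, then so is the left-hand side and the inequality holds. (ii) For all $a,b\in\mathbb{R}$ with $a-b\ge\frac3r$ there is a constant $C>0$ (depending only on $a,b,p,q$) such that for all $f\in\mathcal{S}(\mathcal{B}_4)$, $$\|(I+A)^b f\|_{L^q(\mathcal{B}_4)}\le C\,\|(I+A)^a f\|_{L^p(\mathcal{B}_4)}.$$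
   Context: The Engel group $\mathcal{B}_4$ is $\mathbb{R}^4$ with the group law $$(x_1,x_2,x_3,x_4)\times(y_1,y_2,y_3,y_4)=\left(x_1+y_1,\;x_2+y_2,\;x_3+y_3-x_1y_2,\;x_4+y_4+\tfrac12x_1^2y_2-x_1y_3\right).$$ Its Haar measure is Lebesgue measure on $\mathbb{R}^4$; $L^p(\mathcal{B}_4)=L^p(\mathbb{R}^4)$ and $\mathcal{S}(\mathcal{B}_4)=\mathcal{S}(\mathbb{R}^4)$. The left-invariant vector fields are $$X_1=\partial_{x_1},\quad X_2=\partial_{x_2}-x_1\partial_{x_3}+\tfrac{x_1^2}{2}\partial_{x_4},\quad X_3=\partial_{x_3}-x_1\partial_{x_4},\quad X_4=\partial_{x_4}.$$ The operator $X_4^{-2}$ is the left Fourier multiplier inverse to $X_4^2$. Since $X_4=\partial_{x_4}$ has symbol $i\lambda$, it acts as multiplication by $-\lambda^{-2}$ on the Fourier side, where $\lambda\neq0$ is the frequency dual to $x_4$. Thus $A$ is the nonnegative self-adjoint operator on $L^2(\mathcal{B}_4)$ that is the sum of two strongly commuting nonnegative self-adjoint operators: the closure of $-(X_1^2+X_2^2+X_3^2+X_4^2)$ initially defined on $\mathcal{S}(\mathcal{B}_4)$, and the operator $-X_4^{-2}$ given by multiplication by $\lambda^{-2}$ after the partial Fourier transform in $x_4$. Equivalently, in terms of the representations $\pi_{\lambda,\mu}$ ($\lambda\ne0$, $\mu\in\mathbb{R}$) of $\mathcal{B}_4$ on $L^2(\mathbb{R})$, $$\pi_{\lambda,\mu}(x)h(u)=\exp\left(i\left(-\tfrac{\mu}{2\lambda}x_2+\lambda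 x_4-\lambda x_3u+\tfrac{\lambda}{2}x_2u^2\right)\right)h(u+x_1),$$ and the group Fourier transform $\widehat f(\pi)=\int f(x)\pi(x)^*\,dx$, the operator $A$ satisfies $\widehat{Af}(\pi_{\lambda,\mu})=\pi_{\lambda,\mu}(A)\widehat f(\pi_{\lambda,\mu})$ with $$\pi_{\lambda,\mu}(A)=-\frac{d^2}{du^2}+\frac14\left(\lambda u^2-\frac{\mu}{\lambda}\right)^2+(\lambda u)^2+\lambda^2+\lambda^{-2}.$$ The operators $\phi(A)$ and $(I+A)^a$ are defined by the spectral functional calculus on $L^2(\mathcal{B}_4)$. The norm $\|T\|_{L^p\to L^q}$ of an operator $T$ bounded on $L^2$ is the supremum of $\|Tf\|_{L^q}/\|f\|_{L^p}$ over nonzero $f\in L^p\cap L^2$. In (ii), if $f$ is not in the $L^2$-domain of $(I+A)^a$, the right-hand side is understood as $+\infty$. *)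

(* Defs.v *)
From HB Require Import structures.
From mathcomp Require Import all_boot all_order all_algebra.
From mathcomp Require Import complex.
From mathcomp Require Import all_classical all_reals all_analysis.
From mathcomp Require Import ring.
Set Implicit Arguments.
Unset Strict Implicit.
Unset Printing Implicit Defensive.
Import Order.TTheory GRing.Theory Num.Theory.
Import numFieldNormedType.Exports.
Import HBSimple.
Local Open Scope classical_set_scope.
Local Open Scope ring_scope.
Local Open Scope complex_scope.

Section ComplexLp.
Context (d : measure_display) (T : measurableType d) (R : realType).
Variable mu : {measure set T -> \bar R}.
Implicit Types (f g : T -> R[i]) (p q : R).

Definition cmeasurable f : Prop :=
  measurable_fun [set: T] (fun x => complex.Re (f x)) /\
  measurable_fun [set: T] (fun x => complex.Im (f x)).

Definition cintegral (D : set T) f : R[i] :=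
  Rintegral mu D (fun x => complex.Re (f x)) +i*
  Rintegral mu D (fun x => complex.Im (f x)).

Definition cLnorm p f : \bar R :=
  Lnorm mu p%:E (fun x => (ComplexField.Normc.normc (f x))%:E).

Definition memL p f : Prop := cmeasurable f /\ (cLnorm p f < +oo)%E.

Definition L2inner f g : R[i] := cintegral setT (fun x => f x * (g x)^*).

Definition cvgL2 (u : nat -> T -> R[i]) f : Prop :=
  cLnorm 2 (u n \- f) @[n --> \oo] --> 0%E.

(* A possibly unbounded operator on L^2 is given by its graph, a relation on
   representatives: [A f g] means that f is in the domain and A f = g a.e. *)
Definition operator := (T -> R[i]) -> (T -> R[i]) -> Prop.

Definition op_closure (A : operator) : operator := fun f g =>
  [/\ memL 2 f, memL 2 g &
      exists u v : nat -> T -> R[i],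
        [/\ forall n, A (u n) (v n), cvgL2 u f & cvgL2 v g]].

(* The domain of the sum is the intersection of the domains. *)
Definition op_sum (A B : operator) : operator := fun f g =>
  memL 2 g /\ exists g1 g2, [/\ A f g1, B f g2 & g = g1 \+ g2 %[ae mu]].

Record spectral_measure (E : set R -> (T -> R[i]) -> (T -> R[i])) : Prop := {
  spm_L2 : forall B f, measurable B -> memL 2 f -> memL 2 (E B f) ;
  spm_linear : forall B (a : R[i]) f g, measurable B -> memL 2 f -> memL 2 g ->
    E B (fun x => a * f x + g x) = (fun x => a * E B f x + E B g x) %[ae mu] ;
  spm_sym : forall B f g, measurable B -> memL 2 f -> memL 2 g ->
    L2inner (E B f) g = L2inner f (E B g) ;
  spm_setI : forall B C f, measurable B -> measurable C -> memL 2 f ->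
    E (B `&` C) f = E B (E C f) %[ae mu] ;
  spm_setT : forall f, memL 2 f -> E [set: R] f = f %[ae mu] ;
  spm_bigcup : forall (B : nat -> set R) f, (forall n, measurable (B n)) ->
    trivIset [set: nat] B -> memL 2 f ->
    cvgL2 (fun n x => \sum_(k < n) E (B k) f x) (E (\bigcup_n B n) f) }.

Definition simple_spectral_integral E (s : {sfun R >-> R}) f : T -> R[i] :=
  fun x => \sum_(c \in range s) (c%:C * E (s @^-1` [set c]) f x).

(* g = \int psi dE f : with nu = ||E(.) f||^2, the map s |-> \int s dE f is
   isometric from the simple functions of L^2(nu) to L^2(mu), and psi |-> g is
   its continuous extension; the domain condition is psi \in L^2(nu). *)
Definition spectral_integral (E : set R -> (T -> R[i]) -> (T -> R[i]))
    (psi : R -> R) : operator := fun f g =>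
  [/\ memL 2 f, memL 2 g &
      exists (nu : {measure set (measurableTypeR R) -> \bar R})
             (s : nat -> {sfun R >-> R}),
        [/\ forall B : set R, measurable B -> nu B = (cLnorm 2 (E B f) ^+ 2)%E,
            (\int[nu]_t ((s n t - psi t) ^+ 2)%:E)%E @[n --> \oo] --> 0%E &
            cvgL2 (fun n => simple_spectral_integral E (s n) f) g]].

Definition spectral_measure_of (A : operator)
    (E : set R -> (T -> R[i]) -> (T -> R[i])) : Prop :=
  spectral_measure E /\ forall f g, A f g <-> spectral_integral E id f g.

(* phi(A) for A >= 0 with spectral measure E and phi given on [0, +oo[; the
   extension of phi by 0 is immaterial, E being supported in [0, +oo[. *)
Definition fcalc (E : set R -> (T -> R[i]) -> (T -> R[i])) (phi : R -> R) :
  operator := spectral_integral E (phi \_ `[0, +oo[).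

(* ||A f||_q, with value +oo when f is not in the domain of A (inf of the empty
   set); all the g with [A f g] agree a.e. *)
Definition image_norm q (A : operator) f : \bar R :=
  ereal_inf [set cLnorm q g | g in A f].

Definition opnorm p q (A : operator) : \bar R :=
  ereal_sup [set (image_norm q A f * ((fine (cLnorm p f))^-1)%:E)%E |
             f in [set f | [/\ memL p f, memL 2 f & ~ (f = cst 0 %[ae mu])]]].

End ComplexLp.

Section Engel.
Variable R : realType.
Local Notation mR := (measurableTypeR R).
Local Notation leb := (@lebesgue_measure R).

Definition engel : Type := (R * R * R * R)%type.

Definition engel_measure : {measure set (mR * mR * mR * mR) -> \bar R} :=
  (((leb \x leb) \x leb) \x leb)%E.

Definition x1 (x : engel) : R := x.1.1.1.
Definition x2 (x : engel) : R := x.1.1.2.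
Definition x3 (x : engel) : R := x.1.2.
Definition x4 (x : engel) : R := x.2.

Definition engel_mul (x y : engel) : engel :=
  (x1 x + x1 y,
   x2 x + x2 y,
   x3 x + x3 y - x1 x * x2 y,
   x4 x + x4 y + 2^-1 * x1 x ^+ 2 * x2 y - x1 x * x3 y).

Lemma engel_mulA : associative engel_mul.
Proof.
move=> [[[a1 a2] a3] a4] [[[b1 b2] b3] b4] [[[c1 c2] c3] c4].
by rewrite /engel_mul /x1 /x2 /x3 /x4 /=; do !congr (_, _); field.
Qed.

(* One-parameter subgroups t |-> t e_j acting on the right: the velocities are
   the coefficients of the left-invariant fields X1, X2, X3, X4 below. *)
Lemma engel_right_translation (x : engel) (t : R) :
  [/\ engel_mul x (t, 0, 0, 0) = (x1 x + t, x2 x, x3 x, x4 x),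
      engel_mul x (0, t, 0, 0) =
        (x1 x, x2 x + t, x3 x - t * x1 x, x4 x + t * (x1 x ^+ 2 / 2)),
      engel_mul x (0, 0, t, 0) = (x1 x, x2 x, x3 x + t, x4 x - t * x1 x) &
      engel_mul x (0, 0, 0, t) = (x1 x, x2 x, x3 x, x4 x + t)].
Proof.
case: x => [[[a1 a2] a3] a4].
by rewrite /engel_mul /x1 /x2 /x3 /x4 /=; split; do !congr (_, _); field.
Qed.

Definition basis (j : 'I_4) : R * R * R * R :=
  ((j == 0 :> nat)%:R, (j == 1 :> nat)%:R,
   (j == 2 :> nat)%:R, (j == 3 :> nat)%:R).

Definition pderiv (j : 'I_4) (u : R * R * R * R -> R) : R * R * R * R -> R :=
  fun x => 'D_(basis j) u x.

Definition cpderiv (j : 'I_4) (f : engel -> R[i]) : engel -> R[i] :=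
  fun x => pderiv j (fun y => complex.Re (f y)) x +i*
           pderiv j (fun y => complex.Im (f y)) x.

Definition d1 := cpderiv (inord 0).
Definition d2 := cpderiv (inord 1).
Definition d3 := cpderiv (inord 2).
Definition d4 := cpderiv (inord 3).

Definition X1 (f : engel -> R[i]) : engel -> R[i] := d1 f.
Definition X2 (f : engel -> R[i]) : engel -> R[i] := fun x =>
  d2 f x - (x1 x)%:C * d3 f x + (x1 x ^+ 2 / 2)%:C * d4 f x.
Definition X3 (f : engel -> R[i]) : engel -> R[i] := fun x =>
  d3 f x - (x1 x)%:C * d4 f x.
Definition X4 (f : engel -> R[i]) : engel -> R[i] := d4 f.

Definition pderivs (s : seq 'I_4) (u : R * R * R * R -> R) :
  R * R * R * R -> R := foldr pderiv u s.

Definition real_schwartz (u : R * R * R * R -> R) : Prop :=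
  forall s : seq 'I_4,
    [/\ continuous (pderivs s u),
        forall j x, derivable (pderivs s u) x (basis j) &
        forall k : nat, exists M : R, forall x,
          (1 + `|x|) ^+ k * `|pderivs s u x| <= M].

Definition schwartz (f : engel -> R[i]) : Prop :=
  real_schwartz (fun x => complex.Re (f x)) /\
  real_schwartz (fun x => complex.Im (f x)).

Definition sum_squares (f : engel -> R[i]) : engel -> R[i] := fun x =>
  X1 (X1 f) x + X2 (X2 f) x + X3 (X3 f) x + X4 (X4 f) x.

Definition laplacian_schwartz : operator (mR * mR * mR * mR)%type R :=
  fun f g => schwartz f /\ g = (fun x => - sum_squares f x).

Definition laplacian : operator (mR * mR * mR * mR)%type R :=
  op_closure engel_measure laplacian_schwartz.

(* \int_(-n)^n f(x1, x2, x3, t) exp(- i lambda t) dt, at the point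
   x = (x1, x2, x3, lambda). *)
Definition fourier4_trunc (n : nat) (f : engel -> R[i]) : engel -> R[i] :=
  fun x => cintegral leb `[- n%:R, n%:R]
    (fun t : R => f (x1 x, x2 x, x3 x, t) *
      (cos (x4 x * t) -i* sin (x4 x * t))).

(* Partial Fourier-Plancherel transform in x4 of an L^2 function. *)
Definition fourier4 (f F : engel -> R[i]) : Prop :=
  [/\ memL engel_measure 2 f, memL engel_measure 2 F &
      cvgL2 engel_measure (fun n => fourier4_trunc n f) F].

(* - X4^-2 *)
Definition opp_X4_inv2 : operator (mR * mR * mR * mR)%type R := fun f g =>
  exists F G, [/\ fourier4 f F, fourier4 g G &
    G = (fun x => (x4 x ^- 2)%:C * F x) %[ae engel_measure]].

Definition engelA : operator (mR * mR * mR * mR)%type R :=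
  op_sum engel_measure laplacian opp_X4_inv2.

End Engel.

Arguments engel_measure R : clear implicits.
Arguments engelA R : clear implicits.

(* Main.v *)
Require Import Defs.
From HB Require Import structures.
From mathcomp Require Import all_boot all_order all_algebra.
From mathcomp Require Import complex.
From mathcomp Require Import all_classical all_reals all_analysis.
From mathcomp Require Import measurable_realfun.
From mathcomp Require Import ring lra.
Set Implicit Arguments.
Unset Strict Implicit.
Unset Printing Implicit Defensive.
Import Order.TTheory GRing.Theory Num.Theory.
Import numFieldNormedType.Exports.
Import HBSimple.
Local Open Scope classical_set_scope.
Local Open Scope ring_scope.

(* Write A = L + W, with L the closure of the Laplacian on Schwartz functions and W = - X4^-2.
   Testing A against the functions - X4^2 chi with chi Schwartz, for which W (- X4^2 chi) = chi,
   shows that g = - X4^2 (W g) weakly on the domain of A.  Commutation with translations in x4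
   then gives <W g, L g> >= 0 and |g|^2 <= |W g| |L g|, hence |L g|^2 + |W g|^2 <= |A g|^2 and
   2 |g|^2 <= |A g|^2, so that A has no spectrum below 1.
   On the spectral subspace of A below t^2 one has |L g| <= t^2 |g|, and translating g and L g by
   eta in x4 changes them by at most eta t |g| and eta t^3 |g|.  The Sobolev inequality uses L and
   one further derivative X4, which costs only a factor t; applied to averages of g over segments
   of length eta -> 0 in the x4 direction, it bounds the sup norm of g by O(t^3) |g|.  Hence the
   spectral projections of A below s map L1 to L2 with norm O(s^(3/2)).  Real interpolation over
   dyadic pieces of the spectrum gives the Lp-Lq bound; (ii) is the case of the multiplier
   (1 + s)^(b - a). *)

(** * The real Hilbert space structure of complex L2 *)

(** The exponent 3 is 2 + 1 in powers of t = sqrt s, doubled by passing from t to s and halved by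
    passing from L1-L-infinity to L1-L2: on the spectral subspace below s, L costs t^2 and one
    further X4 costs t. Two derivatives in L2 are borderline for boundedness in dimension four; X4
    crosses the border.

    Elements g of a spectral subspace are only limits of Schwartz functions in the graph norm of L,
    and nothing controls X4 L on the approximants. So X4 acts on an average over a segment of fixed
    length eta, where it becomes a difference of translates, which passes to the limit; eta tends to
    0 afterwards.

    The differences of L g are a second obstacle, since L g is not known to lie in the spectral
    subspace. But A g does, and |L g| <= |A g| holds for increments of g as well, so the increments
    of L g are bounded by those of A g.

    The sign of <W g, L g> comes from second differences in x4: each is - X4^2 applied to a segment
    integral followed by its adjoint, a positive operator commuting with L, and it tends weakly to
    twice the identity as the step grows. *)

Section RealL2.
Context (d : measure_display) (T : measurableType d) (R : realType).
Variable mu : {measure set T -> \bar R}.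
Implicit Types f g h : T -> R.

Definition L2r f : Prop :=
  measurable_fun [set: T] f /\ mu.-integrable [set: T] (EFin \o (fun x => f x ^+ 2)).

Definition ipr f g : R := \int[mu]_x (f x * g x).

Lemma L2r_measurable f : L2r f -> measurable_fun [set: T] f.
Proof. by case. Qed.

Lemma le_integrable_real f g : measurable_fun [set: T] f ->
  (forall x, `|f x| <= g x) -> mu.-integrable [set: T] (EFin \o g) ->
  mu.-integrable [set: T] (EFin \o f).
Proof.
move=> mf fg ig; apply: le_integrable ig => //; first exact/measurable_EFinP.
by move=> x _ /=; rewrite lee_fin (le_trans (fg x))// ler_norm.
Qed.

Lemma integrableD_real f g : mu.-integrable [set: T] (EFin \o f) ->
  mu.-integrable [set: T] (EFin \o g) ->
  mu.-integrable [set: T] (EFin \o (fun x => f x + g x)).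
Proof. by move=> fi gi; have := integrableD measurableT fi gi. Qed.

Lemma integrableZ_real k f : mu.-integrable [set: T] (EFin \o f) ->
  mu.-integrable [set: T] (EFin \o (fun x => k * f x)).
Proof. by move=> fi; have := integrableZl measurableT k fi. Qed.

Lemma L2r_mul f g : L2r f -> L2r g ->
  mu.-integrable [set: T] (EFin \o (fun x => f x * g x)).
Proof.
move=> [mf fi] [mg gi].
apply: (@le_integrable_real _ (fun x => f x ^+ 2 + g x ^+ 2)).
- exact: measurable_funM.
- move=> x; rewrite normrM -(real_normK (num_real (f x))) -(real_normK (num_real (g x))).
  have := normr_ge0 (f x); have := normr_ge0 (g x); nra.
- exact: integrableD_real.
Qed.

Lemma L2r_le f g : measurable_fun [set: T] f -> (forall x, `|f x| <= `|g x|) ->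
  L2r g -> L2r f.
Proof.
move=> mf fg [mg gi]; split => //; apply: le_integrable_real gi.
  exact: measurable_funX.
by move=> x; rewrite normrX -(real_normK (num_real (g x))) lerXn2r ?nnegrE.
Qed.

Lemma L2rD f g : L2r f -> L2r g -> L2r (fun x => f x + g x).
Proof.
move=> [mf fi] [mg gi]; split; first exact: measurable_funD.
apply: (@le_integrable_real _ (fun x => 2 * (f x ^+ 2 + g x ^+ 2))).
- by apply: measurable_funX; exact: measurable_funD.
- by move=> x; rewrite ger0_norm ?sqr_ge0//; have := sqr_ge0 (f x - g x); nra.
- by apply: integrableZ_real; exact: integrableD_real.
Qed.

Lemma L2rZ k f : L2r f -> L2r (fun x => k * f x).
Proof.
move=> [mf fi]; split; first by apply: measurable_funM.
have := integrableZ_real (k ^+ 2) fi.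
by apply: eq_integrable => // x _ /=; rewrite exprMn.
Qed.

Lemma L2rN f : L2r f -> L2r (fun x => - f x).
Proof.
by move=> /(L2rZ (-1)); congr L2r; apply/funext => x; rewrite mulN1r.
Qed.

Lemma L2rB f g : L2r f -> L2r g -> L2r (fun x => f x - g x).
Proof. by move=> Hf Hg; apply: L2rD => //; exact: L2rN. Qed.

Lemma L2r0 : L2r (fun=> 0).
Proof.
split=> //; rewrite [X in integrable _ _ X](_ : _ = cst 0%E) ?integrable0//.
by apply/funext => x /=; rewrite expr0n.
Qed.

Lemma iprC f g : ipr f g = ipr g f.
Proof. by apply: eq_Rintegral => x _; rewrite mulrC. Qed.

Lemma iprDl f g h : L2r f -> L2r g -> L2r h ->
  ipr (fun x => f x + g x) h = ipr f h + ipr g h.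
Proof.
move=> Hf Hg Hh; rewrite /ipr -RintegralD//; try exact: L2r_mul.
by apply: eq_Rintegral => x _; rewrite mulrDl.
Qed.

Lemma iprZl k f g : L2r f -> L2r g -> ipr (fun x => k * f x) g = k * ipr f g.
Proof.
move=> Hf Hg; rewrite /ipr -RintegralZl//; last exact: L2r_mul.
by apply: eq_Rintegral => x _; rewrite mulrA.
Qed.

Lemma iprNl f g : L2r f -> L2r g -> ipr (fun x => - f x) g = - ipr f g.
Proof.
move=> Hf Hg; rewrite -mulN1r -iprZl//; congr ipr.
by apply/funext => x; rewrite mulN1r.
Qed.

Lemma iprBl f g h : L2r f -> L2r g -> L2r h ->
  ipr (fun x => f x - g x) h = ipr f h - ipr g h.
Proof. by move=> Hf Hg Hh; rewrite iprDl ?iprNl//; exact: L2rN. Qed.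

Lemma iprDr f g h : L2r f -> L2r g -> L2r h ->
  ipr h (fun x => f x + g x) = ipr h f + ipr h g.
Proof. by move=> *; rewrite iprC iprDl// ![ipr h _]iprC. Qed.

Lemma iprBr f g h : L2r f -> L2r g -> L2r h ->
  ipr h (fun x => f x - g x) = ipr h f - ipr h g.
Proof. by move=> *; rewrite iprC iprBl// ![ipr h _]iprC. Qed.

Lemma iprZr k f g : L2r f -> L2r g -> ipr g (fun x => k * f x) = k * ipr g f.
Proof. by move=> *; rewrite iprC iprZl// [ipr g _]iprC. Qed.

Lemma ipr_ge0 f : 0 <= ipr f f.
Proof. by apply: Rintegral_ge0 => x _; rewrite -expr2 sqr_ge0. Qed.

End RealL2.

(** The common source of the Cauchy-Schwarz inequalities [ipc_sqr_le], [sum_cauchy_schwarz] and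
    [ip_CS]. *)
Lemma discriminant_le (R : realFieldType) (a b c : R) : 0 <= a ->
  (forall t : R, 0 <= a * t ^+ 2 + 2 * b * t + c) -> b ^+ 2 <= a * c.
Proof.
move=> a0 H; have [a0'|a0'] := eqVneq a 0.
  have [->|b0] := eqVneq b 0; first by rewrite a0' mul0r expr0n.
  (* At this t the affine function 2 b t + c takes the value -1. *)
  have := H (- (c + 1) / (2 * b)); rewrite a0' mul0r add0r.
  rewrite mulrCA divff ?mulr1; last by rewrite mulf_neq0.
  by move=> ?; exfalso; lra.
have ap : 0 < a by rewrite lt_neqAle eq_sym a0'.
have := H (- b / a).
have -> : a * (- b / a) ^+ 2 + 2 * b * (- b / a) + c = (a * c - b ^+ 2) / a by field.
by rewrite pmulr_lge0 ?invr_gt0// subr_ge0.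
Qed.

Lemma ler_sqrt_sqr (R : rcfType) (x y : R) : 0 <= y -> x ^+ 2 <= y -> `|x| <= Num.sqrt y.
Proof. by move=> y0 xy; rewrite -sqrtr_sqr ler_wsqrtr. Qed.

Section ComplexL2.
Context (d : measure_display) (T : measurableType d) (R : realType).
Variable mu : {measure set T -> \bar R}.
Implicit Types f g h : T -> R[i].

Local Notation Ref f := (fun x => complex.Re (f x)).
Local Notation Imf f := (fun x => complex.Im (f x)).

Definition L2c f : Prop := L2r mu (Ref f) /\ L2r mu (Imf f).

(** The real part of the Hermitian product. Complex L2 is used as a real Hilbert space: the norm is
    the same, and the scalars met later (multipliers, step lengths) are real. *)
Definition ipc f g : R := ipr mu (Ref f) (Ref g) + ipr mu (Imf f) (Imf g).

Definition nrmc f : R := Num.sqrt (ipc f f).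

Definition scr (k : R) f : T -> R[i] := fun x => (k%:C)%C * f x.

Lemma Re_scr k f x : complex.Re (scr k f x) = k * complex.Re (f x).
Proof. by rewrite /scr; case: (f x) => a b /=; rewrite mul0r subr0. Qed.

Lemma Im_scr k f x : complex.Im (scr k f x) = k * complex.Im (f x).
Proof. by rewrite /scr; case: (f x) => a b /=; rewrite mul0r addr0. Qed.

Lemma ReD f g x : complex.Re ((f + g) x) = complex.Re (f x) + complex.Re (g x).
Proof. by rewrite fctE; case: (f x) => a b; case: (g x). Qed.

Lemma ImD f g x : complex.Im ((f + g) x) = complex.Im (f x) + complex.Im (g x).
Proof. by rewrite fctE; case: (f x) => a b; case: (g x). Qed.

Lemma ReN f x : complex.Re ((- f) x) = - complex.Re (f x).
Proof. by rewrite fctE; case: (f x). Qed.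

Lemma ImN f x : complex.Im ((- f) x) = - complex.Im (f x).
Proof. by rewrite fctE; case: (f x). Qed.

Lemma ReDE f g : Ref (f + g) = (fun x => complex.Re (f x) + complex.Re (g x)).
Proof. by apply/funext => x; exact: ReD. Qed.
Lemma ImDE f g : Imf (f + g) = (fun x => complex.Im (f x) + complex.Im (g x)).
Proof. by apply/funext => x; exact: ImD. Qed.
Lemma ReNE f : Ref (- f) = (fun x => - complex.Re (f x)).
Proof. by apply/funext => x; exact: ReN. Qed.
Lemma ImNE f : Imf (- f) = (fun x => - complex.Im (f x)).
Proof. by apply/funext => x; exact: ImN. Qed.
Lemma ReBE f g : Ref (f - g) = (fun x => complex.Re (f x) - complex.Re (g x)).
Proof. by apply/funext => x; rewrite ReD ReN. Qed.
Lemma ImBE f g : Imf (f - g) = (fun x => complex.Im (f x) - complex.Im (g x)).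
Proof. by apply/funext => x; rewrite ImD ImN. Qed.
Lemma ReZE k f : Ref (scr k f) = (fun x => k * complex.Re (f x)).
Proof. by apply/funext => x; exact: Re_scr. Qed.
Lemma ImZE k f : Imf (scr k f) = (fun x => k * complex.Im (f x)).
Proof. by apply/funext => x; exact: Im_scr. Qed.

Lemma L2cD f g : L2c f -> L2c g -> L2c (f + g).
Proof.
by move=> [a b] [a' b']; split; rewrite ?ReDE ?ImDE; exact: L2rD.
Qed.

Lemma L2cN f : L2c f -> L2c (- f).
Proof. by move=> [a b]; split; rewrite ?ReNE ?ImNE; exact: L2rN. Qed.

Lemma L2cB f g : L2c f -> L2c g -> L2c (f - g).
Proof. by move=> Hf Hg; apply: L2cD => //; exact: L2cN. Qed.

Lemma L2cZ k f : L2c f -> L2c (scr k f).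
Proof. by move=> [a b]; split; rewrite ?ReZE ?ImZE; exact: L2rZ. Qed.

Lemma L2c0 : L2c 0.
Proof. by split; exact: L2r0. Qed.

Lemma L2c_sum (I : Type) (r : seq I) (P : pred I) (F : I -> T -> R[i]) :
  (forall i, P i -> L2c (F i)) -> L2c (\sum_(i <- r | P i) F i).
Proof. by move=> H; elim/big_rec: _ => [|i f Pi Hf]; [exact: L2c0|apply: L2cD => //; exact: H]. Qed.

Lemma ipcC f g : ipc f g = ipc g f.
Proof. by rewrite /ipc iprC [X in _ + X]iprC. Qed.

Lemma ipcDl f g h : L2c f -> L2c g -> L2c h -> ipc (f + g) h = ipc f h + ipc g h.
Proof.
move=> [a b] [a' b'] [a'' b'']; rewrite /ipc ReDE ImDE !iprDl//; ring.
Qed.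

Lemma ipcNl f g : L2c f -> L2c g -> ipc (- f) g = - ipc f g.
Proof. by move=> [a b] [a' b']; rewrite /ipc ReNE ImNE !iprNl// opprD. Qed.

Lemma ipcBl f g h : L2c f -> L2c g -> L2c h -> ipc (f - g) h = ipc f h - ipc g h.
Proof. by move=> *; rewrite ipcDl ?ipcNl//; exact: L2cN. Qed.

Lemma ipcZl k f g : L2c f -> L2c g -> ipc (scr k f) g = k * ipc f g.
Proof. by move=> [a b] [a' b']; rewrite /ipc ReZE ImZE !iprZl// mulrDr. Qed.

Lemma ipcDr f g h : L2c f -> L2c g -> L2c h -> ipc h (f + g) = ipc h f + ipc h g.
Proof. by move=> *; rewrite ipcC ipcDl// ![ipc h _]ipcC. Qed.

Lemma ipcNr f g : L2c f -> L2c g -> ipc g (- f) = - ipc g f.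
Proof. by move=> *; rewrite ipcC ipcNl// ![ipc g _]ipcC. Qed.

Lemma ipcBr f g h : L2c f -> L2c g -> L2c h -> ipc h (f - g) = ipc h f - ipc h g.
Proof. by move=> *; rewrite ipcC ipcBl// ![ipc h _]ipcC. Qed.

Lemma ipcZr k f g : L2c f -> L2c g -> ipc g (scr k f) = k * ipc g f.
Proof. by move=> *; rewrite ipcC ipcZl// ![ipc g _]ipcC. Qed.

Lemma ipc0l f : L2c f -> ipc 0 f = 0.
Proof.
by move=> Hf; rewrite -(subrr f) ipcBl// subrr.
Qed.

Lemma ipc_suml (I : Type) (r : seq I) (P : pred I) (F : I -> T -> R[i]) g :
  (forall i, P i -> L2c (F i)) -> L2c g ->
  ipc (\sum_(i <- r | P i) F i) g = \sum_(i <- r | P i) ipc (F i) g.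
Proof.
move=> HF Hg; elim: r => [|i r IH]; first by rewrite !big_nil ipc0l.
rewrite !big_cons; case: ifP => // Pi; rewrite ipcDl ?IH//; first exact: HF.
exact: L2c_sum.
Qed.

Lemma ipc_ge0 f : 0 <= ipc f f.
Proof. by rewrite addr_ge0// ipr_ge0. Qed.

Lemma nrmc_ge0 f : 0 <= nrmc f. Proof. exact: sqrtr_ge0. Qed.

Lemma nrmc_sqr f : nrmc f ^+ 2 = ipc f f.
Proof. by rewrite sqr_sqrtr// ipc_ge0. Qed.

Lemma ipc_sqr_le f g : L2c f -> L2c g -> ipc f g ^+ 2 <= ipc f f * ipc g g.
Proof.
move=> Hf Hg; rewrite mulrC; apply: discriminant_le => [|t]; first exact: ipc_ge0.
have := ipc_ge0 (f + scr t g).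
have Ht := L2cZ t Hg.
rewrite ipcDl ?ipcDr ?ipcZl ?ipcZr//; try exact: L2cD.
rewrite (ipcC g f); lra.
Qed.

Lemma ipc_le f g : L2c f -> L2c g -> `|ipc f g| <= nrmc f * nrmc g.
Proof.
move=> Hf Hg; rewrite -sqrtrM ?ipc_ge0//; apply: ler_sqrt_sqr.
  by rewrite mulr_ge0// ipc_ge0.
exact: ipc_sqr_le.
Qed.

Lemma nrmcD f g : L2c f -> L2c g -> nrmc (f + g) <= nrmc f + nrmc g.
Proof.
move=> Hf Hg; rewrite -[leRHS]ger0_norm ?addr_ge0 ?nrmc_ge0// -sqrtr_sqr ler_wsqrtr//.
rewrite ipcDl ?ipcDr//; last exact: L2cD.
rewrite sqrrD !nrmc_sqr (ipcC g f) addrA; have := ipc_le Hf Hg.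
have := ler_norm (ipc f g); rewrite mulr2n; lra.
Qed.

Lemma nrmcN f : L2c f -> nrmc (- f) = nrmc f.
Proof.
by move=> Hf; rewrite /nrmc ipcNl ?ipcNr ?opprK//; exact: L2cN.
Qed.

Lemma nrmcZ k f : L2c f -> nrmc (scr k f) = `|k| * nrmc f.
Proof.
move=> Hf; rewrite /nrmc ipcZl ?ipcZr//; last exact: L2cZ.
by rewrite mulrA -expr2 sqrtrM ?sqr_ge0// sqrtr_sqr.
Qed.

Lemma nrmcB f g : L2c f -> L2c g -> nrmc (f - g) <= nrmc f + nrmc g.
Proof. by move=> Hf Hg; rewrite -(nrmcN Hg); apply: nrmcD => //; exact: L2cN. Qed.

Lemma nrmc_dist f g : L2c f -> L2c g -> `|nrmc f - nrmc g| <= nrmc (f - g).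
Proof.
move=> Hf Hg; have Hfg := L2cB Hf Hg.
have := nrmcD Hfg Hg; rewrite subrK.
have := nrmcB Hf Hfg; rewrite opprB addrC subrK.
by rewrite ler_norml => *; apply/andP; split; lra.
Qed.

(** Almost everywhere equality ([eqL2P]), put as a vanishing norm so that Hilbert space arguments
    can handle it. *)
Definition eqL2 f g : Prop := nrmc (f - g) = 0.

Lemma ipc_eq f g h : L2c f -> L2c g -> L2c h -> eqL2 f g -> ipc f h = ipc g h.
Proof.
move=> Hf Hg Hh fg; apply/eqP; rewrite -subr_eq0 -ipcBl// -normr_le0.
by rewrite (le_trans (ipc_le _ _))//; [exact: L2cB|rewrite fg mul0r].
Qed.

Lemma nrmc_eq f g : L2c f -> L2c g -> eqL2 f g -> nrmc f = nrmc g.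
Proof.
move=> Hf Hg fg; apply/eqP; rewrite -subr_eq0 -normr_le0.
by rewrite (le_trans (nrmc_dist _ _))// fg.
Qed.

Lemma eqL2_sym f g : L2c f -> L2c g -> eqL2 f g -> eqL2 g f.
Proof. by move=> Hf Hg fg; rewrite /eqL2 -opprB nrmcN//; exact: L2cB. Qed.

Lemma eqL2_trans f g h : L2c f -> L2c g -> L2c h -> eqL2 f g -> eqL2 g h -> eqL2 f h.
Proof.
move=> Hf Hg Hh fg gh; apply/eqP; rewrite eq_le nrmc_ge0 andbT.
have -> : f - h = (f - g) + (g - h) by rewrite addrA subrK.
by rewrite (le_trans (nrmcD _ _))//; [exact: L2cB..|rewrite fg gh addr0].
Qed.

Lemma eqL2_refl f : L2c f -> eqL2 f f.
Proof.
by move=> Hf; rewrite /eqL2 subrr /nrmc ipc0l ?sqrtr0//; exact: L2c0.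
Qed.

Definition nsq (z : R[i]) : R := complex.Re z ^+ 2 + complex.Im z ^+ 2.

Lemma nsq_ge0 z : 0 <= nsq z. Proof. by rewrite addr_ge0 ?sqr_ge0. Qed.

Lemma normcE z : ComplexField.Normc.normc z = Num.sqrt (nsq z).
Proof. by case: z. Qed.

Lemma normc_nneg (z : R[i]) : 0 <= ComplexField.Normc.normc z.
Proof. by rewrite normcE sqrtr_ge0. Qed.

Lemma normc_sq z : ComplexField.Normc.normc z ^+ 2 = nsq z.
Proof. by rewrite normcE sqr_sqrtr// nsq_ge0. Qed.

Lemma Re_le_normc (z : R[i]) : `|complex.Re z| <= ComplexField.Normc.normc z.
Proof.
rewrite normcE; apply: ler_sqrt_sqr; first exact: nsq_ge0.
by rewrite /nsq lerDl sqr_ge0.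
Qed.

Lemma Im_le_normc (z : R[i]) : `|complex.Im z| <= ComplexField.Normc.normc z.
Proof.
rewrite normcE; apply: ler_sqrt_sqr; first exact: nsq_ge0.
by rewrite /nsq lerDr sqr_ge0.
Qed.

Lemma measurable_nsq f : cmeasurable f -> measurable_fun [set: T] (fun x => nsq (f x)).
Proof. by move=> [mr mi]; apply: measurable_funD; exact: measurable_funX. Qed.

Lemma measurable_normc f : cmeasurable f ->
  measurable_fun [set: T] (fun x => ComplexField.Normc.normc (f x)).
Proof.
move=> mf; rewrite [X in measurable_fun _ X](_ : _ = fun x => nsq (f x) `^ 2^-1).
  exact: measurableT_comp (measurable_powR _) (measurable_nsq mf).
by apply/funext => x; rewrite normcE powR12_sqrt// nsq_ge0.
Qed.

Lemma L2c_integrable_nsq f : L2c f ->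
  mu.-integrable [set: T] (EFin \o (fun x => nsq (f x))).
Proof. by move=> [[_ a] [_ b]]; exact: integrableD_real. Qed.

Lemma L2cP f : L2c f <-> cmeasurable f /\
  mu.-integrable [set: T] (EFin \o (fun x => nsq (f x))).
Proof.
split=> [Hf|[mf fi]].
  by split; [case: Hf => -[a _] [b _]|exact: L2c_integrable_nsq].
have [mr mi] := mf.
split; split => //; apply: le_integrable_real fi; try exact: measurable_funX.
- by move=> x; rewrite ger0_norm ?sqr_ge0// /nsq lerDl sqr_ge0.
- by move=> x; rewrite ger0_norm ?sqr_ge0// /nsq lerDr sqr_ge0.
Qed.

Lemma ipcE f g : L2c f -> L2c g -> ipc f g =
  \int[mu]_x (complex.Re (f x) * complex.Re (g x) + complex.Im (f x) * complex.Im (g x)).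
Proof. by move=> [a b] [a' b']; rewrite /ipc /ipr -RintegralD//; exact: L2r_mul. Qed.

Lemma cLnorm2_int f : cLnorm mu 2 f = ((\int[mu]_x (nsq (f x))%:E) `^ 2^-1)%E.
Proof.
rewrite /cLnorm unlock; congr poweR; apply: eq_integral => x _.
by rewrite /= ger0_norm ?normc_nneg// powR_mulrn ?normc_nneg// normc_sq.
Qed.

Lemma L2c_int_nsq f : L2c f -> (\int[mu]_x (nsq (f x))%:E = (ipc f f)%:E)%E.
Proof.
move=> Hf; rewrite ipcE// -[LHS]fineK; last exact: integrable_fin_num (L2c_integrable_nsq Hf).
by congr EFin; apply: eq_Rintegral => x _; rewrite -!expr2.
Qed.

Lemma cLnorm2E f : L2c f -> cLnorm mu 2 f = (nrmc f)%:E.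
Proof.
by move=> Hf; rewrite cLnorm2_int L2c_int_nsq// poweR_EFin powR12_sqrt// ipc_ge0.
Qed.

Lemma memL2P f : memL mu 2 f <-> L2c f.
Proof.
split=> [[mf fi]|Hf]; last first.
  by split; [case/L2cP : Hf|rewrite cLnorm2E// ltry].
apply/L2cP; split => //; apply/integrableP; split.
  by apply/measurable_EFinP; exact: measurable_nsq.
move: fi; rewrite cLnorm2_int => fi.
under eq_integral => x _ do rewrite /= ger0_norm ?nsq_ge0//.
by rewrite (@lty_poweRy _ _ 2^-1)// invr_neq0.
Qed.

Lemma cvgL2P (u : nat -> T -> R[i]) f : (forall n, L2c (u n)) -> L2c f ->
  cvgL2 mu u f <-> nrmc (u n - f) @[n --> \oo] --> 0.
Proof.
move=> Hu Hf; rewrite /cvgL2.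
rewrite (_ : (fun n => cLnorm mu 2 (u n \- f)) = (fun n => (nrmc (u n - f))%:E)).
  by split => [/fine_cvgP[]//|H]; apply/fine_cvgP; split => //; exact: nearW.
by apply/funext => n; rewrite -cLnorm2E//; exact: L2cB.
Qed.

Lemma eqL2P f g : L2c f -> L2c g -> eqL2 f g <-> f = g %[ae mu].
Proof.
move=> Hf Hg; have Hfg := L2cB Hf Hg.
have E0 : (\int[mu]_x `|(nsq ((f - g) x))%:E| = (ipc (f - g) (f - g))%:E)%E.
  by rewrite -L2c_int_nsq//; apply: eq_integral => x _; rewrite /= ger0_norm ?nsq_ge0.
have mn : measurable_fun [set: T] (fun x => (nsq ((f - g) x))%:E).
  by apply/measurable_EFinP; apply: measurable_nsq; case/L2cP : Hfg.
have Eq x : (nsq ((f - g) x))%:E = 0%E <-> f x = g x.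
  split=> [[]/eqP|fg].
    rewrite paddr_eq0 ?sqr_ge0// !sqrf_eq0 ReD ImD ReN ImN !subr_eq0 => /andP[/eqP a /eqP b].
    by move: a b; case: (f x) => ? ?; case: (g x) => ? ? /= -> ->.
  by rewrite /nsq ReD ImD ReN ImN fg !subrr expr0n addr0.
have H := ae_eq_integral_abs mu measurableT mn; split=> fg.
  have /H : (\int[mu]_x `|(nsq ((f - g) x))%:E| = 0)%E by rewrite E0 -nrmc_sqr fg expr0n.
  by apply: filterS => x /(_ I)/= /Eq fgx _.
have /H : ae_eq mu setT (fun x => (nsq ((f - g) x))%:E) (cst 0%E).
  by move: fg; apply: filterS => x fgx _; apply/Eq; exact: fgx.
by rewrite E0 => -[e]; rewrite /eqL2 /nrmc e sqrtr0.
Qed.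

Lemma Re_L2inner f g : L2c f -> L2c g -> complex.Re (L2inner mu f g) = ipc f g.
Proof.
move=> Hf Hg; rewrite ipcE//; apply: eq_Rintegral => x _.
by case: (f x) => a b; case: (g x) => a' b' /=; rewrite mulrN opprK.
Qed.

End ComplexL2.

(** * Completeness of L2 *)

Section L2Complete.
Context (R : realType).

(** The intervals of radius 2 c 2^-k around a k are nested, so the supremum of their lower ends lies
    in all of them. *)
Lemma fast_cauchy_lim (a : nat -> R) (c : R) : 0 <= c ->
  (forall k, `|a k.+1 - a k| <= c * 2^-1 ^+ k) ->
  exists l, forall k, `|l - a k| <= 2 * c * 2^-1 ^+ k.
Proof.
move=> c0 H.
pose lo k := a k - 2 * c * 2^-1 ^+ k; pose up k := a k + 2 * c * 2^-1 ^+ k.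
have loS k : lo k <= lo k.+1.
  by rewrite /lo; have := H k; rewrite ler_norml exprS => /andP[? ?]; lra.
have upS k : up k.+1 <= up k.
  by rewrite /up; have := H k; rewrite ler_norml exprS => /andP[? ?]; lra.
have lo_mono k m : lo k <= lo (k + m)%N.
  by elim: m => [|m IH]; rewrite ?addn0// addnS (le_trans IH).
have up_mono k m : up (k + m)%N <= up k.
  by elim: m => [|m IH]; rewrite ?addn0// addnS (le_trans _ IH).
have loup k : lo k <= up k.
  have h : 0 <= 2 * c * 2^-1 ^+ k by rewrite !mulr_ge0// exprn_ge0 ?invr_ge0.
  by rewrite /lo /up; lra.
have lu k m : lo k <= up m.
  by rewrite (le_trans (lo_mono k m))// (le_trans (loup _))// addnC.
have hs : has_sup (range lo).
  by split; [exists (lo 0%N); exists 0%N|exists (up 0%N) => _ [k _ <-]].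
exists (sup (range lo)) => k.
have h1 : lo k <= sup (range lo) by apply: ub_le_sup; [case: hs|exists k].
have h2 : sup (range lo) <= up k by apply: ge_sup => [|_ [m _ <-]//]; exists (lo 0%N); exists 0%N.
by move: h1 h2; rewrite /lo /up ler_norml => *; apply/andP; split; lra.
Qed.

Context (d : measure_display) (T : measurableType d).
Variable mu : {measure set T -> \bar R}.

(** The series G of the 4^k |v (k+1) - v k|^2 has integral at most the sum of 4^k 8^-k, which is 2.
    Where G is finite the increments are at most sqrt(G) 2^-k, so v converges pointwise; G also
    dominates the squared error, which turns the pointwise rate into the L2 rate. *)
Lemma fast_L2_lim (v : nat -> T -> R) : (forall n, L2r mu (v n)) ->
  (forall k, let w x := v k.+1 x - v k x in ipr mu w w <= 8^-1 ^+ k) ->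
  exists2 f, L2r mu f &
    forall n, ipr mu (fun x => v n x - f x) (fun x => v n x - f x) <= 8 * 4^-1 ^+ n.
Proof.
move=> Hv H; pose w k x := v k.+1 x - v k x.
have Hw k : L2r mu (w k) by exact: L2rB.
pose t k x : \bar R := (4 ^+ k * w k x ^+ 2)%:E.
have t0 k x : (0 <= t k x)%E by rewrite lee_fin mulr_ge0 ?sqr_ge0 ?exprn_ge0.
have it k : mu.-integrable [set: T] (t k).
  by apply: (integrableZ_real (4 ^+ k)); case: (Hw k).
have mt k : measurable_fun [set: T] (t k) by apply: measurable_int (it k).
pose G x := (\sum_(0 <= k <oo) t k x)%E.
have mG : measurable_fun [set: T] G.
  by apply: (@ge0_emeasurable_sum _ _ _ _ _ xpredT).
have G0 x : (0 <= G x)%E by apply: nneseries_ge0.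
have Gt k x : (t k x <= G x)%E.
  apply: le_trans (@nneseries_lim_ge _ (t ^~ x) xpredT 0 k.+1 _) => //.
  by rewrite big_nat_recr//= leeDr// sume_ge0.
have iG : (\int[mu]_x G x <= 2%:E)%E.
  rewrite integral_nneseries//.
  apply: lime_le.
    by apply: is_cvg_nneseries => n _ _; exact: integral_ge0.
  apply: nearW => n.
  apply: (@le_trans _ _ (\sum_(0 <= k < n) (2^-1 ^+ k)%:E)%E).
    apply: lee_sum => k _.
    rewrite -[leLHS]fineK ?lee_fin; last exact: integrable_fin_num.
    have -> : fine (\int[mu]_x t k x)%E = 4 ^+ k * ipr mu (w k) (w k).
      rewrite -[LHS]/(\int[mu]_x (4 ^+ k * w k x ^+ 2)) RintegralZl//.
      by case: (Hw k).
    rewrite (_ : 2^-1 = 4 * 8^-1); last lra.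
    by rewrite exprMn ler_wpM2l ?exprn_ge0//; exact: H.
  rewrite sumEFin lee_fin.
  have -> : \sum_(0 <= k < n) 2^-1 ^+ k = 2 - 2 * 2^-1 ^+ n :> R.
    elim: n => [|n IH]; first by rewrite big_nil expr0; lra.
    by rewrite big_nat_recr//= IH exprS; lra.
  by rewrite gerBl mulr_ge0// exprn_ge0// invr_ge0.
have iG' : mu.-integrable [set: T] G.
  apply/integrableP; split => //.
  under eq_integral do rewrite gee0_abs//.
  exact: le_lt_trans iG (ltry _).
have lim x : exists l, forall k, (G x < +oo)%E -> `|l - v k x| <= 2 * Num.sqrt (fine (G x)) * 2^-1 ^+ k.
  have [Gx|Gx] := boolP (G x < +oo)%E; last by exists 0.
  have [|l Hl] := @fast_cauchy_lim (v ^~ x) (Num.sqrt (fine (G x))) (sqrtr_ge0 _).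
    move=> k; have Hk : 4 ^+ k * w k x ^+ 2 <= fine (G x).
      by rewrite -lee_fin fineK ?ge0_fin_numE//; exact: Gt.
    have G0' : 0 <= fine (G x) by exact: fine_ge0.
    rewrite -[2^-1]ger0_norm ?invr_ge0// -normrX -[`|2^-1 ^+ k|]sqrtr_sqr -sqrtrM//.
    apply: ler_sqrt_sqr; first by rewrite mulr_ge0 ?sqr_ge0.
    have e : (2^-1 ^+ k) ^+ 2 = (4 ^+ k)^-1 :> R.
      by rewrite -exprM mulnC exprM -exprVn; congr (_ ^+ _); lra.
    by rewrite e ler_pdivlMr ?exprn_gt0// mulrC.
  by exists l => k _; exact: Hl.
have [l Hl] := choice lim.
pose A := [set x | (G x < +oo)%E].
have mA : measurable A.
  rewrite (_ : A = setT `&` G @^-1` [set y | (y < +oo)%E]); last by rewrite setTI.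
  apply: mG => //; rewrite (_ : [set y | _] = `]-oo, +oo%E[%classic).
    exact: emeasurable_itv.
  by apply/seteqP; split => y /=; rewrite in_itv.
(* Cutting by the set where G is finite makes f an everywhere limit of measurable functions. *)
pose f x := l x * \1_A x.
have mf : measurable_fun [set: T] f.
  apply: (@measurable_fun_cvg _ _ _ _ (fun n x => v n x * \1_A x)).
    by move=> n; apply: measurable_funM; [case: (Hv n)|exact: measurable_indic].
  move=> x _; rewrite /f indicE; case: (boolP (x \in A)) => xA /=; last first.
    by rewrite mulr0; under eq_fun do rewrite mulr0; exact: cvg_cst.
  under eq_fun do rewrite mulr1; rewrite mulr1.
  apply/cvgrPdist_le => e e0; rewrite inE /A /= in xA.
  have : 2 * Num.sqrt (fine (G x)) * 2^-1 ^+ n @[n --> \oo] --> 2 * Num.sqrt (fine (G x)) * 0.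
    by apply: cvgM; [exact: cvg_cst|apply: cvg_expr; rewrite ger0_norm; lra].
  rewrite mulr0 => /cvgrPdist_le/(_ e e0); apply: filterS => n.
  rewrite sub0r normrN => Hn; apply: le_trans (Hl x n xA) _.
  by apply: le_trans Hn; exact: ler_norm.
have Afull : {ae mu, forall x, A x}.
  have := integrable_ae measurableT iG'; apply: filterS => x /(_ I) /=.
  by rewrite ge0_fin_numE.
have sqle n x : A x -> (v n x - f x) ^+ 2 <= 4 * 4^-1 ^+ n * fine (G x).
  move=> Ax; have := Hl x n Ax; rewrite /f indicE mem_set// mulr1 distrC => h.
  rewrite -(real_normK (num_real _)).
  apply: (le_trans (lerXn2r 2 _ _ h)); rewrite ?nnegrE ?mulr_ge0 ?sqrtr_ge0 ?exprn_ge0 ?invr_ge0//.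
  rewrite !exprMn sqr_sqrtr ?fine_ge0// -exprM mulnC exprM.
  rewrite (_ : 2^-1 ^+ 2 = 4^-1 :> R); last by lra.
  lra.
have intle n : (\int[mu]_x ((v n x - f x) ^+ 2)%:E <= (8 * 4^-1 ^+ n)%:E)%E.
  apply: (@le_trans _ _ (\int[mu]_x ((4 * 4^-1 ^+ n)%:E * G x))%E).
    apply: ae_ge0_le_integral => //.
    - by move=> x _; rewrite lee_fin sqr_ge0.
    - apply/measurable_EFinP; apply: measurable_funX; apply: measurable_funB => //.
      by case: (Hv n).
    - by move=> x _; rewrite mule_ge0// lee_fin mulr_ge0// exprn_ge0// invr_ge0.
    - exact: measurable_funeM.
    - move: Afull; apply: filterS => x Ax _; rewrite -[G x]fineK ?ge0_fin_numE//.
      by rewrite -EFinM lee_fin; exact: sqle.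
  rewrite ge0_integralZl// ?lee_fin ?mulr_ge0 ?exprn_ge0 ?invr_ge0//.
  apply: (@le_trans _ _ ((4 * 4^-1 ^+ n)%:E * 2%:E)%E).
    by rewrite lee_pmul2l// lte_fin mulr_gt0// exprn_gt0// invr_gt0.
  by rewrite -EFinM lee_fin; lra.
have Lvf n : L2r mu (fun x => v n x - f x).
  split; first by apply: measurable_funB => //; case: (Hv n).
  apply/integrableP; split.
    apply/measurable_EFinP; apply: measurable_funX; apply: measurable_funB => //.
    by case: (Hv n).
  under eq_integral do rewrite /= ger0_norm ?sqr_ge0//.
  exact: le_lt_trans (intle n) (ltry _).
exists f.
  have := L2rB (Hv 0%N) (Lvf 0%N).
  by congr L2r; apply/funext => x; rewrite subKr.
move=> n; rewrite -lee_fin; apply: le_trans (intle n).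
rewrite [X in (_ <= X)%E]( _ : _ = (ipr mu (fun x => v n x - f x) (fun x => v n x - f x))%:E)//.
rewrite /ipr -[LHS]fineK.
  by congr EFin; apply: eq_Rintegral => x _; rewrite expr2.
by apply: integrable_fin_num => //; case: (Lvf n).
Qed.

Lemma L2c_complete (u : nat -> T -> R[i]) : (forall n, L2c mu (u n)) ->
  (forall e, 0 < e -> exists N, forall m n, (N <= m)%N -> (N <= n)%N ->
     nrmc mu (u m - u n) <= e) ->
  exists2 f, L2c mu f & nrmc mu (u n - f) @[n --> \oo] --> 0.
Proof.
move=> Hu HC.
have e8 k : 0 < Num.sqrt (8^-1 ^+ k) :> R by rewrite sqrtr_gt0 exprn_gt0// invr_gt0.
have /choice[N HN] : forall k, exists N, forall m n, (N <= m)%N -> (N <= n)%N ->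
     nrmc mu (u m - u n) <= Num.sqrt (8^-1 ^+ k) by move=> k; apply: HC.
(* A strictly increasing choice of indices with M k >= N k, so that consecutive distances along it
   decay fast enough for [fast_L2_lim]. *)
pose M := fix M k := if k is k'.+1 then maxn (M k').+1 (N k) else N 0%N.
have MN k : (N k <= M k)%N by case: k => [|k] //=; rewrite leq_maxr.
have MS k : (M k < M k.+1)%N by rewrite /= leq_maxl.
have Mk k : (k <= M k)%N by elim: k => // k IH; exact: leq_ltn_trans IH (MS k).
pose v k := u (M k).
have Hv k : L2c mu (v k) by exact: Hu.
have small k : ipc mu (v k.+1 - v k) (v k.+1 - v k) <= 8^-1 ^+ k.
  rewrite -nrmc_sqr -[leRHS]sqr_sqrtr ?exprn_ge0 ?invr_ge0//.
  rewrite lerXn2r ?nnegrE ?nrmc_ge0 ?sqrtr_ge0//.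
  by apply: HN => //; rewrite (leq_trans (MN k))// ltnW.
have [f Lf Hf] : exists2 f, L2r mu f & forall n,
   ipr mu (fun x => complex.Re (v n x) - f x) (fun x => complex.Re (v n x) - f x) <= 8 * 4^-1 ^+ n.
  apply: fast_L2_lim => [n|k]; first by case: (Hv n).
  apply: le_trans (small k); rewrite /ipc ReBE lerDl; exact: ipr_ge0.
have [g Lg Hg] : exists2 f, L2r mu f & forall n,
   ipr mu (fun x => complex.Im (v n x) - f x) (fun x => complex.Im (v n x) - f x) <= 8 * 4^-1 ^+ n.
  apply: fast_L2_lim => [n|k]; first by case: (Hv n).
  apply: le_trans (small k); rewrite /ipc ImBE lerDr; exact: ipr_ge0.
pose h x : R[i] := (f x +i* g x)%C.
have Lh : L2c mu h by [].
exists h => //.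
have vh k : ipc mu (v k - h) (v k - h) <= 16 * 4^-1 ^+ k.
  have := Hf k; have := Hg k; rewrite /ipc ReBE ImBE; lra.
apply/cvgrPdist_le => e e0.
have [N0 HN0] := HC (e / 2) (divr_gt0 e0 (ltr0n _ 2)).
have : 16 * 4^-1 ^+ n @[n --> \oo] --> (16 * 0 : R).
  by apply: cvgM; [exact: cvg_cst|apply: cvg_expr; rewrite ger0_norm; lra].
rewrite mulr0 => /cvgrPdist_le/(_ ((e / 2) ^+ 2)).
have e2 : 0 < (e / 2) ^+ 2 by rewrite exprn_gt0// divr_gt0.
move=> /(_ e2)[K _ HK].
exists N0 => // n /= Nn; rewrite sub0r normrN ger0_norm ?nrmc_ge0//.
pose k := maxn K N0.
have Hk : nrmc mu (v k - h) <= e / 2.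
  rewrite -[leRHS]ger0_norm ?divr_ge0 ?(ltW e0)// -sqrtr_sqr ler_wsqrtr//.
  apply: le_trans (vh k) _.
  have := HK k; rewrite /= leq_maxl => /(_ isT); rewrite sub0r normrN.
  by move=> /(le_trans (ler_norm _)).
have NMk : (N0 <= M k)%N by rewrite (leq_trans _ (Mk k))// leq_maxr.
have -> : u n - h = (u n - v k) + (v k - h) by rewrite addrA subrK.
apply: le_trans (nrmcD _ _) _; try exact: L2cB.
by have := HN0 n (M k) Nn NMk; rewrite -/(v k); lra.
Qed.

End L2Complete.

(** * Bounded functional calculus of a spectral measure *)

Section CauchyLimits.
Context (R : realType).

Lemma cvg0_ge (a : nat -> R) : a n @[n --> \oo] --> (0 : R) ->
  forall e : R, 0 < e -> exists N, forall n, (N <= n)%N -> `|a n| <= e.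
Proof.
move=> /cvgrPdist_le H e e0; have [N _ HN] := H e e0; exists N => n Nn.
by have := HN n Nn; rewrite sub0r normrN.
Qed.

Lemma ler_addeps_all (x y : R) : (forall e : R, 0 < e -> x <= y + e) -> x <= y.
Proof. by move=> H; apply/ler_addgt0Pr => e; exact: H. Qed.

Lemma eq0_small (x c : R) : (forall e : R, 0 < e -> `|x| <= c * e) -> x = 0.
Proof.
move=> H; apply/eqP; rewrite -normr_le0; apply: ler_addeps_all => e e0; rewrite add0r.
have c1 : 0 < `|c| + 1 by rewrite ltr_wpDl.
apply: le_trans (H (e / (`|c| + 1)) (divr_gt0 e0 c1)) _.
rewrite mulrCA -[leRHS]mulr1; apply: ler_wpM2l; first exact: ltW.
by rewrite ler_pdivrMr// mul1r (le_trans (ler_norm _))// lerDl.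
Qed.

End CauchyLimits.

Section UniformSimple.
Context (R : realType).

(** The sum is eps times the integer part of y / eps, capped at N. It undershoots y by at most eps
    as long as the cap is not exceeded by more than one step. *)
Lemma layer_sum (eps y : R) (N : nat) : 0 < eps -> 0 <= y ->
  let S := \sum_(k < N) eps * (k.+1%:R * eps <= y)%R%:R in
  S <= y /\ (y <= N.+1%:R * eps -> y - eps <= S).
Proof.
move=> e0 y0 /=.
have full n : n%:R * eps <= y -> \sum_(k < n) eps * (k.+1%:R * eps <= y)%R%:R = n%:R * eps.
  move=> ny; rewrite (eq_bigr (fun=> eps)); first by rewrite sumr_const card_ord mulr_natl.
  move=> i _; suff -> : i.+1%:R * eps <= y by rewrite mulr1.
  by apply: le_trans ny; rewrite ler_pM2r// ler_nat.
elim: N => [|N [IH1 IH2]]; first by rewrite big_ord0; split => //; rewrite mul1r subr_le0.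
have [Ny|Ny] := leP (N.+1%:R * eps) y.
  by rewrite full//; split => //; rewrite -[N.+2%:R]natr1 mulrDl; lra.
rewrite big_ord_recr /= (lt_geF Ny) mulr0 addr0; split => // _.
by apply: IH2; exact: ltW.
Qed.

(** The staircase of [layer_sum] under h + M, lowered by M. A uniform approximation serves all
    vectors f at once, which is what the definition of [FC] rests on. *)
Lemma uniform_simple (h : R -> R) (M eps : R) : measurable_fun [set: R] h ->
  (forall t, `|h t| <= M) -> 0 < eps ->
  exists s : {sfun R >-> R}, forall t, `|s t - h t| <= eps.
Proof.
move=> mh hM e0.
have M0 : 0 <= M by apply: le_trans (hM 0).
pose N := (Num.truncn (2 * M / eps)).+1.
have mA k : measurable [set t | k%:R * eps <= h t + M].
  rewrite (_ : [set _ | _] = setT `&` h @^-1` `[k%:R * eps - M, +oo[%classic).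
    by apply: mh => //; exact: measurable_itv.
  by apply/seteqP; split => t /=; rewrite in_itv/= andbT lerBlDr// => -[].
exists (cst_sfun (- M) + \sum_(k < N) (cst_sfun eps * indic_sfun _ (mA k.+1))) => t.
rewrite sfunD /= sfun_sum.
have -> : \sum_(k < N) (cst_sfun eps * indic_sfun _ (mA k.+1) : {sfun R >-> R}) t =
   \sum_(k < N) eps * (k.+1%:R * eps <= h t + M)%R%:R.
  apply: eq_bigr => k _; rewrite sfunM /=; congr (_ * _).
  rewrite -[LHS]/(\1_[set t | k.+1%:R * eps <= h t + M] t) indicE.
  by congr (nat_of_bool _)%:R; apply/idP/idP; rewrite inE.
have y0 : 0 <= h t + M by have := hM t; rewrite ler_norml => /andP[? ?]; lra.
have [h1 h2] := layer_sum N e0 y0.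
have : h t + M <= N.+1%:R * eps.
  have h3 : 2 * M / eps < N%:R by exact: truncnS_gt.
  move: h3; rewrite ltr_pdivrMr// => h3.
  have := hM t; rewrite ler_norml => /andP[? ?].
  by rewrite -natr1 mulrDl; lra.
move=> /h2 h2'; rewrite ler_norml; apply/andP; split; lra.
Qed.

End UniformSimple.

Lemma eqL2_ip (d : measure_display) (T : measurableType d) (R : realType)
  (mu : {measure set T -> \bar R}) (f g : T -> R[i]) : L2c mu f -> L2c mu g ->
  (forall h, L2c mu h -> ipc mu f h = ipc mu g h) -> eqL2 mu f g.
Proof.
move=> Hf Hg H; have Hfg := L2cB Hf Hg.
by rewrite /eqL2 /nrmc ipcBl// H// subrr sqrtr0.
Qed.

Section SpectralCalculus.
Context (d : measure_display) (T : measurableType d) (R : realType).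
Context (mu : {measure set T -> \bar R}) (E : set R -> (T -> R[i]) -> T -> R[i]).
Hypothesis sE : spectral_measure mu E.
Local Notation L2 := (L2c mu).
Local Notation ip := (ipc mu).
Local Notation nr := (nrmc mu).

Lemma E_L2 B f : measurable B -> L2 f -> L2 (E B f).
Proof. by move=> mB /memL2P Hf; apply/memL2P; exact: spm_L2 sE _ _ mB Hf. Qed.

Lemma E_sym B f g : measurable B -> L2 f -> L2 g -> ip (E B f) g = ip f (E B g).
Proof.
move=> mB Hf Hg; rewrite -!Re_L2inner//; try exact: E_L2.
by rewrite (spm_sym sE)//; exact/memL2P.
Qed.

Lemma E_setI B C f g : measurable B -> measurable C -> L2 f -> L2 g ->
  ip (E B f) (E C g) = ip (E (B `&` C) f) g.
Proof.
move=> mB mC Hf Hg; rewrite -E_sym//; last exact: E_L2.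
have mBC : measurable (B `&` C) by exact: measurableI.
apply: ipc_eq => //; try exact: E_L2; try by do 2 apply: E_L2 => //.
apply: eqL2_sym; try exact: E_L2; first by do 2 apply: E_L2 => //.
apply/eqL2P; [exact: E_L2|by do 2 apply: E_L2 => //|].
by rewrite setIC; apply: (spm_setI sE) => //; exact/memL2P.
Qed.

Lemma E_ip B f g : measurable B -> L2 f -> L2 g -> ip (E B f) (E B g) = ip (E B f) g.
Proof. by move=> *; rewrite E_setI// setIid. Qed.

Lemma nr_E_sqr B f : measurable B -> L2 f -> nr (E B f) ^+ 2 = ip (E B f) f.
Proof. by move=> mB Hf; rewrite nrmc_sqr E_ip. Qed.

Lemma E_ge0 B f : measurable B -> L2 f -> 0 <= ip (E B f) f.
Proof. by move=> *; rewrite -nr_E_sqr ?sqr_ge0. Qed.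

Lemma nr_E_le B f : measurable B -> L2 f -> nr (E B f) <= nr f.
Proof.
move=> mB Hf; have HE := E_L2 mB Hf.
have := ipc_le HE Hf; rewrite -nr_E_sqr// ger0_norm ?sqr_ge0// expr2.
have [->|n0] := eqVneq (nr (E B f)) 0; first by rewrite nrmc_ge0.
by rewrite ler_pM2l// lt_neqAle eq_sym n0 nrmc_ge0.
Qed.

Lemma E_B B f g : measurable B -> L2 f -> L2 g -> eqL2 mu (E B (f - g)) (E B f - E B g).
Proof.
move=> mB Hf Hg; apply: eqL2_ip => [||h Hh].
- by apply: E_L2 => //; exact: L2cB.
- by apply: L2cB; exact: E_L2.
- by rewrite E_sym ?ipcBl -?E_sym//; try exact: E_L2; exact: L2cB.
Qed.

Lemma nr_E_sub B f g : measurable B -> L2 f -> L2 g -> nr (E B f - E B g) <= nr (f - g).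
Proof.
move=> mB Hf Hg; have Hfg := L2cB Hf Hg.
rewrite -(nrmc_eq _ _ (E_B mB Hf Hg)) ?nr_E_le//; first exact: E_L2.
by apply: L2cB; exact: E_L2.
Qed.

Lemma E_setT_ip f g : L2 f -> L2 g -> ip (E setT f) g = ip f g.
Proof.
move=> Hf Hg; apply: ipc_eq => //; first exact: E_L2.
apply/eqL2P => //; first exact: E_L2.
by apply: (spm_setT sE); exact/memL2P.
Qed.

Lemma E_bigcup_ip (B : nat -> set R) f g : (forall n, measurable (B n)) ->
  trivIset setT B -> L2 f -> L2 g ->
  \sum_(k < n) ip (E (B k) f) g @[n --> \oo] --> ip (E (\bigcup_n B n) f) g.
Proof.
move=> mB tB Hf Hg.
have mU : measurable (\bigcup_n B n) by exact: bigcupT_measurable.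
have HU := E_L2 mU Hf.
have Hs n : L2 (\sum_(k < n) E (B k) f) by apply: L2c_sum => k _; exact: E_L2.
have := spm_bigcup sE mB tB ((memL2P _ _).2 Hf).
rewrite (_ : (fun n x => _) = (fun n => \sum_(k < n) E (B k) f)); last first.
  by apply/funext => n; apply/funext => x; rewrite fct_sumE.
move=> /cvgL2P -/(_ Hs HU) /cvg0_ge H.
apply/cvgrPdist_le => e e0.
have g1 : 0 < nr g + 1 by rewrite ltr_wpDl// nrmc_ge0.
have [N HN] := H (e / (nr g + 1)) (divr_gt0 e0 g1).
exists N => // n /= Nn.
rewrite -ipc_suml// => [|k _]; last exact: E_L2.
rewrite distrC -(ipcBl (Hs n))//; have h0 := ipc_le (L2cB (Hs n) HU) Hg.
rewrite (le_trans h0)//.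
have := HN n Nn; rewrite ger0_norm ?nrmc_ge0// ler_pdivlMr// => h.
rewrite (le_trans _ h)// ler_wpM2l ?nrmc_ge0// lerDl ler01//.
Qed.

(** Additivity over a constant sequence of empty sets: the partial sums n a converge, so their
    consecutive differences a tend to 0. *)
Lemma E_set0_ip f g : L2 f -> L2 g -> ip (E set0 f) g = 0.
Proof.
move=> Hf Hg; pose a := ip (E set0 f) g.
have t0 : trivIset [set: nat] (fun=> set0 : set R).
  by apply/trivIsetP => i j _ _ _; rewrite setI0.
have := @E_bigcup_ip (fun=> set0) f g (fun=> measurable0) t0 Hf Hg.
rewrite bigcup0//.
move=> H; apply: (@eq0_small _ _ 2) => e e0.
move: H => /cvgrPdist_le /(_ e e0)[N _ HN].
have := HN N (leqnn N); have := HN N.+1 (leqnSn N); rewrite /= -/a big_ord_recr /= -/a => h1 h2.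
have -> : a = (a - \sum_(k < N) a) - (a - (\sum_(k < N) a + a)) by ring.
by apply: le_trans (ler_normB _ _) _; lra.
Qed.

Section Nu.
Variables (f : T -> R[i]) (Hf : L2 f).

(** The scalar spectral measure of f. The proof of square integrability is an argument so that the
    measure structure declared below can be attached to this constant. *)
Definition nuf of L2 f : set (measurableTypeR R) -> \bar R :=
  fun B => (cLnorm mu 2 (E B f) ^+ 2)%E.
Local Notation nu := (nuf Hf).

Lemma nufE (B : set R) : measurable B -> nu B = (ip (E B f) f)%:E.
Proof.
move=> mB; rewrite /nuf cLnorm2E; last exact: E_L2.
by rewrite -nr_E_sqr// EFin_expe.
Qed.

Let nu0 : nu set0 = 0%E.
Proof. by rewrite nufE// E_set0_ip. Qed.

Let nu_ge0 B : (0 <= nu B)%E.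
Proof. by rewrite expe_ge0//; exact: Lnorm_ge0. Qed.

Let nu_sigma : semi_sigma_additive nu.
Proof.
move=> F mF tF mU; rewrite nufE//.
rewrite (_ : (fun n => _) = (fun n => (\sum_(k < n) ip (E (F k) f) f)%:E)).
  apply/fine_cvgP; split; first exact: nearW.
  exact: E_bigcup_ip.
apply/funext => n; rewrite big_mkord -sumEFin; apply: eq_bigr => k _.
exact: nufE (mF k).
Qed.

HB.instance Definition _ := isMeasure.Build _ _ _ nu nu0 nu_ge0 nu_sigma.

Definition num : {measure set (measurableTypeR R) -> \bar R} := nu.

End Nu.

Lemma numE f (Hf : L2 f) (B : set R) : measurable B -> num Hf B = (ip (E B f) f)%:E.
Proof. exact: nufE. Qed.

Definition bdd (h : R -> R) : Prop :=
  measurable_fun [set: R] h /\ exists M : R, forall t, `|h t| <= M.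

Lemma bddD h k : bdd h -> bdd k -> bdd (fun t => h t + k t).
Proof.
move=> [mh [M HM]] [mk [N HN]]; split; first exact: measurable_funD.
by exists (M + N) => t; rewrite (le_trans (ler_normD _ _))// lerD.
Qed.

Lemma bddM h k : bdd h -> bdd k -> bdd (fun t => h t * k t).
Proof.
move=> [mh [M HM]] [mk [N HN]]; split; first exact: measurable_funM.
by exists (M * N) => t; rewrite normrM ler_pM.
Qed.

Lemma bdd_cst c : bdd (fun=> c).
Proof. by split=> //; exists `|c|. Qed.

Lemma bdd_indic (B : set R) : measurable B -> bdd (\1_B).
Proof.
move=> mB; split; first exact: measurable_indic.
by exists 1 => t; rewrite indicE; case: (_ \in _); rewrite ?normr1 ?normr0.
Qed.

Lemma bdd_sfun (s : {sfun R >-> R}) : bdd s.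
Proof.
split; first exact: measurable_funP.
have [M [_ HM]] := simple_bounded s; exists (M + 1) => t.
by apply: HM => //; rewrite ltrDl.
Qed.

Lemma bdd_sum (I : Type) (r : seq I) (P : pred I) (F : I -> R -> R) :
  (forall i, bdd (F i)) -> bdd (fun t => \sum_(i <- r | P i) F i t).
Proof.
move=> HF; elim: r => [|i r IH].
  by under eq_fun do rewrite big_nil; exact: bdd_cst.
under eq_fun do rewrite big_cons; case: (P i) => //.
exact: bddD.
Qed.

Section Nint.
Variables (f : T -> R[i]) (Hf : L2 f).
Local Notation nu := (num Hf).

Lemma num_fin : (nu setT < +oo)%E.
Proof. by rewrite numE// ltry. Qed.

Lemma bdd_integrable h : bdd h -> nu.-integrable setT (EFin \o h).
Proof.
move=> [mh [M HM]]; apply: measurable_bounded_integrable => //.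
- exact: num_fin.
- exists M; split; first exact: num_real.
  by move=> x Mx t _ /=; apply: le_trans (HM t) _; exact: ltW.
Qed.

Definition Nint (h : R -> R) : R := \int[nu]_t h t.

Lemma NintD h k : bdd h -> bdd k -> Nint (fun t => h t + k t) = Nint h + Nint k.
Proof. by move=> *; rewrite /Nint RintegralD//; exact: bdd_integrable. Qed.

Lemma NintZ c h : bdd h -> Nint (fun t => c * h t) = c * Nint h.
Proof. by move=> *; rewrite /Nint RintegralZl//; exact: bdd_integrable. Qed.

Lemma Nint_le h k : bdd h -> bdd k -> (forall t, h t <= k t) -> Nint h <= Nint k.
Proof. by move=> *; rewrite /Nint le_Rintegral//; exact: bdd_integrable. Qed.

Lemma Nint_indic (B : set R) : measurable B -> Nint (\1_B) = ip (E B f) f.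
Proof.
move=> mB; rewrite /Nint /Rintegral integral_indic// setIT.
by rewrite numE.
Qed.

Lemma Nint_cst c : Nint (fun=> c) = c * ip f f.
Proof.
by rewrite /Nint Rintegral_cst// numE//= E_setT_ip.
Qed.

Lemma Nint_EFin h : bdd h -> (\int[nu]_t (h t)%:E)%E = (Nint h)%:E.
Proof. by move=> Hh; rewrite -[LHS]fineK//; apply: integrable_fin_num => //; exact: bdd_integrable. Qed.

End Nint.

(** Polarization: the integral of h against the signed measure sending B to [ip (E B f) g], written
    with the positive measures of f + g, f and g. *)
Definition Jint h f g (Hf : L2 f) (Hg : L2 g) : R :=
  (Nint (L2cD Hf Hg) h - Nint Hf h - Nint Hg h) / 2.

Lemma Jint_ext h k f g (Hf : L2 f) (Hg : L2 g) : h =1 k -> Jint h Hf Hg = Jint k Hf Hg.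
Proof. by move=> /funext ->. Qed.

Lemma JintD h k f g (Hf : L2 f) (Hg : L2 g) : bdd h -> bdd k ->
  Jint (fun t => h t + k t) Hf Hg = Jint h Hf Hg + Jint k Hf Hg.
Proof. by move=> *; rewrite /Jint !NintD//; lra. Qed.

Lemma JintZ c h f g (Hf : L2 f) (Hg : L2 g) : bdd h ->
  Jint (fun t => c * h t) Hf Hg = c * Jint h Hf Hg.
Proof. by move=> *; rewrite /Jint !NintZ//; lra. Qed.

Lemma Jint_sum (I : Type) (r : seq I) (F : I -> R -> R) f g (Hf : L2 f) (Hg : L2 g) :
  (forall i, bdd (F i)) ->
  Jint (fun t => \sum_(i <- r) F i t) Hf Hg = \sum_(i <- r) Jint (F i) Hf Hg.
Proof.
move=> HF; elim: r => [|i r IH].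
  rewrite big_nil; under eq_fun do rewrite big_nil.
  by rewrite /Jint !Nint_cst; lra.
rewrite big_cons -IH -JintD//; last exact: bdd_sum.
by apply: Jint_ext => t; rewrite big_cons.
Qed.

Lemma Jint_indic (B : set R) f g (Hf : L2 f) (Hg : L2 g) : measurable B ->
  Jint (\1_B) Hf Hg = ip (E B f) g.
Proof.
move=> mB; rewrite /Jint !Nint_indic//.
have HEf := E_L2 mB Hf; have HEg := E_L2 mB Hg; have Hfg := L2cD Hf Hg.
have HEfg := E_L2 mB Hfg.
rewrite (E_sym mB Hfg Hfg) (ipcDl Hf Hg HEfg) -(E_sym mB Hf Hfg) -(E_sym mB Hg Hfg).
rewrite !ipcDr// (E_sym mB Hg Hf) (ipcC _ g); lra.
Qed.

Lemma sfun_sumE (s : {sfun R >-> R}) t :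
  s t = \sum_(c <- finmap.enum_fset (fset_set (range s))) c * \1_(s @^-1` [set c]) t.
Proof. by rewrite fimfunE fsbig_finite. Qed.

Local Notation I s f := (simple_spectral_integral E s f).

Lemma IE (s : {sfun R >-> R}) f :
  I s f = \sum_(c <- finmap.enum_fset (fset_set (range s))) scr c (E (s @^-1` [set c]) f).
Proof. by apply/funext => x; rewrite fct_sumE /simple_spectral_integral fsbig_finite. Qed.

Lemma measurable_fiber (s : {sfun R >-> R}) c : measurable (s @^-1` [set c]).
Proof. by rewrite -[X in measurable X]setTI; exact: measurable_funP. Qed.

Lemma I_L2 s f : L2 f -> L2 (I s f).
Proof.
move=> Hf; rewrite IE; apply: L2c_sum => c _; apply: L2cZ.
by apply: E_L2 => //; exact: measurable_fiber.
Qed.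

Lemma ip_I s f g (Hf : L2 f) (Hg : L2 g) : ip (I s f) g = Jint s Hf Hg.
Proof.
have mf := measurable_fiber s.
rewrite IE ipc_suml// => [|c _]; last by apply: L2cZ; exact: E_L2.
have -> : Jint s Hf Hg =
    Jint (fun t => \sum_(c <- finmap.enum_fset (fset_set (range s))) c * \1_(s @^-1` [set c]) t) Hf Hg.
  by apply: Jint_ext => t; exact: sfun_sumE.
rewrite Jint_sum; last by move=> c; apply: bddM; [exact: bdd_cst|exact: bdd_indic].
apply: eq_bigr => c _; rewrite ipcZl//; last exact: E_L2.
by rewrite JintZ ?Jint_indic//; exact: bdd_indic.
Qed.

Lemma I_sym s f g : L2 f -> L2 g -> ip (I s f) g = ip f (I s g).
Proof.
move=> Hf Hg; have mf := measurable_fiber s.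
rewrite (ipcC _ f) !IE !ipc_suml//; try by move=> c _; apply: L2cZ; exact: E_L2.
apply: eq_bigr => c _; rewrite !ipcZl//; try exact: E_L2.
by rewrite E_sym// ipcC.
Qed.

Lemma E_I (B : set R) s f g (Hf : L2 f) (Hg : L2 g) : measurable B ->
  ip (I s f) (E B g) = Jint (fun t => s t * \1_B t) Hf Hg.
Proof.
move=> mB; have mf := measurable_fiber s.
rewrite IE ipc_suml//; [|by move=> c _; apply: L2cZ; exact: E_L2|exact: E_L2].
have -> : Jint (fun t => s t * \1_B t) Hf Hg =
    Jint (fun t => \sum_(c <- finmap.enum_fset (fset_set (range s))) c * \1_(s @^-1` [set c] `&` B) t) Hf Hg.
  apply: Jint_ext => t; rewrite sfun_sumE mulr_suml.
  by apply: eq_bigr => c _; rewrite indicI -mulrA.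
have mI c : measurable (s @^-1` [set c] `&` B) by exact: measurableI.
rewrite Jint_sum; last by move=> c; apply: bddM; [exact: bdd_cst|exact: bdd_indic].
apply: eq_bigr => c _; rewrite ipcZl//; try exact: E_L2.
by rewrite JintZ ?Jint_indic// ?E_setI//; exact: bdd_indic.
Qed.

Lemma I_I s t f g (Hf : L2 f) (Hg : L2 g) :
  ip (I s f) (I t g) = Jint (fun x => s x * t x) Hf Hg.
Proof.
have mt := measurable_fiber t.
rewrite (IE t) ipcC ipc_suml//; [|by move=> c _; apply: L2cZ; exact: E_L2|exact: I_L2].
have -> : Jint (fun x => s x * t x) Hf Hg =
    Jint (fun x => \sum_(c <- finmap.enum_fset (fset_set (range t))) c * (s x * \1_(t @^-1` [set c]) x)) Hf Hg.
  apply: Jint_ext => x; rewrite (sfun_sumE t) mulr_sumr.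
  by apply: eq_bigr => c _; rewrite mulrCA.
have b1 c : bdd (fun x => s x * \1_(t @^-1` [set c]) x).
  by apply: bddM; [exact: bdd_sfun|exact: bdd_indic].
rewrite Jint_sum; last by move=> c; apply: bddM => //; exact: bdd_cst.
apply: eq_bigr => c _; rewrite ipcZl//; [|exact: E_L2|exact: I_L2].
by rewrite JintZ// ipcC (E_I s Hf Hg).
Qed.

(** Polarization at g = f returns [Nint] as soon as f + f weighs four times f. This is clear on
    level sets, extends to simple functions by linearity and to h by uniform approximation. *)
Lemma Jint_self h f (Hf : L2 f) : (forall t, 0 <= h t) -> bdd h -> Jint h Hf Hf = Nint Hf h.
Proof.
move=> h0 bh; have := bh; move=> [mh [M HM]].
have J1 (s : {sfun R >-> R}) : Jint s Hf Hf = Nint Hf s.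
  have -> : s = (fun t => \sum_(c <- finmap.enum_fset (fset_set (range s))) c * \1_(s @^-1` [set c]) t) :> (R -> R).
    by apply/funext => t; exact: sfun_sumE.
  have mf := measurable_fiber s.
  have bb c : bdd (fun t => c * \1_(s @^-1` [set c]) t).
    by apply: bddM; [exact: bdd_cst|exact: bdd_indic].
  rewrite Jint_sum//.
  elim: (finmap.enum_fset _) => [|c r IH].
    by rewrite big_nil; under eq_fun do rewrite big_nil; rewrite Nint_cst mul0r.
  rewrite big_cons IH; under [in RHS]eq_fun do rewrite big_cons.
  rewrite NintD//; last exact: bdd_sum.
  congr (_ + _); rewrite JintZ ?NintZ ?Jint_indic ?Nint_indic//; exact: bdd_indic.
apply/eqP; rewrite -subr_eq0; apply/eqP.
apply: (@eq0_small _ _ (Nint (L2cD Hf Hf) (fun=> 1) + 4 * Nint Hf (fun=> 1))) => e e0.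
have [s Hs] := uniform_simple mh HM e0.
have bs := bdd_sfun s.
have close g (Hg : L2 g) : `|Nint Hg h - Nint Hg s| <= e * Nint Hg (fun=> 1).
  have b1 := bdd_cst 1.
  have be : bdd (fun=> e * 1) by exact: bdd_cst.
  rewrite -NintZ// ler_norml; apply/andP; split.
    rewrite lerNl opprB lerBlDr -NintD//; apply: Nint_le => //; first exact: bddD.
    by move=> t; have := Hs t; rewrite ler_norml => /andP[? ?]; lra.
  rewrite lerBlDr -NintD//; apply: Nint_le => //; first exact: bddD.
  by move=> t; have := Hs t; rewrite ler_norml => /andP[? ?]; lra.
have h1 := close _ (L2cD Hf Hf); have h2 := close _ Hf.
have := J1 s; rewrite /Jint => h3.
move: h1 h2; rewrite !ler_norml => /andP[? ?] /andP[? ?]; apply/andP; split; lra.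
Qed.

(** The isometry of the spectral integral on simple functions, from which the operator bounds of the
    calculus follow. *)
Lemma nr_I s f (Hf : L2 f) : nr (I s f) ^+ 2 = Nint Hf (fun t => s t ^+ 2).
Proof.
rewrite nrmc_sqr (I_I s s Hf Hf) Jint_self => [//|t|].
  by rewrite -expr2 sqr_ge0.
by apply: bddM; exact: bdd_sfun.
Qed.

Lemma Nint_ub h f (Hf : L2 f) (M : R) : bdd h -> (forall t, h t <= M) -> Nint Hf h <= M * nr f ^+ 2.
Proof.
move=> bh hM; rewrite nrmc_sqr -Nint_cst; apply: Nint_le => //; exact: bdd_cst.
Qed.

Lemma nr_I_le (s : {sfun R >-> R}) f (M : R) : L2 f -> 0 <= M -> (forall t, `|s t| <= M) -> nr (I s f) <= M * nr f.
Proof.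
move=> Hf M0 sM; rewrite -(@ler_pXn2r _ 2)// ?nnegrE ?nrmc_ge0 ?mulr_ge0 ?nrmc_ge0//.
rewrite (nr_I s Hf) exprMn; apply: Nint_ub.
  by apply: bddM; exact: bdd_sfun.
by move=> t; rewrite -(real_normK (num_real _)) lerXn2r ?nnegrE.
Qed.

Lemma I_B s t f : L2 f -> eqL2 mu (I s f - I t f) (I (s - t) f).
Proof.
move=> Hf; apply: eqL2_ip => [||g Hg]; [by apply: L2cB; exact: I_L2|exact: I_L2|].
rewrite ipcBl//; try exact: I_L2.
rewrite !(ip_I _ Hf Hg) -mulN1r -JintZ; last exact: bdd_sfun.
rewrite -JintD; [|exact: bdd_sfun|by apply: bddM; [exact: bdd_cst|exact: bdd_sfun]].
by apply: Jint_ext => x; rewrite mulN1r.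
Qed.

Lemma I_M s t f : L2 f -> eqL2 mu (I s (I t f)) (I (s * t) f).
Proof.
move=> Hf; apply: eqL2_ip => [||g Hg]; [by do 2 apply: I_L2|exact: I_L2|].
rewrite I_sym//; last exact: I_L2.
by rewrite (I_I t s Hf Hg) (ip_I _ Hf Hg); apply: Jint_ext => x; rewrite mulrC.
Qed.

Lemma nr_IB s t f : L2 f -> nr (I s f - I t f) = nr (I (s - t) f).
Proof. by move=> Hf; apply: nrmc_eq (I_B s t Hf); [apply: L2cB; exact: I_L2|exact: I_L2]. Qed.

Lemma nr_I_sub (s : {sfun R >-> R}) f g (M : R) : L2 f -> L2 g -> 0 <= M -> (forall t, `|s t| <= M) ->
  nr (I s f - I s g) <= M * nr (f - g).
Proof.
move=> Hf Hg M0 sM; have Hfg := L2cB Hf Hg.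
have e : eqL2 mu (I s f - I s g) (I s (f - g)).
  apply: eqL2_ip => [||h Hh]; [by apply: L2cB; exact: I_L2|exact: I_L2|].
  have HI := I_L2 s Hh.
  by rewrite ipcBl ?I_sym ?ipcBl//; exact: I_L2.
rewrite (nrmc_eq _ _ e); [exact: nr_I_le|by apply: L2cB; exact: I_L2|exact: I_L2].
Qed.

Lemma E_I_eq (B : set R) s f : measurable B -> L2 f -> eqL2 mu (E B (I s f)) (I s (E B f)).
Proof.
move=> mB Hf; have HE := E_L2 mB Hf; have HI := I_L2 s Hf.
apply: eqL2_ip => [||g Hg]; [exact: E_L2|exact: I_L2|].
have HEg := E_L2 mB Hg; have mf := measurable_fiber s.
rewrite E_sym// !IE !ipc_suml//; try by move=> c _; apply: L2cZ; exact: E_L2.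
apply: eq_bigr => c _; rewrite !ipcZl//; try exact: E_L2.
by rewrite E_setI// (E_sym (mf c) HE Hg) E_setI// setIC.
Qed.

(* [FC h f g] says g = h(A) f for a bounded Borel function h. *)
Definition FC (h : R -> R) f g : Prop := [/\ bdd h, L2 f, L2 g &
  forall (s : {sfun R >-> R}) (e : R), (forall t, `|s t - h t| <= e) -> nr (I s f - g) <= e * nr f].

(** Simple approximations of h within 2^-n give a Cauchy sequence; its limit serves every other
    approximation of h, by comparison with a late member of the sequence. *)
Lemma FC_exists h f : bdd h -> L2 f -> exists g, FC h f g.
Proof.
move=> bh Hf; have [mh [M HM]] := bh.
have ep n : 0 < 2^-1 ^+ n :> R by rewrite exprn_gt0// invr_gt0.
have /choice[s Hs] : forall n, exists s : {sfun R >-> R}, forall t, `|s t - h t| <= 2^-1 ^+ n.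
  by move=> n; exact: uniform_simple mh HM (ep n).
have close (s1 s2 : {sfun R >-> R}) (e1 e2 : R) : (forall t, `|s1 t - h t| <= e1) ->
    (forall t, `|s2 t - h t| <= e2) -> nr (I s1 f - I s2 f) <= (e1 + e2) * nr f.
  move=> H1 H2; rewrite nr_IB//; apply: nr_I_le => // [|t].
    by rewrite addr_ge0//; [apply: le_trans (H1 0)|apply: le_trans (H2 0)].
  rewrite sfunB /= (_ : s1 t - s2 t = (s1 t - h t) - (s2 t - h t)); last by ring.
  by rewrite (le_trans (ler_normB _ _))// lerD.
have small (e : R) : 0 < e -> exists N, forall n, (N <= n)%N -> 2^-1 ^+ n <= e.
  move=> e0; have [|N HN] := @cvg0_ge R (fun n => 2^-1 ^+ n) _ e e0.
    by apply: cvg_expr; rewrite ger0_norm; lra.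
  by exists N => n /HN; rewrite ger0_norm// ltW.
have [n|e e0|g Hg cg] := @L2c_complete _ _ _ mu (fun n => I (s n) f).
- exact: I_L2.
- have c0 : 0 < 2 * nr f + 1 by rewrite ltr_wpDl// mulr_ge0// nrmc_ge0.
  have [N HN] := small _ (divr_gt0 e0 c0); exists N => m n /HN hm /HN hn.
  apply: le_trans (close _ _ _ _ (Hs m) (Hs n)) _.
  have h1 : (2^-1 ^+ m + 2^-1 ^+ n) * nr f <= (e / (2 * nr f + 1) + e / (2 * nr f + 1)) * nr f.
    by rewrite ler_wpM2r ?nrmc_ge0// lerD.
  apply: le_trans h1 _; rewrite (_ : _ * _ = e * (2 * nr f / (2 * nr f + 1))); last by lra.
  by rewrite ger_pMr// ler_pdivrMr// mul1r lerDl.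
exists g; split => // t e He.
apply: ler_addeps_all => e' e'0.
have c0 : 0 < nr f + 1 by rewrite ltr_wpDl// nrmc_ge0.
have e'1 : 0 < e' / 2 by rewrite divr_gt0.
have [N1 HN1] := cvg0_ge cg e'1.
have [N2 HN2] := small _ (divr_gt0 e'1 c0).
pose n := maxn N1 N2.
have := HN1 n (leq_maxl _ _); rewrite ger0_norm ?nrmc_ge0// => h1.
have := HN2 n (leq_maxr _ _) => h2.
have -> : I t f - g = (I t f - I (s n) f) + (I (s n) f - g) by rewrite addrA subrK.
apply: le_trans (nrmcD _ _) _; try by apply: L2cB => //; exact: I_L2.
have h3 := close _ _ _ _ He (Hs n).
have h4 : 2^-1 ^+ n * nr f <= e' / 2.
  apply: (@le_trans _ _ (e' / 2 / (nr f + 1) * nr f)); first by rewrite ler_wpM2r ?nrmc_ge0.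
  by rewrite -mulrA ger_pMr// mulrC ler_pdivrMr// mul1r lerDl.
move: h3; rewrite mulrDl; lra.
Qed.

Lemma FC_ip h f g f' g' : FC h f g -> FC h f' g' -> ip g f' = ip f g'.
Proof.
move=> [bh Hf Hg Hfg] [_ Hf' Hg' Hfg']; have [mh [M HM]] := bh.
apply/eqP; rewrite -subr_eq0; apply/eqP.
apply: (@eq0_small _ _ (2 * nr f * nr f')) => e e0.
have [s Hs] := uniform_simple mh HM e0.
have h1 := Hfg _ _ Hs; have h2 := Hfg' _ _ Hs.
have HI := I_L2 s Hf; have HI' := I_L2 s Hf'.
have -> : ip g f' - ip f g' = - ip (I s f - g) f' + ip f (I s f' - g').
  by rewrite ipcBl// ipcBr// (I_sym s Hf Hf'); lra.
apply: le_trans (ler_normD _ _) _; rewrite normrN.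
have i1 := ipc_le (L2cB HI Hg) Hf'; have i2 := ipc_le Hf (L2cB HI' Hg').
have j1 : nr (I s f - g) * nr f' <= e * nr f * nr f' by rewrite ler_wpM2r ?nrmc_ge0.
have j2 : nr f * nr (I s f' - g') <= nr f * (e * nr f') by rewrite ler_wpM2l ?nrmc_ge0.
lra.
Qed.

(** Spectral localisation: on the range of E B only the values of h on B count. It is applied to
    dyadic pieces, where c is the size of the multiplier. *)
Lemma FC_E h f g (B : set R) (c : R) : FC h f g -> measurable B -> 0 <= c ->
  (forall t, B t -> `|h t| <= c) -> nr (E B g) <= c * nr (E B f).
Proof.
move=> [bh Hf Hg Hfg] mB c0 hc; have [mh [M HM]] := bh.
have HEf := E_L2 mB Hf; have HEg := E_L2 mB Hg.
apply: ler_addeps_all => e e0.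
pose e' := e / (nr f + nr (E B f) + 1).
have c1 : 0 < nr f + nr (E B f) + 1 by rewrite ltr_wpDl// addr_ge0 ?nrmc_ge0.
have e'0 : 0 < e' by rewrite divr_gt0.
have [s Hs] := uniform_simple mh HM e'0.
have h1 := Hfg _ _ Hs.
have HI := I_L2 s Hf; have HEI := E_L2 mB HI.
have h2 : nr (E B (I s f)) <= (c + e') * nr (E B f).
  have := E_I_eq s mB Hf => /(nrmc_eq HEI (I_L2 s HEf)) ->.
  pose s' := s * indic_sfun B mB.
  have e3 : eqL2 mu (I s (E B f)) (I s' (E B f)).
    apply: eqL2_ip; [exact: I_L2|exact: I_L2|move=> g' Hg'].
    have HEg' := E_L2 mB Hg'.
    have -> : ip (I s' (E B f)) g' = ip (I s (E B f)) (E B g').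
      by rewrite (E_I s HEf Hg' mB) (ip_I s' HEf Hg').
    have HIE := I_L2 s HEf.
    rewrite -E_sym//.
    apply: ipc_eq => //; first exact: E_L2.
    apply: eqL2_sym => //; first exact: E_L2.
    apply: (@eqL2_trans _ _ _ _ _ (I s (E B (E B f)))) => //; try exact: E_L2.
    - by apply: I_L2; exact: E_L2.
    - exact: E_I_eq.
    - rewrite /eqL2; apply/eqP; rewrite eq_le nrmc_ge0 andbT.
      have [_ [Ms HMs]] := bdd_sfun s.
      have Ms0 : 0 <= Ms by rewrite (le_trans _ (HMs 0)).
      have HEE := E_L2 mB HEf.
      apply: le_trans (nr_I_sub HEE HEf Ms0 HMs) _.
      suff -> : nr (E B (E B f) - E B f) = 0 by rewrite mulr0.
      apply: eqL2_ip => // g2 Hg2; rewrite E_sym// E_ip//; exact: E_L2.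
  rewrite (nrmc_eq (I_L2 _ HEf) (I_L2 _ HEf) e3); apply: nr_I_le => // [|t].
    by rewrite addr_ge0// ltW.
  rewrite /s' sfunM /= -[X in _ * X]/(\1_B t) indicE.
  case: (boolP (t \in B)) => tB; last by rewrite mulr0 normr0 addr_ge0// ltW.
  rewrite mulr1 -[s t](subrK (h t)) (le_trans (ler_normD _ _))// addrC lerD//.
  by apply: hc; move: tB; rewrite inE.
have h3 := nr_E_sub mB HI Hg.
have h4 := nrmcD HEI (L2cB HEg HEI).
move: h4; rewrite addrC subrK => h4.
have h5 : nr (E B g - E B (I s f)) <= nr (I s f - g).
  by rewrite -(nrmcN (L2cB HEg HEI)) opprB.
have h6 : e' * (nr f + nr (E B f)) <= e.
  by rewrite /e' -mulrA ger_pMr// mulrC ler_pdivrMr// mul1r lerDl.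
rewrite mulrDl in h2; rewrite mulrDr in h6; lra.
Qed.

(** Links [FC] to the relation [spectral_integral]. The function psi may be unbounded off B provided
    f has no spectral mass there: this is how A itself, with psi the identity, acts on a bounded
    spectral subspace. *)
Lemma FC_spectral h (psi : R -> R) f g (B : set R) : FC h f g -> measurable B ->
  measurable_fun [set: R] psi -> ip (E (~` B) f) f = 0 -> (forall t, B t -> psi t = h t) ->
  spectral_integral mu E psi f g.
Proof.
move=> [bh Hf Hg Hfg] mB mpsi nB psih; have [mh [M HM]] := bh.
split; [exact/memL2P|exact/memL2P|].
have ep n : 0 < n.+1%:R^-1 :> R by rewrite invr_gt0.
have /choice[s Hs] : forall n, exists s : {sfun R >-> R}, forall t, `|s t - h t| <= n.+1%:R^-1.
  by move=> n; exact: uniform_simple mh HM (ep n).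
have m1 (k : R -> R) (mk : measurable_fun [set: R] k) n :
    measurable_fun [set: R] (fun t => ((s n t - k t) ^+ 2)%:E).
  by apply/measurable_EFinP; apply: measurable_funX; apply: measurable_funB.
exists (num Hf), s; split=> //.
- have Hn n : (\int[num Hf]_t ((s n t - psi t) ^+ 2)%:E)%E = (Nint Hf (fun t => (s n t - h t) ^+ 2))%:E.
    rewrite -Nint_EFin; last first.
      have bsh : bdd (fun t => s n t - h t).
        have := bddD (bdd_sfun (s n)) (bddM (bdd_cst (-1)) bh).
        by congr bdd; apply/funext => t; rewrite mulN1r.
      exact: bddM.
    apply: ge0_ae_eq_integral => //.
    + exact: (m1 psi mpsi n).
    + exact: (m1 h mh n).
    + by move=> t _; rewrite lee_fin sqr_ge0.
    + by move=> t _; rewrite lee_fin sqr_ge0.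
    + exists (~` B); split; first exact: measurableC.
        by rewrite numE ?nB//; exact: measurableC.
      by move=> t /= /not_implyP[_ H] Bt; apply: H; rewrite psih.
  rewrite (_ : (fun n => _) = (fun n => (Nint Hf (fun t => (s n t - h t) ^+ 2))%:E)); last exact/funext.
  apply/fine_cvgP; split; first exact: nearW.
  have H0 n : 0 <= Nint Hf (fun t => (s n t - h t) ^+ 2) <= n.+1%:R^-1 * nr f ^+ 2.
    have bsh : bdd (fun t => s n t - h t).
      have := bddD (bdd_sfun (s n)) (bddM (bdd_cst (-1)) bh).
      by congr bdd; apply/funext => t; rewrite mulN1r.
    apply/andP; split; first by apply: Rintegral_ge0 => t _; rewrite sqr_ge0.
    apply: Nint_ub => [|t]; first exact: bddM.
    rewrite -(real_normK (num_real _)) expr2 -[leRHS]mulr1 ler_pM//.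
    by rewrite (le_trans (Hs n t))// invf_le1// ler1n.
  apply: (@squeeze_cvgr _ _ _ _ (fun=> 0) (fun n => n.+1%:R^-1 * nr f ^+ 2)).
  + by apply: nearW.
  + exact: cvg_cst.
  + rewrite -[X in _ --> X](mul0r (nr f ^+ 2)); apply: cvgM; last exact: cvg_cst.
    exact: cvg_harmonic.
- apply/cvgL2P => //; first by move=> n; exact: I_L2.
  apply: (@squeeze_cvgr _ _ _ _ (fun=> 0) (fun n => n.+1%:R^-1 * nr f)).
  + by apply: nearW => n; rewrite nrmc_ge0 Hfg.
  + exact: cvg_cst.
  + rewrite -[X in _ --> X](mul0r (nr f)); apply: cvgM; last exact: cvg_cst.
    exact: cvg_harmonic.
Qed.

Lemma spectral_integral_num psi f g (Hf : L2 f) : spectral_integral mu E psi f g ->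
  L2 g /\ exists s : nat -> {sfun R >-> R},
    (\int[num Hf]_t ((s n t - psi t) ^+ 2)%:E)%E @[n --> \oo] --> 0%E /\
    nr (I (s n) f - g) @[n --> \oo] --> (0 : R).
Proof.
move=> [_ /memL2P Hg [nu [s [nuE H1 H2]]]]; split => //; exists s; split.
  rewrite (_ : (fun n => _) = (fun n => (\int[nu]_t ((s n t - psi t) ^+ 2)%:E)%E))//.
  apply/funext => n; apply: eq_measure_integral => B mB _; exact/esym/nuE.
by apply/cvgL2P => //; move=> n; exact: I_L2.
Qed.

(** Young's inequality with a weight on x^2 close to 1, which keeps the sharp constant e demanded by
    [FC]. *)
Lemma sqr_split (x y del : R) : 0 < del ->
  (x + y) ^+ 2 <= (1 + del) * x ^+ 2 + (1 + del^-1) * y ^+ 2.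
Proof.
move=> d0; rewrite -subr_ge0.
have -> : (1 + del) * x ^+ 2 + (1 + del^-1) * y ^+ 2 - (x + y) ^+ 2 = (del * x - y) ^+ 2 / del.
  by field; rewrite gt_eqF.
by rewrite divr_ge0 ?sqr_ge0// ltW.
Qed.

Lemma ler_sqrtD (a b c : R) : 0 <= a -> 0 <= b -> 0 <= c ->
  c ^+ 2 <= a ^+ 2 + b ^+ 2 -> c <= a + b.
Proof.
move=> a0 b0 c0 H; rewrite -(@ler_pXn2r _ 2)// ?nnegrE ?addr_ge0//.
by apply: le_trans H _; rewrite sqrrD; have := mulr_ge0 a0 b0; rewrite mulr2n; lra.
Qed.

Lemma E_I_indic (B : set R) (mB : measurable B) s f : L2 f ->
  eqL2 mu (E B (I s f)) (I (s * indic_sfun B mB) f).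
Proof.
move=> Hf; have HI := I_L2 s Hf; apply: eqL2_ip => [||g Hg]; [exact: E_L2|exact: I_L2|].
rewrite E_sym// (E_I s Hf Hg)// (ip_I _ Hf Hg).
exact: Jint_ext.
Qed.

(** A simple approximant of psi in L2 of the spectral measure, once cut to B, approximates h, and
    the spectral integral of the cut approximant is E B of the uncut one. Through this lemma vectors
    of the unbounded domain meet the bounded calculus. *)
Lemma spectral_integral_E psi f g (B : set R) (h : R -> R) :
  spectral_integral mu E psi f g -> measurable_fun [set: R] psi -> L2 f -> measurable B ->
  bdd h -> (forall t, B t -> h t = psi t) -> (forall t, ~ B t -> h t = 0) ->
  FC h f (E B g).
Proof.
move=> HS mpsi Hf mB bh hpsi h0; have [Hg [s [H1 H2]]] := spectral_integral_num Hf HS.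
have HEg := E_L2 mB Hg; split => // s0 e He.
have e0 : 0 <= e by apply: le_trans (He 0).
apply: ler_addeps_all => eta eta0.
pose F := nr f; have F0 : 0 <= F := nrmc_ge0 _ _.
have eta2 : 0 < eta / 2 by rewrite divr_gt0.
(* With q at most del^2, the excess over (e F)^2 will be del e^2 F^2 + del^2 + del, at most del K;
   del is chosen to make this at most (eta / 2)^2. *)
pose K := e ^+ 2 * F ^+ 2 + 2.
have K0 : 0 < K by rewrite ltr_wpDl// mulr_ge0// sqr_ge0.
pose del := Num.min 1 ((eta / 2) ^+ 2 / K).
have d0 : 0 < del by rewrite lt_min ltr01 divr_gt0// exprn_gt0.
have d1 : del <= 1 by rewrite ge_min lexx.
have dK : del * K <= (eta / 2) ^+ 2 by rewrite -ler_pdivlMr// ge_min lexx orbT.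
have [N1 HN1] := cvg0_ge H2 eta2.
move: H1 => /fine_cvgP[[N0 _ HN0] H1].
have [N2 HN2] := cvg0_ge H1 (exprn_gt0 2 d0).
pose n := maxn N0 (maxn N1 N2).
have nN0 : (N0 <= n)%N by exact: leq_maxl.
have nN1 : (N1 <= n)%N by rewrite leq_max leq_maxl orbT.
have nN2 : (N2 <= n)%N by rewrite leq_max leq_maxr orbT.
have := HN1 n nN1; rewrite ger0_norm ?nrmc_ge0// => z1.
have q1 := HN2 n nN2; have q0 := HN0 n nN0.
set q := fine _ in q1.
have Eq : (\int[num Hf]_t ((s n t - psi t) ^+ 2)%:E)%E = q%:E by rewrite /q fineK.
pose s1 := s n * indic_sfun B mB.
have HI0 := I_L2 s0 Hf; have HI1 := I_L2 s1 Hf; have HIn := I_L2 (s n) Hf.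
have HEI := E_L2 mB HIn.
have key (t : R) : (s0 - s1) t ^+ 2 <=
    (1 + del) * e ^+ 2 + (1 + del^-1) * (s n t - psi t) ^+ 2.
  have -> : (s0 - s1) t = s0 t - s n t * \1_B t by [].
  rewrite indicE.
  have [tB|tB] := boolP (t \in B).
    have Bt : B t by move: tB; rewrite inE.
    rewrite mulr1 (_ : s0 t - s n t = (s0 t - h t) + (psi t - s n t)); last by rewrite hpsi//; ring.
    apply: le_trans (sqr_split _ _ d0) _.
    rewrite -[X in _ + _ * X]sqrrN opprB lerD2r ler_wpM2l ?addr_ge0 ?(ltW d0)//.
    by rewrite -(real_normK (num_real _)) lerXn2r ?nnegrE.
  have Bt : ~ B t by move=> Bt; move: tB; rewrite mem_set.
  have := He t; rewrite h0// subr0 mulr0 subr0 => he.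
  apply: (@le_trans _ _ (e ^+ 2)).
    by rewrite -(real_normK (num_real _)) lerXn2r ?nnegrE.
  apply: (@le_trans _ _ ((1 + del) * e ^+ 2)).
    by rewrite ler_peMl ?sqr_ge0// lerDl ltW.
  by rewrite lerDl mulr_ge0 ?sqr_ge0// addr_ge0// invr_ge0 ltW.
have X1 : nr (I s0 f - I s1 f) ^+ 2 <= (e * F) ^+ 2 + (eta / 2) ^+ 2.
  rewrite nr_IB// (nr_I (s0 - s1) Hf) -lee_fin -Nint_EFin; last first.
    by apply: bddM; exact: bdd_sfun.
  apply: (@le_trans _ _ (\int[num Hf]_t
     (((1 + del) * e ^+ 2)%:E + (1 + del^-1)%:E * ((s n t - psi t) ^+ 2)%:E))%E).
    have mm : measurable_fun [set: R] (fun t => ((s n t - psi t) ^+ 2)%:E).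
      by apply/measurable_EFinP; apply: measurable_funX; apply: measurable_funB.
    apply: ge0_le_integral => //.
    - by move=> t _; rewrite lee_fin sqr_ge0.
    - have mm0 : measurable_fun [set: R] (fun t => ((s0 - s1) t ^+ 2)%:E).
        apply/measurable_EFinP; apply: measurable_funX; exact: measurable_funP.
      exact: mm0.
    - apply: emeasurable_funD => //; apply: measurable_funeM; exact: mm.
    - by move=> t _; rewrite -EFinM -EFinD lee_fin; exact: key.
  have mm : measurable_fun [set: measurableTypeR R] (fun t => ((s n t - psi t) ^+ 2)%:E).
    have mm1 : measurable_fun [set: R] (fun t => ((s n t - psi t) ^+ 2)%:E).
      by apply/measurable_EFinP; apply: measurable_funX; apply: measurable_funB.
    exact: mm1.
  have dd : 0 <= 1 + del^-1 by rewrite addr_ge0// invr_ge0 ltW.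
  rewrite ge0_integralD//; last first.
  - exact: measurable_funeM.
  - by move=> t _; rewrite -EFinM lee_fin mulr_ge0// sqr_ge0.
  - by move=> t _; rewrite lee_fin mulr_ge0 ?sqr_ge0// addr_ge0// ltW.
  rewrite ge0_integralZl_EFin//; last by move=> t _; rewrite lee_fin sqr_ge0.
  rewrite Eq integral_cst// numE// E_setT_ip// -nrmc_sqr -/F -!EFinM -EFinD lee_fin.
  have q3 : q <= del ^+ 2 by apply: le_trans (ler_norm _) q1.
  have q4 : (1 + del^-1) * q <= del ^+ 2 + del.
    apply: (@le_trans _ _ ((1 + del^-1) * del ^+ 2)); first by rewrite ler_wpM2l.
    by rewrite mulrDl mul1r expr2 mulrA mulVf ?mul1r// gt_eqF.
  apply: le_trans (lerD (lexx _) q4) _.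
  have q5 : del ^+ 2 <= del by rewrite expr2 ler_piMr// ltW.
  move: dK; rewrite /K exprMn; lra.
have X2 : nr (I s0 f - I s1 f) <= e * F + eta / 2.
  by apply: ler_sqrtD X1 => //; rewrite ?mulr_ge0 ?nrmc_ge0// ltW.
have X3 : nr (I s1 f - E B g) <= eta / 2.
  have := E_I_indic mB (s n) Hf; rewrite -/s1 => e1.
  have -> : I s1 f - E B g = (I s1 f - E B (I (s n) f)) + (E B (I (s n) f) - E B g).
    by rewrite addrA subrK.
  apply: le_trans (nrmcD (L2cB HI1 HEI) (L2cB HEI HEg)) _.
  rewrite (eqL2_sym HEI HI1 e1) add0r.
  exact: le_trans (nr_E_sub mB HIn Hg) z1.
have -> : I s0 f - E B g = (I s0 f - I s1 f) + (I s1 f - E B g) by rewrite addrA subrK.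
apply: le_trans (nrmcD (L2cB HI0 HI1) (L2cB HI1 HEg)) _.
rewrite -/F; lra.
Qed.

(** Composition of a bounded theta(A) with a possibly unbounded psi(A). Part (ii) uses it with psi =
    (1 + s)^a and theta = (1 + s)^(b - a). *)
Lemma spectral_integral_mul psi theta f g g' :
  spectral_integral mu E psi f g -> measurable_fun [set: R] psi -> L2 f ->
  FC theta g g' -> spectral_integral mu E (fun t => theta t * psi t) f g'.
Proof.
move=> HS mpsi Hf [bt Hg Hg' Hgg']; have [_ [s [H1 H2]]] := spectral_integral_num Hf HS.
have [mt [M HM]] := bt.
have M0 : 0 <= M by apply: le_trans (HM 0).
split; [exact/memL2P|exact/memL2P|].
have ep n : 0 < n.+1%:R^-1 :> R by rewrite invr_gt0.
have /choice[th Hth] : forall n, exists s : {sfun R >-> R}, forall t, `|s t - theta t| <= n.+1%:R^-1.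
  by move=> n; exact: uniform_simple mt HM (ep n).
have thM n t : `|th n t| <= M + 1.
  rewrite -[th n t](subrK (theta t)) (le_trans (ler_normD _ _))// addrC lerD//.
  by rewrite (le_trans (Hth n t))// invf_le1// ler1n.
have M1 : 0 <= M + 1 by rewrite addr_ge0.
exists (num Hf), (fun n => th n * s n); split=> //.
- move: H1 => /fine_cvgP[[N0 _ HN0] H1].
  pose G := nr g + 1.
  have [N1 HN1] := cvg0_ge H2 (ltr01 : 0 < 1 :> R).
  have bnd n : (N0 <= n)%N -> (N1 <= n)%N ->
      (\int[num Hf]_t (((th n * s n) t - theta t * psi t) ^+ 2)%:E <=
       (2 * n.+1%:R^-1 * G ^+ 2 + 2 * M ^+ 2 * fine (\int[num Hf]_t ((s n t - psi t) ^+ 2)%:E)%E)%:E)%E.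
    move=> nN0 nN1.
    have mm : measurable_fun [set: R] (fun t => ((s n t - psi t) ^+ 2)%:E).
      by apply/measurable_EFinP; apply: measurable_funX; apply: measurable_funB.
    have mm' : measurable_fun [set: measurableTypeR R] (fun t => ((s n t - psi t) ^+ 2)%:E) by exact: mm.
    have mml : measurable_fun [set: R] (fun t => (((th n * s n) t - theta t * psi t) ^+ 2)%:E).
      apply/measurable_EFinP; apply: measurable_funX; apply: measurable_funB => //.
      exact: measurable_funM.
    have ms : measurable_fun [set: R] (fun t => (s n t ^+ 2)%:E).
      by apply/measurable_EFinP; apply: measurable_funX.
    have ms' : measurable_fun [set: measurableTypeR R] (fun t => (s n t ^+ 2)%:E) by exact: ms.
    apply: (@le_trans _ _ (\int[num Hf]_t
      ((2 * n.+1%:R^-1)%:E * (s n t ^+ 2)%:E + (2 * M ^+ 2)%:E * ((s n t - psi t) ^+ 2)%:E))%E).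
      apply: ge0_le_integral => //.
      - by move=> t _; rewrite lee_fin sqr_ge0.
      - by apply: emeasurable_funD => //; apply: measurable_funeM.
      - move=> t _; rewrite -!EFinM -EFinD lee_fin sfunM /=.
        (* The first product is small because s n stays bounded, by G, in L2 of the spectral
           measure; the second because s n tends to psi there and theta is bounded. *)
        have -> : th n t * s n t - theta t * psi t =
            (th n t - theta t) * s n t + theta t * (s n t - psi t) by ring.
        set a := th n t - theta t; set b := s n t; set c := s n t - psi t.
        have a2 : a ^+ 2 <= n.+1%:R^-1.
          rewrite -(real_normK (num_real _)) expr2 -[leRHS]mulr1 ler_pM ?Hth//.
          by rewrite (le_trans (Hth n t))// invf_le1// ler1n.
        have t2 : theta t ^+ 2 <= M ^+ 2 by rewrite -(real_normK (num_real _)) lerXn2r ?nnegrE.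
        have h1 : (a * b + theta t * c) ^+ 2 <= 2 * (a ^+ 2 * b ^+ 2) + 2 * (theta t ^+ 2 * c ^+ 2).
          by have := sqr_ge0 (a * b - theta t * c); lra.
        apply: le_trans h1 _.
        have u1 := ler_wpM2r (sqr_ge0 b) a2; have u2 := ler_wpM2r (sqr_ge0 c) t2.
        by apply: lerD; rewrite -[leRHS]mulrA ler_pM2l.
    rewrite ge0_integralD//; last first.
    + exact: measurable_funeM.
    + by move=> t _; rewrite -EFinM lee_fin mulr_ge0 ?sqr_ge0// mulr_ge0 ?sqr_ge0.
    + exact: measurable_funeM.
    + by move=> t _; rewrite -EFinM lee_fin mulr_ge0 ?sqr_ge0// mulr_ge0.
    rewrite !ge0_integralZl_EFin//; try (by move=> t _; rewrite lee_fin sqr_ge0);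
      try by rewrite ?mulr_ge0 ?sqr_ge0.
    rewrite Nint_EFin; last by apply: bddM; exact: bdd_sfun.
    rewrite -(nr_I (s n) Hf).
    rewrite -[X in (_ + _ * X)%E](fineK (HN0 n nN0)) -!EFinM -EFinD lee_fin lerD2r.
    rewrite ler_wpM2l ?mulr_ge0// lerXn2r ?nnegrE ?nrmc_ge0 ?addr_ge0 ?nrmc_ge0//.
    have HIn := I_L2 (s n) Hf.
    have := HN1 n nN1; rewrite ger0_norm ?nrmc_ge0// => h1.
    have := nrmcD (L2cB HIn Hg) Hg; rewrite subrK /G; lra.
  have rhs0 : 2 * n.+1%:R^-1 * G ^+ 2 + 2 * M ^+ 2 * fine (\int[num Hf]_t ((s n t - psi t) ^+ 2)%:E)%E
      @[n --> \oo] --> (0 : R).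
    rewrite -[X in _ --> X](addr0 0); apply: cvgD.
      rewrite -[X in _ --> X](mul0r (G ^+ 2)); apply: cvgM; last exact: cvg_cst.
      rewrite -[X in _ --> X](mulr0 2); apply: cvgM; first exact: cvg_cst.
      exact: cvg_harmonic.
    rewrite -[X in _ --> X](mulr0 (2 * M ^+ 2)); apply: cvgM => //; exact: cvg_cst.
  apply: (squeeze_cvge _ (cvg_cst 0%E)
    (_ : (fun n => (2 * n.+1%:R^-1 * G ^+ 2 + 2 * M ^+ 2 *
        fine (\int[num Hf]_t ((s n t - psi t) ^+ 2)%:E)%E)%:E) @ \oo --> 0%E)).
  + exists (maxn N0 N1) => // n /=; rewrite geq_max => /andP[n0 n1].
    by rewrite bnd// andbT integral_ge0// => t _; rewrite lee_fin sqr_ge0.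
  + by apply/fine_cvgP; split => //; exact: nearW.
- apply/cvgL2P => //; first by move=> n; exact: I_L2.
  apply: (@squeeze_cvgr _ _ _ _ (fun=> 0)
    (fun n => (M + 1) * nr (I (s n) f - g) + n.+1%:R^-1 * nr g)).
  + apply: nearW => n; rewrite nrmc_ge0 /=.
    have HIn := I_L2 (s n) Hf; have HIm := I_L2 (th n * s n) Hf.
    have HII := I_L2 (th n) HIn; have HIg := I_L2 (th n) Hg.
    have -> : I (th n * s n) f - g' = (I (th n * s n) f - I (th n) (I (s n) f)) +
       ((I (th n) (I (s n) f) - I (th n) g) + (I (th n) g - g')).
      by rewrite !addrA subrK subrK.
    apply: le_trans (nrmcD (L2cB HIm HII) (L2cD (L2cB HII HIg) (L2cB HIg Hg'))) _.
    rewrite (eqL2_sym HII HIm (I_M _ _ Hf)) add0r.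
    apply: le_trans (nrmcD (L2cB HII HIg) (L2cB HIg Hg')) _.
    by apply: lerD; [exact: nr_I_sub|exact: Hgg'].
  + exact: cvg_cst.
  + rewrite -[X in _ --> X](addr0 0); apply: cvgD.
      by rewrite -[X in _ --> X](mulr0 (M + 1)); apply: cvgM => //; exact: cvg_cst.
    rewrite -[X in _ --> X](mul0r (nr g)); apply: cvgM; last exact: cvg_cst.
    exact: cvg_harmonic.
Qed.

Lemma E_range_fix (h : R -> R) (B : set R) f g : FC h f g -> measurable B ->
  eqL2 mu (E B f) f -> eqL2 mu (E B g) g.
Proof.
move=> [bh Hf Hg Hfg] mB fB; have [mh [M HM]] := bh.
have HEf := E_L2 mB Hf; have HEg := E_L2 mB Hg.
apply: (@eq0_small _ _ (2 * nr f)) => e e0; rewrite ger0_norm ?nrmc_ge0//.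
have [s Hs] := uniform_simple mh HM e0.
have h1 := Hfg _ _ Hs; have HI := I_L2 s Hf; have HEI := E_L2 mB HI; have HIE := I_L2 s HEf.
have [_ [Ms HMs]] := bdd_sfun s.
have Ms0 : 0 <= Ms by apply: le_trans (HMs 0).
have h2 : nr (E B (I s f) - I s f) = 0.
  apply: (@eqL2_trans _ _ _ _ _ (I s (E B f))) => //; first exact: E_I_eq.
  apply/eqP; rewrite eq_le nrmc_ge0 andbT.
  by apply: le_trans (nr_I_sub HEf Hf Ms0 HMs) _; rewrite fB mulr0.
have -> : E B g - g = (E B g - E B (I s f)) + ((E B (I s f) - I s f) + (I s f - g)).
  by rewrite !addrA subrK subrK.
apply: le_trans (nrmcD (L2cB HEg HEI) (L2cD (L2cB HEI HI) (L2cB HI Hg))) _.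
have h3 := nr_E_sub mB Hg HI; have h4 := nrmcD (L2cB HEI HI) (L2cB HI Hg).
have h5 : nr (g - I s f) = nr (I s f - g) by rewrite -(nrmcN (L2cB HI Hg)) opprB.
lra.
Qed.

(** On this range A is the bounded multiplier t cut to the interval, which preserves the range. The
    last clause, symmetry against the whole domain of A, is what later yields the weak equation
    linking g to W g. *)
Lemma bounded_on_range (A : operator T R) (s : R) g :
  (forall f g, A f g <-> spectral_integral mu E id f g) -> 0 < s ->
  L2 g -> eqL2 mu (E `[0, s[%classic g) g ->
  exists h, [/\ A g h, L2 h, eqL2 mu (E `[0, s[%classic h) h, nr h <= s * nr g &
    forall f a, A f a -> ip h f = ip g a].
Proof.
move=> HA s0 Hg gV; set B : set R := `[0, s[%classic in gV *.
have mB : measurable B by exact: measurable_itv.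
have bid : bdd (fun t => t * \1_B t).
  split; first by apply: measurable_funM => //; exact: measurable_indic.
  exists s => t; rewrite indicE; have [|tB] := boolP (t \in B); last by rewrite mulr0 normr0 ltW.
  by rewrite inE /B /= in_itv/= mulr1 => /andP[t0 ts]; rewrite ger0_norm// ltW.
have inB t : B t -> t * \1_B t = t by move=> Bt; rewrite indicE mem_set// mulr1.
have [h Hh] := FC_exists bid Hg.
have HL2h : L2 h by case: Hh.
have Bb t : B t -> `|t * \1_B t| <= s.
  move=> Bt; rewrite inB//; move: Bt; rewrite /B /= in_itv/= => /andP[t0 ts].
  by rewrite ger0_norm// ltW.
have HEg := E_L2 mB Hg; have HEh := E_L2 mB HL2h.
have hV := E_range_fix Hh mB gV.
have mBc : measurable (~` B) by exact: measurableC.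
exists h; split => //.
- apply/HA; apply: (FC_spectral Hh mB) => //.
    have HEc := E_L2 mBc Hg.
    rewrite ipcC -(ipc_eq HEg Hg HEc gV) (E_setI mB mBc Hg Hg).
    by rewrite setICr E_set0_ip.
  by move=> t Bt; rewrite inB.
- rewrite -(nrmc_eq HEh HL2h hV) -(nrmc_eq HEg Hg gV).
  by apply: FC_E Hh mB (ltW s0) Bb.
- move=> f a /HA HS.
  have [/memL2P Hf /memL2P Ha _] := HS.
  have FCf : FC (fun t => t * \1_B t) f (E B a).
    apply: spectral_integral_E HS _ Hf mB bid _ _ => //.
    by move=> t Bt; rewrite indicE memNset// mulr0.
  rewrite (FC_ip Hh FCf) -E_sym//; apply: ipc_eq => //.
Qed.

End SpectralCalculus.

(** * From the dyadic kernel bound to Lp-Lq multipliers *)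

Section Geometric.
Context (R : realType).

(** The terms counted form a geometric progression, dominated by its largest term, hence by y, up to
    the factor rho / (rho - 1). *)
Lemma geometric_low (rho y : R) (J : nat) : 1 < rho -> 0 <= y ->
  \sum_(j < J) rho ^+ j * (rho ^+ j < y)%R%:R <= y * (rho / (rho - 1)).
Proof.
move=> r1 y0; have r0 : 0 < rho by apply: lt_trans r1.
have rm : 0 < rho - 1 by rewrite subr_gt0.
have full n : \sum_(j < n) rho ^+ j <= rho ^+ n / (rho - 1).
  rewrite ler_pdivlMr// mulrC -subrX1 gerBl//.
elim: J => [|J IH]; first by rewrite big_ord0 mulr_ge0// divr_ge0// ltW.
have [Jy|Jy] := ltP (rho ^+ J) y; last first.
  by rewrite big_ord_recr /= (le_gtF Jy) mulr0 addr0.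
apply: (@le_trans _ _ (\sum_(j < J.+1) rho ^+ j)).
  apply: ler_sum => j _; rewrite ler_piMr ?exprn_ge0 ?(ltW r0)//.
  by case: (_ < y)%R.
apply: le_trans (full _) _; rewrite exprSr -mulrA.
by rewrite ler_wpM2r ?divr_ge0 ?(ltW r0) ?(ltW rm)// ltW.
Qed.

Lemma geometric_high (rho y : R) (J : nat) : 1 < rho -> 0 < y ->
  \sum_(j < J) rho^-1 ^+ j * (y <= rho ^+ j)%R%:R <= y^-1 * (rho / (rho - 1)).
Proof.
move=> r1; have r0 : 0 < rho by apply: lt_trans r1.
have rm : 0 < rho - 1 by rewrite subr_gt0.
elim: J y => [|J IH] y y0.
  by rewrite big_ord0 mulr_ge0 ?divr_ge0 ?invr_ge0// ltW.
have [y1|y1] := leP y 1; last first.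
  rewrite big_ord_recl /= expr0 (lt_geF y1) mulr0 add0r.
  (* For y > 1 the term j = 0 is absent, and factoring out 1 / rho turns the rest into the same sum
     for y / rho. *)
  have yr : 0 < y / rho by rewrite divr_gt0.
  have -> : \sum_(i < J) rho^-1 ^+ bump 0 i * (y <= rho ^+ bump 0 i)%R%:R =
      rho^-1 * \sum_(i < J) rho^-1 ^+ i * (y / rho <= rho ^+ i)%R%:R.
    rewrite mulr_sumr; apply: eq_bigr => i _.
    by rewrite /bump /= add1n exprS -mulrA ler_pdivrMr// -exprSr.
  apply: (@le_trans _ _ (rho^-1 * ((y / rho)^-1 * (rho / (rho - 1))))).
    by rewrite ler_pM2l ?invr_gt0//; exact: IH.
  rewrite le_eqVlt; apply/orP; left; apply/eqP; field.
  by rewrite !gt_eqF.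
apply: (@le_trans _ _ (\sum_(j < J.+1) rho^-1 ^+ j)).
  apply: ler_sum => j _; rewrite ler_piMr ?exprn_ge0 ?invr_ge0 ?(ltW r0)//.
  by case: (y <= _)%R.
apply: (@le_trans _ _ (rho / (rho - 1))).
  have -> : rho / (rho - 1) = (1 - rho^-1)^-1 by field; rewrite gt_eqF// gt_eqF.
  have i1 : 0 < 1 - rho^-1 by rewrite subr_gt0 invf_lt1.
  rewrite -[leRHS]mul1r ler_pdivlMr// mulrC -opprB mulNr -subrX1 opprB gerBl.
  by rewrite exprn_ge0// invr_ge0 ltW.
rewrite -[leLHS]mul1r ler_wpM2r ?divr_ge0 ?(ltW r0) ?(ltW rm)//.
by rewrite invf_ge1.
Qed.

Lemma powR_expn (b r : R) n : 0 <= b -> (b `^ r) ^+ n = (b ^+ n) `^ r.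
Proof.
move=> b0; rewrite -(powR_mulrn n (powR_ge0 b r)) -(powR_mulrn n b0).
by rewrite -(powRrM b r n%:R) -(powRrM b n%:R r) mulrC.
Qed.

Lemma powR_gt1 (b r : R) : 1 < b -> 0 < r -> 1 < b `^ r.
Proof.
move=> b1 r0; have -> : 1 = 1 `^ r :> R by rewrite powR1.
by apply: gt0_ltr_powR => //; rewrite nnegrE// ltW// (lt_trans _ b1).
Qed.

Lemma powR_sub1 (m p : R) : 0 < m -> m * m `^ (p - 1) = m `^ p.
Proof.
move=> m0; have := @powRD _ m 1 (p - 1); rewrite (gt_eqF m0) implybT => /(_ isT).
by rewrite (powRr1 (ltW m0)) => <-; congr (m `^ _); ring.
Qed.

Lemma powR_sub2 (m p : R) : 0 < m -> m ^+ 2 * (m `^ (2 - p))^-1 = m `^ p.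
Proof.
move=> m0; have := @powRD _ m 2 (- (2 - p)); rewrite (gt_eqF m0) implybT => /(_ isT).
by rewrite powRN (powR_mulrn 2 (ltW m0)) => <-; congr (m `^ _); ring.
Qed.

(* Summing over the dyadic heights beta^j, only a geometric series up to (resp. beyond) the
   height m survives. *)
Lemma dyadic_height_sum (p C m beta r1 r2 : R) (J : nat) :
  1 < p -> p < 2 -> 0 <= C -> 0 <= m ->
  beta = 8 `^ p^-1 -> r1 = beta `^ (p - 1) -> r2 = beta `^ (2 - p) ->
  \sum_(j < J) (2 * C * r1 ^+ j * (m * (beta ^+ j < m)%R%:R)
     + 2 * r2^-1 ^+ j * (m ^+ 2 * (m <= beta ^+ j)%R%:R)) <=
  (2 * C * (r1 / (r1 - 1)) + 2 * (r2 / (r2 - 1))) * m `^ p.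
Proof.
move=> p1 p2 C0 mm betaE r1E r2E; move: mm; rewrite le_eqVlt => /predU1P[<-|m0].
  rewrite powR0; last by rewrite gt_eqF// (lt_trans _ p1).
  rewrite mulr0 big1// => j _; rewrite expr0n !mul0r !mulr0 addr0//.
have b0 : 0 < beta by rewrite betaE powR_gt0.
have p0 : 0 < p by rewrite (lt_trans _ p1).
have b1 : 1 < beta.
  by rewrite betaE powR_gt1 ?invr_gt0//; lra.
have pow1 r : 0 < r -> 1 < beta `^ r.
  exact: powR_gt1.
have r1g : 1 < r1 by rewrite r1E; apply: pow1; rewrite subr_gt0.
have r2g : 1 < r2 by rewrite r2E; apply: pow1; rewrite subr_gt0.
have h1 j : (beta ^+ j < m) = (r1 ^+ j < m `^ (p - 1)).
  rewrite r1E (powR_expn _ _ (ltW b0)); apply/idP/idP => H.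
    by rewrite gt0_ltr_powR ?subr_gt0// nnegrE ?exprn_ge0// ltW.
  rewrite ltNge; apply/negP => H'; move: H; rewrite ltNge => /negP; apply.
  by rewrite ge0_ler_powR ?subr_ge0 ?(ltW p1)// nnegrE ?exprn_ge0// ltW.
have h2 j : (m <= beta ^+ j) = (m `^ (2 - p) <= r2 ^+ j).
  rewrite r2E (powR_expn _ _ (ltW b0)); apply/idP/idP => H.
    by rewrite ge0_ler_powR ?subr_ge0 ?(ltW p2)// nnegrE ?exprn_ge0// ltW.
  rewrite leNgt; apply/negP => H'; move: H; rewrite leNgt => /negP; apply.
  by rewrite gt0_ltr_powR ?subr_gt0// nnegrE ?exprn_ge0// ltW.
rewrite big_split /= [leRHS]mulrDl; apply: lerD.
  rewrite (eq_bigr (fun j : 'I_J => 2 * C * m * (r1 ^+ j * (r1 ^+ j < m `^ (p - 1))%R%:R))).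
    rewrite -mulr_sumr -[in leRHS](powR_sub1 _ m0).
    have := geometric_low J r1g (powR_ge0 m (p - 1)).
    move=> /(ler_wpM2l (mulr_ge0 (mulr_ge0 (ler0n R 2) C0) (ltW m0))) H.
    by apply: le_trans H _; rewrite le_eqVlt; apply/orP; left; apply/eqP; ring.
  by move=> j _; rewrite h1; ring.
rewrite (eq_bigr (fun j : 'I_J => 2 * m ^+ 2 * (r2^-1 ^+ j * (m `^ (2 - p) <= r2 ^+ j)%R%:R))).
  rewrite -mulr_sumr -[in leRHS](powR_sub2 _ m0).
  have := geometric_high J r2g (powR_gt0 (2 - p) m0).
  move=> /(ler_wpM2l (mulr_ge0 (ler0n R 2) (sqr_ge0 m))) H.
  by apply: le_trans H _; rewrite le_eqVlt; apply/orP; left; apply/eqP; ring.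
by move=> j _; rewrite h2; ring.
Qed.

End Geometric.

(** * Lp norms and duality *)

Section LpNorms.
Context (d : measure_display) (T : measurableType d) (R : realType).
Context (mu : {measure set T -> \bar R}).
Local Notation nm f := (fun x => ComplexField.Normc.normc (f x)).

Lemma cLnorm_powR (p : R) (f : T -> R[i]) : 0 < p ->
  ((cLnorm mu p f) `^ p = \int[mu]_x (nm f x `^ p)%:E)%E.
Proof.
move=> p0; rewrite /cLnorm (@poweR_Lnorm _ _ _ mu _ p (lt0r_neq0 p0)); apply: eq_integral => x _.
by rewrite /= ger0_norm ?normc_nneg.
Qed.

Lemma measurable_nm_powR (p : R) (f : T -> R[i]) : cmeasurable f ->
  measurable_fun [set: T] (fun x => nm f x `^ p).
Proof. by move=> mf; exact: measurableT_comp (measurable_powR _) (measurable_normc mf). Qed.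

Lemma memL_integrable (p : R) f : 0 < p -> memL mu p f ->
  mu.-integrable [set: T] (EFin \o (fun x => nm f x `^ p)).
Proof.
move=> p0 [mf fi]; apply/integrableP; split.
  by apply/measurable_EFinP; exact: measurable_nm_powR.
under eq_integral => x _ do rewrite /= ger0_norm ?powR_ge0//.
by rewrite -cLnorm_powR//; exact: poweR_lty.
Qed.

Lemma memL_fine (p : R) f : 0 < p -> memL mu p f ->
  fine (cLnorm mu p f) `^ p = \int[mu]_x (nm f x `^ p).
Proof.
move=> p0 Hf; have [mf fi] := Hf.
rewrite /Rintegral -cLnorm_powR// -[in RHS](@fineK _ (cLnorm mu p f)) ?poweR_EFin//.
by rewrite ge0_fin_numE//; exact: Lnorm_ge0.
Qed.

Lemma integrable_memL (p : R) f : 0 < p -> cmeasurable f ->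
  mu.-integrable [set: T] (EFin \o (fun x => nm f x `^ p)) -> memL mu p f.
Proof.
move=> p0 mf fi; split => //; apply: (@lty_poweRy _ _ p); first by rewrite gt_eqF.
rewrite cLnorm_powR//; exact: integrable_lty fi.
Qed.

Lemma cLnorm_ge0 (p : R) (f : T -> R[i]) : (0 <= cLnorm mu p f)%E.
Proof. exact: Lnorm_ge0. Qed.

Lemma normc_realM (k : R) (z : R[i]) : 0 <= k ->
  ComplexField.Normc.normc (k%:C%C * z) = k * ComplexField.Normc.normc z.
Proof.
move=> k0; rewrite !normcE /nsq; case: z => a b /=.
rewrite !mul0r subr0 addr0 !exprMn -mulrDr sqrtrM ?sqr_ge0//.
by rewrite sqrtr_sqr ger0_norm.
Qed.

(** The test function is the extremal |g|^(q - 2) g of Hoelder's inequality, cut to the set where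
    |g| <= n. Since q >= 2, the factor is bounded there and the test function stays in L2; monotone
    convergence removes the cut. *)
Lemma Lq_dual (q K : R) g : 2 <= q -> L2c mu g -> 0 <= K ->
  (forall f, L2c mu f -> memL mu (q / (q - 1)) f ->
    ipc mu g f <= K * fine (cLnorm mu (q / (q - 1)) f)) ->
  (cLnorm mu q g <= K%:E)%E.
Proof.
move=> q2 Hg K0 H.
have q0 : 0 < q by rewrite (lt_le_trans _ q2).
have q1 : 0 < q - 1 by lra.
set q' := q / (q - 1) in H.
have q'0 : 0 < q' by rewrite divr_gt0.
have [mg ig] := (L2cP mu g).1 Hg.
pose m x := nm g x; pose c n x : R := (m x <= n%:R)%R%:R.
have m0 x : 0 <= m x by exact: normc_nneg.
have mm : measurable_fun [set: T] m by exact: measurable_normc.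
have mc n : measurable_fun [set: T] (c n).
  rewrite [X in measurable_fun _ X](_ : _ = \1_[set x | m x <= n%:R]).
    apply: measurable_indic; rewrite -[X in measurable X]setTI.
    rewrite (_ : [set x | _] = m @^-1` `]-oo, n%:R]); last by apply/seteqP; split => x /=; rewrite in_itv.
    by apply: mm => //; exact: measurable_itv.
  apply/funext => x; rewrite indicE /c; congr (nat_of_bool _)%:R.
  by apply/idP/idP; rewrite inE.
pose k n x := m x `^ (q - 2) * c n x.
have k0 n x : 0 <= k n x by rewrite mulr_ge0 ?powR_ge0// /c ler0n.
have mk n : measurable_fun [set: T] (k n).
  by apply: measurable_funM => //; exact: measurable_nm_powR.
have kn n x : k n x <= n%:R `^ (q - 2).
  rewrite /k /c; case: (leP (m x) n%:R) => mn; last by rewrite mulr0 powR_ge0.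
  by rewrite mulr1 ge0_ler_powR ?nnegrE ?ler0n//; lra.
pose F n x : R[i] := (k n x)%:C%C * g x.
have ReF n x : complex.Re (F n x) = k n x * complex.Re (g x).
  by rewrite /F; case: (g x) => a b /=; rewrite mul0r subr0.
have ImF n x : complex.Im (F n x) = k n x * complex.Im (g x).
  by rewrite /F; case: (g x) => a b /=; rewrite mul0r addr0.
have mF n : cmeasurable (F n).
  by split; [under eq_fun do rewrite ReF|under eq_fun do rewrite ImF];
     apply: measurable_funM => //; case: mg.
have LF n : L2c mu (F n).
  have [a b] := L2cZ (n%:R `^ (q - 2)) Hg.
  split; [apply: L2r_le a|apply: L2r_le b]; try by case: (mF n).
    by move=> x; rewrite ReF Re_scr (normrM (k n x)) (normrM (n%:R `^ _)) (ger0_norm (k0 n x)) (ger0_norm (powR_ge0 _ _)) ler_wpM2r.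
  by move=> x; rewrite ImF Im_scr (normrM (k n x)) (normrM (n%:R `^ _)) (ger0_norm (k0 n x)) (ger0_norm (powR_ge0 _ _)) ler_wpM2r.
pose h n x := m x `^ q * c n x.
have hE n x : h n x = k n x * nsq (g x).
  rewrite /h /k -normc_sq -/(m x); have [->|mx] := eqVneq (m x) 0.
    by rewrite powR0 ?gt_eqF// expr0n mulr0 mul0r.
  have mp : 0 < m x by rewrite lt_neqAle eq_sym mx m0.
  have -> : m x `^ q = m x `^ (q - 2) * m x ^+ 2.
    have := @powRD _ (m x) (q - 2) 2; rewrite (gt_eqF mp) implybT => /(_ isT).
    by rewrite (powR_mulrn 2 (ltW mp)) => <-; congr (_ `^ _); ring.
  by rewrite mulrAC.
have h0 n x : 0 <= h n x by rewrite hE mulr_ge0// nsq_ge0.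
have mh n : measurable_fun [set: T] (h n).
  by apply: measurable_funM => //; exact: measurable_nm_powR.
have ih n : mu.-integrable [set: T] (EFin \o h n).
  apply: le_integrable_real (integrableZ_real (n%:R `^ (q - 2)) ig) => // x.
  by rewrite ger0_norm// hE ler_wpM2r// nsq_ge0.
pose I n := \int[mu]_x h n x.
have I0 n : 0 <= I n by apply: Rintegral_ge0.
have ipF n : ipc mu g (F n) = I n.
  rewrite ipcE//; apply: eq_Rintegral => x _.
  by rewrite ReF ImF hE /nsq; ring.
have nmF n x : nm (F n) x `^ q' = h n x.
  rewrite /F normc_realM// -/(m x) /k /h /c.
  case: (leP (m x) n%:R) => mn; last by rewrite !mulr0 mul0r powR0// gt_eqF.
  rewrite !mulr1; have [->|mx] := eqVneq (m x) 0.
    by rewrite mulr0 !powR0// gt_eqF.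
  have mp : 0 < m x by rewrite lt_neqAle eq_sym mx m0.
  have -> : m x `^ (q - 2) * m x = m x `^ (q - 1).
    have := @powRD _ (m x) (q - 2) 1; rewrite (gt_eqF mp) implybT => /(_ isT).
    by rewrite (powRr1 (ltW mp)) => <-; congr (_ `^ _); ring.
  by rewrite -(powRrM (m x) (q - 1) q') /q' mulrC divfK// gt_eqF.
have memF n : memL mu q' (F n).
  apply: integrable_memL => //; rewrite (_ : (fun x => _) = h n)//.
  by apply/funext => x; exact: nmF.
have IK n : I n <= K `^ q.
  have [->|In] := eqVneq (I n) 0; first exact: powR_ge0.
  have Ip : 0 < I n by rewrite lt_neqAle eq_sym In I0.
  have := H _ (LF n) (memF n); rewrite ipF.
  have e1 : fine (cLnorm mu q' (F n)) = I n `^ q'^-1.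
    have := memL_fine q'0 (memF n).
    rewrite [RHS](_ : _ = I n); last by apply: eq_Rintegral => x _; exact: nmF.
    move=> <-; rewrite -(powRrM _ q' q'^-1) mulfV ?gt_eqF// powRr1//.
    by rewrite fine_ge0// cLnorm_ge0.
  rewrite e1 => H1.
  (* The second factor is the norm of the test function, so it cancels against the right-hand side
     of the hypothesis. *)
  have e2 : I n = I n `^ q^-1 * I n `^ q'^-1.
    have := @powRD _ (I n) q^-1 q'^-1; rewrite (gt_eqF Ip) implybT => /(_ isT) <-.
    rewrite -[LHS](powRr1 (ltW Ip)); congr (_ `^ _); rewrite /q' invf_div.
    by field; rewrite gt_eqF.
  have H2 : I n `^ q^-1 <= K.
    by rewrite -(@ler_pM2r _ (I n `^ q'^-1)) ?powR_gt0// -e2.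
  have -> : I n = (I n `^ q^-1) `^ q.
    by rewrite -(powRrM (I n) q^-1 q) mulVf ?gt_eqF// powRr1// ltW.
  by rewrite ge0_ler_powR ?(ltW q0)// nnegrE ?powR_ge0.
have lim : (\int[mu]_x (m x `^ q)%:E <= (K `^ q)%:E)%E.
  have nd x : {homo (fun n => (h n x)%:E) : n n' / (n <= n')%N >-> (n <= n')%E}.
    move=> n n' nn'; rewrite lee_fin /h ler_wpM2l ?powR_ge0// /c.
    case: (leP (m x) n%:R) => mn; last exact: ler0n.
    by rewrite (le_trans mn)// ler_nat.
  have cv : (\int[mu]_x (h n x)%:E)%E @[n --> \oo] --> (\int[mu]_x (m x `^ q)%:E)%E.
    have := @cvg_monotone_convergence _ _ _ mu setT measurableT (fun n x => (h n x)%:E).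
    move=> /(_ _ _ _)-/(_ _ _ _) H3.
    have -> : (\int[mu]_x (m x `^ q)%:E)%E = (\int[mu]_x limn (fun n => (h n x)%:E))%E.
      apply: eq_integral => x _; apply/esym/cvg_lim => //.
      apply: cvg_near_cst; exists (Num.truncn (m x)).+1 => // n /= xn.
      rewrite /h /c (_ : m x <= n%:R) ?mulr1//.
      by apply: (@le_trans _ _ (Num.truncn (m x)).+1%:R); rewrite ?ler_nat// ltW// truncnS_gt.
    apply: H3 => //.
    - by move=> n; apply/measurable_EFinP.
    - by move=> n x _; rewrite lee_fin.
  rewrite -(cvg_lim _ cv)//; apply: lime_le; first by apply/cvg_ex; eexists; exact: cv.
  apply: nearW => n; rewrite -[leLHS]fineK; last exact: integrable_fin_num (ih n).
  by rewrite lee_fin; exact: IK.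
have e3 : (cLnorm mu q g = (\int[mu]_x (m x `^ q)%:E) `^ q^-1)%E.
  by rewrite -cLnorm_powR// -poweRrM mulfV ?gt_eqF// poweRe1// cLnorm_ge0.
have -> : K = (K `^ q) `^ q^-1.
  by rewrite -(powRrM K q q^-1) mulfV ?gt_eqF// powRr1.
rewrite e3 -poweR_EFin gt0_ler_poweR ?invr_ge0 ?(ltW q0)//.
  by rewrite in_itv /= leey andbT integral_ge0// => x _; rewrite lee_fin powR_ge0.
by rewrite in_itv /= leey andbT lee_fin powR_ge0.
Qed.

End LpNorms.

Section RealMultiplier.
Context (d : measure_display) (T : measurableType d) (R : realType).
Context (mu : {measure set T -> \bar R}).
Local Notation nm f := (fun x => ComplexField.Normc.normc (f x)).

Definition rmul (k : T -> R) (f : T -> R[i]) : T -> R[i] := fun x => (k x)%:C%C * f x.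

Lemma Re_rmul k f x : complex.Re (rmul k f x) = k x * complex.Re (f x).
Proof. by rewrite /rmul; case: (f x) => a b /=; rewrite mul0r subr0. Qed.

Lemma Im_rmul k f x : complex.Im (rmul k f x) = k x * complex.Im (f x).
Proof. by rewrite /rmul; case: (f x) => a b /=; rewrite mul0r addr0. Qed.

Lemma L2c_rmul (k : T -> R) f : measurable_fun [set: T] k -> (forall x, 0 <= k x <= 1) ->
  L2c mu f -> L2c mu (rmul k f).
Proof.
move=> mk k01 [a b].
have kn x (y : R) : `|k x * y| <= `|y|.
  rewrite normrM ler_piMl//; have /andP[k0 k1] := k01 x; by rewrite ger0_norm.
have [ma mb] := (L2r_measurable a, L2r_measurable b).
split; [apply: L2r_le a|apply: L2r_le b].
- by under eq_fun do rewrite Re_rmul; exact: measurable_funM.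
- by move=> x; rewrite Re_rmul.
- by under eq_fun do rewrite Im_rmul; exact: measurable_funM.
- by move=> x; rewrite Im_rmul.
Qed.

End RealMultiplier.

(** * Real interpolation over dyadic pieces of the spectrum *)

Section Interpolation.
Context (d : measure_display) (T : measurableType d) (R : realType).
Context (mu : {measure set T -> \bar R}).
Local Notation nm f := (fun x => ComplexField.Normc.normc (f x)).

Definition dyad (j : nat) : set R := `[2 ^+ j, 2 ^+ j.+1[%classic.

(** An L1 to L2 norm of order s^(3/2) below s reads, after squaring and with s of size 2^j, as 8^j.
    The first clause says that nothing of the spectrum lies in [0, 1[, so that the pieces with j >=
    0 suffice. *)
Definition kernel_bound (E : set R -> (T -> R[i]) -> T -> R[i]) (C : R) : Prop :=
  (forall f, L2c mu f -> ipc mu (E `[0, 1[%classic f) f = 0) /\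
  forall (j : nat) f, L2c mu f -> mu.-integrable [set: T] (EFin \o nm f) ->
    nrmc mu (E (dyad j) f) ^+ 2 <= C * 8 ^+ j * (\int[mu]_x nm f x) ^+ 2.

Lemma measurable_dyad j : measurable (dyad j).
Proof. exact: measurable_itv. Qed.

(** Completes the dyadic pieces to a countable partition of the line; the two pieces put in front
    shift the dyadic index by 2. *)
Definition dyadic_pieces (n : nat) : set R :=
  match n with
  | 0%N => `]-oo, 0[%classic | 1%N => `[0, 1[%classic | j.+2 => dyad j
  end.

Lemma measurable_pieces n : measurable (dyadic_pieces n).
Proof. by case: n => [|[|n]]; exact: measurable_itv. Qed.

Lemma dyadic_pieces_cover : \bigcup_n dyadic_pieces n = setT.
Proof.
apply/seteqP; split => // x _.
have [x0|x0] := ltP x 0; first by exists 0%N => //=; rewrite in_itv.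
have [x1|x1] := ltP x 1; first by exists 1%N => //=; rewrite in_itv /= x0 x1.
have ex : exists n, x < 2 ^+ n.
  exists (Num.truncn x).+1; apply: lt_trans (truncnS_gt x) _.
  by rewrite -natrX ltr_nat ltn_expl.
case: (ex_minnP ex) => -[|n] Hn Hmin; first by move: Hn; rewrite expr0 ltNge x1.
exists n.+2 => //=; rewrite /dyad /= in_itv /= Hn andbT leNgt.
by apply/negP => /Hmin; rewrite ltnn.
Qed.

Lemma dyadic_pieces_disjoint : trivIset setT dyadic_pieces.
Proof.
suff H i j : (i < j)%N -> dyadic_pieces i `&` dyadic_pieces j = set0.
  apply/trivIsetP => i j _ _; rewrite neq_ltn => /orP[|] ij; first exact: H.
  by rewrite setIC; exact: H.
move=> ij; rewrite -subset0 => x [].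
case: i j ij => [|[|i]] [|[|j]]//= ij; rewrite /dyad /= !in_itv/=.
- by move=> /lt_le_trans H /andP[/H]; rewrite ltxx.
- move=> x0 /andP[h _]; have := lt_le_trans x0 (le_trans (exprn_ge0 j (ler0n R 2)) h).
  by rewrite ltxx.
- move=> /andP[_ x1] /andP[h _].
  by have := lt_le_trans x1 (le_trans (exprn_ege1 j (ler1n R 2)) h); rewrite ltxx.
- move=> /andP[_ x1] /andP[h _].
  have H : 2 ^+ i.+1 <= 2 ^+ j :> R by rewrite ler_weXn2l ?ler1n.
  by have := lt_le_trans x1 (le_trans H h); rewrite ltxx.
Qed.

Lemma bessel E f J : spectral_measure mu E -> L2c mu f ->
  \sum_(j < J) nrmc mu (E (dyad j) f) ^+ 2 <= nrmc mu f ^+ 2.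
Proof.
move=> sE Hf.
have cv := E_bigcup_ip sE measurable_pieces dyadic_pieces_disjoint Hf Hf.
rewrite dyadic_pieces_cover (E_setT_ip sE Hf Hf) -nrmc_sqr in cv.
have nd : {homo (fun n => \sum_(k < n) ipc mu (E (dyadic_pieces k) f) f) :
    n m / (n <= m)%N >-> n <= m}.
  apply/nondecreasing_seqP => n; rewrite big_ord_recr /= lerDl.
  by apply: (E_ge0 sE) => //; exact: measurable_pieces.
have := nondecreasing_cvgn_le nd (cvgP _ cv) J.+2; rewrite (cvg_lim _ cv)//.
apply: le_trans; rewrite 2!big_ord_recl /= addrA.
rewrite (eq_bigr (fun j : 'I_J => ipc mu (E (dyad j) f) f)).
  by rewrite lerDr addr_ge0//; apply: (E_ge0 sE) => //; exact: measurable_itv.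
by move=> j _; apply: (nr_E_sqr sE) => //; exact: measurable_dyad.
Qed.

(** Interpolates between the L1 bound, growing like 8^j, and the L2 contraction. At level j the
    function is split at height beta^j with beta = 8^(1/p): the part above goes through
    [kernel_bound], the part below through [nr_E_le], and the moving height makes both contributions
    geometric in j. The normalisation of f is removed by scaling in [marcinkiewicz]. *)
Lemma marcinkiewicz_unit (p C : R) : 1 < p -> p <= 2 -> 0 <= C -> exists2 Cp : R, 0 < Cp &
  forall E f (J : nat), spectral_measure mu E -> kernel_bound E C -> L2c mu f ->
  mu.-integrable [set: T] (EFin \o (fun x => nm f x `^ p)) ->
  \int[mu]_x (nm f x `^ p) <= 1 ->
  \sum_(j < J) (8 `^ (1 - 2 / p)) ^+ j * nrmc mu (E (dyad j) f) ^+ 2 <= Cp.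
Proof.
move=> p1; rewrite le_eqVlt => /predU1P[->|p2] C0.
  (* At p = 2 the weights are 1 and the ratio of one of the geometric series degenerates to 1;
     orthogonality of the pieces takes over. *)
  exists 1 => // E f J sE _ Hf fi f1.
  rewrite divff// subrr powRr0.
  under eq_bigr do rewrite expr1n mul1r.
  apply: le_trans (bessel J sE Hf) _; apply: le_trans f1.
  rewrite nrmc_sqr ipcE//; apply: le_Rintegral => //.
    by have := L2c_integrable_nsq Hf; apply: eq_integrable.
  by move=> x _; rewrite powR_mulrn ?normc_nneg// normc_sq /nsq !expr2.
have p0 : 0 < p by rewrite (lt_trans _ p1).
pose beta := 8 `^ p^-1 : R; pose r1 := beta `^ (p - 1); pose r2 := beta `^ (2 - p).
have b0 : 0 < beta by exact: powR_gt0.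
have b1 : 1 < beta by apply: powR_gt1; rewrite ?invr_gt0//; lra.
have r1g : 1 < r1 by apply: powR_gt1 => //; rewrite subr_gt0.
have r2g : 1 < r2 by apply: powR_gt1 => //; rewrite subr_gt0.
pose Cp := 2 * C * (r1 / (r1 - 1)) + 2 * (r2 / (r2 - 1)).
have Cp0 : 0 < Cp.
  have q1 : 0 < r1 / (r1 - 1) by rewrite divr_gt0 ?subr_gt0 ?powR_gt0.
  have q2 : 0 < r2 / (r2 - 1) by rewrite divr_gt0 ?subr_gt0 ?powR_gt0.
  by have := mulr_ge0 C0 (ltW q1); rewrite /Cp -mulrA; lra.
exists Cp => // E f J sE [_ KB] Hf fi f1.
have r2E : r2^-1 = 8 `^ (1 - 2 / p).
  rewrite /r2 -powRN /beta -(powRrM 8 p^-1); congr (_ `^ _).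
  by field; rewrite gt_eqF.
rewrite -r2E.
pose m x := nm f x.
have m0 x : 0 <= m x by exact: normc_nneg.
have mf : cmeasurable f by case/L2cP : Hf.
have mm : measurable_fun [set: T] m by exact: measurable_normc.
have mlt (h : R) : measurable_fun [set: T] (fun x => (h < m x)%R%:R : R).
  rewrite [X in measurable_fun _ X](_ : _ = \1_[set x | h < m x]).
    apply: measurable_indic; rewrite -[X in measurable X]setTI.
    rewrite (_ : [set x | _] = m @^-1` `]h, +oo[%classic).
      by apply: mm => //; exact: measurable_itv.
    by apply/seteqP; split => x /=; rewrite in_itv /= andbT.
  apply/funext => x; rewrite indicE; congr (nat_of_bool _)%:R.
  by apply/idP/idP; rewrite inE.
have mle (h : R) : measurable_fun [set: T] (fun x => (m x <= h)%R%:R : R).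
  rewrite [X in measurable_fun _ X](_ : _ = fun x => 1 - (h < m x)%R%:R).
    by apply: measurable_funB.
  by apply/funext => x; case: leP; rewrite ?subr0 ?subrr.
have step j : r2^-1 ^+ j * nrmc mu (E (dyad j) f) ^+ 2 <=
   \int[mu]_x (2 * C * r1 ^+ j * (m x * (beta ^+ j < m x)%R%:R)
     + 2 * r2^-1 ^+ j * (m x ^+ 2 * (m x <= beta ^+ j)%R%:R)) /\
   mu.-integrable [set: T] (EFin \o (fun x => 2 * C * r1 ^+ j * (m x * (beta ^+ j < m x)%R%:R)
     + 2 * r2^-1 ^+ j * (m x ^+ 2 * (m x <= beta ^+ j)%R%:R))).
  pose h := beta ^+ j.
  have h0 : 0 < h by rewrite exprn_gt0.
  pose k1 x : R := (h < m x)%R%:R; pose k2 x : R := (m x <= h)%R%:R.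
  have H1 : L2c mu (rmul k1 f).
    apply: L2c_rmul => //; first exact: mlt.
    by move=> x; rewrite /k1; case: (h < m x)%R; rewrite ?lexx ?ler01.
  have H2 : L2c mu (rmul k2 f).
    apply: L2c_rmul => //; first exact: mle.
    by move=> x; rewrite /k2; case: (m x <= h)%R; rewrite ?lexx ?ler01.
  have fE : f = rmul k1 f + rmul k2 f.
    apply/funext => x; rewrite fctE /rmul /k1 /k2.
    by case: leP; rewrite ?mul0r ?mul1r ?addr0 ?add0r.
  have nm1 x : nm (rmul k1 f) x = m x * k1 x.
    by rewrite normc_realM 1?mulrC// /k1 ler0n.
  have le1 x : m x * k1 x <= h `^ (1 - p) * m x `^ p.
    rewrite /k1; case: (ltP h (m x)) => hm; last by rewrite mulr0 mulr_ge0 ?powR_ge0.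
    have mp : 0 < m x by exact: lt_trans h0 hm.
    rewrite mulr1 -(powR_sub1 p mp) mulrCA ler_peMr ?(ltW mp)//.
    have -> : 1 - p = - (p - 1) by ring.
    rewrite powRN mulrC ler_pdivlMr ?powR_gt0// mul1r.
    by rewrite ge0_ler_powR ?nnegrE ?(ltW h0) ?(ltW hm) ?subr_ge0 ?(ltW p1).
  have i1 : mu.-integrable [set: T] (EFin \o (fun x => m x * k1 x)).
    apply: le_integrable_real (integrableZ_real (h `^ (1 - p)) fi).
      by apply: measurable_funM => //; exact: mlt.
    by move=> x; rewrite ger0_norm ?mulr_ge0// ?ler0n.
  have i1' : mu.-integrable [set: T] (EFin \o nm (rmul k1 f)).
    by move: i1; apply: eq_integrable => // x _ /=; rewrite nm1.
  have i2 : mu.-integrable [set: T] (EFin \o (fun x => m x ^+ 2 * k2 x)).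
    have := L2c_integrable_nsq H2; apply: eq_integrable => // x _ /=.
    rewrite /nsq Re_rmul Im_rmul -[m x ^+ 2]/(ComplexField.Normc.normc (f x) ^+ 2) normc_sq /nsq /k2.
    by case: (m x <= h)%R; rewrite ?mul1r ?mulr1 ?mul0r ?mulr0 ?expr0n ?addr0.
  have IF : mu.-integrable [set: T] (EFin \o (fun x => 2 * C * r1 ^+ j * (m x * k1 x)
     + 2 * r2^-1 ^+ j * (m x ^+ 2 * k2 x))).
    by apply: integrableD_real; exact: integrableZ_real.
  split; last exact: IF.
  rewrite RintegralD//; try exact: integrableZ_real.
  rewrite !RintegralZl//.
  have mE := measurable_dyad j.
  have E1 := E_L2 sE mE H1; have E2 := E_L2 sE mE H2.
  have nE : nrmc mu (E (dyad j) f) <= nrmc mu (E (dyad j) (rmul k1 f)) + nrmc mu (rmul k2 f).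
    have e : eqL2 mu (E (dyad j) f) (E (dyad j) (rmul k1 f) + E (dyad j) (rmul k2 f)).
      apply: eqL2_ip => [||g Hg]; [exact: E_L2|exact: L2cD|].
      have Eg := E_L2 sE mE Hg.
      by rewrite ipcDl// !(E_sym sE)// {1}fE ipcDl.
    rewrite (nrmc_eq (E_L2 sE mE Hf) (L2cD E1 E2) e); apply: le_trans (nrmcD E1 E2) _.
    by rewrite lerD2l; exact: nr_E_le.
  have n2 : nrmc mu (rmul k2 f) ^+ 2 = \int[mu]_x (m x ^+ 2 * k2 x).
    rewrite nrmc_sqr ipcE//; apply: eq_Rintegral => x _.
    rewrite Re_rmul Im_rmul -[m x ^+ 2]/(ComplexField.Normc.normc (f x) ^+ 2) normc_sq /nsq /k2.
    by case: (m x <= h)%R; rewrite ?mul1r ?mulr1 ?mul0r ?mulr0 ?addr0 ?expr2.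
  have K1 := KB j _ H1 i1'.
  have I1E : \int[mu]_x nm (rmul k1 f) x = \int[mu]_x (m x * k1 x).
    by apply: eq_Rintegral => x _; exact: nm1.
  rewrite I1E in K1; set I1 := \int[mu]_x (m x * k1 x) in K1 *.
  have I10 : 0 <= I1 by apply: Rintegral_ge0 => x _; rewrite mulr_ge0// ler0n.
  (* Only one of the two factors I1 is estimated through the normalisation. The other stays an
     integral over the set above the height, so that the sum over j can be taken pointwise by
     [dyadic_height_sum]. *)
  have I1h : I1 <= h `^ (1 - p).
    apply: (@le_trans _ _ (\int[mu]_x (h `^ (1 - p) * m x `^ p))).
      by apply: le_Rintegral => //; exact: integrableZ_real.
    by rewrite RintegralZl// ger_pMr ?powR_gt0.
  have I1sq : I1 ^+ 2 <= h `^ (1 - p) * I1 by rewrite expr2 ler_wpM2r.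
  (* The exponents of 8 add up to (1 - 2/p) + 1 + (1 - p)/p = (p - 1)/p, which is the exponent in
     r1. *)
  have cf : r2^-1 ^+ j * (8 ^+ j * h `^ (1 - p)) = r1 ^+ j.
    rewrite /h -(powR_expn (1 - p) j (ltW b0)) -!exprMn; congr (_ ^+ _).
    have e8 : 8 = 8 `^ 1 :> R by rewrite powRr1.
    rewrite r2E /r1 /beta -(powRrM 8 p^-1 (1 - p)) -(powRrM 8 p^-1 (p - 1)) {2}e8.
    have n8 : (8 : R) != 0 by [].
    have := @powRD _ 8 1 (p^-1 * (1 - p)); rewrite n8 implybT => /(_ isT) <-.
    have := @powRD _ 8 (1 - 2 / p) (1 + p^-1 * (1 - p)); rewrite n8 implybT => /(_ isT) <-.
    by congr (_ `^ _); field; rewrite gt_eqF.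
  have w0 : 0 <= r2^-1 ^+ j by rewrite exprn_ge0// invr_ge0 powR_ge0.
  apply: (@le_trans _ _ (r2^-1 ^+ j * (2 * nrmc mu (E (dyad j) (rmul k1 f)) ^+ 2 +
      2 * nrmc mu (rmul k2 f) ^+ 2))).
    rewrite ler_wpM2l//; set a := nrmc mu _ in nE *; set b := nrmc mu (E _ (rmul _ _)) in nE *.
    set c := nrmc mu _ in nE *.
    have a0 : 0 <= a := nrmc_ge0 _ _.
    apply: (@le_trans _ _ ((b + c) ^+ 2)); first by rewrite lerXn2r ?nnegrE// (le_trans a0).
    by have := sqr_ge0 (b - c); lra.
  rewrite mulrDr; apply: lerD.
    apply: (@le_trans _ _ (r2^-1 ^+ j * (2 * (C * 8 ^+ j * (h `^ (1 - p) * I1))))).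
      rewrite ler_wpM2l// ler_pM2l//; apply: le_trans K1 _.
      by rewrite ler_wpM2l// mulr_ge0// exprn_ge0.
    rewrite -cf le_eqVlt; apply/orP; left; apply/eqP; ring.
  by rewrite n2 mulrA [r2^-1 ^+ j * 2]mulrC.
have Sint (n : nat) : mu.-integrable [set: T] (EFin \o (fun x => \sum_(j < n)
      (2 * C * r1 ^+ j * (m x * (beta ^+ j < m x)%R%:R)
     + 2 * r2^-1 ^+ j * (m x ^+ 2 * (m x <= beta ^+ j)%R%:R)))) /\
   \int[mu]_x (\sum_(j < n) (2 * C * r1 ^+ j * (m x * (beta ^+ j < m x)%R%:R)
     + 2 * r2^-1 ^+ j * (m x ^+ 2 * (m x <= beta ^+ j)%R%:R))) =
   \sum_(j < n) \int[mu]_x (2 * C * r1 ^+ j * (m x * (beta ^+ j < m x)%R%:R)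
     + 2 * r2^-1 ^+ j * (m x ^+ 2 * (m x <= beta ^+ j)%R%:R)).
  elim: n => [|n [IH1 IH2]].
    split; first by under eq_fun do rewrite big_ord0; exact: integrable0.
    by under eq_Rintegral do rewrite big_ord0; rewrite big_ord0 Rintegral_cst// mul0r.
  have [_ In] := step n.
  split; first by under eq_fun do rewrite big_ord_recr /=; exact: integrableD_real.
  under eq_Rintegral do rewrite big_ord_recr /=.
  by rewrite RintegralD// IH2 big_ord_recr.
apply: (@le_trans _ _ (\int[mu]_x (\sum_(j < J) (2 * C * r1 ^+ j * (m x * (beta ^+ j < m x)%R%:R)
     + 2 * r2^-1 ^+ j * (m x ^+ 2 * (m x <= beta ^+ j)%R%:R))))).
  by rewrite (Sint J).2; apply: ler_sum => j _; case: (step j).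
apply: (@le_trans _ _ (\int[mu]_x (Cp * m x `^ p))).
  apply: le_Rintegral => //; [exact: (Sint J).1|exact: integrableZ_real|].
  by move=> x _; apply: dyadic_height_sum.
by rewrite RintegralZl// ger_pMr.
Qed.

End Interpolation.

Section InterpolationTheorem.
Context (d : measure_display) (T : measurableType d) (R : realType).
Context (mu : {measure set T -> \bar R}).
Local Notation nm f := (fun x => ComplexField.Normc.normc (f x)).

Lemma nr_E_scr E (B : set R) (k : R) f : spectral_measure mu E -> measurable B -> L2c mu f ->
  nrmc mu (E B (scr k f)) = `|k| * nrmc mu (E B f).
Proof.
move=> sE mB Hf; have HE := E_L2 sE mB Hf; have Hk := L2cZ k Hf.
rewrite -nrmcZ//; apply: nrmc_eq; [exact: E_L2|exact: L2cZ|].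
apply: eqL2_ip => [||g Hg]; [exact: E_L2|exact: L2cZ|].
have HEg := E_L2 sE mB Hg.
by rewrite ipcZl// (E_sym sE)// ipcZl// (E_sym sE).
Qed.

Lemma marcinkiewicz (p C : R) : 1 < p -> p <= 2 -> 0 <= C -> exists2 Cp : R, 0 < Cp &
  forall E f (J : nat), spectral_measure mu E -> kernel_bound mu E C -> L2c mu f ->
  memL mu p f ->
  \sum_(j < J) (8 `^ (1 - 2 / p)) ^+ j * nrmc mu (E (dyad j) f) ^+ 2 <=
    Cp * fine (cLnorm mu p f) ^+ 2.
Proof.
move=> p1 p2 C0; have [Cp Cp0 H] := marcinkiewicz_unit mu p1 p2 C0.
have p0 : 0 < p by rewrite (lt_trans _ p1).
exists Cp => // E f J sE KB Hf fp.
set S := \sum_(j < J) _; set N := fine _.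
have N0 : 0 <= N by rewrite fine_ge0// cLnorm_ge0.
have NI := memL_fine p0 fp; rewrite -/N in NI.
have scale (k : R) : 0 < k -> k * N <= 1 -> k ^+ 2 * S <= Cp.
  move=> k0 kN; have Hk := L2cZ k Hf.
  have -> : k ^+ 2 * S = \sum_(j < J) (8 `^ (1 - 2 / p)) ^+ j * nrmc mu (E (dyad j) (scr k f)) ^+ 2.
    rewrite mulr_sumr; apply: eq_bigr => j _.
    rewrite nr_E_scr//; last exact: measurable_dyad.
    by rewrite exprMn (gtr0_norm k0) mulrCA.
  have nmk x : nm (scr k f) x `^ p = k `^ p * nm f x `^ p.
    by rewrite normc_realM ?(ltW k0)// powRM ?(ltW k0)// normc_nneg.
  apply: H => //.
    have := integrableZ_real (k `^ p) (memL_integrable p0 fp).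
    by apply: eq_integrable => // x _ /=; rewrite nmk.
  under eq_Rintegral do rewrite nmk.
  rewrite RintegralZl//; last exact: memL_integrable.
  rewrite -NI -powRM ?(ltW k0)//.
  have -> : 1 = 1 `^ p :> R by rewrite powR1.
  by rewrite ge0_ler_powR ?(ltW p0)// ?nnegrE ?mulr_ge0 ?(ltW k0).
(* If the norm vanishes every scale k is admissible, and S <= Cp / k^2 for all k. *)
have [NE|Nn] := eqVneq N 0.
  rewrite NE expr0n mulr0; apply: ler_addeps_all => e e0; rewrite add0r.
  have k0 : 0 < Num.sqrt (Cp / e) by rewrite sqrtr_gt0 divr_gt0.
  have := scale _ k0; rewrite NE mulr0 ler01 => /(_ isT).
  by rewrite (sqr_sqrtr (divr_ge0 (ltW Cp0) (ltW e0))) mulrAC ler_pdivrMr// ler_pM2l.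
have Np : 0 < N by rewrite lt_neqAle eq_sym Nn.
have iN : 0 < N^-1 by rewrite invr_gt0.
have := scale _ iN; rewrite mulVf// lexx => /(_ isT).
by rewrite exprVn mulrC ler_pdivrMr ?exprn_gt0.
Qed.

Lemma sum_cauchy_schwarz (J : nat) (x y : 'I_J -> R) :
  (\sum_j x j * y j) ^+ 2 <= (\sum_j x j ^+ 2) * (\sum_j y j ^+ 2).
Proof.
rewrite mulrC; apply: discriminant_le => [|t]; first by apply: sumr_ge0 => j _; exact: sqr_ge0.
have : 0 <= \sum_j (x j + t * y j) ^+ 2 by apply: sumr_ge0 => j _; exact: sqr_ge0.
rewrite (eq_bigr (fun j => y j ^+ 2 * t ^+ 2 + 2 * t * (x j * y j) + x j ^+ 2)); last by move=> j _; ring.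
rewrite !big_split /= -mulr_suml -mulr_sumr; lra.
Qed.

(** By duality, theta(A) f is paired piece by piece with f' in L^q'. Both p and q' are at most 2, so
    [marcinkiewicz] bounds the weighted square sums of f and of f', and Cauchy-Schwarz over the
    pieces joins them. *)
Theorem spectral_multiplier_bound (p q C : R) : 1 < p -> p <= 2 -> 2 <= q -> 0 <= C ->
  exists2 K : R, 0 < K &
  forall E, spectral_measure mu E -> kernel_bound mu E C ->
  forall theta f g (M : R), FC mu E theta f g -> (forall t, t < 0 -> theta t = 0) -> 0 <= M ->
  (forall t, 1 <= t -> `|theta t| * t `^ (3 * (p^-1 - q^-1)) <= M) ->
  memL mu p f -> (cLnorm mu q g <= (K * M * fine (cLnorm mu p f))%:E)%E.
Proof.
move=> p1 p2 q2 C0.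
have p0 : 0 < p by rewrite (lt_trans _ p1).
have q0 : 0 < q by rewrite (lt_le_trans _ q2).
have qm : 0 < q - 1 by lra.
pose q' := q / (q - 1).
have q'1 : 1 < q' by rewrite ltr_pdivlMr// mul1r; lra.
have q'2 : q' <= 2 by rewrite ler_pdivrMr//; lra.
have [Cp Cp0 Hp] := marcinkiewicz p1 p2 C0.
have [Cq Cq0 Hq] := marcinkiewicz q'1 q'2 C0.
have CC0 : 0 < Cp * Cq by rewrite mulr_gt0.
exists (Num.sqrt (Cp * Cq)); first by rewrite sqrtr_gt0.
move=> E sE KB theta f g M HFC th0 M0 thM fp.
have [_ Hf Hg _] := HFC.
set N := fine _; have N0 : 0 <= N by rewrite fine_ge0// cLnorm_ge0.
apply: Lq_dual => //; first by rewrite !mulr_ge0// sqrtr_ge0.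
rewrite -/q' => f' Hf' fq'.
set N' := fine _; have N'0 : 0 <= N' by rewrite fine_ge0// cLnorm_ge0.
have cv := E_bigcup_ip sE (@measurable_pieces R) (@dyadic_pieces_disjoint R) Hg Hf'.
rewrite dyadic_pieces_cover (E_setT_ip sE Hg Hf') in cv.
rewrite -(cvg_lim _ cv)//; apply: limr_le; first by apply/cvg_ex; eexists; exact: cv.
pose rho := 3 * (p^-1 - q^-1).
have pq : q^-1 <= p^-1 by rewrite lef_pV2 ?posrE//; lra.
have rho0 : 0 <= rho by rewrite mulr_ge0// subr_ge0.
exists 2%N => // n /= n2; rewrite -(subnK n2) addn2.
move: (n - 2)%N => J {n n2}.
rewrite 2!big_ord_recl /=.
have z0 : ipc mu (E `]-oo, 0[%classic g) f' = 0.
  have m0 : measurable (`]-oo, 0[%classic : set R) by exact: measurable_itv.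
  have HE := E_L2 sE m0 Hg.
  apply/eqP; rewrite -normr_le0; apply: le_trans (ipc_le HE Hf') _.
  have := FC_E sE HFC m0 (lexx 0).
  rewrite mul0r => H0; have {}H0 : nrmc mu (E `]-oo, 0[%classic g) <= 0.
    by apply: H0 => t /=; rewrite in_itv /= => /th0 ->; rewrite normr0.
  by have := ler_wpM2r (nrmc_ge0 mu f') H0; rewrite mul0r.
have z1 : ipc mu (E `[0, 1[%classic g) f' = 0.
  have m0 : measurable (`[0, 1[%classic : set R) by exact: measurable_itv.
  have HE := E_L2 sE m0 Hg.
  apply/eqP; rewrite -normr_le0; apply: le_trans (ipc_le HE Hf') _.
  have := nr_E_sqr sE m0 Hg; rewrite KB.1// => /eqP; rewrite sqrf_eq0 => /eqP ->.
  by rewrite mul0r.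
rewrite z0 z1 !add0r.
(* Square roots of the two interpolation weights. Their product is 8^(1/q - 1/p) = 2^(-rho), which
   matches the bound M 2^(-rho j) of theta on [dyad j]. *)
pose u := 8 `^ (2^-1 - p^-1) : R; pose v := 8 `^ (2^-1 - q'^-1) : R.
have n8 : (8 : R) != 0 by [].
have u2 : u ^+ 2 = 8 `^ (1 - 2 / p).
  rewrite /u -(powR_mulrn 2 (powR_ge0 _ _)) -(powRrM 8 _ 2); congr (_ `^ _).
  by field; rewrite gt_eqF.
have v2 : v ^+ 2 = 8 `^ (1 - 2 / q').
  rewrite /v -(powR_mulrn 2 (powR_ge0 _ _)) -(powRrM 8 _ 2); congr (_ `^ _).
  by field; rewrite gt_eqF// (lt_trans _ q'1).
have uv : u * v = (2 `^ rho)^-1.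
  have e8 : 8 = 2 `^ 3 :> R by rewrite powR_mulrn// -natrX.
  have := @powRD _ 8 (2^-1 - p^-1) (2^-1 - q'^-1); rewrite n8 implybT => /(_ isT) <-.
  rewrite -powRN e8 -(powRrM 2 3); congr (_ `^ _); rewrite /rho /q' invf_div.
  by field; rewrite !gt_eqF.
have pc j : `|ipc mu (E (dyad j) g) f'| <=
    M * ((u ^+ j * nrmc mu (E (dyad j) f)) * (v ^+ j * nrmc mu (E (dyad j) f'))).
  have mj := @measurable_dyad R j.
  have HEg := E_L2 sE mj Hg; have HEf' := E_L2 sE mj Hf'.
  rewrite -(E_ip sE mj Hg Hf'); apply: le_trans (ipc_le HEg HEf') _.
  have -> : M * ((u ^+ j * nrmc mu (E (dyad j) f)) * (v ^+ j * nrmc mu (E (dyad j) f'))) =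
     (M * (u * v) ^+ j * nrmc mu (E (dyad j) f)) * nrmc mu (E (dyad j) f').
    by rewrite exprMn; ring.
  rewrite ler_wpM2r ?nrmc_ge0//.
  have uv0 : 0 <= (u * v) ^+ j by rewrite exprn_ge0// mulr_ge0// powR_ge0.
  apply: (FC_E sE HFC mj); first by rewrite mulr_ge0.
  move=> t; rewrite /dyad /= in_itv /= => /andP[t1 _].
  have tp : 0 < t by apply: lt_le_trans t1; rewrite exprn_gt0.
  have t1' : 1 <= t by apply: le_trans t1; rewrite exprn_ege1// ler1n.
  have h1 := thM t t1'; rewrite -/rho in h1.
  rewrite uv exprVn (powR_expn _ _ (ler0n R 2)) ler_pdivlMr ?powR_gt0 ?exprn_gt0//.
  apply: le_trans h1; rewrite ler_wpM2l// ge0_ler_powR// nnegrE ?exprn_ge0//; exact: ltW.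
apply: (@le_trans _ _ (\sum_(j < J) M * ((u ^+ j * nrmc mu (E (dyad j) f)) *
     (v ^+ j * nrmc mu (E (dyad j) f'))))).
  by apply: ler_sum => j _; apply: le_trans (ler_norm _) (pc j).
rewrite -mulr_sumr.
have CS := @sum_cauchy_schwarz J (fun j => u ^+ j * nrmc mu (E (dyad j) f))
   (fun j => v ^+ j * nrmc mu (E (dyad j) f')).
have S1 : \sum_(j < J) (u ^+ j * nrmc mu (E (dyad j) f)) ^+ 2 <= Cp * N ^+ 2.
  apply: le_trans (Hp E f J sE KB Hf fp); rewrite le_eqVlt; apply/orP; left; apply/eqP.
  by apply: eq_bigr => j _; rewrite exprMn -u2 -!exprM mulnC.
have S2 : \sum_(j < J) (v ^+ j * nrmc mu (E (dyad j) f')) ^+ 2 <= Cq * N' ^+ 2.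
  apply: le_trans (Hq E f' J sE KB Hf' fq'); rewrite le_eqVlt; apply/orP; left; apply/eqP.
  by apply: eq_bigr => j _; rewrite exprMn -v2 -!exprM mulnC.
rewrite [_ * M]mulrC -!mulrA ler_wpM2l//.
set X := \sum_(j < J) _ in CS *.
have X0 : 0 <= X by apply: sumr_ge0 => j _; rewrite !mulr_ge0 ?nrmc_ge0 ?exprn_ge0 ?powR_ge0.
rewrite -[leLHS](ger0_norm X0) mulrA.
have -> : Num.sqrt (Cp * Cq) * N * N' = Num.sqrt ((Cp * N ^+ 2) * (Cq * N' ^+ 2)).
  have -> : (Cp * N ^+ 2) * (Cq * N' ^+ 2) = (Cp * Cq) * (N * N') ^+ 2 by ring.
  by rewrite [in RHS](sqrtrM _ (ltW CC0)) sqrtr_sqr ger0_norm ?mulr_ge0// mulrA.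
apply: ler_sqrt_sqr; first by rewrite !mulr_ge0 ?sqr_ge0// ltW.
apply: le_trans CS _; apply: ler_pM => //; apply: sumr_ge0 => j _; exact: sqr_ge0.
Qed.

End InterpolationTheorem.

(** * Schwartz functions on the Engel group *)

Section DirectionalCalculus.
Context (R : realType).
Local Notation V := (R * R * R * R)%type.
Local Notation e := (@Defs.basis R).
Implicit Types (u v : V -> R) (x y : V) (j : 'I_4) (t : R).

Lemma normV (a b c d : R) (r : R) : 0 <= r ->
  (`|((a, b, c, d) : V)| <= r) = [&& `|a| <= r, `|b| <= r, `|c| <= r & `|d| <= r].
Proof.
by move=> r0; rewrite !prod_normE /= !ge_max -!andbA.
Qed.

Lemma norm_basis j t : `|t *: e j| <= `|t|.
Proof.
rewrite normrZ ler_piMr// /Defs.basis normV//.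
by case: j => -[|[|[|[|]]]]//= _; rewrite !normr0 normr1 lexx ler01.
Qed.

Lemma line_shift u j x t h :
  u ((h *: (1 : R) + t) *: e j + x) = u (h *: e j + (x + t *: e j)).
Proof. by congr u; rewrite scalerDl -addrA (addrC x) -[h *: 1]/(h * 1) mulr1. Qed.

Lemma is_derive_line u j x t : derivable u (x + t *: e j) (e j) ->
  is_derive t 1 (fun s => u (x + s *: e j)) (pderiv j u (x + t *: e j)).
Proof.
move=> /derivableP [/cvg_ex[l Hl] _].
have El : pderiv j u (x + t *: e j) = l by exact: cvg_lim Hl.
rewrite El.
have Hl' : h^-1 *: (((fun s => u (x + s *: e j)) \o shift t) (h *: (1 : R)) - u (x + t *: e j))
    @[h --> 0^'] --> l.
  move: Hl; rewrite (_ : (fun h => h^-1 *: ((u \o shift (x + t *: e j)) (h *: e j) - u (x + t *: e j))) =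
    (fun h => h^-1 *: (((fun s => u (x + s *: e j)) \o shift t) (h *: (1 : R)) - u (x + t *: e j))))//.
  apply/funext => h /=; congr (_ *: (_ - _)).
  by rewrite -line_shift addrC.
apply: DeriveDef; first by apply/cvg_ex; exists l.
exact: cvg_lim Hl'.
Qed.

(** Asks only for a quadratic remainder, so that the derivatives of [x1] and of the segment
    integrals [S4] can be read off from estimates. *)
Lemma pderiv_quad u j x l C :
  (forall h, `|h| <= 1 -> `|u (x + h *: e j) - u x - h * l| <= C * h ^+ 2) ->
  derivable u x (e j) /\ pderiv j u x = l.
Proof.
move=> H.
have Hl : h^-1 *: ((u \o shift x) (h *: e j) - u x) @[h --> 0^'] --> l.
  apply/cvgrPdist_le => eps eps0.
  have C1 : 0 < `|C| + 1 by rewrite ltr_wpDl.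
  near=> h.
  have h0 : h != 0 by near: h; exact: nbhs_dnbhs_neq.
  have h1 : `|h| <= 1.
    near: h; apply: dnbhs0_le; exact: ltr01.
  have h2 : `|h| <= eps / (`|C| + 1) by near: h; apply: dnbhs0_le; exact: divr_gt0.
  rewrite /= addrC -[_ *: _]/(h^-1 * _).
  have -> : - (h^-1 * (u (h *: e j + x) - u x)) + l =
      - (h^-1 * (u (x + h *: e j) - u x - h * l)).
    by rewrite (addrC _ x); field.
  rewrite normrN normrM normfV ler_pdivrMl ?normr_gt0//.
  apply: le_trans (H h h1) _.
  rewrite -(real_normK (num_real h)) expr2 mulrA mulrC ler_wpM2l//.
  apply: (@le_trans _ _ (`|C| * `|h|)); first by rewrite ler_wpM2r// ler_norm.
  move: h2; rewrite ler_pdivlMr// => h2; rewrite mulrC; apply: le_trans h2.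
  by rewrite ler_wpM2l// lerDl.
split; first by apply/cvg_ex; exists l.
exact: cvg_lim Hl.
Unshelve. all: by end_near.
Qed.

Lemma mvt_line u j y t : (forall x, derivable u x (e j)) ->
  exists2 c : R, `|c| <= `|t| & u (y + t *: e j) - u y = t * pderiv j u (y + c *: e j).
Proof.
move=> du.
have D (s : R) : is_derive s 1 (fun s => u (y + s *: e j)) (pderiv j u (y + s *: e j)).
  exact: is_derive_line.
have cont (a b : R) : {within `[a, b], continuous (fun s => u (y + s *: e j))}.
  apply: continuous_subspaceT => s; apply: differentiable_continuous.
  by apply/derivable1_diffP; case: (D s).
have y0 : y + 0 *: e j = y by rewrite scale0r addr0.
have [t0|t0] := leP 0 t.
  have [c] := MVT_segment t0 (fun s _ => D s) (cont 0 t).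
  rewrite in_itv/= y0 subr0 => /andP[c0 ct] ->; exists c; last by rewrite mulrC.
  by rewrite !ger0_norm.
have [c] := MVT_segment (ltW t0) (fun s _ => D s) (cont t 0).
rewrite in_itv/= y0 sub0r => /andP[c0 ct] H; exists c.
  by rewrite !ler0_norm ?lerN2// ltW.
by rewrite -opprB H; ring.
Qed.

Definition rapid u : Prop := forall k : nat, exists M : R, forall x,
  (1 + `|x|) ^+ k * `|u x| <= M.

Local Notation SW := (@real_schwartz R).

(** Coinduction: closure proofs below only exhibit a class of functions stable under the partial
    derivatives and check continuity, derivability and decay of its members. *)
Lemma SW_coind (P : (V -> R) -> Prop) :
  (forall u, P u -> [/\ continuous u, forall j x, derivable u x (e j), rapid u &
     forall j, P (pderiv j u)]) ->
  forall u, P u -> SW u.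
Proof.
move=> H u Pu s.
have Ps : P (pderivs s u) by elim: s => //= j s IH; case: (H _ IH).
by have [] := H _ Ps.
Qed.

Lemma SW_pderiv u j : SW u -> SW (pderiv j u).
Proof. by move=> Hu s; have := Hu (rcons s j); rewrite /pderivs foldr_rcons. Qed.

Lemma SW_continuous u : SW u -> continuous u.
Proof. by move=> /(_ [::])[]. Qed.

Lemma SW_derivable u : SW u -> forall j x, derivable u x (e j).
Proof. by move=> /(_ [::])[]. Qed.

Lemma SW_rapid u : SW u -> rapid u.
Proof. by move=> /(_ [::])[]. Qed.

Lemma rapidP u : rapid u <-> forall k : nat, exists2 M : R, 0 <= M & forall x,
  (1 + `|x|) ^+ k * `|u x| <= M.
Proof.
split=> H k; have [M HM] := H k; last by exists M.
by exists M => //; apply: le_trans (HM 0); rewrite mulr_ge0// exprn_ge0// addr_ge0.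
Qed.

(** The exponent 8 is twice the dimension: each factor (1 + |x|)^2 dominates one 1 + t^2, so that
    this weight lies below a product of four integrable functions of one variable ([Wt_le]). *)
Definition Wt x : R := ((1 + `|x|) ^+ 8)^-1.

Lemma onepnorm_gt0 x : 0 < 1 + `|x|.
Proof. by rewrite ltr_pwDl. Qed.

Lemma Wt_gt0 x : 0 < Wt x.
Proof. by rewrite invr_gt0 exprn_gt0// onepnorm_gt0. Qed.

Lemma Wt_le1 x : Wt x <= 1.
Proof. by rewrite invf_le1 ?exprn_gt0 ?onepnorm_gt0// exprn_ege1// lerDl. Qed.

Lemma onepnorm_shift x y (r : R) : 0 <= r -> `|y - x| <= r -> 1 + `|x| <= (1 + r) * (1 + `|y|).
Proof.
move=> r0 yx; have : `|x| <= `|y| + r.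
  by rewrite -[x](subrK y) (le_trans (ler_normD _ _))// addrC lerD2l distrC.
by have := mulr_ge0 r0 (normr_ge0 y); nra.
Qed.

Lemma rapid_local u (k : nat) (r : R) : rapid u -> 0 <= r -> exists2 M : R, 0 <= M &
  forall x y, `|y - x| <= r -> (1 + `|x|) ^+ k * `|u y| <= M.
Proof.
move=> /rapidP /(_ k)[M M0 HM] r0; exists ((1 + r) ^+ k * M).
  by rewrite mulr_ge0// exprn_ge0// addr_ge0.
move=> x y yx; apply: (@le_trans _ _ ((1 + r) ^+ k * (1 + `|y|) ^+ k * `|u y|)).
  rewrite ler_wpM2r// -exprMn lerXn2r ?nnegrE ?mulr_ge0 ?addr_ge0//.
  exact: onepnorm_shift.
by rewrite -mulrA ler_wpM2l// exprn_ge0// addr_ge0.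
Qed.

Lemma SW_local u (r : R) : SW u -> 0 <= r -> exists2 M : R, 0 <= M &
  forall x y, `|y - x| <= r -> `|u y| <= M * Wt x.
Proof.
move=> /SW_rapid Hu r0; have [M M0 HM] := rapid_local 8 Hu r0; exists M => // x y yx.
by rewrite ler_pdivlMr ?exprn_gt0 ?onepnorm_gt0// mulrC; exact: HM.
Qed.

Lemma SW_lip u (r : R) j : SW u -> 0 <= r -> exists2 M : R, 0 <= M &
  forall x y t, `|y - x| <= r -> `|t| <= 1 -> `|u (y + t *: e j) - u y| <= M * `|t| * Wt x.
Proof.
move=> Hu r0; have r1 : 0 <= r + 1 by rewrite addr_ge0.
have [M M0 HM] := SW_local (SW_pderiv j Hu) r1; exists M => // x y t yx t1.
have [c ct ->] := @mvt_line u j y t (@SW_derivable u Hu j).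
rewrite normrM mulrAC mulrC ler_wpM2r//; apply: HM.
rewrite addrAC (le_trans (ler_normD _ _))// lerD//.
by rewrite (le_trans (norm_basis _ _))// (le_trans ct).
Qed.

Lemma SW_taylor_dir u (r : R) j : SW u -> 0 <= r -> exists2 M : R, 0 <= M &
  forall x y t, `|y - x| <= r -> `|t| <= 1 ->
  `|u (y + t *: e j) - u y - t * pderiv j u y| <= M * t ^+ 2 * Wt x.
Proof.
move=> Hu r0; have [M M0 HM] := SW_lip j (SW_pderiv j Hu) r0; exists M => // x y t yx t1.
have [c ct ->] := @mvt_line u j y t (@SW_derivable u Hu j).
rewrite -mulrBr normrM.
apply: (@le_trans _ _ (`|t| * (M * `|t| * Wt x))); last first.
  by rewrite -(real_normK (num_real t)); lra.
rewrite ler_wpM2l//; apply: le_trans (HM x y c yx (le_trans ct t1)) _.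
by rewrite ler_wpM2r ?(ltW (Wt_gt0 _))// ler_wpM2l.
Qed.

Definition i1 : 'I_4 := inord 0.
Definition i2 : 'I_4 := inord 1.
Definition i3 : 'I_4 := inord 2.
Definition i4 : 'I_4 := inord 3.

Lemma basis_i1 : e i1 = (1, 0, 0, 0). Proof. by rewrite /Defs.basis inordK. Qed.
Lemma basis_i2 : e i2 = (0, 1, 0, 0). Proof. by rewrite /Defs.basis inordK. Qed.
Lemma basis_i3 : e i3 = (0, 0, 1, 0). Proof. by rewrite /Defs.basis inordK. Qed.
Lemma basis_i4 : e i4 = (0, 0, 0, 1). Proof. by rewrite /Defs.basis inordK. Qed.

Lemma scaleV (t a b c d : R) : t *: ((a, b, c, d) : V) = (t * a, t * b, t * c, t * d).
Proof. by []. Qed.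

Lemma addV (a b c d a' b' c' d' : R) :
  ((a, b, c, d) : V) + (a', b', c', d') = (a + a', b + b', c + c', d + d').
Proof. by []. Qed.

Lemma decompV (a b c d : R) :
  ((a, b, c, d) : V) = a *: e i1 + b *: e i2 + c *: e i3 + d *: e i4.
Proof.
by rewrite basis_i1 basis_i2 basis_i3 basis_i4 !scaleV !addV !mulr0 !mulr1 !addr0 !add0r.
Qed.

Lemma telescope4 (u0 u1 u2 u3 u4 a b c d p1 p2 p21 p3 p31 p32 p4 p41 p42 p43 : R) :
  u4 - u0 - (a * p1 + b * p2 + c * p3 + d * p4) =
  (u1 - u0 - a * p1) + (u2 - u1 - b * p21) + (u3 - u2 - c * p32) + (u4 - u3 - d * p43) +
  b * (p21 - p2) + c * (p31 - p3) + c * (p32 - p31) + d * (p41 - p4) +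
  d * (p42 - p41) + d * (p43 - p42).
Proof. ring. Qed.

(** Move along the four axes in turn. By [telescope4] the remainder consists of four directional
    Taylor remainders and of first derivatives at intermediate points compared back to y, each
    comparison being a Lipschitz increment times a coordinate. *)
Lemma SW_taylor u (r : R) : SW u -> 0 <= r -> exists2 M : R, 0 <= M &
  forall x y (a b c d rho : R), `|y - x| <= r -> rho <= 1 ->
  `|a| <= rho -> `|b| <= rho -> `|c| <= rho -> `|d| <= rho ->
  `|u (y + (a, b, c, d)) - u y - (a * pderiv i1 u y + b * pderiv i2 u y +
      c * pderiv i3 u y + d * pderiv i4 u y)| <= M * rho ^+ 2 * Wt x.
Proof.
move=> Hu r0.
(* The path has base points up to three unit steps beyond distance r. *)
have r3 : 0 <= r + 3 by rewrite addr_ge0.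
have le3 (q : R) : q <= q + 3 /\ q + 1 <= q + 3 /\ q + 1 + 1 <= q + 3 /\ q + 1 + 1 + 1 <= q + 3.
  by do !split; lra.
have [T1 T10 HT1] := SW_taylor_dir i1 Hu r3; have [T2 T20 HT2] := SW_taylor_dir i2 Hu r3.
have [T3 T30 HT3] := SW_taylor_dir i3 Hu r3; have [T4 T40 HT4] := SW_taylor_dir i4 Hu r3.
have L j i := SW_lip i (SW_pderiv j Hu) r3.
have [L21 L210 HL21] := L i2 i1.
have [L31 L310 HL31] := L i3 i1; have [L32 L320 HL32] := L i3 i2.
have [L41 L410 HL41] := L i4 i1; have [L42 L420 HL42] := L i4 i2; have [L43 L430 HL43] := L i4 i3.
exists (T1 + T2 + T3 + T4 + L21 + L31 + L32 + L41 + L42 + L43); first by rewrite !addr_ge0.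
move=> x y a b c d rho yx rho1 ar br cr dr.
have rho0 : 0 <= rho by apply: le_trans ar.
have w0 : 0 <= Wt x := ltW (Wt_gt0 x).
pose y1 := y + a *: e i1; pose y2 := y1 + b *: e i2; pose y3 := y2 + c *: e i3.
have st (z : V) t i (q : R) : `|z - x| <= q -> `|t| <= 1 -> `|z + t *: e i - x| <= q + 1.
  move=> zq t1; rewrite addrAC (le_trans (ler_normD _ _))// lerD//.
  exact: le_trans (norm_basis _ _) t1.
have a1 := le_trans ar rho1; have b1 := le_trans br rho1.
have c1 := le_trans cr rho1; have d1 := le_trans dr rho1.
have h1 := st y a i1 _ yx a1; have h2 := st y1 b i2 _ h1 b1; have h3 := st y2 c i3 _ h2 c1.
have B0 := le_trans yx (le3 r).1; have B1 := le_trans h1 (le3 r).2.1.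
have B2 := le_trans h2 (le3 r).2.2.1; have B3 := le_trans h3 (le3 r).2.2.2.
have -> : y + (a, b, c, d) = y3 + d *: e i4.
  by rewrite (decompV a b c d) /y3 /y2 /y1 !addrA.
have Q (K t : R) : 0 <= K -> `|t| <= rho -> K * t ^+ 2 * Wt x <= K * rho ^+ 2 * Wt x.
  move=> K0 tr; rewrite ler_wpM2r// ler_wpM2l// -(real_normK (num_real t)).
  by rewrite lerXn2r ?nnegrE.
have P (K s t X : R) : 0 <= K -> `|s| <= rho -> `|t| <= rho -> `|X| <= K * `|s| * Wt x ->
    `|t * X| <= K * rho ^+ 2 * Wt x.
  move=> K0 sr tr HX; rewrite normrM.
  apply: (@le_trans _ _ (rho * (K * `|s| * Wt x))); first by rewrite ler_pM.
  rewrite [leLHS]mulrA ler_wpM2r// mulrCA ler_wpM2l// expr2 ler_wpM2l//.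
have q1 := le_trans (HT1 x y a B0 a1) (Q _ _ T10 ar).
have q2 := le_trans (HT2 x y1 b B1 b1) (Q _ _ T20 br).
have q3 := le_trans (HT3 x y2 c B2 c1) (Q _ _ T30 cr).
have q4 := le_trans (HT4 x y3 d B3 d1) (Q _ _ T40 dr).
have p21 := P _ a b _ L210 ar br (HL21 x y a B0 a1).
have p31 := P _ a c _ L310 ar cr (HL31 x y a B0 a1).
have p32 := P _ b c _ L320 br cr (HL32 x y1 b B1 b1).
have p41 := P _ a d _ L410 ar dr (HL41 x y a B0 a1).
have p42 := P _ b d _ L420 br dr (HL42 x y1 b B1 b1).
have p43 := P _ c d _ L430 cr dr (HL43 x y2 c B2 c1).
rewrite -/y1 in q1 p21 p31 p41; rewrite -/y2 in q2 p32 p42; rewrite -/y3 in q3 p43.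
rewrite (telescope4 _ (u y1) (u y2) (u y3) _ a b c d _ _ (pderiv i2 u y1) _ (pderiv i3 u y1)
  (pderiv i3 u y2) _ (pderiv i4 u y1) (pderiv i4 u y2) (pderiv i4 u y3)).
rewrite !mulrDl; do 9 (apply: le_trans (ler_normD _ _) _; apply: lerD => //).
Qed.

End DirectionalCalculus.

(** * Lebesgue measure on R^4 and its translations *)

Lemma product_sigma_finite (d1 d2 : measure_display) (T1 : measurableType d1)
    (T2 : measurableType d2) (R : realType) (m1 : {sigma_finite_measure set T1 -> \bar R})
    (m2 : {sigma_finite_measure set T2 -> \bar R}) : sigma_finite setT (m1 \x m2)%E.
Proof.
have /sigma_finiteP[F [TF ndF Foo]] := sigma_finiteT m1.
have /sigma_finiteP[G [TG ndG Goo]] := sigma_finiteT m2.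
exists (fun n => F n `*` G n).
  apply/seteqP; split => // -[x y] _.
  have [n _ Fx] : (\bigcup_i F i) x by rewrite -TF.
  have [m _ Gy] : (\bigcup_i G i) y by rewrite -TG.
  exists (maxn n m) => //; split => /=.
    by move: x Fx; exact/subsetPset/ndF/leq_maxl.
  by move: y Gy; exact/subsetPset/ndG/leq_maxr.
move=> n; have [mF Fn] := Foo n; have [mG Gn] := Goo n; split; first exact: measurableX.
by rewrite product_measure1E// lte_mul_pinfty// ge0_fin_numE.
Qed.

Section MeasureR4.
Context (R : realType).
Local Notation V := (R * R * R * R)%type.
Local Notation mR := (measurableTypeR R).
Local Notation mV := (mR * mR * mR * mR)%type.
Local Notation leb := (@lebesgue_measure R).
Local Notation e := (@Defs.basis R).

Definition box (q : rat * rat * rat * rat * rat) : set mV :=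
  let: (a, b, c, d, r) := q in
  ball (ratr a : R) (ratr r) `*` ball (ratr b : R) (ratr r) `*` ball (ratr c : R) (ratr r)
    `*` ball (ratr d : R) (ratr r).

Lemma measurable_box q : measurable (box q).
Proof.
case: q => [[[[a b] c] d] r] /=.
by do !apply: measurableX; apply: measurable_ball.
Qed.

(** An open set is the union of the rational boxes that it contains. There are countably many of
    them, and for the maximum norm the boxes are products of intervals, hence measurable for the
    product structure. *)
Lemma open_measurable_R4 (U : set V) : open U -> measurable (U : set mV).
Proof.
move=> oU.
have -> : U = \bigcup_q (if `[< box q `<=` U >] then box q else set0).
  apply/seteqP; split => [[[[x1 x2] x3] x4] Ux|y [q _]]; last by case: asboolP => // qU /qU.
  have /nbhs_ballP[eps /= eps0 He] := open_nbhs_nbhs (conj oU Ux).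
  have [r /andP[r0 re]] : exists r : rat, (0 < ratr r :> R) && (ratr r < eps / 2).
    have /rat_in_itvoo[r] : 0 < eps / 2 by rewrite divr_gt0.
    by rewrite in_itv/=; exists r.
  have ap (x : R) : exists q : rat, `|ratr q - x| < ratr r.
    have /rat_in_itvoo[q] : x - ratr r < x + ratr r by lra.
    by rewrite in_itv/= => Hq; exists q; rewrite ltr_distl.
  have [q1 h1] := ap x1; have [q2 h2] := ap x2; have [q3 h3] := ap x3; have [q4 h4] := ap x4.
  exists (q1, q2, q3, q4, r) => //.
  case: asboolP => [_|[]]; first by split => //; split => //; split.
  move=> [[[y1 y2] y3] y4] [/= [/= [/= b1 b2] b3] b4]; apply: He.
  have cl (x y q : R) : `|q - x| < ratr r -> `|q - y| < ratr r -> `|x - y| < eps.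
    by move=> xq yq; rewrite (le_lt_trans (ler_distD q _ _))// distrC; lra.
  split; [split; [split|]|]; apply: cl; eassumption.
apply: countable_bigcupT_measurable; first exact: countableP.
by move=> q; case: ifP => // _; exact: measurable_box.
Qed.

Lemma continuous_measurable_R4 (u : V -> R) : continuous u ->
  measurable_fun [set: mV] (u : mV -> R).
Proof.
move=> /continuousP cu; apply: (measurability _ (RGenOInfty.measurableE R)) => //.
move=> _ [_ [a ->] <-]; rewrite setTI; apply: open_measurable_R4; apply: cu.
exact: rray_open.
Qed.

Definition affine (s r : R) (x : mR) : mR := s + r * x.

Lemma measurable_affine s r : measurable_fun [set: mR] (affine s r).
Proof. by apply: measurable_funD => //; apply: measurable_funM. Qed.

Definition affine_pf s r : {measure set mR -> \bar R} :=
  measure_function_pushforward__canonical__measure_function_Measure leb (measurable_affine s r).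

(** Both sides are measures that agree on half-open intervals, and these determine Lebesgue
    measure. *)
Lemma affine_measure (r s : R) (A : set mR) : 0 < r -> measurable A ->
  leb A = (r%:E * pushforward leb (affine s r) A)%E.
Proof.
move=> r0 mA.
pose m : {measure set mR -> \bar R} := mscale (NngNum (ltW r0)) (affine_pf s r).
suff H X : ocitv X -> leb X = m X by exact: (lebesgue_measure_unique H mA).
move=> [[a b]] _ <-.
have -> : m `]a, b]%classic = (r%:E * leb (affine s r @^-1` `]a, b]%classic))%E by [].
have -> : affine s r @^-1` `]a, b]%classic = `](a - s) / r, (b - s) / r]%classic.
  apply/seteqP; split => x /=; rewrite !in_itv/= ltr_pdivrMr// ler_pdivlMr//;
    by rewrite ltrBlDl lerBrDl (mulrC x).
rewrite !lebesgue_measure_itv/= !lte_fin ltr_pM2r ?invr_gt0// ltrD2r.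
case: ifP => ab; last by rewrite mule0.
by rewrite -!EFinB -EFinM; congr (_%:E); field; rewrite gt_eqF.
Qed.

Lemma integral_affine (f : R -> \bar R) (r s : R) : 0 < r ->
  measurable_fun [set: mR] f -> (forall x, (0 <= f x)%E) ->
  (r%:E * \int[leb]_x f (s + r * x)%R = \int[leb]_x f x)%E.
Proof.
move=> r0 mf f0.
transitivity (r%:E * \int[affine_pf s r]_x f x)%E.
  rewrite ge0_integral_pushforward ?preimage_setT//; exact: measurable_affine.
rewrite -[in LHS](_ : (NngNum (ltW r0))%:num = r)//.
rewrite -ge0_integral_mscale//.
by apply: eq_measure_integral => A mA _; rewrite [RHS](affine_measure s r0 mA).
Qed.

Lemma integral_shift1 (f : R -> \bar R) (s : R) :
  measurable_fun [set: mR] f -> (forall x, (0 <= f x)%E) ->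
  (\int[leb]_x f (s + x)%R = \int[leb]_x f x)%E.
Proof.
move=> mf f0; rewrite -(integral_affine s ltr01 mf f0) mul1e.
by apply: eq_integral => x _; rewrite mul1r.
Qed.

Lemma measurable_section (d1 d2 d3 : measure_display) (T1 : measurableType d1)
    (T2 : measurableType d2) (T3 : measurableType d3) (f : T1 * T2 -> T3) (a : T1) :
  measurable_fun setT f -> measurable_fun setT (fun y => f (a, y)).
Proof. by move=> mf; apply: measurableT_comp => //; exact: measurable_pair2. Qed.

Local Notation mu := (engel_measure R).

(** Bundles sigma-finiteness with the product, so that it can serve as a factor in Tonelli's
    theorem; [engel_measure] is an iterated product. *)
Definition leb2 : {sigma_finite_measure set (mR * mR)%type -> \bar R} :=
  HB.pack (leb \x leb)%E (Measure_isSigmaFinite.Build _ _ _ (leb \x leb)%E (product_sigma_finite leb leb)).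

Definition leb3 : {sigma_finite_measure set (mR * mR * mR)%type -> \bar R} :=
  HB.pack (leb2 \x leb)%E (Measure_isSigmaFinite.Build _ _ _ (leb2 \x leb)%E (product_sigma_finite leb2 leb)).

Lemma integral_R4 (f : mV -> \bar R) : measurable_fun [set: mV] f -> (forall x, (0 <= f x)%E) ->
  (\int[mu]_x f x = \int[leb]_a \int[leb]_b \int[leb]_c \int[leb]_d f (a, b, c, d))%E.
Proof.
move=> mf f0.
pose F1 := fubini_F leb f.
have F10 x : (0 <= F1 x)%E by apply: integral_ge0.
have m1 : measurable_fun setT F1 := measurable_fun_fubini_tonelli_F (m2 := leb) f mf f0.
pose F2 := fubini_F leb F1.
have F20 x : (0 <= F2 x)%E by apply: integral_ge0.
have m2 : measurable_fun setT F2 := measurable_fun_fubini_tonelli_F (m2 := leb) F1 m1 F10.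
have E1 := fubini_tonelli1 (m1 := leb3) (m2 := leb) f mf f0.
have E2 := fubini_tonelli1 (m1 := leb2) (m2 := leb) F1 m1 F10.
have E3 := fubini_tonelli1 (m1 := leb) (m2 := leb) F2 m2 F20.
exact: (etrans E1 (etrans E2 E3)).
Qed.

Definition shift4 (a b c d : R) (x : mV) : mV := (a + x.1.1.1, b + x.1.1.2, c + x.1.2, d + x.2).

Lemma measurable_shift4 a b c d : measurable_fun [set: mV] (shift4 a b c d).
Proof.
have m1 : measurable_fun [set: mV] (fun x : mV => x.1.1.1) by do !apply: measurableT_comp => //.
have m2 : measurable_fun [set: mV] (fun x : mV => x.1.1.2) by do !apply: measurableT_comp => //.
have m3 : measurable_fun [set: mV] (fun x : mV => x.1.2) by do !apply: measurableT_comp => //.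
have m4 : measurable_fun [set: mV] (fun x : mV => x.2) by exact: measurable_snd.
by do !apply: measurable_fun_pair; apply: measurable_funD.
Qed.

Lemma integral_shift4 (f : mV -> \bar R) a b c d : measurable_fun [set: mV] f ->
  (forall x, (0 <= f x)%E) -> (\int[mu]_x f (shift4 a b c d x) = \int[mu]_x f x)%E.
Proof.
move=> mf f0.
rewrite (integral_R4 mf f0).
rewrite (integral_R4 (measurableT_comp mf (measurable_shift4 a b c d)) (fun x => f0 _)).
pose F1 := fubini_F leb f.
have F10 x : (0 <= F1 x)%E by apply: integral_ge0.
have m1 : measurable_fun setT F1 := measurable_fun_fubini_tonelli_F (m2 := leb) f mf f0.
pose F2 := fubini_F leb F1.
have F20 x : (0 <= F2 x)%E by apply: integral_ge0.
have m2 : measurable_fun setT F2 := measurable_fun_fubini_tonelli_F (m2 := leb) F1 m1 F10.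
pose F3 := fubini_F leb F2.
have F30 x : (0 <= F3 x)%E by apply: integral_ge0.
have m3 : measurable_fun setT F3 := measurable_fun_fubini_tonelli_F (m2 := leb) F2 m2 F20.
transitivity (\int[leb]_x F3 (a + x)%R)%E; last exact: (integral_shift1 a m3 F30).
apply: eq_integral => x _.
transitivity (\int[leb]_y F2 (a + x, b + y)%R)%E; last first.
  exact: (integral_shift1 b (measurable_section (a + x) m2) (fun y => F20 _)).
apply: eq_integral => y _.
transitivity (\int[leb]_z F1 (a + x, b + y, c + z)%R)%E; last first.
  exact: (integral_shift1 c (measurable_section (a + x, b + y) m1) (fun y => F10 _)).
apply: eq_integral => z _.
exact: (integral_shift1 d (measurable_section (a + x, b + y, c + z) mf) (fun y => f0 _)).
Qed.

Definition wt1 (t : R) : R := (1 + t ^+ 2)^-1.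

Lemma wt1_gt0 t : 0 < wt1 t. Proof. by rewrite invr_gt0 ltr_pwDl// sqr_ge0. Qed.

Lemma measurable_wt1 : measurable_fun [set: mR] wt1.
Proof. by apply: (@continuous_measurable_fun R wt1) => x; exact: continuous_oneDsqrV. Qed.

Lemma integral_wt1 : (\int[leb]_t (wt1 t)%:E = pi%:E)%E.
Proof.
rewrite ge0_symfun_integralT//.
- rewrite -set_itvcy (_ : (\int[_]_(_ in _) _)%E = (pi / 2)%:E); last exact: integral0y_oneDsqr.
  by rewrite -EFinM; congr (_%:E); field.
- by move=> x; rewrite ltW// wt1_gt0.
- by move=> x; exact: continuous_oneDsqrV.
- by move=> x; rewrite /wt1 /= sqrrN.
Qed.

Lemma Wt_le (x : V) : Wt x <= wt1 x.1.1.1 * wt1 x.1.1.2 * wt1 x.1.2 * wt1 x.2.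
Proof.
case: x => [[[a b] c] d]; rewrite /Wt /wt1/= -!invfM lef_pV2 ?posrE.
- have nx : 0 <= `|((a, b, c, d) : V)| by [].
  move: (lexx `|((a, b, c, d) : V)|); rewrite {1}normV//.
  set n : R := `|((a, b, c, d) : V)| => /and4P[an bn cn dn].
  have sq (t : R) : `|t| <= n -> 0 <= 1 + t ^+ 2 <= (1 + n) ^+ 2.
    move=> tn; rewrite addr_ge0 ?sqr_ge0//= -(real_normK (num_real t)).
    by have := normr_ge0 t; nra.
  have /andP[a0 a1] := sq _ an; have /andP[b0 b1] := sq _ bn.
  have /andP[c0 c1] := sq _ cn; have /andP[d0 d1] := sq _ dn.
  rewrite -[8%N]/(2 + 2 + 2 + 2)%N !exprD.
  by rewrite !ler_pM// ?mulr_ge0// !mulr_ge0.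
- by rewrite exprn_gt0// onepnorm_gt0.
- by rewrite !mulr_gt0// -invr_gt0 wt1_gt0.
Qed.

Lemma continuous_Wt : continuous (@Wt R : V -> R).
Proof.
move=> x; apply: cvgV; first by rewrite gt_eqF// exprn_gt0// onepnorm_gt0.
apply: (@continuous_comp _ _ _ (fun x : V => 1 + `|x|) (fun t : R => t ^+ 8)).
  by apply: continuousD; [exact: cst_continuous|exact: norm_continuous].
exact: exprn_continuous.
Qed.

Definition wt4 (x : mV) : R := wt1 x.1.1.1 * wt1 x.1.1.2 * wt1 x.1.2 * wt1 x.2.

Lemma wt4_gt0 x : 0 < wt4 x. Proof. by rewrite !mulr_gt0 ?wt1_gt0. Qed.

Lemma measurable_wt4 : measurable_fun [set: mV] wt4.
Proof.
have m1 : measurable_fun [set: mV] (fun x : mV => x.1.1.1) by do !apply: measurableT_comp => //.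
have m2 : measurable_fun [set: mV] (fun x : mV => x.1.1.2) by do !apply: measurableT_comp => //.
have m3 : measurable_fun [set: mV] (fun x : mV => x.1.2) by do !apply: measurableT_comp => //.
have m4 : measurable_fun [set: mV] (fun x : mV => x.2) by exact: measurable_snd.
do !apply: measurable_funM; exact: measurableT_comp measurable_wt1 _.
Qed.

Lemma integral_wt4 : (\int[mu]_x (wt4 x)%:E < +oo)%E.
Proof.
have w0 (t : R) : 0 <= wt1 t := ltW (wt1_gt0 t).
have mP : measurable_fun [set: mV] (fun x : mV => (wt4 x)%:E).
  by apply/measurable_EFinP; exact: measurable_wt4.
have P0 x : (0 <= (wt4 x)%:E)%E by rewrite lee_fin ltW// wt4_gt0.
have mw : measurable_fun [set: mR] (fun t => (wt1 t)%:E) by apply/measurable_EFinP; exact: measurable_wt1.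
have ew (k l : R) : (0 <= k)%R -> (0 <= l)%R ->
    (\int[leb]_t (k * wt1 t * l)%:E = (k * (l * pi))%:E)%E.
  move=> k0 l0; under eq_integral do rewrite mulrAC EFinM.
  rewrite ge0_integralZl//; [|by move=> t _; rewrite lee_fin|by rewrite lee_fin mulr_ge0].
  by rewrite integral_wt1 -EFinM mulrA.
have p0 : (0 <= pi :> R)%R := pi_ge0 R.
rewrite (integral_R4 mP P0).
under eq_integral => a _.
  under eq_integral => b _.
    under eq_integral => c _.
      under eq_integral do rewrite /wt4/= -[X in X%:E]mulr1.
      by rewrite ew ?mulr_ge0//; over.
    by rewrite ew ?mulr_ge0//; over.
  by rewrite ew ?mulr_ge0//; over.
by under eq_integral do rewrite -[X in X%:E]mul1r mulrA; rewrite ew ?mulr_ge0// ltry.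
Qed.

Lemma integral_Wt : (\int[mu]_x (Wt x)%:E < +oo)%E.
Proof.
have mW : measurable_fun [set: mV] (fun x : mV => (Wt x)%:E).
  by apply/measurable_EFinP; exact: (continuous_measurable_R4 continuous_Wt).
have mP : measurable_fun [set: mV] (fun x : mV => (wt4 x)%:E).
  by apply/measurable_EFinP; exact: measurable_wt4.
have W0 (x : mV) : (0 <= (Wt x)%:E)%E by rewrite lee_fin ltW// Wt_gt0.
apply: le_lt_trans integral_wt4.
by apply: ge0_le_integral => // x _; rewrite lee_fin; exact: Wt_le.
Qed.

End MeasureR4.

(** * Stability of the Schwartz space *)

Section SchwartzClosure.
Context (R : realType).
Local Notation V := (R * R * R * R)%type.
Local Notation e := (@Defs.basis R).
Local Notation SW := (@real_schwartz R).
Implicit Types (u v : V -> R) (x y : V) (j : 'I_4) (t : R).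

Lemma pderiv_lin (k : R) u v j x : derivable u x (e j) -> derivable v x (e j) ->
  derivable (fun x => k * u x + v x) x (e j) /\
  pderiv j (fun x => k * u x + v x) x = k * pderiv j u x + pderiv j v x.
Proof.
move=> du dv; have dku : derivable (k \*: u) x (e j) by exact: derivableZ.
split; first exact: (derivableD dku dv).
by rewrite -[LHS]/('D_(e j) ((k \*: u) + v) x) deriveD// deriveZ.
Qed.

Lemma SW_lin (k : R) u v : SW u -> SW v -> SW (fun x => k * u x + v x).
Proof.
move=> Hu Hv.
pose P w := exists u v, [/\ SW u, SW v & w = fun x => k * u x + v x].
apply: (@SW_coind R P); last by exists u, v.
move=> w [{}u [{}v [{}Hu {}Hv ->]]]; split.
- by move=> x; apply: cvgD; [apply: cvgMr; exact: SW_continuous|exact: SW_continuous].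
- by move=> j x; have [] := pderiv_lin k (@SW_derivable R _ Hu j x) (@SW_derivable R _ Hv j x).
- move=> m; have /rapidP/(_ m)[M1 M10 H1] := SW_rapid Hu.
  have /rapidP/(_ m)[M2 M20 H2] := SW_rapid Hv; exists (`|k| * M1 + M2) => x.
  have n0 : 0 <= (1 + `|x|) ^+ m by rewrite exprn_ge0// ltW// onepnorm_gt0.
  apply: (@le_trans _ _ ((1 + `|x|) ^+ m * (`|k| * `|u x| + `|v x|))).
    by rewrite ler_wpM2l// (le_trans (ler_normD _ _))// normrM.
  by rewrite mulrDr mulrCA lerD// ler_wpM2l.
- move=> j; exists (pderiv j u), (pderiv j v); split; [exact: SW_pderiv|exact: SW_pderiv|].
  apply/funext => x.
  by have [] := pderiv_lin k (@SW_derivable R _ Hu j x) (@SW_derivable R _ Hv j x).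
Qed.

Lemma SW0 : SW (fun=> 0).
Proof.
apply: (@SW_coind R (fun w => w = fun=> 0)) => // _ ->; split.
- exact: cst_continuous.
- by move=> j x; exact: derivable_cst.
- by move=> m; exists 0 => x; rewrite normr0 mulr0.
- by move=> j; apply/funext => x; rewrite /pderiv derive_cst.
Qed.

Lemma SWD u v : SW u -> SW v -> SW (fun x => u x + v x).
Proof.
move=> Hu Hv; have := SW_lin 1 Hu Hv.
by rewrite (_ : (fun x => 1 * u x + v x) = (fun x => u x + v x))//; apply/funext => x; rewrite mul1r.
Qed.

Lemma SWZ (k : R) u : SW u -> SW (fun x => k * u x).
Proof.
move=> Hu; have := SW_lin k Hu SW0.
by rewrite (_ : (fun x => k * u x + 0) = (fun x => k * u x))//; apply/funext => x; rewrite addr0.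
Qed.

Lemma SWN u : SW u -> SW (fun x => - u x).
Proof.
move=> Hu; have := SWZ (-1) Hu.
by rewrite (_ : (fun x => -1 * u x) = (fun x => - u x))//; apply/funext => x; rewrite mulN1r.
Qed.

Lemma SWB u v : SW u -> SW v -> SW (fun x => u x - v x).
Proof. by move=> Hu Hv; have := SWD Hu (SWN Hv). Qed.

Lemma pderivD u v j : SW u -> SW v ->
  pderiv j (fun x => u x + v x) = (fun x => pderiv j u x + pderiv j v x).
Proof.
move=> Hu Hv; apply/funext => x; rewrite -[LHS]/('D_(e j) (u + v) x) deriveD//.
  exact: SW_derivable.
exact: SW_derivable.
Qed.

Lemma pderivZ k u j : SW u ->
  pderiv j (fun x => k * u x) = (fun x => k * pderiv j u x).
Proof.
move=> Hu; apply/funext => x; rewrite -[LHS]/('D_(e j) (k \*: u) x) deriveZ//.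
exact: SW_derivable.
Qed.

Lemma pderivN u j : SW u -> pderiv j (fun x => - u x) = (fun x => - pderiv j u x).
Proof.
move=> Hu; apply/funext => x; rewrite -[LHS]/('D_(e j) (- u) x) deriveN//.
exact: SW_derivable.
Qed.

Lemma pderivB u v j : SW u -> SW v ->
  pderiv j (fun x => u x - v x) = (fun x => pderiv j u x - pderiv j v x).
Proof. by move=> Hu Hv; rewrite (pderivD j Hu (SWN Hv)) (pderivN j Hv). Qed.

Lemma lip_continuous u :
  (forall x, exists C : R, forall y, `|y - x| <= 1 -> `|u y - u x| <= C * `|y - x|) -> continuous u.
Proof.
move=> H x; have [C HC] := H x; apply/cvgrPdist_lt => eps eps0.
suff : nbhs (x : V) [set y | `|u x - u y| < eps] by [].
have C1 : 0 < `|C| + 1 by rewrite ltr_wpDl.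
apply/nbhs_ballP; exists (Num.min 1 (eps / (`|C| + 1))) => /=.
  by rewrite lt_min ltr01 divr_gt0.
move=> y; rewrite -ball_normE /= lt_min ltr_pdivlMr// distrC => /andP[/ltW y1 y2].
rewrite distrC (le_lt_trans (HC _ y1))// (le_lt_trans _ y2)// mulrC ler_wpM2l//.
by rewrite (le_trans (ler_norm _))// lerDl.
Qed.

Lemma x1_le x : `|x1 x| <= `|x|.
Proof. by case: x => [[[a b] c] d]; rewrite !prod_normE /= !le_max lexx. Qed.

Lemma continuous_x1 : continuous (@x1 R : V -> R).
Proof.
apply: lip_continuous => x; exists 1 => y _.
by rewrite mul1r -[y.1.1.1 - _]/(x1 (y - x)) x1_le.
Qed.

Lemma pderiv_x1 j x : derivable (@x1 R) x (e j) /\ pderiv j (@x1 R) x = (j == i1)%:R.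
Proof.
apply: (@pderiv_quad R _ _ _ _ 0) => h _; rewrite mul0r normr_le0 /x1 /= -[_ *: _]/(h * _).
have -> : (j == 0 :> nat) = (j == i1) by rewrite -val_eqE /= inordK.
by rewrite [X in X - h * _]addrAC subrr add0r subrr.
Qed.

Lemma pderiv_x1M u j x : derivable u x (e j) ->
  derivable (fun x => x1 x * u x) x (e j) /\
  pderiv j (fun x => x1 x * u x) x = x1 x * pderiv j u x + (j == i1)%:R * u x.
Proof.
move=> du; have [d1 E1] := pderiv_x1 j x; split; first exact: (derivableM d1 du).
rewrite -[LHS]/('D_(e j) ((@x1 R) * u) x) (deriveM d1 du) -[X in _ + _ *: X]/(pderiv j (@x1 R) x) E1.
by rewrite [X in _ + X]mulrC.
Qed.

(** The derivative of x1 u in the first direction brings in u itself, so the class stable under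
    differentiation consists of the sums x1 u + v. *)
Lemma SW_x1 u : SW u -> SW (fun x => x1 x * u x).
Proof.
move=> Hu.
(* The factor 1 gives the sum the shape treated by [pderiv_lin]. *)
pose P w := exists u v, [/\ SW u, SW v & w = fun x => 1 * (x1 x * u x) + v x].
apply: (@SW_coind R P); last first.
  by exists u, (fun=> 0); split => //; [exact: SW0|apply/funext => x; rewrite addr0 mul1r].
move=> w [{}u [{}v [{}Hu {}Hv ->]]].
have D j x := pderiv_lin 1 (pderiv_x1M (@SW_derivable R _ Hu j x)).1 (@SW_derivable R _ Hv j x).
split.
- move=> x; apply: cvgD; last exact: SW_continuous.
  apply: cvgMr; apply: cvgM; last exact: SW_continuous.
  exact: continuous_x1.
- by move=> j x; have [] := D j x.
- move=> m; have /rapidP/(_ m.+1)[M1 M10 H1] := SW_rapid Hu.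
  have /rapidP/(_ m)[M2 M20 H2] := SW_rapid Hv; exists (M1 + M2) => x.
  have n0 : 0 <= (1 + `|x|) ^+ m by rewrite exprn_ge0// ltW// onepnorm_gt0.
  apply: (@le_trans _ _ ((1 + `|x|) ^+ m * (`|x1 x| * `|u x| + `|v x|))).
    by rewrite ler_wpM2l// (le_trans (ler_normD _ _))// mul1r normrM.
  rewrite mulrDr lerD//; apply: le_trans (H1 x); rewrite exprSr -mulrA ler_wpM2l// ler_wpM2r//.
  by rewrite (le_trans (x1_le x))// lerDr.
- move=> j; exists (pderiv j u), (fun x => (j == i1)%:R * u x + pderiv j v x).
  split; [exact: SW_pderiv|by apply: SW_lin => //; exact: SW_pderiv|].
  apply/funext => x; have [_ ->] := D j x.
  have [_ ->] := pderiv_x1M (@SW_derivable R _ Hu j x).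
  by rewrite !mul1r addrA.
Qed.

Lemma pderiv_x1E u j : SW u -> pderiv j (fun x => x1 x * u x) =
  (fun x => x1 x * pderiv j u x + (j == i1)%:R * u x).
Proof. by move=> Hu; apply/funext => x; have [] := pderiv_x1M (@SW_derivable R _ Hu j x). Qed.

Definition tau (T : Type) (h : V) (f : V -> T) : V -> T := fun x => f (x + h).

Lemma derivable_tau h u j x : derivable u (x + h) (e j) -> derivable (tau h u) x (e j).
Proof.
rewrite /derivable (_ : (fun t => t^-1 *: ((u \o shift (x + h)) (t *: e j) - u (x + h))) =
  (fun t => t^-1 *: ((tau h u \o shift x) (t *: e j) - tau h u x)))//.
by apply/funext => t /=; rewrite /tau addrA.
Qed.

Lemma pderiv_tau h u j : pderiv j (tau h u) = tau h (pderiv j u).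
Proof.
apply/funext => x; rewrite /pderiv /tau /derive.
rewrite (_ : (fun t => t^-1 *: ((u \o shift (x + h)) (t *: e j) - u (x + h))) =
  (fun t => t^-1 *: ((tau h u \o shift x) (t *: e j) - tau h u x)))//.
by apply/funext => t /=; rewrite /tau addrA.
Qed.

Lemma SW_tau h u : SW u -> SW (tau h u).
Proof.
move=> Hu; pose P w := exists2 u, SW u & w = tau h u.
apply: (@SW_coind R P); last by exists u.
move=> w [{}u {}Hu ->]; split.
- move=> x; apply: (@continuous_comp _ _ _ (fun x : V => x + h) u); last exact: SW_continuous.
  by apply: cvgD; [exact: cvg_id|exact: cvg_cst].
- by move=> j x; apply: derivable_tau; exact: SW_derivable.
- move=> m; have [M M0 HM] := rapid_local m (SW_rapid Hu) (normr_ge0 h).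
  by exists M => x; apply: HM; rewrite addrC addKr.
- by move=> j; exists (pderiv j u); [exact: SW_pderiv|exact: pderiv_tau].
Qed.

Lemma ler_dist_half (a b c eps : R) : `|a - b| < eps / 2 -> `|b - c| < eps / 2 -> `|a - c| <= eps.
Proof. by move=> h1 h2; rewrite (le_trans (ler_distD b _ _))//; lra. Qed.

Lemma second_difference_eq (a b c d t X Y : R) : t != 0 ->
  a - b - c + d = t * (t * X) -> a - c - b + d = t * (t * Y) -> X = Y.
Proof.
move=> t0 EX EY; suff : t * (t * X) = t * (t * Y) by move=> /(mulfI t0)/(mulfI t0).
by rewrite -EX -EY; ring.
Qed.

(* Both mixed differences equal the same second difference, which two mean value theorems
   turn into [t ^+ 2] times either mixed derivative at a nearby point. *)
Lemma pderiv_comm u i j : SW u -> pderiv i (pderiv j u) = pderiv j (pderiv i u).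
Proof.
move=> Hu; apply/funext => x.
have diff k l t : exists2 y : V, `|y - x| <= 2 * `|t| &
    u (x + t *: e k + t *: e l) - u (x + t *: e k) - u (x + t *: e l) + u x =
    t * (t * pderiv l (pderiv k u) y).
  have Hd := SWB (SW_tau (t *: e l) Hu) Hu.
  have [c ct] := @mvt_line R _ k x t (@SW_derivable R _ Hd k).
  rewrite (pderivB k (SW_tau _ Hu) Hu) (pderiv_tau _ _ k) /tau.
  have [c' ct'] := @mvt_line R _ l (x + c *: e k) t (@SW_derivable R _ (SW_pderiv k Hu) l).
  move=> -> E; exists (x + c *: e k + c' *: e l); last by rewrite -E; ring.
  rewrite -[x + _ + _]addrA addrAC subrr add0r (le_trans (ler_normD _ _))// mulr_natl mulr2n.
  by rewrite lerD// (le_trans (norm_basis _ _)).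
have cont k l : {for x, continuous (pderiv k (pderiv l u))} by exact: SW_continuous (SW_pderiv k (SW_pderiv l Hu)) x.
apply/eqP; rewrite -subr_eq0 -normr_le0; apply/ler_addgt0Pl => eps eps0; rewrite addr0.
have /cvgrPdist_lt/(_ _ (divr_gt0 eps0 (ltr0n _ 2)))/nbhs_ballP[r1 /= r10 H1] := cont i j.
have /cvgrPdist_lt/(_ _ (divr_gt0 eps0 (ltr0n _ 2)))/nbhs_ballP[r2 /= r20 H2] := cont j i.
pose t : R := Num.min r1 r2 / 4.
have t0 : (0 : R) < t by rewrite divr_gt0// lt_min r10.
have tn0 : t != 0 := lt0r_neq0 t0.
have tr : 2 * t < Num.min r1 r2 by rewrite /t; have : 0 < Num.min r1 r2 by [rewrite lt_min r10]; lra.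
move: tr; rewrite lt_min => /andP[tr1 tr2].
have [y yx Ey] := diff j i t; have [z zx Ez] := diff i j t.
rewrite gtr0_norm// in yx; rewrite gtr0_norm// in zx.
have Eyz : pderiv i (pderiv j u) y = pderiv j (pderiv i u) z.
  have Ex : x + t *: e j + t *: e i = x + t *: e i + t *: e j by exact: addrAC.
  by rewrite Ex in Ey; exact: (second_difference_eq tn0 Ey Ez).
have h1 : `|pderiv i (pderiv j u) x - pderiv i (pderiv j u) y| < eps / 2.
  by apply: H1; rewrite -ball_normE /= distrC (le_lt_trans yx).
have h2 : `|pderiv j (pderiv i u) x - pderiv j (pderiv i u) z| < eps / 2.
  by apply: H2; rewrite -ball_normE /= distrC (le_lt_trans zx).
rewrite -Eyz distrC in h2.
exact: (ler_dist_half h1 h2).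
Qed.

End SchwartzClosure.

(** * Integrals over segments *)

Section IntervalIntegrals.
Context (R : realType).
Local Notation leb := (@lebesgue_measure R).
Implicit Types (f g F : R -> R) (a b : R).

Lemma itv_integrable f a b : continuous f -> leb.-integrable `[a, b] (EFin \o f).
Proof.
move=> cf; apply: (@continuous_compact_integrable R f); first exact: segment_compact.
exact: continuous_subspaceT.
Qed.

Lemma itv_bound f a b (M : R) : continuous f -> a <= b ->
  (forall t, a <= t <= b -> `|f t| <= M) -> `|\int[leb]_(t in `[a, b]) f t| <= M * (b - a).
Proof.
move=> cf ab fM.
apply: le_trans (le_normr_Rintegral _ (itv_integrable a b cf)) _ => //.
have <- : \int[leb]_(t in `[a, b]) M = M * (b - a).
  rewrite Rintegral_cst//; congr (_ * _).
  have := lebesgue_measure_itv `[a, b]; rewrite /= lte_fin => ->.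
  by have [//|ba] := ltP a b; rewrite (le_anti (introT andP (conj ba ab))) subrr.
apply: le_Rintegral => //.
- by apply: (@itv_integrable (fun t => `|f t|)) => t; apply: cvg_norm; exact: cf.
- by apply: itv_integrable => t; exact: cvg_cst.
Qed.

Lemma itv_lin f g (k : R) a b : continuous f -> continuous g ->
  \int[leb]_(t in `[a, b]) (k * f t + g t) =
  k * \int[leb]_(t in `[a, b]) f t + \int[leb]_(t in `[a, b]) g t.
Proof.
move=> cf cg; rewrite RintegralD//.
- by rewrite RintegralZl//; exact: itv_integrable.
- by apply: (@itv_integrable (fun t => k * f t)) => t; apply: cvgMr; exact: cf.
- exact: itv_integrable.
Qed.

Lemma itv_sub f g a b : continuous f -> continuous g ->
  \int[leb]_(t in `[a, b]) (f t - g t) =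
  \int[leb]_(t in `[a, b]) f t - \int[leb]_(t in `[a, b]) g t.
Proof. by move=> cf cg; rewrite RintegralB//; exact: itv_integrable. Qed.

Lemma itv_FTC F f a b : a <= b -> continuous f -> (forall t : R, is_derive t 1 F (f t)) ->
  \int[leb]_(t in `[a, b]) f t = F b - F a.
Proof.
rewrite le_eqVlt => /predU1P[->|ab] cf dF.
  by rewrite set_itv1 subrr /Rintegral integral_set1.
have cF : continuous F.
  by move=> t; apply: differentiable_continuous; apply/derivable1_diffP; case: (dF t).
rewrite /Rintegral (@continuous_FTC2 _ f F)//.
- exact: continuous_subspaceT.
- split; [|exact: cvg_at_right_filter (cF a)|exact: cvg_at_left_filter (cF b)].
  by move=> t _; case: (dF t).
- by move=> t _; rewrite derive1E; have [_ ->] := dF t.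
Qed.

End IntervalIntegrals.

(** * Segment integrals in the central direction *)

Section AverageX4.
Context (R : realType).
Local Notation V := (R * R * R * R)%type.
Local Notation e := (@Defs.basis R).
Local Notation e4 := (@Defs.basis R (@i4)).
Local Notation SW := (@real_schwartz R).
Local Notation leb := (@lebesgue_measure R).
Implicit Types (u v : V -> R) (x y : V) (j : 'I_4) (t h k : R).

Lemma add4_sub (X a b c d : R) : X = (X - (a + b + c + d)) + a + b + c + d.
Proof. ring. Qed.

Lemma SW_lip4 u : SW u -> exists2 M : R, 0 <= M &
  forall x y, `|y - x| <= 1 -> `|u y - u x| <= M * `|y - x|.
Proof.
move=> Hu; have [M M0 HM] := SW_taylor Hu (lexx 0).
have B j : exists2 K : R, 0 <= K & forall x, `|pderiv j u x| <= K.
  have [K K0 HK] := SW_local (SW_pderiv j Hu) (lexx 0); exists K => // x.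
  have := HK x x; rewrite subrr normr0 lexx => /(_ isT) /le_trans; apply.
  by rewrite ler_piMr// Wt_le1.
have [K1 K10 H1] := B i1; have [K2 K20 H2] := B i2.
have [K3 K30 H3] := B i3; have [K4 K40 H4] := B i4.
exists (M + K1 + K2 + K3 + K4); first by rewrite !addr_ge0.
move=> x y; set z := y - x => z1.
have -> : y = x + z by rewrite addrC subrK.
clearbody z; case: z z1 => [[[a b] c] d] z1.
move: (lexx `|((a, b, c, d) : V)|); rewrite {1}normV//.
set rho : R := `|((a, b, c, d) : V)| in z1 * => /and4P[ar br cr dr].
have rho0 : 0 <= rho by apply: le_trans ar.
have := HM x x a b c d rho; rewrite subrr normr0 lexx => /(_ isT z1 ar br cr dr) T.
have P (s X K : R) : `|s| <= rho -> `|X| <= K -> `|s * X| <= K * rho.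
  by move=> sr XK; rewrite normrM mulrC ler_pM.
have T' : M * rho ^+ 2 * Wt x <= M * rho.
  rewrite -mulrA ler_wpM2l// expr2 -mulrA ler_piMr// mulr_ile1 ?Wt_le1//.
  exact: ltW (Wt_gt0 x).
rewrite (add4_sub (u (x + (a, b, c, d)) - u x) (a * pderiv i1 u x) (b * pderiv i2 u x) (c * pderiv i3 u x) (d * pderiv i4 u x)).
rewrite !mulrDl; do 4 (apply: le_trans (ler_normD _ _) _; apply: lerD; last by apply: P).
exact: le_trans T T'.
Qed.

Lemma line_continuous u j x : SW u -> continuous (fun t => u (x + t *: e j)).
Proof.
move=> Hu t; apply: differentiable_continuous; apply/derivable1_diffP.
by case: (is_derive_line (@SW_derivable R _ Hu j (x + t *: e j))).
Qed.

(** The direction e4 is central in the group, so this unnormalised average commutes with all four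
    fields, while X4 of it is a mere difference of two values of u. *)
Definition S4 (h : R) u : V -> R := fun x => \int[leb]_(t in `[0, h]) u (x + t *: e4).

Lemma near_line x t h : 0 <= t <= h -> `|x + t *: e4 - x| <= h.
Proof.
move=> /andP[t0 th]; rewrite addrAC subrr add0r (le_trans (norm_basis _ _))//.
by rewrite ger0_norm.
Qed.

Lemma S4_bound h u x (M : R) : 0 <= h -> SW u ->
  (forall t, 0 <= t <= h -> `|u (x + t *: e4)| <= M) -> `|S4 h u x| <= M * h.
Proof.
move=> h0 Hu HM; rewrite -[X in M * X]subr0; apply: itv_bound => //.
exact: line_continuous.
Qed.

Lemma S4_lin h u v k x : SW u -> SW v ->
  S4 h (fun x => k * u x + v x) x = k * S4 h u x + S4 h v x.
Proof. by move=> Hu Hv; apply: itv_lin; exact: line_continuous. Qed.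

Lemma S4_tau h z u : S4 h (tau z u) = tau z (S4 h u).
Proof. by apply/funext => x; apply: eq_Rintegral => t _; rewrite /tau addrAC. Qed.

Lemma S4_quad h u j : 0 <= h -> SW u -> exists2 M : R, 0 <= M & forall x s, `|s| <= 1 ->
  `|S4 h u (x + s *: e j) - S4 h u x - s * S4 h (pderiv j u) x| <= M * s ^+ 2.
Proof.
move=> h0 Hu; have [M M0 HM] := SW_taylor_dir j Hu h0; exists (M * h); first by rewrite mulr_ge0.
move=> x s s1; have Ht := SW_tau (s *: e j) Hu.
have Hw : SW (fun y => - s * pderiv j u y + (tau (s *: e j) u y - u y)).
  by apply: SW_lin; [exact: SW_pderiv|exact: SWB].
have -> : S4 h u (x + s *: e j) - S4 h u x - s * S4 h (pderiv j u) x =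
    S4 h (fun y => - s * pderiv j u y + (tau (s *: e j) u y - u y)) x.
  rewrite S4_lin; [|exact: SW_pderiv|exact: SWB].
  rewrite -[S4 h u (x + _)]/(tau (s *: e j) (S4 h u) x) -S4_tau.
  have -> : S4 h (fun y => tau (s *: e j) u y - u y) x = S4 h (tau (s *: e j) u) x - S4 h u x.
    by apply: itv_sub; exact: line_continuous.
  by rewrite mulNr addrC.
rewrite mulrAC; apply: S4_bound => // t th.
have := HM x (x + t *: e4) s (near_line x th) s1.
rewrite /tau mulNr addrC => /le_trans; apply.
by rewrite ler_piMr ?Wt_le1// mulr_ge0// sqr_ge0.
Qed.

Lemma pderiv_S4 h u j : 0 <= h -> SW u -> pderiv j (S4 h u) = S4 h (pderiv j u).
Proof.
move=> h0 Hu; apply/funext => x; have [M _ HM] := S4_quad j h0 Hu.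
by have [] := pderiv_quad (HM x).
Qed.

Lemma SW_S4 h u : 0 <= h -> SW u -> SW (S4 h u).
Proof.
move=> h0 Hu; pose P w := exists2 u, SW u & w = S4 h u.
apply: (@SW_coind R P); last by exists u.
move=> w [{}u {}Hu ->]; split.
- apply: lip_continuous => x; have [M M0 HM] := SW_lip4 Hu; exists (M * h) => y yx.
  have -> : S4 h u y - S4 h u x = S4 h (fun z => tau (y - x) u z - u z) x.
    have -> : S4 h (fun z => tau (y - x) u z - u z) x = S4 h (tau (y - x) u) x - S4 h u x.
      by apply: itv_sub; apply: line_continuous => //; exact: SW_tau.
    by rewrite S4_tau /tau; congr (S4 h u _ - _); rewrite addrC subrK.
  rewrite mulrAC; apply: S4_bound => //; first by apply: SWB => //; exact: SW_tau.
  move=> t _; rewrite /tau.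
  have := HM (x + t *: e4) (x + t *: e4 + (y - x)).
  by rewrite [X in `|X|]addrAC subrr add0r; apply.
- move=> j x; have [M _ HM] := S4_quad j h0 Hu; by have [] := pderiv_quad (HM x).
- move=> m; have [M M0 HM] := rapid_local m (SW_rapid Hu) h0; exists (M * h) => x.
  have n0 : 0 < (1 + `|x|) ^+ m by rewrite exprn_gt0// onepnorm_gt0.
  rewrite mulrC -ler_pdivlMr// mulrAC; apply: S4_bound => // t th.
  by rewrite ler_pdivlMr// mulrC; apply: HM; exact: near_line.
- by move=> j; exists (pderiv j u); [exact: SW_pderiv|exact: pderiv_S4].
Qed.

Lemma S4_d4 h u : 0 <= h -> SW u -> S4 h (pderiv i4 u) = (fun x => tau (h *: e4) u x - u x).
Proof.
move=> h0 Hu; apply/funext => x.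
have D t : is_derive t 1 (fun t => u (x + t *: e4)) (pderiv i4 u (x + t *: e4)).
  by apply: is_derive_line; exact: SW_derivable.
rewrite /S4 (itv_FTC h0 _ D); last by apply: line_continuous; exact: SW_pderiv.
by rewrite scale0r addr0.
Qed.

(** Such a function is constant on lines in the direction e4 and tends to 0 along them. *)
Lemma SW_d4_eq0 u : SW u -> (forall x, pderiv i4 u x = 0) -> forall x, u x = 0.
Proof.
move=> Hu d0 x.
have /rapidP/(_ 1)[M M0 HM] := SW_rapid Hu.
have E t : u (x + t *: e4) = u x.
  have [c _] := @mvt_line R _ i4 x t (@SW_derivable R _ Hu i4).
  by rewrite d0 mulr0 => /eqP; rewrite subr_eq0 => /eqP.
apply/eqP; rewrite -normr_le0; apply/ler_addgt0Pl => eps eps0; rewrite addr0.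
(* Far enough for |x + t e4| to be at least M / eps, where the decay forces |u x| <= eps. *)
pose t : R := M / eps + `|x|.
have t0 : 0 <= t by rewrite addr_ge0// divr_ge0// ltW.
have := HM (x + t *: e4); rewrite E expr1.
have nt : M / eps <= `|x + t *: e4|.
  have te : t <= `|t *: e4|.
    rewrite (basis_i4 R) scaleV mulr1 !mulr0 prod_normE /= le_max.
    by rewrite [X in _ || (_ <= X)]ger0_norm// lexx orbT.
  have := ler_normB (x + t *: e4) x; rewrite addrAC subrr add0r /t in te *; lra.
rewrite leNgt => H; rewrite leNgt; apply: contra H => ux.
have : M < (1 + M / eps) * eps by rewrite mulrDl mul1r divfK ?gt_eqF//; lra.
move=> /lt_le_trans; apply; rewrite ler_pM ?addr_ge0 ?divr_ge0 ?(ltW eps0) ?(ltW ux)//.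
by rewrite lerD2l.
Qed.

(* Both sides have the same derivative in x4 and decay. *)
Lemma S4_add h k u : 0 <= h -> 0 <= k -> SW u ->
  S4 (h + k) u = (fun x => S4 h u x + tau (h *: e4) (S4 k u) x).
Proof.
move=> h0 k0 Hu; apply/funext => x; apply/eqP; rewrite -subr_eq0; apply/eqP.
have hk : 0 <= h + k by rewrite addr_ge0.
have H1 := SW_S4 hk Hu; have H2 := SW_S4 h0 Hu; have H3 := SW_tau (h *: e4) (SW_S4 k0 Hu).
apply: (@SW_d4_eq0 (fun x => S4 (h + k) u x - (S4 h u x + tau (h *: e4) (S4 k u) x))).
  by apply: SWB => //; exact: SWD.
move=> y; rewrite (pderivB _ H1 (SWD H2 H3)) (pderivD _ H2 H3) (pderiv_tau _ _ i4).
rewrite !pderiv_S4// !S4_d4// /tau.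
have -> : y + h *: e4 + k *: e4 = y + (h + k) *: e4 by rewrite scalerDl addrA.
by move: (u (y + (h + k) *: e4)) (u (y + h *: e4)) (u y) => a b c; ring.
Qed.

End AverageX4.

(** * The left-invariant fields and their Laplacian *)

Section SchwartzL2.
Context (R : realType).
Local Notation V := (R * R * R * R)%type.
Local Notation mR := (measurableTypeR R).
Local Notation mV := (mR * mR * mR * mR)%type.
Local Notation e := (@Defs.basis R).
Local Notation e4 := (@Defs.basis R i4).
Local Notation SW := (@real_schwartz R).
Variable mu : {measure set mV -> \bar R}.
Hypothesis mu_shift : forall (f : mV -> \bar R) (h : V), measurable_fun setT f ->
  (forall x, (0 <= f x)%E) -> (\int[mu]_x (tau h f : mV -> \bar R) x = \int[mu]_x f x)%E.
Hypothesis mu_Wt : (\int[mu]_x (Wt (x : V))%:E < +oo)%E.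
Implicit Types (u v w : V -> R) (x y h : V) (j : 'I_4) (t : R).
Local Notation ip := (@ipr _ mV R mu).
Local Notation L2 := (@L2r _ mV R mu).

Lemma SW_measurable u : SW u -> measurable_fun [set: mV] (u : mV -> R).
Proof. by move=> /SW_continuous; exact: continuous_measurable_R4. Qed.

Lemma measurable_Wt : measurable_fun [set: mV] (@Wt R : mV -> R).
Proof. exact: (continuous_measurable_R4 (@continuous_Wt R)). Qed.

Lemma integrable_Wt : mu.-integrable [set: mV] (EFin \o (@Wt R : mV -> R)).
Proof.
apply/integrableP; split; first by apply/measurable_EFinP; exact: measurable_Wt.
rewrite (eq_integral (fun x : mV => (Wt (x : V))%:E))//.
by move=> x _ /=; rewrite gtr0_norm// Wt_gt0.
Qed.

Lemma SW_Wt u : SW u -> exists2 M : R, 0 <= M & forall x, `|u x| <= M * Wt x.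
Proof.
move=> Hu; have [M M0 HM] := SW_local Hu (lexx 0); exists M => // x.
by apply: HM; rewrite subrr normr0.
Qed.

Lemma Wt_L2 (f : mV -> R) (M : R) : measurable_fun setT f -> (forall x, `|f x| <= M * Wt (x : V)) -> L2 f.
Proof.
move=> mf fM; split => //.
apply: (@le_integrable_real _ _ _ _ _ (fun x : mV => M ^+ 2 * Wt (x : V))); last first.
- by apply: integrableZ_real; exact: integrable_Wt.
- move=> x; rewrite normrX; have w0 := ltW (Wt_gt0 (x : V)); have w1 := Wt_le1 (x : V).
  apply: (@le_trans _ _ ((M * Wt (x : V)) ^+ 2)).
    by rewrite lerXn2r ?nnegrE// (le_trans (normr_ge0 _) (fM x)).
  by rewrite exprMn ler_wpM2l ?sqr_ge0// expr2 ler_piMr.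
- exact: measurable_funX.
Qed.

Lemma SW_L2 u : SW u -> L2 u.
Proof. by move=> Hu; have [M _ HM] := SW_Wt Hu; apply: Wt_L2 HM; exact: SW_measurable. Qed.

Lemma measurable_tau (d' : measure_display) (T : measurableType d') (f : mV -> T) h :
  measurable_fun setT f -> measurable_fun [set: mV] (tau h f : mV -> T).
Proof.
move=> mf; apply: (measurableT_comp mf).
have -> : (fun x : mV => (x : V) + h) = @shift4 R h.1.1.1 h.1.1.2 h.1.2 h.2.
  apply/funext => -[[[a b] c] d]; case: h => [[[ha hb] hc] hd].
  by rewrite /shift4 /= addrC.
exact: measurable_shift4.
Qed.

Lemma Rintegral_tau (f : mV -> R) h : mu.-integrable setT (EFin \o f) ->
  mu.-integrable setT (EFin \o (tau h f : mV -> R)) /\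
  \int[mu]_x (tau h f : mV -> R) x = \int[mu]_x f x.
Proof.
move=> fi; have /integrableP[mf fi'] := fi.
have mt : measurable_fun [set: mV] (EFin \o (tau h f : mV -> R)) by exact: (measurable_tau h mf).
split.
  apply/integrableP; split => //; apply: le_lt_trans fi'.
  rewrite -[leRHS](@mu_shift _ h)//.
  by apply/measurable_EFinP; apply: measurableT_comp => //; apply/measurable_EFinP.
rewrite /Rintegral; congr fine; rewrite integralE [RHS]integralE; congr (_ - _)%E.
  rewrite -[RHS](mu_shift h (measurable_funepos mf) (funepos_ge0 _)).
  by apply: eq_integral => x _; rewrite /tau !funeposE.
rewrite -[RHS](mu_shift h (measurable_funeneg mf) (funeneg_ge0 _)).
by apply: eq_integral => x _; rewrite /tau !funenegE.
Qed.

Lemma L2_tau (f : mV -> R) h : L2 f -> L2 (tau h f).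
Proof.
by move=> [mf fi]; split; [exact: measurable_tau|have [] := Rintegral_tau h fi].
Qed.

Lemma ip_tau (f g : mV -> R) h : L2 f -> L2 g -> ip (tau h f) (tau h g) = ip f g.
Proof. by move=> Hf Hg; have [_] := Rintegral_tau h (L2r_mul Hf Hg). Qed.

Lemma tau_tau (T : Type) (f : V -> T) h h' : tau h (tau h' f) = tau (h + h') f.
Proof. by apply/funext => x; rewrite /tau addrA. Qed.

Lemma tau0 (T : Type) (f : V -> T) : tau 0 f = f.
Proof. by apply/funext => x; rewrite /tau addr0. Qed.

Lemma ip_tau_adj (f g : mV -> R) h : L2 f -> L2 g -> ip (tau h f) g = ip f (tau (- h) g).
Proof.
move=> Hf Hg; rewrite -[in RHS](ip_tau h Hf (L2_tau (- h) Hg)).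
by rewrite tau_tau subrr tau0.
Qed.

Lemma ip_Wt (g : mV -> R) : L2 g -> exists2 K : R, 0 <= K & forall (f : mV -> R) (M : R),
  measurable_fun setT f -> 0 <= M -> (forall x, `|f x| <= M * Wt (x : V)) -> `|ip f g| <= M * K.
Proof.
move=> Hg; have HW : L2 (@Wt R).
  apply: (@Wt_L2 _ 1); first exact: measurable_Wt.
  by move=> x; rewrite mul1r gtr0_norm// Wt_gt0.
have Hn : L2 (fun x => `|g x|).
  by apply: (L2r_le _ _ Hg) => [|x]; [apply: measurableT_comp => //; exact: L2r_measurable Hg|rewrite normr_id].
exists (ip (@Wt R) (fun x => `|g x|)).
  by apply: Rintegral_ge0 => x _; rewrite mulr_ge0// ltW// Wt_gt0.
move=> f M mf M0 fM; have Hf := Wt_L2 mf fM.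
apply: le_trans (le_normr_Rintegral measurableT (L2r_mul Hf Hg)) _.
rewrite -iprZl//; apply: le_Rintegral => //.
- exact: (integrable_abse (L2r_mul Hf Hg)).
- by apply: L2r_mul => //; exact: L2rZ.
- by move=> x _; rewrite normrM ler_wpM2r.
Qed.

Lemma small_eq0 (X C : R) : (forall t, 0 < t -> t <= 1 -> `|t * X| <= C * t ^+ 2) -> X = 0.
Proof.
move=> H; apply/eqP; rewrite -normr_le0; apply/ler_addgt0Pl => eps eps0; rewrite addr0.
have C1 : 0 < `|C| + 1 by rewrite ltr_wpDl.
pose t : R := Num.min 1 (eps / (`|C| + 1)).
have t0 : 0 < t by rewrite lt_min ltr01 divr_gt0.
have t1 : t <= 1 by rewrite ge_min lexx.
have te : t * (`|C| + 1) <= eps by rewrite -ler_pdivlMr// ge_min lexx orbT.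
have := H t t0 t1; rewrite normrM (gtr0_norm t0) expr2 mulrCA ler_pM2l// => /le_trans; apply.
apply: le_trans te; rewrite mulrC ler_wpM2l ?(ltW t0)//.
by rewrite (le_trans (ler_norm _))// lerDl.
Qed.

(* Translation invariance of the measure, differentiated. *)
Lemma by_parts u v j : SW u -> SW v -> ip (pderiv j u) v = - ip u (pderiv j v).
Proof.
move=> Hu Hv; apply/eqP; rewrite -subr_eq0 opprK; apply/eqP.
have du := SW_pderiv j Hu; have dv := SW_pderiv j Hv.
have L := SW_L2.
have [Mu Mu0 HMu] := SW_taylor_dir j Hu (lexx 0).
have [Mv Mv0 HMv] := SW_taylor_dir j Hv (lexx 0).
have [Ku Ku0 HKu] := ip_Wt (L _ Hu); have [Kv Kv0 HKv] := ip_Wt (L _ Hv).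
apply: (@small_eq0 _ (Mu * Kv + Mv * Ku)) => t t0 t1.
pose z := t *: e j.
have tu := SW_tau z Hu; have tv := SW_tau (- z) Hv.
have Eu : ip (tau z u) v - ip u v - t * ip (pderiv j u) v =
    ip (fun x => (tau z u x - u x) - t * pderiv j u x) v.
  by rewrite !iprBl ?iprZl//; try exact: L; [apply: L2rB|apply: L2rZ]; exact: L.
have Ev : ip u (tau (- z) v) - ip u v + t * ip u (pderiv j v) =
    ip (fun x => (tau (- z) v x - v x) - (- t) * pderiv j v x) u.
  rewrite !iprBl ?iprZl//; try exact: L; [|by apply: L2rB; exact: L|by apply: L2rZ; exact: L].
  by rewrite mulNr opprK iprC [ip u v]iprC [ip u (pderiv j v)]iprC.
have bu : `|ip (tau z u) v - ip u v - t * ip (pderiv j u) v| <= Mu * t ^+ 2 * Kv.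
  rewrite Eu; apply: HKv.
  - by apply: SW_measurable; apply: SWB; [exact: SWB|exact: SWZ].
  - by rewrite mulr_ge0// sqr_ge0.
  - move=> x; rewrite /tau; apply: HMu; first by rewrite subrr normr0.
    by rewrite gtr0_norm.
have bv : `|ip u (tau (- z) v) - ip u v + t * ip u (pderiv j v)| <= Mv * t ^+ 2 * Ku.
  rewrite Ev; apply: HKu.
  - by apply: SW_measurable; apply: SWB; [exact: SWB|exact: SWZ].
  - by rewrite mulr_ge0// sqr_ge0.
  - move=> x; rewrite /tau /z -scaleNr -(sqrrN t); apply: HMv; first by rewrite subrr normr0.
    by rewrite normrN gtr0_norm.
rewrite ip_tau_adj in bu; [|exact: L..].
move: bu bv; move: (ip u (tau (- z) v)) (ip u v) (ip (pderiv j u) v) (ip u (pderiv j v)).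
move=> A B X Y bu bv; have -> : t * (X + Y) = (A - B + t * Y) - (A - B - t * X) by ring.
by rewrite (le_trans (ler_normB _ _))//; lra.
Qed.

(** Real forms of [X1] to [X4]. Complex functions are reached through their real and imaginary parts
    ([X2E], [X3E], [sum_squaresE]). *)
Definition Y1 u : V -> R := pderiv i1 u.
Definition Y2 u : V -> R := fun x =>
  pderiv i2 u x - x1 x * pderiv i3 u x + x1 x ^+ 2 / 2 * pderiv i4 u x.
Definition Y3 u : V -> R := fun x => pderiv i3 u x - x1 x * pderiv i4 u x.
Definition Y4 u : V -> R := pderiv i4 u.

Definition Lap u : V -> R := fun x => - (Y1 (Y1 u) x + Y2 (Y2 u) x + Y3 (Y3 u) x + Y4 (Y4 u) x).

Lemma Y2E u : Y2 u = (fun x => pderiv i2 u x - x1 x * pderiv i3 u x +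
  2^-1 * (x1 x * (x1 x * pderiv i4 u x))).
Proof.
apply/funext => x; rewrite /Y2; congr (_ + _).
by move: (x1 x) (pderiv i4 u x) => a b; field.
Qed.

Lemma SW_Y1 u : SW u -> SW (Y1 u). Proof. exact: SW_pderiv. Qed.
Lemma SW_Y4 u : SW u -> SW (Y4 u). Proof. exact: SW_pderiv. Qed.
Lemma SW_Y3 u : SW u -> SW (Y3 u).
Proof. by move=> Hu; apply: SWB; [exact: SW_pderiv|apply: SW_x1; exact: SW_pderiv]. Qed.
Lemma SW_Y2 u : SW u -> SW (Y2 u).
Proof.
move=> Hu; rewrite Y2E; apply: SWD; first by apply: SWB; [exact: SW_pderiv|apply: SW_x1; exact: SW_pderiv].
by apply: SWZ; do 2 apply: SW_x1; exact: SW_pderiv.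
Qed.
Lemma SW_Lap u : SW u -> SW (Lap u).
Proof.
move=> Hu; exact: (SWN (SWD (SWD (SWD (SW_Y1 (SW_Y1 Hu)) (SW_Y2 (SW_Y2 Hu)))
  (SW_Y3 (SW_Y3 Hu))) (SW_Y4 (SW_Y4 Hu)))).
Qed.

Lemma ip_x1 u v : ip (fun x => x1 x * u x) v = ip u (fun x => x1 x * v x).
Proof. by apply: eq_Rintegral => x _; rewrite [x1 _ * u _]mulrC -mulrA. Qed.

Lemma i2n1 : (i2 == i1) = false. Proof. by rewrite -val_eqE /= !inordK. Qed.
Lemma i3n1 : (i3 == i1) = false. Proof. by rewrite -val_eqE /= !inordK. Qed.
Lemma i4n1 : (i4 == i1) = false. Proof. by rewrite -val_eqE /= !inordK. Qed.

Lemma pderiv_x1n u j : (j == i1) = false -> SW u ->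
  pderiv j (fun x => x1 x * u x) = (fun x => x1 x * pderiv j u x).
Proof. by move=> j1 Hu; rewrite pderiv_x1E// j1; apply/funext => x; rewrite mul0r addr0. Qed.

Lemma Y1_anti u v : SW u -> SW v -> ip (Y1 u) v = - ip u (Y1 v).
Proof. exact: by_parts. Qed.
Lemma Y4_anti u v : SW u -> SW v -> ip (Y4 u) v = - ip u (Y4 v).
Proof. exact: by_parts. Qed.

(** Multiplication by x1 is symmetric and commutes with every derivative but the first, so the
    product stays antisymmetric. *)
Lemma ip_x1_anti u v j : (j == i1) = false -> SW u -> SW v ->
  ip (fun x => x1 x * pderiv j u x) v = - ip u (fun x => x1 x * pderiv j v x).
Proof. by move=> j1 Hu Hv; rewrite ip_x1 (by_parts _ Hu (SW_x1 Hv)) pderiv_x1n. Qed.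

Lemma ip_x1x1_anti u v j : (j == i1) = false -> SW u -> SW v ->
  ip (fun x => x1 x * (x1 x * pderiv j u x)) v = - ip u (fun x => x1 x * (x1 x * pderiv j v x)).
Proof.
move=> j1 Hu Hv; rewrite ip_x1 (ip_x1_anti j1 Hu (SW_x1 Hv)) (pderiv_x1n j1 Hv).
by [].
Qed.

Lemma Y3_anti u v : SW u -> SW v -> ip (Y3 u) v = - ip u (Y3 v).
Proof.
move=> Hu Hv; have L := SW_L2; have D := @SW_pderiv R; have X := @SW_x1 R.
have A i (w : V -> R) : SW w -> L2 (pderiv i w) by move=> Hw; exact: (L _ (D _ _ Hw)).
have B i (w : V -> R) : SW w -> L2 (fun x => x1 x * pderiv i w x) by move=> Hw; exact: (L _ (X _ (D _ _ Hw))).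
rewrite (iprBl (A i3 _ Hu) (B i4 _ Hu) (L _ Hv)) (iprBr (A i3 _ Hv) (B i4 _ Hv) (L _ Hu)).
by rewrite (ip_x1_anti i4n1 Hu Hv) (by_parts _ Hu Hv) opprB opprK addrC.
Qed.

Lemma Y2_anti u v : SW u -> SW v -> ip (Y2 u) v = - ip u (Y2 v).
Proof.
move=> Hu Hv; have L := SW_L2; have D := @SW_pderiv R; have X := @SW_x1 R.
have A i (w : V -> R) : SW w -> L2 (pderiv i w) by move=> Hw; exact: (L _ (D _ _ Hw)).
have B i (w : V -> R) : SW w -> L2 (fun x => x1 x * pderiv i w x) by move=> Hw; exact: (L _ (X _ (D _ _ Hw))).
have C (w : V -> R) : SW w -> L2 (fun x => 2^-1 * (x1 x * (x1 x * pderiv i4 w x))).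
  by move=> Hw; exact: (L2rZ _ (L _ (X _ (X _ (D _ _ Hw))))).
have C' (w : V -> R) : SW w -> L2 (fun x => x1 x * (x1 x * pderiv i4 w x)).
  by move=> Hw; exact: (L _ (X _ (X _ (D _ _ Hw)))).
have Lu := L _ Hu; have Lv := L _ Hv.
rewrite !Y2E (iprDl (L2rB (A i2 _ Hu) (B i3 _ Hu)) (C _ Hu) Lv).
rewrite (iprDr (L2rB (A i2 _ Hv) (B i3 _ Hv)) (C _ Hv) Lu).
rewrite (iprBl (A i2 _ Hu) (B i3 _ Hu) Lv) (iprBr (A i2 _ Hv) (B i3 _ Hv) Lu).
rewrite (iprZl _ (C' _ Hu) Lv) (iprZr _ (C' _ Hv) Lu).
rewrite (ip_x1_anti i3n1 Hu Hv) (by_parts _ Hu Hv) (ip_x1x1_anti i4n1 Hu Hv).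
by move: (ip u _) (ip u _) (ip u _) => p q r; ring.
Qed.

Lemma pderiv_Y3 u j : SW u -> pderiv j (Y3 u) =
  (fun x => Y3 (pderiv j u) x - (j == i1)%:R * pderiv i4 u x).
Proof.
move=> Hu; have D := @SW_pderiv R; have X := @SW_x1 R.
rewrite (pderivB j (D _ i3 Hu) (X _ (D _ i4 Hu))) (pderiv_x1E j (D _ i4 Hu)).
rewrite (pderiv_comm j i3 Hu) (pderiv_comm j i4 Hu).
by apply/funext => x; rewrite /Y3 opprD addrA.
Qed.

Lemma pderiv_Y2 u j : SW u -> pderiv j (Y2 u) =
  (fun x => Y2 (pderiv j u) x - (j == i1)%:R * Y3 u x).
Proof.
move=> Hu; have D := @SW_pderiv R; have X := @SW_x1 R.
have H4 := D _ i4 Hu; have H3 := D _ i3 Hu; have H2 := D _ i2 Hu.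
rewrite Y2E (pderivD j (SWB H2 (X _ H3)) (SWZ _ (X _ (X _ H4)))) (pderivB j H2 (X _ H3)).
rewrite (pderivZ _ j (X _ (X _ H4))) (pderiv_x1E j (X _ H4)) (pderiv_x1E j H4) (pderiv_x1E j H3).
rewrite (pderiv_comm j i2 Hu) (pderiv_comm j i3 Hu) (pderiv_comm j i4 Hu) Y2E.
apply/funext => x; rewrite /Y3.
move: (x1 x) (pderiv i4 u x) (pderiv i3 u x) (j == i1)%:R => a b c d.
by move: (pderiv _ _ x) (pderiv _ _ x) (pderiv _ _ x) => p q r; field.
Qed.

Lemma pderiv_Y3n u j : (j == i1) = false -> SW u -> pderiv j (Y3 u) = Y3 (pderiv j u).
Proof. by move=> j1 Hu; rewrite (pderiv_Y3 j Hu) j1; apply/funext => x; rewrite mul0r subr0. Qed.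

Lemma pderiv_Y2n u j : (j == i1) = false -> SW u -> pderiv j (Y2 u) = Y2 (pderiv j u).
Proof. by move=> j1 Hu; rewrite (pderiv_Y2 j Hu) j1; apply/funext => x; rewrite mul0r subr0. Qed.

Lemma Y12 u : SW u -> Y1 (Y2 u) = (fun x => Y2 (Y1 u) x - Y3 u x).
Proof. by move=> Hu; rewrite /Y1 pderiv_Y2// eqxx; apply/funext => x; rewrite mul1r. Qed.
Lemma Y13 u : SW u -> Y1 (Y3 u) = (fun x => Y3 (Y1 u) x - Y4 u x).
Proof. by move=> Hu; rewrite /Y1 pderiv_Y3// eqxx; apply/funext => x; rewrite mul1r. Qed.
Lemma Y14 u : SW u -> Y1 (Y4 u) = Y4 (Y1 u).
Proof. exact: pderiv_comm. Qed.
Lemma Y24 u : SW u -> Y2 (Y4 u) = Y4 (Y2 u).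
Proof. by move=> Hu; rewrite [in RHS]/Y4 (pderiv_Y2n i4n1 Hu). Qed.
Lemma Y34 u : SW u -> Y3 (Y4 u) = Y4 (Y3 u).
Proof. by move=> Hu; rewrite [in RHS]/Y4 (pderiv_Y3n i4n1 Hu). Qed.

Lemma Y23_identity (a p q r s t : R) :
  p - a * q - a * (r - a * s) + a ^+ 2 / 2 * (s - a * t) =
  (p - a * r + a ^+ 2 / 2 * s) - a * (q - a * s + a ^+ 2 / 2 * t).
Proof. by field. Qed.

Lemma Y23 u : SW u -> Y2 (Y3 u) = Y3 (Y2 u).
Proof.
move=> Hu; apply/funext => x.
rewrite [in RHS]/Y3 (pderiv_Y2n i3n1 Hu) (pderiv_Y2n i4n1 Hu).
rewrite [LHS]/Y2 (pderiv_Y3n i2n1 Hu) (pderiv_Y3n i3n1 Hu) (pderiv_Y3n i4n1 Hu) /Y3 /Y2.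
have -> : pderiv i4 (pderiv i3 u) = pderiv i3 (pderiv i4 u) by exact: pderiv_comm.
have -> : pderiv i4 (pderiv i2 u) = pderiv i2 (pderiv i4 u) by exact: pderiv_comm.
have -> : pderiv i3 (pderiv i2 u) = pderiv i2 (pderiv i3 u) by exact: pderiv_comm.
exact: Y23_identity.
Qed.

End SchwartzL2.

(** * Second-order estimates from the commutation relations *)

Section FieldEstimates.
Context (R : realFieldType) (E : lmodType R) (S : E -> Prop) (ip : E -> E -> R).
Hypothesis SD : forall f g, S f -> S g -> S (f + g).
Hypothesis SZ : forall k f, S f -> S (k *: f).
Hypothesis ipC : forall f g, ip f g = ip g f.
Hypothesis ipD : forall f g h, S f -> S g -> S h -> ip (f + g) h = ip f h + ip g h.
Hypothesis ipZ : forall k f g, S f -> S g -> ip (k *: f) g = k * ip f g.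
Hypothesis ip0 : forall f, 0 <= ip f f.
Variables Y1 Y2 Y3 Y4 : E -> E.
Definition antisym (A : E -> E) : Prop :=
  (forall u, S u -> S (A u)) /\ (forall u v, S u -> S v -> ip (A u) v = - ip u (A v)).
Hypotheses (aY1 : antisym Y1) (aY2 : antisym Y2) (aY3 : antisym Y3) (aY4 : antisym Y4).
Hypothesis Y12 : forall u, S u -> Y1 (Y2 u) = Y2 (Y1 u) - Y3 u.
Hypothesis Y13 : forall u, S u -> Y1 (Y3 u) = Y3 (Y1 u) - Y4 u.
Hypothesis Y14 : forall u, S u -> Y1 (Y4 u) = Y4 (Y1 u).
Hypothesis Y23 : forall u, S u -> Y2 (Y3 u) = Y3 (Y2 u).
Hypothesis Y24 : forall u, S u -> Y2 (Y4 u) = Y4 (Y2 u).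
Hypothesis Y34 : forall u, S u -> Y3 (Y4 u) = Y4 (Y3 u).
Local Notation N f := (ip f f).

Definition sumsq u : E := - (Y1 (Y1 u) + Y2 (Y2 u) + Y3 (Y3 u) + Y4 (Y4 u)).

Let SY1 u : S u -> S (Y1 u). Proof. exact: aY1.1. Qed.
Let SY2 u : S u -> S (Y2 u). Proof. exact: aY2.1. Qed.
Let SY3 u : S u -> S (Y3 u). Proof. exact: aY3.1. Qed.
Let SY4 u : S u -> S (Y4 u). Proof. exact: aY4.1. Qed.

Let SN f : S f -> S (- f). Proof. by move=> Hf; rewrite -scaleN1r; exact: SZ. Qed.

Let ipN f g : S f -> S g -> ip (- f) g = - ip f g.
Proof. by move=> Hf Hg; rewrite -scaleN1r ipZ// mulN1r. Qed.

Let Ssum u : S u -> S (sumsq u).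
Proof.
move=> Hu; exact: (SN (SD (SD (SD (SY1 (SY1 Hu)) (SY2 (SY2 Hu))) (SY3 (SY3 Hu))) (SY4 (SY4 Hu)))).
Qed.

Lemma sumsqE u v : S u -> S v -> ip (sumsq u) v =
  - (ip (Y1 (Y1 u)) v + ip (Y2 (Y2 u)) v + ip (Y3 (Y3 u)) v + ip (Y4 (Y4 u)) v).
Proof.
move=> Hu Hv; have l1 := SY1 (SY1 Hu); have l2 := SY2 (SY2 Hu).
have l3 := SY3 (SY3 Hu); have l4 := SY4 (SY4 Hu).
by rewrite ipN ?ipD//; do !apply: SD.
Qed.

Lemma sumsq_form u v : S u -> S v -> ip (sumsq u) v =
  ip (Y1 u) (Y1 v) + ip (Y2 u) (Y2 v) + ip (Y3 u) (Y3 v) + ip (Y4 u) (Y4 v).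
Proof.
move=> Hu Hv; rewrite sumsqE// aY1.2 ?aY2.2 ?aY3.2 ?aY4.2//; try by [exact: SY1|exact: SY2|exact: SY3|exact: SY4].
by rewrite -!opprD opprK.
Qed.

Lemma sumsq_sym u v : S u -> S v -> ip (sumsq u) v = ip u (sumsq v).
Proof.
move=> Hu Hv; rewrite sumsq_form// [RHS]ipC sumsq_form//.
by rewrite (ipC (Y1 u)) (ipC (Y2 u)) (ipC (Y3 u)) (ipC (Y4 u)).
Qed.

Lemma sumsq_ge0 u : S u -> 0 <= ip (sumsq u) u.
Proof. by move=> Hu; rewrite sumsq_form// !addr_ge0. Qed.

Lemma Y4_le_sumsq u : S u -> N (Y4 u) <= ip (sumsq u) u.
Proof. by move=> Hu; rewrite sumsq_form// lerDr !addr_ge0. Qed.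

Lemma ip_amgm f g : S f -> S g -> `|ip f g| <= N f + 4^-1 * N g.
Proof.
move=> Hf Hg; rewrite ler_norml.
have H (k : R) : 0 <= N f + (k ^+ 2 * N g - 2 * k * ip f g).
  have := ip0 (f + (- k) *: g); have Hk := SZ (- k) Hg.
  rewrite ipD ?ipZ//; [|exact: SD..]; rewrite ipC ipD// [ip g (_ + _)]ipC ipD//.
  rewrite !ipZ// (ipC g f); move: (ip f f) (ip f g) (ip g g) => a b c; lra.
by apply/andP; split; [have := H (- 2^-1)|have := H 2^-1]; lra.
Qed.

(** Integration by parts, moving one A and then one B across. It shows that a cross term of |L u|^2
    is a square up to terms containing the commutator s C. *)
Lemma pair_identity A B C (s : R) u : antisym A -> antisym B -> (forall w, S w -> S (C w)) ->
  (forall w, S w -> A (B w) = B (A w) + s *: C w) -> S u ->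
  ip (A (A u)) (B (B u)) = N (A (B u)) - s * ip (C u) (A (B u)) - s * ip (A u) (C (B u)).
Proof.
move=> [HA aA] [HB aB] HC com Hu.
have Au := HA _ Hu; have Bu := HB _ Hu; have Cu := HC _ Hu.
have BA := HB _ Au; have AB := HA _ Bu; have CB := HC _ Bu.
rewrite (aA _ _ Au (HB _ Bu)) (com _ Bu) ipC ipD ?ipZ//; [|exact: HB|exact: SZ].
have := aB _ _ Au AB.
have -> : ip (B (A u)) (A (B u)) = N (A (B u)) - s * ip (C u) (A (B u)).
  by rewrite {2}(com _ Hu) ipD ?ipZ//; [ring|exact: SZ].
rewrite (ipC (B (A (B u)))) (ipC (C (B u))).
by move: (ip (A u) (B (A (B u)))) (ip _ _) (ip _ _) (ip _ _) => p q r t H; lra.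
Qed.

Lemma pair_eq A B u : antisym A -> antisym B ->
  (forall w, S w -> A (B w) = B (A w)) -> S u -> ip (A (A u)) (B (B u)) = N (A (B u)).
Proof.
move=> hA hB com Hu; rewrite (pair_identity (s := 0) hA hB hA.1 _ Hu).
  by rewrite !mul0r !subr0.
by move=> w Hw; rewrite com// scale0r addr0.
Qed.

(** Each commutator term is split with weights 1 and 1/4, the quarter falling on the factor of
    second order so that it can be absorbed. *)
Lemma pair_ge A B C (s : R) u : `|s| = 1 -> antisym A -> antisym B -> (forall w, S w -> S (C w)) ->
  (forall w, S w -> A (B w) = B (A w) + s *: C w) -> S u ->
  N (A (B u)) - (N (C u) + 4^-1 * N (A (B u))) - (N (A u) + 4^-1 * N (C (B u)))
  <= ip (A (A u)) (B (B u)).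
Proof.
move=> s1 hA hB HC com Hu; rewrite (pair_identity hA hB HC com Hu).
have [HA _] := hA; have [HB _] := hB.
have h1 := ip_amgm (HC _ Hu) (HA _ (HB _ Hu)).
have h2 := ip_amgm (HA _ Hu) (HC _ (HB _ Hu)).
have b (X Z : R) : `|X| <= Z -> s * X <= Z.
  by move=> XZ; rewrite (le_trans (ler_norm _))// normrM s1 mul1r.
by apply: lerB; [apply: lerB => //; exact: b|exact: b].
Qed.

Definition first_order u : R := N (Y1 u) + N (Y2 u) + N (Y3 u) + N (Y4 u).

Definition second_order u : R := first_order (Y1 u) + first_order (Y2 u) +
  first_order (Y3 u) + first_order (Y4 u).

Lemma first_order_le u : S u -> first_order u <= N (sumsq u) + N u.
Proof.
move=> Hu; rewrite /first_order -sumsq_form//.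
have := ip_amgm (Ssum Hu) Hu; have := ip0 u.
by have := ler_norm (ip (sumsq u) u); move: (ip _ _) (ip _ _) (ip _ _) => a b c; lra.
Qed.

Lemma sumsq_norm u : S u -> N (sumsq u) =
  N (Y1 (Y1 u)) + N (Y2 (Y2 u)) + N (Y3 (Y3 u)) + N (Y4 (Y4 u)) +
  ip (Y1 (Y1 u)) (Y2 (Y2 u)) + ip (Y2 (Y2 u)) (Y1 (Y1 u)) +
  ip (Y1 (Y1 u)) (Y3 (Y3 u)) + ip (Y3 (Y3 u)) (Y1 (Y1 u)) +
  2 * ip (Y1 (Y1 u)) (Y4 (Y4 u)) + 2 * ip (Y2 (Y2 u)) (Y3 (Y3 u)) +
  2 * ip (Y2 (Y2 u)) (Y4 (Y4 u)) + 2 * ip (Y3 (Y3 u)) (Y4 (Y4 u)).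
Proof.
move=> Hu; have l1 := SY1 (SY1 Hu); have l2 := SY2 (SY2 Hu).
have l3 := SY3 (SY3 Hu); have l4 := SY4 (SY4 Hu).
rewrite sumsqE//; last exact: Ssum.
rewrite ![ip _ (sumsq u)]ipC !sumsqE//.
rewrite (ipC (Y2 (Y2 u)) (Y1 (Y1 u))) (ipC (Y3 (Y3 u)) (Y1 (Y1 u))) (ipC (Y4 (Y4 u)) (Y1 (Y1 u))).
rewrite (ipC (Y3 (Y3 u)) (Y2 (Y2 u))) (ipC (Y4 (Y4 u)) (Y2 (Y2 u))) (ipC (Y4 (Y4 u)) (Y3 (Y3 u))).
by ring.
Qed.

(** In |L u|^2 the commuting pairs contribute exact squares. The pairs (1,2) and (1,3), taken in
    both orders, contribute squares less first-order terms and less quarters of second-order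
    squares; the squares in the expansion absorb the quarters, and [first_order_le] bounds the
    rest. *)
Lemma second_order_le u : S u -> second_order u <= 8 * (N (sumsq u) + N u).
Proof.
move=> Hu; have F := first_order_le Hu.
have o1 : `|1 : R| = 1 by rewrite normr1.
have om : `|-1 : R| = 1 by rewrite normrN1.
have C12 w : S w -> Y1 (Y2 w) = Y2 (Y1 w) + (-1) *: Y3 w by move=> Hw; rewrite Y12// scaleN1r.
have C21 w : S w -> Y2 (Y1 w) = Y1 (Y2 w) + 1 *: Y3 w by move=> Hw; rewrite Y12// scale1r subrK.
have C13 w : S w -> Y1 (Y3 w) = Y3 (Y1 w) + (-1) *: Y4 w by move=> Hw; rewrite Y13// scaleN1r.
have C31 w : S w -> Y3 (Y1 w) = Y1 (Y3 w) + 1 *: Y4 w by move=> Hw; rewrite Y13// scale1r subrK.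
have p12 := pair_ge om aY1 aY2 SY3 C12 Hu.
have p21 := pair_ge o1 aY2 aY1 SY3 C21 Hu.
have p13 := pair_ge om aY1 aY3 SY4 C13 Hu.
have p31 := pair_ge o1 aY3 aY1 SY4 C31 Hu.
have := sumsq_norm Hu.
rewrite (pair_eq aY1 aY4 Y14 Hu) (pair_eq aY2 aY3 Y23 Hu) (pair_eq aY2 aY4 Y24 Hu) (pair_eq aY3 aY4 Y34 Hu).
move: F p12 p21 p13 p31; rewrite /second_order /first_order.
rewrite -(Y14 Hu) -(Y23 Hu) -(Y24 Hu) -(Y34 Hu).
have n0 := ip0 u.
have n1 := ip0 (Y1 u); have n2 := ip0 (Y2 u); have n3 := ip0 (Y3 u); have n4 := ip0 (Y4 u).
have m1 := ip0 (Y1 (Y1 u)); have m2 := ip0 (Y2 (Y2 u)); have m3 := ip0 (Y3 (Y3 u)).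
have m4 := ip0 (Y4 (Y4 u)); have m12 := ip0 (Y1 (Y2 u)); have m21 := ip0 (Y2 (Y1 u)).
have m13 := ip0 (Y1 (Y3 u)); have m31 := ip0 (Y3 (Y1 u)); have m14 := ip0 (Y1 (Y4 u)).
have m23 := ip0 (Y2 (Y3 u)); have m24 := ip0 (Y2 (Y4 u)); have m34 := ip0 (Y3 (Y4 u)).
move: n0 n1 n2 n3 n4 m1 m2 m3 m4 m12 m21 m13 m31 m14 m23 m24 m34.
move: (N (sumsq u)) (ip (Y1 (Y1 u)) (Y2 (Y2 u))) (ip (Y2 (Y2 u)) (Y1 (Y1 u))).
move: (ip (Y1 (Y1 u)) (Y3 (Y3 u))) (ip (Y3 (Y3 u)) (Y1 (Y1 u))).
move: (N u) (N (Y1 u)) (N (Y2 u)) (N (Y3 u)) (N (Y4 u)) (N (Y1 (Y1 u))) (N (Y2 (Y2 u))).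
move: (N (Y3 (Y3 u))) (N (Y4 (Y4 u))) (N (Y1 (Y2 u))) (N (Y2 (Y1 u))) (N (Y1 (Y3 u))).
move: (N (Y3 (Y1 u))) (N (Y1 (Y4 u))) (N (Y2 (Y3 u))) (N (Y2 (Y4 u))) (N (Y3 (Y4 u))).
by move=> *; lra.
Qed.

(** X4 commutes with the other fields, so its cross terms in |L u|^2 are nonnegative. This
    domination of X4^2 by L is what bounds g by W g and L g later. *)
Lemma Y44_le u : S u -> N (Y4 (Y4 u)) <= N (sumsq u).
Proof.
move=> Hu; have l1 := SY1 (SY1 Hu); have l2 := SY2 (SY2 Hu).
have l3 := SY3 (SY3 Hu); have l4 := SY4 (SY4 Hu).
pose w := Y1 (Y1 u) + Y2 (Y2 u) + Y3 (Y3 u).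
have Hw : S w by do !apply: SD.
have -> : N (sumsq u) = N w + 2 * ip w (Y4 (Y4 u)) + N (Y4 (Y4 u)).
  rewrite ipN; [|exact: SD|exact: Ssum]; rewrite ipC ipN; [|exact: SD|exact: SD].
  rewrite opprK ipD//; last exact: SD.
  rewrite -/w [ip w (_ + _)]ipC ipD// [ip (Y4 _) (_ + _)]ipC ipD// (ipC (Y4 (Y4 u)) w); ring.
have Hd : S (Y1 (Y1 u) + Y2 (Y2 u)) by exact: SD.
have -> : ip w (Y4 (Y4 u)) = ip (Y1 (Y1 u)) (Y4 (Y4 u)) + ip (Y2 (Y2 u)) (Y4 (Y4 u)) + ip (Y3 (Y3 u)) (Y4 (Y4 u)).
  by rewrite !ipD.
have := ip0 w.
rewrite (pair_eq aY1 aY4 Y14 Hu) (pair_eq aY2 aY4 Y24 Hu) (pair_eq aY3 aY4 Y34 Hu).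
have := ip0 (Y1 (Y4 u)); have := ip0 (Y2 (Y4 u)); have := ip0 (Y3 (Y4 u)).
by move=> *; lra.
Qed.

End FieldEstimates.

(** * Segment integrals in L2 *)

Section AverageL2.
Context (R : realType).
Local Notation V := (R * R * R * R)%type.
Local Notation mR := (measurableTypeR R).
Local Notation mV := (mR * mR * mR * mR)%type.
Local Notation e4 := (@Defs.basis R i4).
Local Notation SW := (@real_schwartz R).
Variable mu : {measure set mV -> \bar R}.
Hypothesis mu_shift : forall (f : mV -> \bar R) (h : V), measurable_fun setT f ->
  (forall x, (0 <= f x)%E) -> (\int[mu]_x (tau h f : mV -> \bar R) x = \int[mu]_x f x)%E.
Hypothesis mu_Wt : (\int[mu]_x (Wt (x : V))%:E < +oo)%E.
Implicit Types (u v w : V -> R) (x y z : V) (h k t : R).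
Local Notation ip := (@ipr _ mV R mu).
Local Notation L2 := (@L2r _ mV R mu).
Local Notation N f := (ip f f).
Let L u (Hu : SW u) : L2 u := SW_L2 mu_Wt Hu.

Lemma ip_CS (f g : mV -> R) : L2 f -> L2 g -> ip f g ^+ 2 <= N f * N g.
Proof.
move=> Hf Hg; apply: discriminant_le; first exact: ipr_ge0.
move=> k; have := ipr_ge0 mu (fun x => k * f x + g x); have Hk := L2rZ k Hf.
rewrite (iprDl Hk Hg (L2rD Hk Hg)) (iprDr Hk Hg Hk) (iprDr Hk Hg Hg).
rewrite (iprZl k Hf Hk) (iprZl k Hf Hg) (iprZr k Hf Hf) (iprZr k Hf Hg) (iprC _ g f).
move: (ip f f) (ip f g) (ip g g) => a b c; lra.
Qed.

Lemma ip_bound (f g : mV -> R) (a b : R) : L2 f -> L2 g -> 0 <= a -> 0 <= b ->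
  N f <= a ^+ 2 -> N g <= b ^+ 2 -> `|ip f g| <= a * b.
Proof.
move=> Hf Hg a0 b0 fa gb; rewrite -[leRHS]ger0_norm ?mulr_ge0//.
rewrite -ler_sqr ?nnegrE// !real_normK ?num_real// exprMn.
by apply: le_trans (ip_CS Hf Hg) _; rewrite ler_pM ?ipr_ge0.
Qed.

Lemma N_sum (f g : mV -> R) : L2 f -> L2 g -> N (fun x => f x + g x) <= 2 * N f + 2 * N g.
Proof.
move=> Hf Hg; have := ipr_ge0 mu (fun x => f x - g x).
rewrite (iprBl Hf Hg (L2rB Hf Hg)) (iprBr Hf Hg Hf) (iprBr Hf Hg Hg).
rewrite (iprDl Hf Hg (L2rD Hf Hg)) (iprDr Hf Hg Hf) (iprDr Hf Hg Hg) (iprC _ g f).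
by move: (ip f f) (ip f g) (ip g g) => a b c; lra.
Qed.

Lemma N_Wt (f : mV -> R) (c : R) : measurable_fun setT f ->
  (forall x, `|f x| <= c * Wt (x : V)) -> N f <= c ^+ 2 * N (@Wt R).
Proof.
move=> mf fc; have Hf := Wt_L2 mu_Wt mf fc.
have HW : L2 (@Wt R).
  apply: (@Wt_L2 R mu mu_Wt _ 1); first exact: measurable_Wt.
  by move=> x; rewrite mul1r gtr0_norm// Wt_gt0.
have HZ := L2rZ c HW.
have -> : c ^+ 2 * N (@Wt R) = N (fun x => c * Wt (x : V)).
  by rewrite (iprZl c HW HZ) (iprZr c HW HW) mulrA expr2.
apply: le_Rintegral => //; [exact: L2r_mul|exact: L2r_mul|].
move=> x _; rewrite -!expr2 -[leLHS]real_normK ?num_real//.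
by rewrite lerXn2r ?nnegrE// (le_trans (normr_ge0 _) (fc x)).
Qed.

Lemma S4_small u : SW u -> exists2 M : R, 0 <= M & forall k x, 0 <= k -> k <= 1 ->
  `|S4 k u x - k * u x| <= M * k ^+ 2 * Wt x.
Proof.
move=> Hu; have [M M0 HM] := SW_lip i4 Hu (lexx 0); exists M => // k x k0 k1.
have cu : continuous (fun t => u (x + t *: e4)) by exact: line_continuous.
have cc : continuous (fun t : R => u x) by exact: cst_continuous.
have E : k * u x = \int[@lebesgue_measure R]_(t in `[0, k]) (fun=> u x) t.
  have D (t : R) : is_derive t 1 (fun t => t * u x) (u x).
    by apply: is_derive_eq; rewrite scaler0 add0r -[_ *: _]/(u x * 1) mulr1.
  by rewrite (itv_FTC k0 cc D) mul0r subr0.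
rewrite E -(itv_sub _ _ cu cc).
have -> : M * k ^+ 2 * Wt x = M * k * Wt x * (k - 0) by rewrite subr0; ring.
apply: itv_bound => //; first by move=> t; apply: cvgB; [exact: cu|exact: cc].
move=> t /andP[t0 tk]; apply: le_trans (HM x x t _ _) _.
- by rewrite subrr normr0.
- by rewrite ger0_norm// (le_trans tk).
- by rewrite ler_wpM2r ?(ltW (Wt_gt0 x))// ler_wpM2l// ger0_norm.
Qed.

Lemma SW_S4sub k u : 0 <= k -> SW u -> SW (fun x => S4 k u x - k * u x).
Proof. by move=> k0 Hu; exact: (SWB (SW_S4 k0 Hu) (SWZ k Hu)). Qed.

Lemma N_S4sub u : SW u -> exists2 X : R, 0 <= X & forall k, 0 <= k -> k <= 1 ->
  N (fun x => S4 k u x - k * u x) <= (X * k ^+ 2) ^+ 2.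
Proof.
move=> Hu; have [M M0 HM] := S4_small Hu.
exists (M * Num.sqrt (N (@Wt R))); first by rewrite mulr_ge0// sqrtr_ge0.
move=> k k0 k1; rewrite mulrAC exprMn sqr_sqrtr ?ipr_ge0//.
apply: N_Wt => [|x]; last exact: HM.
exact: (SW_measurable (SW_S4sub k0 Hu)).
Qed.

(** Closes the arguments by halving ([S4_norm], [S4_adjoint], [cS_sub]): after n halvings the pieces
    are short and the accumulated error C h / 2^n is below eps. *)
Lemma exists_dyadic (h C eps : R) : 0 <= h -> 0 < eps ->
  exists n : nat, h / 2 ^+ n <= 1 /\ C * (h / 2 ^+ n) <= eps.
Proof.
move=> h0 eps0; pose K : R := h + `|C| * h / eps.
have [n Kn] : exists n : nat, K <= n%:R.
  by exists (Num.truncn K).+1; rewrite ltW// truncnS_gt.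
have n2 : n%:R <= 2 ^+ n :> R by rewrite -natrX ler_nat ltnW// ltn_expl.
have p2 : 0 < 2 ^+ n :> R by rewrite exprn_gt0.
have Ch : 0 <= `|C| * h / eps by rewrite divr_ge0 ?mulr_ge0// ltW.
have K2 := le_trans Kn n2.
exists n; split; first by rewrite ler_pdivrMr// mul1r (le_trans _ K2)// lerDl.
rewrite mulrA ler_pdivrMr// (le_trans (ler_norm _))// normrM (ger0_norm h0).
rewrite -ler_pdivrMl// (le_trans _ K2)// mulrC /K lerDr//.
Qed.

Lemma S4_double k u : 0 <= k -> SW u ->
  S4 (k + k) u = (fun x => S4 k u x + tau (k *: e4) (S4 k u) x).
Proof. by move=> k0; exact: S4_add. Qed.

Lemma halves h (n : nat) : h / 2 ^+ n.+1 + h / 2 ^+ n.+1 = h / 2 ^+ n.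
Proof. by rewrite exprS; field; rewrite expf_neq0. Qed.

Lemma dyadic_ge0 h (n : nat) : 0 <= h -> 0 <= h / 2 ^+ n.
Proof. by move=> h0; rewrite divr_ge0// exprn_ge0. Qed.

(** Minkowski's inequality for integrals, by halving. Joining two halves multiplies the squared norm
    by at most 4, and a short segment of length k gives k u up to an error that adds O(k^3) to the
    squared norm; with k = h / 2^n the accumulated error is of order 4^n k^3 = h^2 k. *)
Lemma S4_norm h u : 0 <= h -> SW u -> N (S4 h u) <= h ^+ 2 * N u.
Proof.
move=> h0 Hu.
have step (n : nat) : N (S4 h u) <= 4 ^+ n * N (S4 (h / 2 ^+ n) u).
  elim: n => [|n IH]; first by rewrite !expr0 divr1 mul1r.
  apply: le_trans IH _; rewrite exprSr -mulrA ler_wpM2l ?exprn_ge0//.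
  have k0 := dyadic_ge0 n.+1 h0; have HS := L (SW_S4 k0 Hu).
  rewrite -halves (S4_double k0 Hu).
  apply: le_trans (N_sum HS (L2_tau mu_shift _ HS)) _.
  by rewrite (ip_tau mu_shift _ HS HS); move: (ip _ _) => a; lra.
have [X X0 HX] := N_S4sub Hu.
have [Y Y0 HY] : exists2 Y : R, 0 <= Y & N u <= Y ^+ 2.
  by exists (Num.sqrt (N u)); rewrite ?sqrtr_ge0// sqr_sqrtr ?ipr_ge0.
have small k : 0 <= k -> k <= 1 -> N (S4 k u) <= k ^+ 2 * N u + (2 * X * Y + X ^+ 2) * k ^+ 3.
  move=> k0 k1; pose r x := S4 k u x - k * u x.
  have Hr : SW r := SW_S4sub k0 Hu.
  have -> : S4 k u = (fun x => k * u x + r x) by apply/funext => x; rewrite /r addrC subrK.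
  have lk := L2rZ k (L Hu); have lr := L Hr.
  rewrite (iprDl lk lr (L2rD lk lr)) (iprDr lk lr lk) (iprDr lk lr lr) (iprC mu r (fun x => k * u x)).
  rewrite (iprZl k (L Hu) lk) (iprZl k (L Hu) lr) (iprZr k (L Hu) (L Hu)).
  have b1 := HX k k0 k1; rewrite -/r in b1.
  have b2 := ip_bound (L Hu) lr Y0 (mulr_ge0 X0 (sqr_ge0 k)) HY b1.
  have := ler_norm (ip u r); move: (ip u r) (ip u u) (ip r r) b1 b2 => a b c b1 b2 b3.
  have k3 : k ^+ 4 <= k ^+ 3 by rewrite ler_wiXn2l.
  have ka : k * a <= k * (Y * (X * k ^+ 2)) by rewrite ler_wpM2l// (le_trans b3).
  have xk : X ^+ 2 * k ^+ 4 <= X ^+ 2 * k ^+ 3 by rewrite ler_wpM2l// sqr_ge0.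
  by move: ka xk b1; rewrite !exprS !expr0 !mulr1; lra.
apply/ler_addgt0Pl => eps eps0.
pose C := (2 * X * Y + X ^+ 2) * h ^+ 2.
have [n [n1 n2]] := exists_dyadic C h0 eps0.
have k0 := dyadic_ge0 n h0.
apply: le_trans (step n) _; set k := h / 2 ^+ n in n1 n2 k0 *.
have hk : 4 ^+ n * k ^+ 2 = h ^+ 2.
  rewrite /k expr_div_n -exprM mulnC exprM -[2 ^+ 2]/(2 * 2) -natrM mulrCA divff ?mulr1//.
have sm := small k k0 n1; clearbody k.
have p40 : 0 <= 4 ^+ n :> R by rewrite exprn_ge0.
apply: (@le_trans _ _ (4 ^+ n * (k ^+ 2 * N u + (2 * X * Y + X ^+ 2) * k ^+ 3))).
  exact: (ler_wpM2l p40 sm).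
rewrite mulrDr mulrA hk addrC lerD2r (le_trans _ n2)// /C -hk.
by move: (4 ^+ n) => p; rewrite le_eqVlt; apply/orP; left; apply/eqP; ring.
Qed.

Lemma N_tau_sub v : SW v -> exists2 X : R, 0 <= X & forall k, `|k| <= 1 ->
  N (fun x => tau (k *: e4) v x - v x) <= (X * `|k|) ^+ 2.
Proof.
move=> Hv; have [M M0 HM] := SW_lip i4 Hv (lexx 0).
exists (M * Num.sqrt (N (@Wt R))); first by rewrite mulr_ge0// sqrtr_ge0.
move=> k k1; rewrite mulrAC exprMn sqr_sqrtr ?ipr_ge0//.
apply: N_Wt => [|x]; first exact: (SW_measurable (SWB (SW_tau _ Hv) Hv)).
by apply: HM; rewrite ?subrr ?normr0.
Qed.

Lemma N_S4_back v : SW v -> exists2 X : R, 0 <= X & forall k, 0 <= k -> k <= 1 ->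
  N (fun x => tau (- (k *: e4)) (S4 k v) x - k * v x) <= (X * k ^+ 2) ^+ 2.
Proof.
move=> Hv; have [X X0 HX] := N_S4sub Hv; have [M M0 HM] := N_tau_sub Hv.
exists (2 * (X + M)); first by rewrite mulr_ge0// addr_ge0.
move=> k k0 k1; have H1 := SW_tau (- (k *: e4)) (SW_S4sub k0 Hv).
have H2 := SWZ k (SWB (SW_tau (- (k *: e4)) Hv) Hv).
have -> : (fun x => tau (- (k *: e4)) (S4 k v) x - k * v x) =
    (fun x => tau (- (k *: e4)) (fun x => S4 k v x - k * v x) x +
              k * (tau (- (k *: e4)) v x - v x)).
  by apply/funext => x; rewrite /tau mulrBr addrA subrK.
apply: le_trans (N_sum (L H1) (L H2)) _.
rewrite (ip_tau mu_shift _ (L (SW_S4sub k0 Hv)) (L (SW_S4sub k0 Hv))).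
have H3 := L (SWB (SW_tau (- (k *: e4)) Hv) Hv).
rewrite (iprZl k H3 (L H2)) (iprZr k H3 H3).
have b1 := HX k k0 k1.
have b2 : N (fun x => tau (- (k *: e4)) v x - v x) <= (M * k) ^+ 2.
  by have := HM (- k); rewrite scaleNr normrN ger0_norm//; apply.
have b3 : k * (k * N (fun x => tau (- (k *: e4)) v x - v x)) <= k * (k * (M * k) ^+ 2).
  by rewrite !ler_wpM2l.
move: b1 b3; move: (ip _ _) (ip _ _) => p q b1 b3.
have := mulr_ge0 X0 M0; have := exprn_ge0 4 k0.
by rewrite !exprS !expr0 !mulr1 in b1 b3 *; nra.
Qed.

(** The defect [dl] is additive when a segment is doubled, up to a translation of v, and is of order
    k^2 uniformly in that translation. The 2^n pieces of length k = h / 2^n leave 2^n k^2 = h k,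
    which tends to 0. *)
Lemma S4_adjoint h u v : 0 <= h -> SW u -> SW v ->
  ip (S4 h u) v = ip u (tau (- (h *: e4)) (S4 h v)).
Proof.
move=> h0 Hu Hv.
pose dl k z := ip (S4 k u) (tau z v) - ip u (tau (- (k *: e4)) (S4 k (tau z v))).
suff dl0 : dl h 0 = 0 by move/eqP: dl0; rewrite /dl tau0 subr_eq0 => /eqP.
have step k z : 0 <= k -> dl (k + k) z = dl k z + dl k (- (k *: e4) + z).
  move=> k0; have Hw := SW_tau z Hv; have HSu := SW_S4 k0 Hu; have HSw := SW_S4 k0 Hw.
  rewrite /dl (S4_double k0 Hu) (S4_double k0 Hw).
  rewrite (iprDl (L HSu) (L (SW_tau _ HSu)) (L Hw)) (ip_tau_adj mu_shift _ (L HSu) (L Hw)) tau_tau.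
  have -> : tau (- ((k + k) *: e4)) (fun x => S4 k (tau z v) x + tau (k *: e4) (S4 k (tau z v)) x) =
      (fun x => tau (- (k *: e4)) (S4 k (tau z v)) x +
                tau (- (k *: e4)) (S4 k (tau (- (k *: e4) + z) v)) x).
    rewrite -(tau_tau v) (S4_tau k (- (k *: e4))) (tau_tau (S4 k (tau z v))).
    apply/funext => x; rewrite /tau addrC; congr (S4 k _ _ + S4 k _ _).
      by rewrite scalerDl opprD addrA subrK.
    by rewrite scalerDl opprD.
  have Hw' := SW_S4 k0 (SW_tau (- (k *: e4) + z) Hv).
  rewrite (iprDr (L (SW_tau _ HSw)) (L (SW_tau _ Hw')) (L Hu)).
  by move: (ip _ _) (ip _ _) (ip _ _) (ip _ _) => p q r t; ring.
have [Xu Xu0 HXu] := N_S4sub Hu; have [Xv Xv0 HXv] := N_S4_back Hv.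
have ex (w : mV -> R) : exists2 Y : R, 0 <= Y & N w <= Y ^+ 2.
  by exists (Num.sqrt (N w)); rewrite ?sqrtr_ge0// sqr_sqrtr ?ipr_ge0.
have [Yu Yu0 HYu] := ex u; have [Yv Yv0 HYv] := ex v.
pose C := Xu * Yv + Yu * Xv.
have small k z : 0 <= k -> k <= 1 -> `|dl k z| <= C * k ^+ 2.
  move=> k0 k1; have Hw := SW_tau z Hv; have Hr := SW_S4sub k0 Hu.
  have HSw := SW_tau (- (k *: e4)) (SW_S4 k0 Hw).
  have Hr' := SWB HSw (SWZ k Hw).
  have -> : dl k z = ip (fun x => S4 k u x - k * u x) (tau z v) -
      ip u (fun x => tau (- (k *: e4)) (S4 k (tau z v)) x - k * tau z v x).
    rewrite (iprBl (L (SW_S4 k0 Hu)) (L (SWZ k Hu)) (L Hw)) (iprBr (L HSw) (L (SWZ k Hw)) (L Hu)).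
    rewrite (iprZl k (L Hu) (L Hw)) (iprZr k (L Hw) (L Hu)) /dl.
    by move: (ip _ _) (ip _ _) (ip _ _) => p q r; ring.
  have b1 : `|ip (fun x => S4 k u x - k * u x) (tau z v)| <= Xu * k ^+ 2 * Yv.
    apply: ip_bound => //; [exact: L|exact: L|by rewrite mulr_ge0// sqr_ge0|exact: HXu|].
    by rewrite (ip_tau mu_shift _ (L Hv) (L Hv)).
  have b2 : `|ip u (fun x => tau (- (k *: e4)) (S4 k (tau z v)) x - k * tau z v x)| <= Yu * (Xv * k ^+ 2).
    apply: ip_bound => //; [exact: L|exact: L|by rewrite mulr_ge0// sqr_ge0|].
    have Hb := SWB (SW_tau (- (k *: e4)) (SW_S4 k0 Hv)) (SWZ k Hv).
    have -> : (fun x => tau (- (k *: e4)) (S4 k (tau z v)) x - k * tau z v x) =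
        tau z (fun x => tau (- (k *: e4)) (S4 k v) x - k * v x).
      by rewrite S4_tau; apply/funext => x; rewrite /tau [x + _ + z]addrAC.
    by rewrite (ip_tau mu_shift _ (L Hb) (L Hb)); exact: HXv.
  rewrite (le_trans (ler_normB _ _))// (le_trans (lerD b1 b2))// /C.
  by move: (k ^+ 2) => q; rewrite le_eqVlt; apply/orP; left; apply/eqP; ring.
have iter (n : nat) z : h / 2 ^+ n <= 1 -> `|dl h z| <= 2 ^+ n * (C * (h / 2 ^+ n) ^+ 2).
  move=> n1.
  suff H m z' : (m <= n)%N -> `|dl (h / 2 ^+ (n - m)) z'| <= 2 ^+ m * (C * (h / 2 ^+ n) ^+ 2).
    by have := H n z (leqnn n); rewrite subnn expr0 divr1.
  elim: m z' => [|m IH] z' mn.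
    by rewrite subn0 expr0 mul1r; apply: small => //; exact: dyadic_ge0.
  have E : (n - m)%N = (n - m.+1).+1 by rewrite subnSK.
  rewrite -halves -E step ?dyadic_ge0// (le_trans (ler_normD _ _))//.
  rewrite exprS -mulrA mulr_natl mulr2n; apply: lerD; apply: IH; exact: ltnW.
apply/eqP; rewrite -normr_le0; apply/ler_addgt0Pl => eps eps0; rewrite addr0.
have [n [n1 n2]] := exists_dyadic (C * h) h0 eps0.
apply: le_trans (iter n 0 n1) _; apply: le_trans n2.
rewrite le_eqVlt; apply/orP; left; apply/eqP; field.
by rewrite expf_neq0.
Qed.

End AverageL2.

(** * The Laplacian against translations and segment integrals in x4 *)

Section LaplacianSchwartz.
Context (R : realType).
Local Notation V := (R * R * R * R)%type.
Local Notation mR := (measurableTypeR R).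
Local Notation mV := (mR * mR * mR * mR)%type.
Local Notation e4 := (@Defs.basis R i4).
Local Notation SW := (@real_schwartz R).
Implicit Types (u v w : V -> R) (x y z : V) (h k t : R).

Lemma x1_e4 x t : x1 (x + t *: e4) = x1 x.
Proof. by rewrite (basis_i4 R) scaleV mulr0 /x1 /= addr0. Qed.

Lemma Y1_tau t u : Y1 (tau (t *: e4) u) = tau (t *: e4) (Y1 u).
Proof. exact: pderiv_tau. Qed.
Lemma Y4_tau t u : Y4 (tau (t *: e4) u) = tau (t *: e4) (Y4 u).
Proof. exact: pderiv_tau. Qed.
Lemma Y3_tau t u : Y3 (tau (t *: e4) u) = tau (t *: e4) (Y3 u).
Proof.
by apply/funext => x; rewrite /Y3 (pderiv_tau _ u i3) (pderiv_tau _ u i4) /tau x1_e4.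
Qed.
Lemma Y2_tau t u : Y2 (tau (t *: e4) u) = tau (t *: e4) (Y2 u).
Proof.
apply/funext => x; rewrite /Y2 (pderiv_tau _ u i2) (pderiv_tau _ u i3) (pderiv_tau _ u i4).
by rewrite /tau x1_e4.
Qed.
Lemma Lap_tau t u : Lap (tau (t *: e4) u) = tau (t *: e4) (Lap u).
Proof.
by apply/funext => x; rewrite /Lap !Y1_tau !Y2_tau !Y3_tau !Y4_tau.
Qed.

Lemma Y1_lin k u v : SW u -> SW v ->
  Y1 (fun x => k * u x + v x) = (fun x => k * Y1 u x + Y1 v x).
Proof.
move=> Hu Hv; apply/funext => x.
by have [] := pderiv_lin k (@SW_derivable R _ Hu i1 x) (@SW_derivable R _ Hv i1 x).
Qed.
Lemma Y4_lin k u v : SW u -> SW v ->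
  Y4 (fun x => k * u x + v x) = (fun x => k * Y4 u x + Y4 v x).
Proof.
move=> Hu Hv; apply/funext => x.
by have [] := pderiv_lin k (@SW_derivable R _ Hu i4 x) (@SW_derivable R _ Hv i4 x).
Qed.

Lemma lin_Y3 (a k p q p' q' : R) : k * p + p' - a * (k * q + q') = k * (p - a * q) + (p' - a * q').
Proof. ring. Qed.
Lemma lin_Y2 (a b k p q r p' q' r' : R) : k * p + p' - a * (k * q + q') + b * (k * r + r') =
  k * (p - a * q + b * r) + (p' - a * q' + b * r').
Proof. ring. Qed.
Lemma lin_Lap (k a b c d a' b' c' d' : R) :
  - (k * a + a' + (k * b + b') + (k * c + c') + (k * d + d')) =
  k * - (a + b + c + d) + - (a' + b' + c' + d').
Proof. ring. Qed.

Lemma Y3_lin k u v : SW u -> SW v ->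
  Y3 (fun x => k * u x + v x) = (fun x => k * Y3 u x + Y3 v x).
Proof.
move=> Hu Hv; apply/funext => x; rewrite /Y3.
have [_ ->] := pderiv_lin k (@SW_derivable R _ Hu i3 x) (@SW_derivable R _ Hv i3 x).
have [_ ->] := pderiv_lin k (@SW_derivable R _ Hu i4 x) (@SW_derivable R _ Hv i4 x).
exact: lin_Y3.
Qed.
Lemma Y2_lin k u v : SW u -> SW v ->
  Y2 (fun x => k * u x + v x) = (fun x => k * Y2 u x + Y2 v x).
Proof.
move=> Hu Hv; apply/funext => x; rewrite /Y2.
have [_ ->] := pderiv_lin k (@SW_derivable R _ Hu i2 x) (@SW_derivable R _ Hv i2 x).
have [_ ->] := pderiv_lin k (@SW_derivable R _ Hu i3 x) (@SW_derivable R _ Hv i3 x).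
have [_ ->] := pderiv_lin k (@SW_derivable R _ Hu i4 x) (@SW_derivable R _ Hv i4 x).
exact: lin_Y2.
Qed.
Lemma Lap_lin k u v : SW u -> SW v ->
  Lap (fun x => k * u x + v x) = (fun x => k * Lap u x + Lap v x).
Proof.
move=> Hu Hv; apply/funext => x; rewrite /Lap.
rewrite (Y1_lin k Hu Hv) (Y2_lin k Hu Hv) (Y3_lin k Hu Hv) (Y4_lin k Hu Hv).
rewrite (Y1_lin k (SW_Y1 Hu) (SW_Y1 Hv)) (Y2_lin k (SW_Y2 Hu) (SW_Y2 Hv)).
rewrite (Y3_lin k (SW_Y3 Hu) (SW_Y3 Hv)) (Y4_lin k (SW_Y4 Hu) (SW_Y4 Hv)).
exact: lin_Lap.
Qed.

Lemma LapB u v : SW u -> SW v -> Lap (fun x => u x - v x) = (fun x => Lap u x - Lap v x).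
Proof.
move=> Hu Hv; have := Lap_lin (-1) Hv Hu.
have E (f g : V -> R) : (fun x => -1 * g x + f x) = (fun x => f x - g x).
  by apply/funext => x; rewrite mulN1r addrC.
by rewrite !E.
Qed.

Lemma line_cont4 u x : SW u -> continuous (fun t => u (x + t *: e4)).
Proof. exact: line_continuous. Qed.

Lemma lin_reorder (a b p q r : R) : b * r + (- a * q + p) = p - a * q + b * r.
Proof. ring. Qed.

Lemma Y3_S4 h u : 0 <= h -> SW u -> Y3 (S4 h u) = S4 h (Y3 u).
Proof.
move=> h0 Hu; apply/funext => x; rewrite /Y3 (pderiv_S4 i3 h0 Hu) (pderiv_S4 i4 h0 Hu).
have c3 := @line_cont4 _ x (SW_pderiv i3 Hu); have c4 := @line_cont4 _ x (SW_pderiv i4 Hu).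
rewrite addrC -mulNr -(itv_lin (- x1 x) 0 h c4 c3).
by apply: eq_Rintegral => t _; rewrite x1_e4 mulNr addrC.
Qed.

Lemma Y2_S4 h u : 0 <= h -> SW u -> Y2 (S4 h u) = S4 h (Y2 u).
Proof.
move=> h0 Hu; apply/funext => x.
rewrite /Y2 (pderiv_S4 i2 h0 Hu) (pderiv_S4 i3 h0 Hu) (pderiv_S4 i4 h0 Hu).
have c2 := @line_cont4 _ x (SW_pderiv i2 Hu).
have c3 := @line_cont4 _ x (SW_pderiv i3 Hu); have c4 := @line_cont4 _ x (SW_pderiv i4 Hu).
have c32 : continuous (fun t => - x1 x * pderiv i3 u (x + t *: e4) + pderiv i2 u (x + t *: e4)).
  by move=> t; apply: cvgD; [apply: cvgMr; exact: c3|exact: c2].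
transitivity (\int[@lebesgue_measure R]_(t in `[0, h]) (x1 x ^+ 2 / 2 * pderiv i4 u (x + t *: e4) +
  (- x1 x * pderiv i3 u (x + t *: e4) + pderiv i2 u (x + t *: e4)))); last first.
  by apply: eq_Rintegral => t _; rewrite x1_e4; exact: lin_reorder.
rewrite (itv_lin (x1 x ^+ 2 / 2) 0 h c4 c32) (itv_lin (- x1 x) 0 h c3 c2).
by apply/esym; exact: lin_reorder.
Qed.

Lemma Lap_S4 h u : 0 <= h -> SW u -> Lap (S4 h u) = S4 h (Lap u).
Proof.
move=> h0 Hu; apply/funext => x.
have H1 := SW_Y1 Hu; have H2 := SW_Y2 Hu; have H3 := SW_Y3 Hu; have H4 := SW_Y4 Hu.
rewrite /Lap (Y2_S4 h0 Hu) (Y2_S4 h0 H2) (Y3_S4 h0 Hu) (Y3_S4 h0 H3).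
have -> : Y1 (Y1 (S4 h u)) = S4 h (Y1 (Y1 u)).
  by rewrite /Y1 (pderiv_S4 i1 h0 Hu) (pderiv_S4 i1 h0 H1).
have -> : Y4 (Y4 (S4 h u)) = S4 h (Y4 (Y4 u)).
  by rewrite /Y4 (pderiv_S4 i4 h0 Hu) (pderiv_S4 i4 h0 H4).
have c1 := @line_cont4 _ x (SW_Y1 H1); have c2 := @line_cont4 _ x (SW_Y2 H2).
have c3 := @line_cont4 _ x (SW_Y3 H3); have c4 := @line_cont4 _ x (SW_Y4 H4).
have c12 := @line_cont4 _ x (SWD (SW_Y1 H1) (SW_Y2 H2)).
have c123 := @line_cont4 _ x (SWD (SWD (SW_Y1 H1) (SW_Y2 H2)) (SW_Y3 H3)).
have add (f g : R -> R) : continuous f -> continuous g ->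
    \int[@lebesgue_measure R]_(t in `[0, h]) f t + \int[@lebesgue_measure R]_(t in `[0, h]) g t =
    \int[@lebesgue_measure R]_(t in `[0, h]) (f t + g t).
  move=> cf cg; have := itv_lin 1 0 h cf cg; rewrite mul1r => <-.
  by apply: eq_Rintegral => t _; rewrite mul1r.
rewrite /S4 (add _ _ c1 c2) (add _ _ c12 c3) (add _ _ c123 c4).
have c0 := @line_cont4 _ x (@SW0 R).
have c1234 := @line_cont4 _ x (SWD (SWD (SWD (SW_Y1 H1) (SW_Y2 H2)) (SW_Y3 H3)) (SW_Y4 H4)).
rewrite -[LHS]mulN1r -[LHS]addr0 -[X in _ + X](_ : \int[@lebesgue_measure R]_(t in `[0, h]) 0 = 0); last first.
  by rewrite /Rintegral integral0.
rewrite -(itv_lin (-1) 0 h c1234 c0).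
by apply: eq_Rintegral => t _; rewrite mulN1r addr0.
Qed.

Variable mu : {measure set mV -> \bar R}.
Hypothesis mu_shift : forall (f : mV -> \bar R) (h : V), measurable_fun setT f ->
  (forall x, (0 <= f x)%E) -> (\int[mu]_x (tau h f : mV -> \bar R) x = \int[mu]_x f x)%E.
Hypothesis mu_Wt : (\int[mu]_x (Wt (x : V))%:E < +oo)%E.
Local Notation ip := (@ipr _ mV R mu).
Local Notation L2 := (@L2r _ mV R mu).
Local Notation N f := (ip f f).
Let L u (Hu : SW u) : L2 u := SW_L2 mu_Wt Hu.

Let ipD u v w : SW u -> SW v -> SW w -> ip (u + v) w = ip u w + ip v w.
Proof. by move=> Hu Hv Hw; exact: (iprDl (L Hu) (L Hv) (L Hw)). Qed.
Let ipZ k u v : SW u -> SW v -> ip (k *: u) v = k * ip u v.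
Proof. by move=> Hu Hv; exact: (iprZl k (L Hu) (L Hv)). Qed.
Let SD u v : SW u -> SW v -> SW (u + v). Proof. exact: SWD. Qed.
Let SZ k u : SW u -> SW (k *: u). Proof. exact: SWZ. Qed.
Let a1 : antisym SW ip (@Y1 R).
Proof. by split; [exact: SW_Y1|move=> u v; exact: Y1_anti]. Qed.
Let a2 : antisym SW ip (@Y2 R).
Proof. by split; [exact: SW_Y2|move=> u v; exact: Y2_anti]. Qed.
Let a3 : antisym SW ip (@Y3 R).
Proof. by split; [exact: SW_Y3|move=> u v; exact: Y3_anti]. Qed.
Let a4 : antisym SW ip (@Y4 R).
Proof. by split; [exact: SW_Y4|move=> u v; exact: Y4_anti]. Qed.

Lemma Lap_sym u v : SW u -> SW v -> ip (Lap u) v = ip u (Lap v).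
Proof. by move=> Hu Hv; exact: (sumsq_sym SD (iprC mu) ipD ipZ a1 a2 a3 a4 Hu Hv). Qed.

Lemma Lap_ge0 u : SW u -> 0 <= ip (Lap u) u.
Proof. by move=> Hu; exact: (sumsq_ge0 SD ipD ipZ (ipr_ge0 mu) a1 a2 a3 a4 Hu). Qed.

Lemma Y4_le_Lap u : SW u -> N (Y4 u) <= ip (Lap u) u.
Proof. by move=> Hu; exact: (Y4_le_sumsq SD ipD ipZ (ipr_ge0 mu) a1 a2 a3 a4 Hu). Qed.

Definition first_orderL u : R := N (Y1 u) + N (Y2 u) + N (Y3 u) + N (Y4 u).

Lemma Lap_first u : SW u -> first_orderL u <= N (Lap u) + N u.
Proof. by move=> Hu; exact: (first_order_le SD SZ (iprC mu) ipD ipZ (ipr_ge0 mu) a1 a2 a3 a4 Hu). Qed.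

Lemma Lap_second u : SW u -> first_orderL (Y1 u) + first_orderL (Y2 u) + first_orderL (Y3 u) +
  first_orderL (Y4 u) <= 8 * (N (Lap u) + N u).
Proof.
move=> Hu; exact: (second_order_le SD SZ (iprC mu) ipD ipZ (ipr_ge0 mu) a1 a2 a3 a4
  (@Y12 R) (@Y13 R) (@Y14 R) (@Y23 R) (@Y24 R) (@Y34 R) Hu).
Qed.

Lemma D4_le_Lap u : SW u -> N (Y4 (Y4 u)) <= N (Lap u).
Proof.
move=> Hu; exact: (Y44_le SD SZ (iprC mu) ipD ipZ (ipr_ge0 mu) a1 a2 a3 a4
  (@Y14 R) (@Y24 R) (@Y34 R) Hu).
Qed.

(** The increment is the integral of X4 u over the segment, and |X4 u|^2 <= <L u, u>. *)
Lemma tau_sub_le h u : 0 <= h -> SW u ->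
  N (fun x => tau (h *: e4) u x - u x) <= h ^+ 2 * ip (Lap u) u.
Proof.
move=> h0 Hu; rewrite -(S4_d4 h0 Hu).
apply: le_trans (S4_norm mu_shift mu_Wt h0 (SW_pderiv i4 Hu)) _.
by rewrite ler_wpM2l ?sqr_ge0//; exact: Y4_le_Lap.
Qed.

End LaplacianSchwartz.

(** * A Sobolev inequality along left translates of lines *)

Section LineSobolev.
Context (R : realType).
Local Notation V := (R * R * R * R)%type.
Local Notation e4 := (@Defs.basis R i4).
Local Notation SW := (@real_schwartz R).
Local Notation leb := (@lebesgue_measure R).
Implicit Types (u v : V -> R) (x y : V) (a b r t : R).

Lemma is_derive_quad (f : R -> R) t (l C d : R) : 0 < d ->
  (forall h, `|h| <= d -> `|f (t + h) - f t - h * l| <= C * h ^+ 2) -> is_derive t 1 f l.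
Proof.
move=> d0 H.
have Hl : h^-1 *: ((f \o shift t) (h *: (1 : R)) - f t) @[h --> 0^'] --> l.
  apply/cvgrPdist_le => eps eps0.
  have C1 : 0 < `|C| + 1 by rewrite ltr_wpDl.
  near=> h.
  have h0 : h != 0 by near: h; exact: nbhs_dnbhs_neq.
  have h1 : `|h| <= d by near: h; exact: dnbhs0_le.
  have h2 : `|h| <= eps / (`|C| + 1) by near: h; apply: dnbhs0_le; exact: divr_gt0.
  rewrite /= -[h *: 1]/(h * 1) mulr1 (addrC h) -[_ *: _]/(h^-1 * _).
  have -> : l - h^-1 * (f (t + h) - f t) = - (h^-1 * (f (t + h) - f t - h * l)) by field.
  rewrite normrN normrM normfV ler_pdivrMl ?normr_gt0//.
  apply: le_trans (H h h1) _.
  rewrite -(real_normK (num_real h)) expr2 mulrA mulrC ler_wpM2l//.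
  apply: (@le_trans _ _ (`|C| * `|h|)); first by rewrite ler_wpM2r// ler_norm.
  move: h2; rewrite ler_pdivlMr// => h2; rewrite mulrC; apply: le_trans h2.
  by rewrite ler_wpM2l// lerDl.
apply: DeriveDef; first by apply/cvg_ex; exists l.
exact: cvg_lim Hl.
Unshelve. all: by end_near.
Qed.

(* The point reached at time r on the left translate by y of the line r (1, a, b, 0). *)
Definition ray y a b r : V := (y.1.1.1 + r, y.1.1.2 + a * r, y.1.2 + (b - y.1.1.1 * a) * r,
  y.2 + (y.1.1.1 ^+ 2 / 2 * a - y.1.1.1 * b) * r).

Lemma ray0 y a b : ray y a b 0 = y.
Proof. by case: y => [[[p q] s] t]; rewrite /ray /= !mulr0 !addr0. Qed.

Lemma ray_chain (p r a b q1 q2 q3 q4 : R) :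
  1 * q1 + a * q2 + (b - p * a) * q3 + (p ^+ 2 / 2 * a - p * b) * q4 =
  q1 + a * (q2 - (p + r) * q3 + (p + r) ^+ 2 / 2 * q4) + (a * r + b) * (q3 - (p + r) * q4) +
  (a * r ^+ 2 / 2 + b * r) * q4.
Proof. by field. Qed.

(** With [cf4], the X3 and X4 components of the velocity of the ray in the left-invariant frame at
    time r. The line r (1, a, b, 0) need not be a one-parameter subgroup, so they depend on r. *)
Definition cf3 a b r : R := a * r + b.
Definition cf4 a b r : R := a * r ^+ 2 / 2 + b * r.

Definition ray_deriv u y a b r : R :=
  Y1 u (ray y a b r) + a * Y2 u (ray y a b r) + cf3 a b r * Y3 u (ray y a b r) +
  cf4 a b r * Y4 u (ray y a b r).

Lemma is_derive_ray u y a b r : SW u ->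
  is_derive r 1 (fun r => u (ray y a b r)) (ray_deriv u y a b r).
Proof.
move=> Hu; have [M M0 HM] := SW_taylor Hu (lexx 0).
set p := y.1.1.1.
pose w3 := b - p * a; pose w4 := p ^+ 2 / 2 * a - p * b.
pose om : R := 1 + `|a| + `|w3| + `|w4|.
have om0 : 0 < om by rewrite /om -!addrA ltr_pwDl// !addr_ge0.
apply: (@is_derive_quad _ r _ (M * om ^+ 2) om^-1); first by rewrite invr_gt0.
move=> h hom.
have sh : ray y a b (r + h) = ray y a b r + (h * 1, h * a, h * w3, h * w4).
  have A (z c : R) : z + c * (r + h) = z + c * r + h * c by ring.
  by rewrite /ray addV; congr (_, _, _, _); [rewrite mulr1 addrA|exact: A..].
have hom1 : `|h| * om <= 1 by rewrite -ler_pdivlMr// div1r.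
have B c : `|c| <= om -> `|h * c| <= `|h| * om by move=> co; rewrite normrM ler_wpM2l.
have := HM (ray y a b r) (ray y a b r) (h * 1) (h * a) (h * w3) (h * w4) (`|h| * om).
rewrite subrr normr0 lexx => /(_ isT hom1).
have o1 : `|1 : R| <= om by rewrite normr1 /om -!addrA lerDl !addr_ge0.
have oa : `|a| <= om by rewrite /om; have := normr_ge0 w3; have := normr_ge0 w4; lra.
have o3 : `|w3| <= om by rewrite /om; have := normr_ge0 a; have := normr_ge0 w4; lra.
have o4 : `|w4| <= om by rewrite /om; have := normr_ge0 w3; have := normr_ge0 a; lra.
move=> /(_ (B _ o1) (B _ oa) (B _ o3) (B _ o4)); rewrite -sh.
have -> : h * 1 * pderiv i1 u (ray y a b r) + h * a * pderiv i2 u (ray y a b r) +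
   h * w3 * pderiv i3 u (ray y a b r) + h * w4 * pderiv i4 u (ray y a b r) =
   h * ray_deriv u y a b r.
  rewrite /ray_deriv /Y1 /Y2 /Y3 /Y4 /cf3 /cf4 -/p.
  by rewrite -(ray_chain p) -/w3 -/w4 -!mulrA -!mulrDr.
move=> /le_trans; apply; rewrite exprMn real_normK ?num_real// mulrCA mulrA.
have -> : h ^+ 2 * M * om ^+ 2 = M * om ^+ 2 * h ^+ 2 by ring.
have k0 : 0 <= M * om ^+ 2 * h ^+ 2 := mulr_ge0 (mulr_ge0 M0 (sqr_ge0 _)) (sqr_ge0 _).
by rewrite ler_piMr ?Wt_le1.
Qed.

Lemma is_derive_mul (f g : R -> R) t (df dg : R) : is_derive t 1 f df -> is_derive t 1 g dg ->
  is_derive t 1 (fun s => f s * g s) (f t * dg + df * g t).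
Proof.
move=> Df Dg; have := is_deriveM Df Dg.
by rewrite (_ : f t *: dg + g t *: df = f t * dg + df * g t)//; congr (_ + _); exact: mulrC.
Qed.

Lemma is_derive_add (f g : R -> R) t (df dg : R) : is_derive t 1 f df -> is_derive t 1 g dg ->
  is_derive t 1 (fun s => f s + g s) (df + dg).
Proof. by move=> Df Dg; exact: is_deriveD. Qed.

Lemma is_derive_scale (k : R) (f : R -> R) t (df : R) : is_derive t 1 f df ->
  is_derive t 1 (fun s => k * f s) (k * df).
Proof. by move=> Df; have := is_deriveZ k Df. Qed.

Lemma is_derive_const (k : R) t : is_derive t 1 (fun _ : R => k) (0 : R).
Proof. exact: is_derive_cst. Qed.

Lemma is_derive_val (f : R -> R) t (d d' : R) : is_derive t 1 f d -> d = d' -> is_derive t 1 f d'.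
Proof. by move=> + <-. Qed.

Lemma is_derive_continuous (f df : R -> R) : (forall t, is_derive t 1 f (df t)) -> continuous f.
Proof. by move=> D t; apply: differentiable_continuous; apply/derivable1_diffP; case: (D t). Qed.

Lemma jensen01 (f : R -> R) : continuous f ->
  (\int[leb]_(t in `[0, 1]) f t) ^+ 2 <= \int[leb]_(t in `[0, 1]) (f t ^+ 2).
Proof.
move=> cf; set m := \int[leb]_(t in `[0, 1]) f t.
have cf2 : continuous (fun t => f t ^+ 2).
  by move=> t; apply: (@continuous_comp _ _ _ f (fun s : R => s ^+ 2)); [exact: cf|exact: exprn_continuous].
have cm : continuous (fun _ : R => m ^+ 2) by exact: cst_continuous.
have Im : \int[leb]_(t in `[0, 1]) m ^+ 2 = m ^+ 2.
  have D (t : R) : is_derive t 1 (fun t => t * m ^+ 2) (m ^+ 2).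
    by apply: is_derive_eq; rewrite scaler0 add0r -[_ *: _]/(m ^+ 2 * 1) mulr1.
  by rewrite (itv_FTC ler01 cm D) mul0r subr0 mul1r.
have c1 : continuous (fun t => f t ^+ 2 - m ^+ 2) by move=> t; apply: cvgB; [exact: cf2|exact: cm].
have : 0 <= \int[leb]_(t in `[0, 1]) (f t - m) ^+ 2.
  by apply: Rintegral_ge0 => t _; rewrite sqr_ge0.
have -> : \int[leb]_(t in `[0, 1]) (f t - m) ^+ 2 =
    \int[leb]_(t in `[0, 1]) ((- 2 * m) * f t + (f t ^+ 2 + m ^+ 2)).
  by apply: eq_Rintegral => t _; ring.
have c2 : continuous (fun t => f t ^+ 2 + m ^+ 2) by move=> t; apply: cvgD; [exact: cf2|exact: cm].
rewrite (itv_lin _ 0 1 cf c2) -/m.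
have -> : \int[leb]_(t in `[0, 1]) (f t ^+ 2 + m ^+ 2) = \int[leb]_(t in `[0, 1]) (f t ^+ 2) + m ^+ 2.
  rewrite -[in RHS]Im -[X in _ = X + _]mul1r -(itv_lin 1 0 1 cf2 cm).
  by apply: eq_Rintegral => t _; rewrite mul1r.
by move: (\int[leb]_(t in _) _ ^+ 2) => A; lra.
Qed.

Definition jet1 u y : R := Y1 u y ^+ 2 + Y2 u y ^+ 2 + Y3 u y ^+ 2 + Y4 u y ^+ 2.
Definition jet2 u y : R := u y ^+ 2 + jet1 u y +
  (jet1 (Y1 u) y + jet1 (Y2 u) y + jet1 (Y3 u) y + jet1 (Y4 u) y).

Lemma jet1_ge0 u y : 0 <= jet1 u y. Proof. by rewrite /jet1 !addr_ge0 ?sqr_ge0. Qed.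
Lemma jet2_ge0 u y : 0 <= jet2 u y. Proof. by rewrite /jet2 !addr_ge0 ?sqr_ge0 ?jet1_ge0. Qed.

Definition ray_deriv2 u y a b r : R :=
  ray_deriv (Y1 u) y a b r + a * ray_deriv (Y2 u) y a b r +
  (a * Y3 u (ray y a b r) + cf3 a b r * ray_deriv (Y3 u) y a b r) +
  (cf3 a b r * Y4 u (ray y a b r) + cf4 a b r * ray_deriv (Y4 u) y a b r).

Lemma is_derive_ray2 u y a b r : SW u ->
  is_derive r 1 (ray_deriv u y a b) (ray_deriv2 u y a b r).
Proof.
move=> Hu.
have d1 := is_derive_ray y a b r (SW_Y1 Hu); have d2 := is_derive_ray y a b r (SW_Y2 Hu).
have d3 := is_derive_ray y a b r (SW_Y3 Hu); have d4 := is_derive_ray y a b r (SW_Y4 Hu).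
have dr : is_derive r 1 (fun s : R => s) (1 : R) by exact: is_derive_id.
have dc3 : is_derive r 1 (cf3 a b) a.
  apply: (is_derive_val (is_derive_add (is_derive_scale a dr) (is_derive_const b r))).
  by rewrite mulr1 addr0.
have dc4 : is_derive r 1 (cf4 a b) (cf3 a b r).
  rewrite (_ : cf4 a b = fun s => a / 2 * (s * s) + b * s); last first.
    by apply/funext => s; rewrite /cf4 expr2; field.
  apply: (is_derive_val (is_derive_add (is_derive_scale (a / 2) (is_derive_mul dr dr)) (is_derive_scale b dr))).
  by rewrite /cf3; field.
apply: (is_derive_val (is_derive_add (is_derive_add (is_derive_add d1 (is_derive_scale a d2))
  (is_derive_mul dc3 d3)) (is_derive_mul dc4 d4))).
by rewrite /ray_deriv2; congr (_ + _ + _); rewrite addrC.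
Qed.

(** The second derivative of (1 - r)^2 u along the ray; the double zero at r = 1 removes the
    boundary terms there. *)
Definition bump_jet u y a b r : R := 2 * u (ray y a b r) - 4 * (1 - r) * ray_deriv u y a b r +
  (1 - r) ^+ 2 * ray_deriv2 u y a b r.

Lemma ray_continuous u y a b : SW u -> continuous (fun r => u (ray y a b r)).
Proof. by move=> Hu; apply: is_derive_continuous => r; exact: is_derive_ray. Qed.

Lemma ray_deriv_continuous u y a b : SW u -> continuous (ray_deriv u y a b).
Proof. by move=> Hu; apply: is_derive_continuous => r; exact: is_derive_ray2. Qed.

Lemma cf_continuous a b : continuous (cf3 a b) /\ continuous (cf4 a b).
Proof.
split => r; first by apply: cvgD; [apply: cvgMr; exact: cvg_id|exact: cvg_cst].
apply: cvgD; last by apply: cvgMr; exact: cvg_id.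
apply: cvgMl; apply: cvgMr; exact: exprn_continuous.
Qed.

Lemma ray_deriv2_continuous u y a b : SW u -> continuous (ray_deriv2 u y a b).
Proof.
move=> Hu r; have [c3 c4] := cf_continuous a b.
have d1 := @ray_deriv_continuous _ y a b (SW_Y1 Hu); have d2 := @ray_deriv_continuous _ y a b (SW_Y2 Hu).
have d3 := @ray_deriv_continuous _ y a b (SW_Y3 Hu); have d4 := @ray_deriv_continuous _ y a b (SW_Y4 Hu).
have r3 := @ray_continuous _ y a b (SW_Y3 Hu); have r4 := @ray_continuous _ y a b (SW_Y4 Hu).
apply: cvgD; [apply: cvgD; [apply: cvgD; [exact: d1|apply: cvgMr; exact: d2]|]|].
  by apply: cvgD; [apply: cvgMr; exact: r3|apply: cvgM; [exact: c3|exact: d3]].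
by apply: cvgD; apply: cvgM; [exact: c3|exact: r4|exact: c4|exact: d4].
Qed.

Lemma onem_continuous : continuous (fun r : R => 1 - r).
Proof. by move=> r; apply: cvgB; [exact: cvg_cst|exact: cvg_id]. Qed.

Lemma bump_jet_continuous u y a b : SW u -> continuous (bump_jet u y a b).
Proof.
move=> Hu r; have c0 := @ray_continuous _ y a b Hu; have c1 := @ray_deriv_continuous _ y a b Hu.
have c2 := @ray_deriv2_continuous _ y a b Hu.
apply: cvgD; [apply: cvgB; [apply: cvgMr; exact: c0|]|].
  by apply: cvgM; [apply: cvgMr; exact: onem_continuous|exact: c1].
apply: cvgM; last exact: c2.
apply: (@continuous_comp _ _ _ (fun r : R => 1 - r) (fun s : R => s ^+ 2)).
  exact: onem_continuous.
exact: exprn_continuous.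
Qed.

(* With v r = (1 - r)^2 u(ray r), integrate r v'' = (r v' - v)'. *)
Lemma ray_representation u y a b : SW u ->
  u y = \int[leb]_(r in `[0, 1]) (r * bump_jet u y a b r).
Proof.
move=> Hu.
pose A r := u (ray y a b r); pose B := ray_deriv u y a b.
pose F r := r * (- 2 * ((1 - r) * A r) + (1 - r) * (1 - r) * B r) - (1 - r) * (1 - r) * A r.
have D r : is_derive r 1 F (r * bump_jet u y a b r).
  have dA : is_derive r 1 A (B r) by exact: is_derive_ray.
  have dB : is_derive r 1 B (ray_deriv2 u y a b r) by exact: is_derive_ray2.
  have dr : is_derive r 1 (fun s : R => s) (1 : R) by exact: is_derive_id.
  have d1 : is_derive r 1 (fun s : R => 1 - s) (-1 : R).
    by have := is_derive_add (is_derive_const 1 r) (is_derive_scale (-1) dr);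
      rewrite mulr1 add0r (_ : (fun s => 1 + -1 * s) = (fun s => 1 - s))//;
      apply/funext => s; rewrite mulN1r.
  have dd := is_derive_mul d1 d1.
  have G1 := is_derive_mul dr (is_derive_add (is_derive_scale (-2) (is_derive_mul d1 dA)) (is_derive_mul dd dB)).
  have G2 := is_derive_scale (-1) (is_derive_mul dd dA).
  have := is_derive_add G1 G2.
  rewrite (_ : (fun s => _ + -1 * _) = F); last by apply/funext => s; rewrite mulN1r.
  move=> /is_derive_val; apply; rewrite /bump_jet -/(A r) -/(B r).
  by move: (A r) (B r) (ray_deriv2 u y a b r) => p q s; ring.
have cont : continuous (fun r => r * bump_jet u y a b r).
  by move=> r; apply: cvgM; [exact: cvg_id|exact: bump_jet_continuous].
rewrite (itv_FTC ler01 cont D) /F; have -> : A 0 = u y by rewrite /A ray0.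
by move: (u y) (A 1) (B 1) (B 0) => p q s t; ring.
Qed.

Lemma norm_le_mul (c p k s : R) : 0 <= k -> `|c| <= k -> `|p| <= s -> `|c * p| <= k * s.
Proof. by move=> k0 ck ps; rewrite normrM ler_pM. Qed.

Lemma cf_le a b r : 0 <= a <= 1 -> 0 <= b <= 1 -> 0 <= r <= 1 ->
  `|cf3 a b r| <= 2 /\ `|cf4 a b r| <= 2.
Proof.
move=> /andP[a0 a1] /andP[b0 b1] /andP[r0 r1].
have r2 : 0 <= r ^+ 2 <= 1 by rewrite sqr_ge0 expr_le1.
have ar : 0 <= a * r <= 1 by rewrite mulr_ge0// mulr_ile1.
have br : 0 <= b * r <= 1 by rewrite mulr_ge0// mulr_ile1.
have arr : 0 <= a * r ^+ 2 <= 1.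
  by have /andP[r20 r21] := r2; rewrite mulr_ge0// mulr_ile1.
by rewrite /cf3 /cf4 !ger0_norm; lra.
Qed.

Lemma le_sum4 (p q s t : R) : 0 <= p -> 0 <= q -> 0 <= s -> 0 <= t ->
  [/\ p <= p + q + s + t, q <= p + q + s + t, s <= p + q + s + t & t <= p + q + s + t].
Proof. by move=> *; split; lra. Qed.

Lemma le_sum6 (o c p q s t : R) : 0 <= o -> 0 <= c -> 0 <= p -> 0 <= q -> 0 <= s -> 0 <= t ->
  [/\ c <= o + c + (p + q + s + t), p <= o + c + (p + q + s + t), q <= o + c + (p + q + s + t),
     s <= o + c + (p + q + s + t) & t <= o + c + (p + q + s + t)].
Proof. by move=> *; split; lra. Qed.

Lemma le_6 (p q v t s : R) : p <= s -> q <= 1 * s -> v <= 2 * s -> t <= 2 * s ->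
  p + q + v + t <= 6 * s.
Proof. lra. Qed.

Lemma le_39 (p q v t w x s : R) : p <= 6 * s -> q <= 1 * (6 * s) -> v <= 1 * s ->
  t <= 2 * (6 * s) -> w <= 2 * s -> x <= 2 * (6 * s) -> p + q + (v + t) + (w + x) <= 39 * s.
Proof. lra. Qed.

Lemma le_65 (p q s : R) : p <= 2 * s -> q <= 4 * (6 * s) -> p + q + 1 * (39 * s) <= 65 * s.
Proof. lra. Qed.

(** Every value of u or of its derivatives along the fields that occurs is at most s, the root of
    the jet, and the velocity components are at most 1, 1, 2, 2. A first derivative along the ray is
    thus at most 1 + 1 + 2 + 2 = 6 times s, a second one 6 + 6 + 1 + 12 + 2 + 12 = 39 times s, the
    whole 2 + 24 + 39 = 65 times s, and 4225 is 65^2. *)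
Lemma bump_jet_le u y a b r : 0 <= a <= 1 -> 0 <= b <= 1 -> 0 <= r <= 1 ->
  bump_jet u y a b r ^+ 2 <= 4225 * jet2 u (ray y a b r).
Proof.
move=> ha hb hr; have [c3 c4] := cf_le ha hb hr.
have a1 : `|a| <= 1 by have /andP[a0 a1] := ha; rewrite ger0_norm.
have r1 : `|1 - r| <= 1 by have /andP[r0 r1] := hr; rewrite ger0_norm; lra.
have e65 : (65 : R) ^+ 2 <= 4225 by rewrite -natrX ler_nat.
pose z := ray y a b r; pose s : R := Num.sqrt (jet2 u z).
have s0 : 0 <= s by rewrite sqrtr_ge0.
have C (c : R) : c ^+ 2 <= jet2 u z -> `|c| <= s by move=> cz; apply: ler_sqrt_sqr => //; exact: jet2_ge0.
have sq (w : V -> R) : 0 <= w z ^+ 2 := sqr_ge0 _.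
have j1 w : [/\ Y1 w z ^+ 2 <= jet1 w z, Y2 w z ^+ 2 <= jet1 w z, Y3 w z ^+ 2 <= jet1 w z
    & Y4 w z ^+ 2 <= jet1 w z].
  exact: (le_sum4 (sq (Y1 w)) (sq (Y2 w)) (sq (Y3 w)) (sq (Y4 w))).
have J : [/\ jet1 u z <= jet2 u z, jet1 (Y1 u) z <= jet2 u z, jet1 (Y2 u) z <= jet2 u z,
    jet1 (Y3 u) z <= jet2 u z & jet1 (Y4 u) z <= jet2 u z].
  exact: (le_sum6 (sq u) (jet1_ge0 u z) (jet1_ge0 (Y1 u) z) (jet1_ge0 (Y2 u) z)
    (jet1_ge0 (Y3 u) z) (jet1_ge0 (Y4 u) z)).
have U : `|u z| <= s.
  apply: C; rewrite /jet2 -addrA lerDl !addr_ge0 ?jet1_ge0//.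
have rd w : jet1 w z <= jet2 u z -> `|ray_deriv w y a b r| <= 6 * s /\ `|Y3 w z| <= s /\ `|Y4 w z| <= s.
  move=> jw; have [h1 h2 h3 h4] := j1 w.
  have k1 := C _ (le_trans h1 jw); have k2 := C _ (le_trans h2 jw).
  have k3 := C _ (le_trans h3 jw); have k4 := C _ (le_trans h4 jw); split => //.
  have m2 := norm_le_mul ler01 a1 k2; have m3 := norm_le_mul (ler0n _ 2) c3 k3.
  have m4 := norm_le_mul (ler0n _ 2) c4 k4.
  rewrite /ray_deriv -/z; apply: le_trans (ler_normD _ _) _.
  apply: le_trans (lerD (le_trans (ler_normD _ _) (lerD (ler_normD _ _) (lexx _))) (lexx _)) _.
  exact: (le_6 k1 m2 m3 m4).
have [J0 J1 J2 J3 J4] := J.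
have [R0 [U3 U4]] := rd u J0; have [R1 _] := rd _ J1; have [R2 _] := rd _ J2.
have [R3 _] := rd _ J3; have [R4 _] := rd _ J4.
have R2' := norm_le_mul ler01 a1 R2; have R3' := norm_le_mul (ler0n _ 2) c3 R3.
have R4' := norm_le_mul (ler0n _ 2) c4 R4.
have V3 := norm_le_mul ler01 a1 U3; have V4 := norm_le_mul (ler0n _ 2) c3 U4.
have D2 : `|ray_deriv2 u y a b r| <= 39 * s.
  rewrite /ray_deriv2 -/z.
  apply: le_trans (ler_normD _ _) _; apply: le_trans (lerD (ler_normD _ _) (ler_normD _ _)) _.
  apply: le_trans (lerD (lerD (ler_normD _ _) (ler_normD _ _)) (lexx _)) _.
  exact: (le_39 R1 R2' V3 R3' V4 R4').
have r2 : `|(1 - r) ^+ 2| <= 1 by rewrite normrX expr_le1.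
have r4 : `|4 * (1 - r)| <= 4 by rewrite normrM (ger0_norm (ler0n _ 4)) ler_piMr.
have B0 : `|bump_jet u y a b r| <= 65 * s.
  rewrite /bump_jet -/z; apply: le_trans (ler_normD _ _) _.
  apply: le_trans (lerD (ler_normB _ _) (norm_le_mul ler01 r2 D2)) _.
  have n2 : `|2 : R| <= 2 by rewrite ger0_norm.
  exact: (le_65 (norm_le_mul (ler0n _ 2) n2 U) (norm_le_mul (ler0n _ 4) r4 R0)).
rewrite -(real_normK (num_real (bump_jet _ _ _ _ _))).
apply: (@le_trans _ _ ((65 * s) ^+ 2)); first by rewrite lerXn2r ?nnegrE// mulr_ge0.
by rewrite exprMn /s sqr_sqrtr ?jet2_ge0// ler_wpM2r ?jet2_ge0.
Qed.

(** The factor r of the representation becomes r^2 under Jensen's inequality. This is the Jacobian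
    of the cone of rays from y with slopes a and b, so that averaging over the slopes leaves a plain
    integral over the cone. *)
Lemma ray_sobolev u y a b : SW u -> 0 <= a <= 1 -> 0 <= b <= 1 ->
  u y ^+ 2 <= \int[leb]_(r in `[0, 1]) (4225 * (r ^+ 2 * jet2 u (ray y a b r))).
Proof.
move=> Hu ha hb; rewrite {1}(ray_representation y a b Hu).
have cb := @bump_jet_continuous u y a b Hu.
have c1 : continuous (fun r => r * bump_jet u y a b r).
  by move=> r; apply: cvgM; [exact: cvg_id|exact: cb].
apply: le_trans (jensen01 c1) _.
have cr (w : V -> R) : SW w -> continuous (fun r => w (ray y a b r) ^+ 2).
  move=> Hw r; apply: (@continuous_comp _ _ _ (fun r => w (ray y a b r)) (fun s : R => s ^+ 2)).
    exact: ray_continuous.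
  exact: exprn_continuous.
have cj (w : V -> R) : SW w -> continuous (fun r => jet1 w (ray y a b r)).
  move=> Hw r; apply: cvgD; [apply: cvgD; [apply: cvgD|]|].
  - exact: (cr _ (SW_Y1 Hw)).
  - exact: (cr _ (SW_Y2 Hw)).
  - exact: (cr _ (SW_Y3 Hw)).
  - exact: (cr _ (SW_Y4 Hw)).
have c2 : continuous (fun r => 4225 * (r ^+ 2 * jet2 u (ray y a b r))).
  move=> r; apply: cvgMr; apply: cvgM; first exact: exprn_continuous.
  apply: cvgD; [apply: cvgD; [exact: (cr _ Hu)|exact: (cj _ Hu)]|].
  apply: cvgD; [apply: cvgD; [apply: cvgD|]|].
  - exact: (cj _ (SW_Y1 Hu)).
  - exact: (cj _ (SW_Y2 Hu)).
  - exact: (cj _ (SW_Y3 Hu)).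
  - exact: (cj _ (SW_Y4 Hu)).
apply: le_Rintegral => //.
- apply: itv_integrable => r.
  apply: (@continuous_comp _ _ _ (fun r => r * bump_jet u y a b r) (fun s : R => s ^+ 2)).
    exact: c1.
  exact: exprn_continuous.
- exact: itv_integrable.
move=> r /=; rewrite in_itv/= => hr.
have := ler_wpM2l (sqr_ge0 (r : R)) (bump_jet_le u y ha hb hr).
by rewrite exprMn [X in _ -> _ <= X]mulrCA.
Qed.

(** The rays from one point sweep only three dimensions. The fourth is covered by this
    one-dimensional inequality along x4, at the price of one derivative X4. *)
Lemma x4_sobolev u x : SW u ->
  u x ^+ 2 <= \int[leb]_(t in `[0, 1]) (2 * (u (x + t *: e4) ^+ 2 + Y4 u (x + t *: e4) ^+ 2)).
Proof.
move=> Hu; pose A t := u (x + t *: e4); pose B t := Y4 u (x + t *: e4).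
have cA : continuous A by exact: line_continuous.
have cB : continuous B by apply: line_continuous; exact: SW_Y4.
pose F t := - ((1 - t) * (A t * A t)).
have D t : is_derive t 1 F (A t ^+ 2 - 2 * (1 - t) * (A t * B t)).
  have dA : is_derive t 1 A (B t) by apply: is_derive_line; exact: SW_derivable.
  have dr : is_derive t 1 (fun s : R => s) (1 : R) by exact: is_derive_id.
  have d1 : is_derive t 1 (fun s : R => 1 - s) (-1 : R).
    by have := is_derive_add (is_derive_const 1 t) (is_derive_scale (-1) dr);
      rewrite mulr1 add0r (_ : (fun s => 1 + -1 * s) = (fun s => 1 - s))//;
      apply/funext => s; rewrite mulN1r.
  have := is_derive_scale (-1) (is_derive_mul d1 (is_derive_mul dA dA)).
  rewrite (_ : (fun s => -1 * _) = F); last by apply/funext => s; rewrite mulN1r.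
  by move=> /is_derive_val; apply; move: (A t) (B t) => p q; ring.
have c1 : continuous (fun t => A t ^+ 2 - 2 * (1 - t) * (A t * B t)).
  move=> t; apply: cvgB.
    by apply: (@continuous_comp _ _ _ A (fun s : R => s ^+ 2)); [exact: cA|exact: exprn_continuous].
  apply: cvgM; first by apply: cvgMr; exact: onem_continuous.
  by apply: cvgM; [exact: cA|exact: cB].
have -> : u x ^+ 2 = \int[leb]_(t in `[0, 1]) (A t ^+ 2 - 2 * (1 - t) * (A t * B t)).
  rewrite (itv_FTC ler01 c1 D) /F; have -> : A 0 = u x by rewrite /A scale0r addr0.
  by move: (u x) (A 1) => p q; ring.
have csq (f : R -> R) : continuous f -> continuous (fun t => f t ^+ 2).
  by move=> cf t; apply: (@continuous_comp _ _ _ f (fun s : R => s ^+ 2)); [exact: cf|exact: exprn_continuous].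
apply: le_Rintegral => //.
- exact: itv_integrable.
- apply: itv_integrable => t; apply: cvgMr; apply: cvgD; [exact: (csq _ cA)|exact: (csq _ cB)].
move=> t /=; rewrite in_itv/= => /andP[t0 t1]; rewrite -/(A t) -/(B t).
have := sqr_ge0 (A t + B t); have := sqr_ge0 (A t - B t); have := sqr_ge0 (A t); have := sqr_ge0 (B t).
by move: (A t) (B t) => p q h1 h2 h3 h4; nra.
Qed.

End LineSobolev.

(** * Integration over the cone of rays *)

Section PointwiseSobolev.
Context (R : realType).
Local Notation V := (R * R * R * R)%type.
Local Notation mR := (measurableTypeR R).
Local Notation mV := (mR * mR * mR * mR)%type.
Local Notation leb := (@lebesgue_measure R).
Local Notation e4 := (@Defs.basis R i4).
Local Notation SW := (@real_schwartz R).
Local Notation mu := (engel_measure R).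
Implicit Types (u v : V -> R) (x y : V).

Lemma integral_R3 (f : mR * mR * mR -> \bar R) : measurable_fun setT f -> (forall z, (0 <= f z)%E) ->
  (\int[leb3 R]_z f z = \int[leb]_a \int[leb]_b \int[leb]_c f (a, b, c))%E.
Proof.
move=> mf f0.
pose F1 := fubini_F leb f.
have F10 z : (0 <= F1 z)%E by apply: integral_ge0.
have m1 : measurable_fun setT F1 := measurable_fun_fubini_tonelli_F (m2 := leb) f mf f0.
have E1 := fubini_tonelli1 (m1 := leb2 R) (m2 := leb) f mf f0.
have E2 := fubini_tonelli1 (m1 := leb) (m2 := leb) F1 m1 F10.
exact: (etrans E1 E2).
Qed.

(** The parameters are the slopes a and b, a displacement along x4 made before following the ray,
    and the time r; see [ray4E]. *)
Definition ray4 x (z : mV) : mV :=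
  (x.1.1.1 + z.2, x.1.1.2 + z.2 * z.1.1.1, x.1.2 + z.2 * (z.1.1.2 - x.1.1.1 * z.1.1.1),
   x.2 + z.1.2 + (x.1.1.1 ^+ 2 / 2 * z.1.1.1 - x.1.1.1 * z.1.1.2) * z.2).

Lemma ray4E x (a b s r : R) : ray4 x (a, b, s, r) = ray (x + s *: e4) a b r.
Proof.
case: x => [[[p q] t] v]; rewrite (basis_i4 R) scaleV !mulr0 mulr1 addV !addr0 /ray4 /ray /=.
by rewrite (mulrC r a) (mulrC r (b - p * a)).
Qed.

Lemma measurable_ray4 x : measurable_fun [set: mV] (ray4 x).
Proof.
have m1 : measurable_fun [set: mV] (fun z : mV => z.1.1.1) by do !apply: measurableT_comp => //.
have m2 : measurable_fun [set: mV] (fun z : mV => z.1.1.2) by do !apply: measurableT_comp => //.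
have m3 : measurable_fun [set: mV] (fun z : mV => z.1.2) by do !apply: measurableT_comp => //.
have m4 : measurable_fun [set: mV] (fun z : mV => z.2) by exact: measurable_snd.
have mM (k : R) (f : mV -> R) : measurable_fun setT f -> measurable_fun setT (fun z => k * f z).
  by move=> mf; apply: measurable_funM.
have mD (k : R) (f : mV -> R) : measurable_fun setT f -> measurable_fun setT (fun z => k + f z).
  by move=> mf; apply: measurable_funD.
apply: measurable_fun_pair; [apply: measurable_fun_pair; [apply: measurable_fun_pair|]|].
- exact: mD.
- by apply: mD; apply: measurable_funM.
- by apply: mD; apply: measurable_funM => //; apply: measurable_funB => //; exact: mM.
- apply: measurable_funD; first exact: mD.
  by apply: measurable_funM => //; apply: measurable_funB; exact: mM.
Qed.

Definition cut (r : R) : R := r ^+ 2 * (0 <= r <= 1)%R%:R.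

Lemma cut_ge0 r : 0 <= cut r. Proof. by rewrite mulr_ge0 ?sqr_ge0// ler0n. Qed.

Lemma measurable_cut : measurable_fun [set: mR] cut.
Proof.
apply: measurable_funM; first exact: measurable_funX.
rewrite (_ : (fun r => _) = \1_`[0%R, 1%R]); last first.
  by apply/funext => r; rewrite indicE mem_setE in_itv.
exact: measurable_indic.
Qed.

Definition rayK (G : mV -> \bar R) x (z : mV) : \bar R := ((cut z.2)%:E * G (ray4 x z))%E.

Section Upper.
Variables (G : mV -> \bar R) (x : V).
Hypotheses (mG : measurable_fun setT G) (G0 : forall z, (0 <= G z)%E).

Lemma rayK_ge0 z : (0 <= rayK G x z)%E.
Proof. by rewrite mule_ge0// lee_fin cut_ge0. Qed.

Lemma measurable_rayK : measurable_fun setT (rayK G x).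
Proof.
apply: emeasurable_funM; last exact: measurableT_comp mG (measurable_ray4 x).
by apply/measurable_EFinP; apply: measurableT_comp measurable_cut measurable_snd.
Qed.

Let F1 := fubini_F leb G.
Let F2 := fubini_F leb F1.
Let F3 := fubini_F leb F2.
Let F10 z : (0 <= F1 z)%E. Proof. exact: integral_ge0. Qed.
Let F20 z : (0 <= F2 z)%E. Proof. exact: integral_ge0. Qed.
Let F30 z : (0 <= F3 z)%E. Proof. exact: integral_ge0. Qed.
Let m1 : measurable_fun setT F1. Proof. exact: (measurable_fun_fubini_tonelli_F (m2 := leb) G mG G0). Qed.
Let m2 : measurable_fun setT F2. Proof. exact: (measurable_fun_fubini_tonelli_F (m2 := leb) F1 m1 F10). Qed.
Let m3 : measurable_fun setT F3. Proof. exact: (measurable_fun_fubini_tonelli_F (m2 := leb) F2 m2 F20). Qed.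

(** At fixed time the cone map is a translation in the x4 parameter and a dilation by r, up to
    translation, in each slope. The two dilations produce r^-2, which cancels the weight [cut]. *)
Lemma rayK_slice (r : R) : 0 < r -> r <= 1 ->
  (\int[leb]_a \int[leb]_b \int[leb]_c rayK G x (a, b, c, r) = F3 (x.1.1.1 + r)%R)%E.
Proof.
move=> r0 r1; have r0' := ltW r0.
have cr : cut r = r * r by rewrite /cut r0' r1 mulr1 expr2.
pose p := x.1.1.1.
have S1 (a b : R) : (\int[leb]_c rayK G x (a, b, c, r) =
    (r * r)%:E * F1 (p + r, x.1.1.2 + r * a, x.1.2 + r * (b - p * a))%R)%E.
  rewrite /rayK /= cr.
  pose k : R := x.2 + (p ^+ 2 / 2 * a - p * b) * r.
  have mg := measurable_section (p + r, x.1.1.2 + r * a, x.1.2 + r * (b - p * a)) mG.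
  rewrite ge0_integralZl//.
  - congr (_ * _)%E; rewrite /F1 /fubini_F -(integral_shift1 k mg (fun _ => G0 _)).
    by apply: eq_integral => c _; rewrite /ray4 /= -/p; congr (G (_, _)); rewrite /k; ring.
  - apply: (measurableT_comp mG); apply: (@measurableT_comp _ _ _ _ _ _ (ray4 x)); first exact: measurable_ray4.
    by apply: measurable_fun_pair => //; apply: measurable_fun_pair.
  - by rewrite lee_fin mulr_ge0.
have S2 (a : R) : (\int[leb]_b \int[leb]_c rayK G x (a, b, c, r) = r%:E * F2 (p + r, x.1.1.2 + r * a)%R)%E.
  have mg := measurable_section (p + r, x.1.1.2 + r * a) m1.
  pose k : R := x.1.2 - r * (p * a).
  rewrite /F2 /fubini_F -(integral_affine k r0 mg (fun _ => F10 _)) muleA -EFinM.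
  rewrite -ge0_integralZl//; last 2 first.
  - apply: (measurableT_comp mg); exact: (measurable_affine k r).
  - by rewrite lee_fin mulr_ge0.
  apply: eq_integral => b _; rewrite S1; congr (_ * F1 (_, _))%E; rewrite /k; ring.
have mg := measurable_section (p + r) m2.
transitivity (\int[leb]_a (r%:E * F2 (p + r, x.1.1.2 + r * a)%R))%E.
  by apply: eq_integral => a _; exact: S2.
have ma : measurable_fun [set: mR] (fun a : mR => F2 (p + r, x.1.1.2 + r * a)%R).
  apply: (measurableT_comp mg); exact: (measurable_affine x.1.1.2 r).
have r0e : (0 <= r%:E)%E by rewrite lee_fin.
apply: (etrans (ge0_integralZl leb measurableT ma (fun _ _ => F20 _) r0e)).
exact: (integral_affine x.1.1.2 r0 mg (fun _ => F20 _)).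
Qed.

(** Tonelli with the time outermost: on slices with 0 < r <= 1 there is equality by [rayK_slice],
    and elsewhere [cut] vanishes. *)
Lemma rayK_upper : (\int[mu]_z rayK G x z <= \int[mu]_z G z)%E.
Proof.
have E1 := fubini_tonelli2 (m1 := leb3 R) (m2 := leb) _ measurable_rayK rayK_ge0.
have -> : (\int[mu]_z rayK G x z = \int[leb]_r fubini_G (leb3 R) (rayK G x) r)%E by exact: E1.
have -> : (\int[mu]_z G z = \int[leb]_r F3 (x.1.1.1 + r)%R)%E.
  exact: (etrans (integral_R4 mG G0) (esym (integral_shift1 x.1.1.1 m3 F30))).
have mK := measurable_fun_fubini_tonelli_G (m1 := leb3 R) _ measurable_rayK rayK_ge0.
have m3' : measurable_fun [set: mR] (fun r => F3 (x.1.1.1 + r)%R).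
  by apply: (measurableT_comp m3); apply: measurable_funD.
apply: ge0_le_integral => //.
  by move=> r _; apply: integral_ge0 => z _; exact: rayK_ge0.
move=> r _; rewrite /fubini_G.
have ms : measurable_fun [set: mR * mR * mR] (fun z => rayK G x (z, r)).
  by apply: (measurableT_comp measurable_rayK); apply: measurable_fun_pair.
rewrite (integral_R3 ms (fun z => rayK_ge0 _)).
have [r0|r0] := ltP 0 r; last first.
  rewrite integral0_eq// => a _; rewrite integral0_eq// => b _; rewrite integral0_eq// => c _.
  rewrite /rayK /= /cut; have [->|rn0] := eqVneq r 0; first by rewrite expr0n mul0r mul0e.
  by rewrite leNgt lt_neqAle rn0 r0 /= mulr0 mul0e.
have [r1|r1] := leP r 1; first by rewrite rayK_slice.
rewrite integral0_eq// => a _; rewrite integral0_eq// => b _; rewrite integral0_eq// => c _.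
by rewrite /rayK /= /cut [(r <= 1)%R]leNgt r1 andbF mulr0 mul0e.
Qed.

End Upper.

Lemma itv_EFin (f : R -> R) (a b : R) : continuous f ->
  (\int[leb]_(t in `[a, b]) (f t)%:E = (\int[leb]_(t in `[a, b]) f t)%R%:E)%E.
Proof. by move=> cf; rewrite /Rintegral fineK//; exact: integrable_fin_num (itv_integrable a b cf). Qed.

Definition unit_ind (t : R) : R := (0 <= t <= 1)%R%:R.

Lemma unit_ind_ge0 t : 0 <= unit_ind t. Proof. exact: ler0n. Qed.

Lemma unit_indE : unit_ind = \1_`[0%R, 1%R].
Proof. by apply/funext => r; rewrite indicE mem_setE in_itv. Qed.

Lemma measurable_unit_ind : measurable_fun [set: mR] unit_ind.
Proof. by rewrite unit_indE; exact: measurable_indic. Qed.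

Lemma integral_unit_ind (f : R -> R) (k : R) : continuous f -> (forall t, 0 <= f t) -> 0 <= k ->
  (\int[leb]_t (k * (unit_ind t * f t))%:E = (k * \int[leb]_(t in `[0, 1]) f t)%R%:E)%E.
Proof.
move=> cf f0 k0.
have mf : measurable_fun [set: mR] f by exact: continuous_measurable_fun.
have mu1 := measurable_unit_ind.
under eq_integral do rewrite EFinM.
rewrite ge0_integralZl//; last 2 first.
- by apply/measurable_EFinP; apply: measurable_funM.
- by move=> t _; rewrite lee_fin mulr_ge0// unit_ind_ge0.
rewrite EFinM -(itv_EFin 0 1 cf); congr (_ * _)%E.
rewrite [RHS]integral_mkcond; apply: eq_integral => t _.
rewrite patchE mem_setE in_itv /= /unit_ind.
by case: ifP => _; rewrite ?mul1r ?mul0r.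
Qed.

Lemma continuous_sqr (f : R -> R) : continuous f -> continuous (fun t => f t ^+ 2).
Proof.
move=> cf t; apply: (@continuous_comp _ _ _ f (fun s : R => s ^+ 2)); first exact: cf.
exact: exprn_continuous.
Qed.

Lemma continuous_jet2 u y (a b : R) : SW u -> continuous (fun r => jet2 u (ray y a b r)).
Proof.
move=> Hu.
have cr (w : V -> R) : SW w -> continuous (fun r => w (ray y a b r) ^+ 2).
  by move=> Hw; apply: continuous_sqr; exact: ray_continuous.
have cj (w : V -> R) : SW w -> continuous (fun r => jet1 w (ray y a b r)).
  move=> Hw r; apply: cvgD; [apply: cvgD; [apply: cvgD|]|].
  - exact: (cr _ (SW_Y1 Hw)).
  - exact: (cr _ (SW_Y2 Hw)).
  - exact: (cr _ (SW_Y3 Hw)).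
  - exact: (cr _ (SW_Y4 Hw)).
move=> r; apply: cvgD; [apply: cvgD; [exact: (cr _ Hu)|exact: (cj _ Hu)]|].
apply: cvgD; [apply: cvgD; [apply: cvgD|]|].
- exact: (cj _ (SW_Y1 Hu)).
- exact: (cj _ (SW_Y2 Hu)).
- exact: (cj _ (SW_Y3 Hu)).
- exact: (cj _ (SW_Y4 Hu)).
Qed.

Definition sobG u (z : V) : R := 2 * (4225 * jet2 u z + 4225 * jet2 (Y4 u) z).

Lemma sobG_ge0 u z : 0 <= sobG u z.
Proof.
exact: (mulr_ge0 (ler0n _ _) (addr_ge0 (mulr_ge0 (ler0n _ _) (jet2_ge0 _ _)) (mulr_ge0 (ler0n _ _) (jet2_ge0 _ _)))).
Qed.

Lemma measurable_jet1 u : SW u -> measurable_fun [set: mV] (jet1 u : mV -> R).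
Proof.
move=> Hu; apply: measurable_funD; [apply: measurable_funD; [apply: measurable_funD|]|];
  apply: measurable_funX.
- exact: (SW_measurable (SW_Y1 Hu)).
- exact: (SW_measurable (SW_Y2 Hu)).
- exact: (SW_measurable (SW_Y3 Hu)).
- exact: (SW_measurable (SW_Y4 Hu)).
Qed.

Lemma measurable_jet2 u : SW u -> measurable_fun [set: mV] (jet2 u : mV -> R).
Proof.
move=> Hu; apply: measurable_funD.
  by apply: measurable_funD; [apply: measurable_funX; exact: SW_measurable|exact: measurable_jet1].
apply: measurable_funD; [apply: measurable_funD; [apply: measurable_funD|]|].
- exact: (measurable_jet1 (SW_Y1 Hu)).
- exact: (measurable_jet1 (SW_Y2 Hu)).
- exact: (measurable_jet1 (SW_Y3 Hu)).
- exact: (measurable_jet1 (SW_Y4 Hu)).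
Qed.

Lemma measurable_sobG u : SW u -> measurable_fun [set: mV] (sobG u : mV -> R).
Proof.
move=> Hu; have mc (k : R) : measurable_fun [set: mV] (fun=> k) by exact: measurable_cst.
apply: (measurable_funM (mc 2)); apply: measurable_funD; apply: (measurable_funM (mc _)).
  exact: measurable_jet2.
exact: (measurable_jet2 (SW_Y4 Hu)).
Qed.

Lemma itv_add2 (f g : R -> R) : continuous f -> continuous g ->
  \int[leb]_(r in `[0, 1]) (2 * (f r + g r)) =
  2 * (\int[leb]_(r in `[0, 1]) f r + \int[leb]_(r in `[0, 1]) g r).
Proof.
move=> cf cg; have cg2 : continuous (fun r => 2 * g r) by move=> r; apply: cvgMr; exact: cg.
rewrite mulrDr -[X in _ = _ + X]addr0.
rewrite -[X in _ + (_ + X)](_ : \int[leb]_(r in `[0, 1]) (fun=> 0 : R) r = 0); last first.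
  by rewrite /Rintegral integral0.
have c0 : continuous (fun _ : R => 0 : R) by exact: cst_continuous.
rewrite -(itv_lin 2 0 1 cg c0).
have c3 : continuous (fun r => 2 * g r + 0) by move=> r; apply: cvgD; [exact: cg2|exact: cvg_cst].
rewrite -(itv_lin 2 0 1 cf c3); apply: eq_Rintegral => r _.
by rewrite addr0 mulrDr.
Qed.

Lemma rayK_lower_slice u x (a b s : R) : SW u -> 0 <= a <= 1 -> 0 <= b <= 1 ->
  ((2 * (u (x + s *: e4) ^+ 2 + Y4 u (x + s *: e4) ^+ 2))%:E <=
   \int[leb]_r rayK (EFin \o (sobG u : mV -> R)) x (a, b, s, r))%E.
Proof.
move=> Hu ha hb; set y : V := x + s *: e4.
have cG : continuous (fun r : R => r ^+ 2 * sobG u (ray y a b r)).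
  move=> r; apply: cvgM; first exact: exprn_continuous.
  by apply: cvgMr; apply: cvgD; apply: cvgMr; [exact: continuous_jet2|exact: (continuous_jet2 (SW_Y4 Hu))].
have G0 (r : R) : 0 <= r ^+ 2 * sobG u (ray y a b r) by rewrite mulr_ge0 ?sqr_ge0// sobG_ge0.
have -> : (\int[leb]_r rayK (EFin \o (sobG u : mV -> R)) x (a, b, s, r) =
    \int[leb]_r (1 * (unit_ind r * (r ^+ 2 * sobG u (ray y a b r))))%:E)%E.
  apply: eq_integral => r _; rewrite /rayK /= ray4E -/y -EFinM mul1r /cut /unit_ind.
  by rewrite mulrA [X in (X * _)%R%:E]mulrC.
rewrite (integral_unit_ind cG G0 ler01) lee_fin mul1r.
have c1 (w : V -> R) : SW w -> continuous (fun r : R => 4225 * (r ^+ 2 * jet2 w (ray y a b r))).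
  move=> Hw r; apply: cvgMr; apply: cvgM; [exact: exprn_continuous|exact: continuous_jet2].
have -> : \int[leb]_(r in `[0, 1]) (r ^+ 2 * sobG u (ray y a b r)) =
    2 * (\int[leb]_(r in `[0, 1]) (4225 * (r ^+ 2 * jet2 u (ray y a b r))) +
         \int[leb]_(r in `[0, 1]) (4225 * (r ^+ 2 * jet2 (Y4 u) (ray y a b r)))).
  apply: (etrans _ (itv_add2 (c1 _ Hu) (c1 _ (SW_Y4 Hu)))); apply: eq_Rintegral => r _.
  by rewrite /sobG; move: (jet2 u _) (jet2 (Y4 u) _) (4225 : R) => p q k; ring.
exact: (ler_wpM2l (ler0n _ 2) (lerD (ray_sobolev y Hu ha hb) (ray_sobolev y (SW_Y4 Hu) ha hb))).
Qed.

(** Averaging [x4_sobolev] and then [ray_sobolev] over the unit cube of slopes and x4 displacements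
    bounds u(x)^2 by an integral over the cone, which [rayK_upper] compares with the integral over
    the group. *)
Lemma pointwise_sobolev u x : SW u -> ((u x ^+ 2)%:E <= \int[mu]_z (sobG u (z : V))%:E)%E.
Proof.
move=> Hu.
have mG : measurable_fun setT (EFin \o (sobG u : mV -> R)).
  by apply/measurable_EFinP; exact: measurable_sobG.
have G0 (z : mV) : (0 <= (EFin \o (sobG u : mV -> R)) z)%E by rewrite lee_fin sobG_ge0.
apply: le_trans (rayK_upper x mG G0).
have mK := measurable_rayK x mG; have K0 := rayK_ge0 x G0.
have E1 := fubini_tonelli1 (m1 := leb3 R) (m2 := leb) _ mK K0.
have -> : (\int[mu]_z rayK (EFin \o (sobG u : mV -> R)) x z =
  \int[leb3 R]_z fubini_F leb (rayK (EFin \o (sobG u : mV -> R)) x) z)%E by exact: E1.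
have mF := measurable_fun_fubini_tonelli_F (m2 := leb) _ mK K0.
pose phi (s : R) : R := 2 * (u (x + s *: e4) ^+ 2 + Y4 u (x + s *: e4) ^+ 2).
have cphi : continuous phi.
  move=> s; apply: cvgMr; apply: cvgD; apply: continuous_sqr; first exact: line_continuous.
  exact: (line_continuous (SW_Y4 Hu)).
have phi0 s : 0 <= phi s by rewrite mulr_ge0// addr_ge0 ?sqr_ge0.
have mphi : measurable_fun [set: mR] phi by exact: continuous_measurable_fun.
pose psi (z : mR * mR * mR) : R := unit_ind z.1.1 * (unit_ind z.1.2 * (unit_ind z.2 * phi z.2)).
have mi := measurable_unit_ind.
have mpsi : measurable_fun [set: mR * mR * mR] (fun z => (psi z)%:E).
  apply/measurable_EFinP; apply: measurable_funM.
    by apply: (measurableT_comp mi); apply: measurableT_comp.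
  apply: measurable_funM; first by apply: (measurableT_comp mi); apply: measurableT_comp.
  apply: measurable_funM; first exact: (measurableT_comp mi).
  exact: (measurableT_comp mphi).
have psi0 z : (0 <= (psi z)%:E)%E by rewrite lee_fin; exact: (mulr_ge0 (unit_ind_ge0 _) (mulr_ge0 (unit_ind_ge0 _) (mulr_ge0 (unit_ind_ge0 _) (phi0 _)))).
apply: (@le_trans _ _ (\int[leb3 R]_z (psi z)%:E)%E); last first.
  apply: ge0_le_integral => //.
  move=> [[a b] s] _; rewrite /psi /= /unit_ind.
  have nn : (0 <= fubini_F leb (rayK (EFin \o (sobG u : mV -> R)) x) (a, b, s))%E.
    by apply: integral_ge0 => r _; exact: K0.
  have [ha|] := boolP (0 <= a <= 1); last by rewrite mul0r.
  have [hb|] := boolP (0 <= b <= 1); last by rewrite mul0r mulr0.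
  have [hs|] := boolP (0 <= s <= 1); last by rewrite mul0r !mulr0.
  by rewrite !mul1r; exact: rayK_lower_slice.
rewrite (integral_R3 mpsi psi0).
have c1 : continuous (fun _ : R => 1 : R) by exact: cst_continuous.
have I1 : \int[leb]_(t in `[0, 1]) (fun=> 1 : R) t = 1.
  have D (t : R) : is_derive t 1 (fun t : R => t) (1 : R) by exact: is_derive_id.
  by rewrite (itv_FTC ler01 c1 D) subr0.
have I0 : 0 <= \int[leb]_(t in `[0, 1]) phi t by apply: Rintegral_ge0.
have -> : (\int[leb]_a \int[leb]_b \int[leb]_c (psi (a, b, c))%:E =
    (\int[leb]_(t in `[0, 1]) phi t)%R%:E)%E.
  have Ic (a b : R) : (\int[leb]_c (psi (a, b, c))%:E =
      (unit_ind a * \int[leb]_(t in `[0, 1]) phi t * (unit_ind b * 1))%R%:E)%E.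
    have := integral_unit_ind cphi phi0 (mulr_ge0 (unit_ind_ge0 a) (unit_ind_ge0 b)).
    have -> : unit_ind a * unit_ind b * \int[leb]_(t in `[0, 1]) phi t =
      unit_ind a * \int[leb]_(t in `[0, 1]) phi t * (unit_ind b * 1) by rewrite mulr1 mulrAC.
    by move=> <-; apply: eq_integral => c _; rewrite /psi /= mulrA.
  have Ib (a : R) : (\int[leb]_b \int[leb]_c (psi (a, b, c))%:E =
      (\int[leb]_(t in `[0, 1]) phi t * (unit_ind a * 1))%R%:E)%E.
    transitivity (\int[leb]_b (unit_ind a * \int[leb]_(t in `[0, 1]) phi t * (unit_ind b * 1))%R%:E)%E.
      by apply: eq_integral => b _; exact: Ic.
    apply: (etrans (integral_unit_ind c1 (fun=> ler01) (mulr_ge0 (unit_ind_ge0 a) I0))).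
    by rewrite I1 !mulr1 mulrC.
  transitivity (\int[leb]_a (\int[leb]_(t in `[0, 1]) phi t * (unit_ind a * 1))%R%:E)%E.
    by apply: eq_integral => a _; exact: Ib.
  apply: (etrans (integral_unit_ind c1 (fun=> ler01) I0)).
  by rewrite I1 mulr1.
rewrite lee_fin; exact: x4_sobolev.
Qed.

Lemma engel_shift (f : mV -> \bar R) (h : V) : measurable_fun setT f ->
  (forall z, (0 <= f z)%E) -> (\int[mu]_z (tau h f : mV -> \bar R) z = \int[mu]_z f z)%E.
Proof.
move=> mf f0; apply: (etrans _ (integral_shift4 h.1.1.1 h.1.1.2 h.1.2 h.2 mf f0)).
apply: eq_integral => z _; rewrite /tau; congr f; case: z => [[[a b] c] d].
by case: h => [[[p q] r] s]; rewrite /shift4 addV /= (addrC p) (addrC q) (addrC r) (addrC s).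
Qed.

Lemma engel_Wt : (\int[mu]_z (Wt (z : V))%:E < +oo)%E.
Proof. exact: integral_Wt. Qed.

Local Notation ip := (@ipr _ mV R mu).
Local Notation N f := (ip f f).
Local Notation integ f := (mu.-integrable setT (EFin \o (f : mV -> R))).

Let L2S u : SW u -> L2r mu (u : mV -> R). Proof. exact: (SW_L2 engel_Wt). Qed.

Definition has_integral (f : mV -> R) (A : R) : Prop := integ f /\ \int[mu]_z f z = A.

Lemma has_integralD f g (A B : R) : has_integral f A -> has_integral g B ->
  has_integral (fun z => f z + g z) (A + B).
Proof.
move=> [fi <-] [gi <-]; split; first exact: integrableD_real.
exact: RintegralD.
Qed.

Lemma has_integralZ k f (A : R) : has_integral f A -> has_integral (fun z => k * f z) (k * A).
Proof. by move=> [fi <-]; split; [exact: integrableZ_real|exact: RintegralZl]. Qed.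

Lemma N_jet u : SW u -> has_integral (fun z => u z ^+ 2) (N u).
Proof. by move=> Hu; have [_ H] := L2S Hu; split. Qed.

Lemma integral_jet1 u : SW u -> has_integral (jet1 u) (first_orderL mu u).
Proof.
move=> Hu; exact: (has_integralD (has_integralD (has_integralD (N_jet (SW_Y1 Hu)) (N_jet (SW_Y2 Hu)))
  (N_jet (SW_Y3 Hu))) (N_jet (SW_Y4 Hu))).
Qed.

Lemma integral_jet2 u : SW u -> has_integral (jet2 u)
  (N u + first_orderL mu u + (first_orderL mu (Y1 u) + first_orderL mu (Y2 u) +
  first_orderL mu (Y3 u) + first_orderL mu (Y4 u))).
Proof.
move=> Hu; exact: (has_integralD (has_integralD (N_jet Hu) (integral_jet1 Hu))
  (has_integralD (has_integralD (has_integralD (integral_jet1 (SW_Y1 Hu)) (integral_jet1 (SW_Y2 Hu)))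
  (integral_jet1 (SW_Y3 Hu))) (integral_jet1 (SW_Y4 Hu)))).
Qed.

Lemma le_10 (p q r s : R) : 0 <= s -> p <= s + r -> q <= 8 * (s + r) -> r + p + q <= 10 * (s + r).
Proof. lra. Qed.

Lemma le_sobK (k p q r s P Q : R) : k * P <= k * (10 * (q + p)) -> k * Q <= k * (10 * (s + r)) ->
  2 * (k * P + k * Q) <= 2 * (k * 10) * ((q + p) + (s + r)).
Proof. lra. Qed.

Lemma jet2_le u : SW u -> exists2 A : R, has_integral (jet2 u) A & A <= 10 * (N (Lap u) + N u).
Proof.
move=> Hu; eexists; first exact: integral_jet2.
exact: (le_10 (ipr_ge0 mu (Lap u)) (Lap_first engel_shift engel_Wt Hu) (Lap_second engel_shift engel_Wt Hu)).
Qed.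

(** The factors 2 and 4225 come from [sobG]; 10 = 1 + 1 + 8 counts the terms of order 0, 1 and 2 in
    [jet2_le]. *)
Definition sobK : R := 2 * (4225 * 10).

Lemma sobK_gt0 : 0 < sobK. Proof. exact: (mulr_gt0 (ltr0Sn _ _) (mulr_gt0 (ltr0Sn _ _) (ltr0Sn _ _))). Qed.

Lemma sobolev u x : SW u -> u x ^+ 2 <=
  sobK * ((N (Lap u) + N u) + (N (Lap (Y4 u)) + N (Y4 u))).
Proof.
move=> Hu; have H4 := SW_Y4 Hu; have [A hA a0] := jet2_le Hu; have [B hB a4] := jet2_le H4.
have [kG EG] := has_integralZ 2 (has_integralD (has_integralZ 4225 hA) (has_integralZ 4225 hB)).
have := pointwise_sobolev x Hu.
have -> : (\int[mu]_z (sobG u (z : V))%:E)%E = (2 * (4225 * A + 4225 * B))%:E.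
  by rewrite -EG /Rintegral fineK//; exact: integrable_fin_num kG.
rewrite lee_fin => /le_trans; apply.
have c0 : 0 <= 4225 :> R := ler0n _ _.
exact: (le_sobK (ler_wpM2l c0 a0) (ler_wpM2l c0 a4)).
Qed.

End PointwiseSobolev.

(** * The kernel bound from energy estimates *)

Lemma subrBB (U : zmodType) (a b c e : U) : a - b - (c - e) = a - c - (b - e).
Proof. by rewrite !opprB addrACA [RHS]addrACA [- c - b]addrC. Qed.

Section EnergyArgument.
Context (d : measure_display) (T : measurableType d) (R : realType).
Context (mu : {measure set T -> \bar R}).
Local Notation L2 := (L2c mu).
Local Notation ip := (ipc mu).
Local Notation nr := (nrmc mu).
Local Notation fT := (T -> R[i]).
(** Read [Lp] as L, [D] as - X4^2, [tr h] as the translation by h along x4, and [SS h] as the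
    segment integral of length h followed by its adjoint, so that D (SS h u) is a second
    difference. *)
Variables (Sch : fT -> Prop) (Lp D : fT -> fT) (tr SS : R -> fT -> fT).
Hypothesis Sch_L2 : forall u, Sch u -> L2 u.
Hypothesis Sch_Lp : forall u, Sch u -> Sch (Lp u).
Hypothesis Sch_D : forall u, Sch u -> Sch (D u).
Hypothesis Sch_tr : forall h u, Sch u -> Sch (tr h u).
Hypothesis Sch_SS : forall h u, 0 <= h -> Sch u -> Sch (SS h u).
Hypothesis Sch_B : forall u v, Sch u -> Sch v -> Sch (u - v).
Hypothesis L2_tr : forall h f, L2 f -> L2 (tr h f).
Hypothesis nr_tr : forall h f, L2 f -> nr (tr h f) = nr f.
Hypothesis tr_B : forall h f g, tr h (f - g) = tr h f - tr h g.
Hypothesis tr_adj : forall h f g, L2 f -> L2 g -> ip (tr h f) g = ip f (tr (- h) g).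
Hypothesis Lp_sym : forall u v, Sch u -> Sch v -> ip (Lp u) v = ip u (Lp v).
Hypothesis Lp_tr : forall h u, Sch u -> Lp (tr h u) = tr h (Lp u).
Hypothesis Lp_B : forall u v, Sch u -> Sch v -> Lp (u - v) = Lp u - Lp v.
Hypothesis D_tr : forall h u, Sch u -> D (tr h u) = tr h (D u).
Hypothesis D_le : forall u, Sch u -> nr (D u) <= nr (Lp u).
Hypothesis tr_sub : forall h u, 0 <= h -> Sch u -> nr (tr h u - u) ^+ 2 <= h ^+ 2 * ip (Lp u) u.
Hypothesis SS_Lp : forall h u, 0 <= h -> Sch u -> Lp (SS h u) = SS h (Lp u).
Hypothesis D_SS : forall h u, 0 <= h -> Sch u -> D (SS h u) = u + u - tr h u - tr (- h) u.
Hypothesis SS_pos : forall h u, 0 <= h -> Sch u -> 0 <= ip (Lp u) (SS h u).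
Hypothesis SS_le : forall h u, 0 <= h -> Sch u -> nr (SS h u) <= h ^+ 2 * nr u.
Hypothesis tr_decay : forall w f (eps : R), L2 w -> L2 f -> 0 < eps ->
  exists2 h, 0 <= h & `|ip w (tr h f)| <= eps /\ `|ip w (tr (- h) f)| <= eps.

Definition approx (g l : fT) : Prop := forall dl : R, 0 < dl ->
  exists u, [/\ Sch u, nr (u - g) <= dl & nr (Lp u - l) <= dl].

(* g in the domain of the closure of Lp, with image l, and D w = g weakly. *)
Definition triple (g l w : fT) : Prop :=
  [/\ L2 g, L2 l, L2 w, approx g l & forall chi, Sch chi -> ip g chi = ip w (D chi)].

Lemma approx_sym g l chi : L2 g -> L2 l -> approx g l -> Sch chi -> ip g (Lp chi) = ip l chi.
Proof.
move=> Hg Hl ap Hc; apply/eqP; rewrite -subr_eq0; apply/eqP.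
have HLc := Sch_L2 (Sch_Lp Hc); have Hc2 := Sch_L2 Hc.
apply: (@eq0_small R _ (nr (Lp chi) + nr chi)) => dl dl0.
have [u [Hu ug ul]] := ap _ dl0; have Hu2 := Sch_L2 Hu; have HL := Sch_L2 (Sch_Lp Hu).
have -> : ip g (Lp chi) - ip l chi = ip (Lp u - l) chi - ip (u - g) (Lp chi).
  by rewrite !ipcBl// Lp_sym//; lra.
apply: le_trans (ler_normB _ _) _; rewrite mulrDl addrC.
apply: lerD; apply: le_trans (ipc_le _ _) _ => //; try exact: L2cB.
  by rewrite mulrC ler_wpM2l// nrmc_ge0.
by rewrite mulrC ler_wpM2l// nrmc_ge0.
Qed.

Local Notation Th h f := (f + f - tr h f - tr (- h) f).

Lemma L2_Th h f : L2 f -> L2 (Th h f).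
Proof.
move=> Hf; exact: (L2cB (L2cB (L2cD Hf Hf) (L2_tr _ Hf)) (L2_tr _ Hf)).
Qed.

Lemma nr_Th h f : L2 f -> nr (Th h f) <= 4 * nr f.
Proof.
move=> Hf; have H1 := L2_tr h Hf; have H2 := L2_tr (- h) Hf.
have h1 := nrmcB (L2cB (L2cD Hf Hf) H1) H2; have h2 := nrmcB (L2cD Hf Hf) H1.
have h3 := nrmcD Hf Hf; rewrite !nr_tr// in h1 h2; lra.
Qed.

Lemma ThB h f g : Th h (f - g) = Th h f - Th h g.
Proof.
rewrite !tr_B; apply/funext => x; rewrite !fctE.
move: (f x) (g x) (tr h f x) (tr h g x) (tr (- h) f x) (tr (- h) g x) => p q r s t v; ring.
Qed.

(** For an approximant u of g, the second difference of L u is D (SS h (L u)) = D (L (SS h u)). The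
    weak equation turns its pairing with w into <g, L (SS h u)> = <l, SS h u>, close to <L u, SS h
    u>, which is nonnegative. *)
Lemma triple_Th g l w h : triple g l w -> 0 <= h -> 0 <= ip w (Th h l).
Proof.
move=> [Hg Hl Hw ap wk] h0.
(* Errors per unit of dl: 4 |w| for replacing L u by l under the second difference, and h^2 (|g| +
   1) for replacing l by L u against [SS h u]. *)
pose C := 4 * nr w + h ^+ 2 * (nr g + 1).
have C0 : 0 <= C by rewrite addr_ge0// mulr_ge0 ?addr_ge0 ?sqr_ge0// nrmc_ge0.
suff H (dl : R) : 0 < dl -> dl <= 1 -> - (C * dl) <= ip w (Th h l).
  rewrite -oppr_le0; apply: ler_addeps_all => e e0; rewrite add0r lerNl.
  have C1 : 0 < C + 1 by rewrite ltr_wpDl.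
  pose dl := Num.min 1 (e / (C + 1)).
  have dl0 : 0 < dl by rewrite lt_min ltr01 divr_gt0.
  apply: le_trans (H dl dl0 _); last by rewrite ge_min lexx.
  rewrite lerN2; apply: (@le_trans _ _ ((C + 1) * dl)).
    by rewrite ler_wpM2r ?(ltW dl0)// lerDl.
  by rewrite mulrC -ler_pdivlMr// ge_min lexx orbT.
move=> dl0 dl1; have [u [Hu ug ul]] := ap _ dl0.
have HLu := Sch_Lp Hu; have L2u := Sch_L2 Hu; have L2Lu := Sch_L2 HLu.
have HS := Sch_SS h0 Hu; have L2S := Sch_L2 HS.
have E1 : ip w (Th h (Lp u)) = ip l (SS h u).
  rewrite -(approx_sym Hg Hl ap HS) (wk _ (Sch_Lp HS)) SS_Lp// D_SS//.
have E2 : ip w (Th h l) = ip w (Th h (Lp u)) - ip w (Th h (Lp u - l)).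
  by rewrite (ThB h (Lp u) l) (ipcBr (L2_Th h L2Lu) (L2_Th h Hl) Hw) subKr.
rewrite E2 E1.
have b1 : ip w (Th h (Lp u - l)) <= 4 * nr w * dl.
  have Hd := L2cB L2Lu Hl; apply: le_trans (ler_norm _) _.
  apply: le_trans (ipc_le Hw (L2_Th h Hd)) _; have -> : 4 * nr w * dl = nr w * (4 * dl) by ring.
  by rewrite ler_wpM2l ?nrmc_ge0// (le_trans (nr_Th h Hd))// ler_wpM2l.
have b2 : ip l (SS h u) = ip (Lp u) (SS h u) - ip (Lp u - l) (SS h u) by rewrite ipcBl//; lra.
have b3 : ip (Lp u - l) (SS h u) <= dl * (h ^+ 2 * (nr g + 1)).
  apply: le_trans (ler_norm _) _; apply: le_trans (ipc_le (L2cB L2Lu Hl) L2S) _.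
  rewrite ler_pM ?nrmc_ge0//; apply: le_trans (SS_le h0 Hu) _.
  rewrite ler_wpM2l ?sqr_ge0//; have := nrmc_dist L2u Hg; have := ler_norm (nr u - nr g); lra.
have := SS_pos h0 Hu; rewrite b2 /C mulrDl; lra.
Qed.

(** Far translates of l become orthogonal to w ([tr_decay]), so the second difference paired with w
    tends to 2 <w, l>. *)
Lemma triple_pos g l w : triple g l w -> 0 <= ip w l.
Proof.
move=> tp; have [Hg Hl Hw ap wk] := tp.
suff : - ip w l <= 0 by rewrite oppr_le0.
apply: ler_addeps_all => e e0; rewrite add0r.
have [h h0 [h1 h2]] := tr_decay Hw Hl e0.
have := triple_Th tp h0; have H1 := L2_tr h Hl; have H2 := L2_tr (- h) Hl.
rewrite (ipcBr (L2cB (L2cD Hl Hl) H1) H2 Hw) (ipcBr (L2cD Hl Hl) H1 Hw) (ipcDr Hl Hl Hw).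
move: h1 h2; rewrite !ler_norml => /andP[a1 a2] /andP[a3 a4]; lra.
Qed.

Lemma triple_le g l w : triple g l w -> nr l ^+ 2 + nr w ^+ 2 <= nr (l + w) ^+ 2.
Proof.
move=> tp; have := triple_pos tp; have [Hg Hl Hw _ _] := tp.
rewrite !nrmc_sqr (ipcDl Hl Hw (L2cD Hl Hw)) (ipcDr Hl Hw Hl) (ipcDr Hl Hw Hw) (ipcC mu l w); lra.
Qed.

(** Test the weak equation with approximants u of g: <g, u> = <w, D u>, and |D u| <= |L u|. *)
Lemma triple_g g l w : triple g l w -> nr g ^+ 2 <= nr w * nr l.
Proof.
move=> [Hg Hl Hw ap wk]; have n0 := nrmc_ge0 mu.
apply: ler_addeps_all => e e0.
have C1 : 0 < nr g + nr w + 1 by rewrite ltr_wpDl ?addr_ge0.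
have [u [Hu ug ul]] := ap _ (divr_gt0 e0 C1).
set dl := e / _ in ug ul; have dl0 : 0 < dl by exact: divr_gt0.
have edl : e = (nr g + nr w + 1) * dl by rewrite mulrC divfK ?gt_eqF.
have Hu2 := Sch_L2 Hu; have HL := Sch_L2 (Sch_Lp Hu).
have -> : nr g ^+ 2 = ip w (D u) - ip (u - g) g.
  by rewrite -(wk _ Hu) nrmc_sqr (ipcBl Hu2 Hg Hg) (ipcC mu u g); lra.
have b1 : ip w (D u) <= nr w * (nr l + dl).
  apply: le_trans (ler_norm _) _; apply: le_trans (ipc_le Hw (Sch_L2 (Sch_D Hu))) _.
  rewrite ler_wpM2l//; apply: le_trans (D_le Hu) _.
  by have := nrmc_dist HL Hl; have := ler_norm (nr (Lp u) - nr l); lra.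
have b2 : - ip (u - g) g <= dl * nr g.
  rewrite lerNl; have := ipc_le (L2cB Hu2 Hg) Hg; rewrite ler_norml => /andP[h1 _].
  by apply: le_trans h1; rewrite lerN2 ler_wpM2r.
rewrite edl; nra.
Qed.

(** Makes [triple_le] available for increments, where it compares the increment of l with that of l
    + w = A g. *)
Lemma triple_tr g l w h : triple g l w -> triple (tr h g - g) (tr h l - l) (tr h w - w).
Proof.
move=> [Hg Hl Hw ap wk]; split; try by apply: L2cB => //; exact: L2_tr.
- move=> dl dl0; have [u [Hu ug ul]] := ap _ (divr_gt0 dl0 (ltr0n _ 2)).
  have Hu2 := Sch_L2 Hu; have HL := Sch_L2 (Sch_Lp Hu).
  exists (tr h u - u); split; first by apply: Sch_B => //; exact: Sch_tr.
    have -> : tr h u - u - (tr h g - g) = tr h (u - g) - (u - g).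
      by rewrite tr_B; exact: subrBB.
    have Hd := L2cB Hu2 Hg; apply: le_trans (nrmcB (L2_tr h Hd) Hd) _; rewrite nr_tr//; lra.
  have -> : Lp (tr h u - u) - (tr h l - l) = tr h (Lp u - l) - (Lp u - l).
    by rewrite Lp_B ?Lp_tr ?tr_B//; [exact: subrBB|exact: Sch_tr].
  have Hd := L2cB HL Hl; apply: le_trans (nrmcB (L2_tr h Hd) Hd) _; rewrite nr_tr//; lra.
- move=> chi Hc; have Hc2 := Sch_L2 Hc; have HD := Sch_L2 (Sch_D Hc).
  rewrite (ipcBl (L2_tr h Hg) Hg Hc2) (ipcBl (L2_tr h Hw) Hw HD) !tr_adj//.
  by rewrite (wk _ Hc) (wk _ (Sch_tr (- h) Hc)) D_tr.
Qed.

Lemma triple_sub g l w h : 0 <= h -> triple g l w -> nr (tr h g - g) ^+ 2 <= h ^+ 2 * (nr l * nr g).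
Proof.
move=> h0 [Hg Hl Hw ap _]; have n0 := nrmc_ge0 mu.
suff : nr (tr h g - g) <= h * Num.sqrt (nr l * nr g).
  move=> H; rewrite -[X in _ <= _ * X]sqr_sqrtr ?mulr_ge0// -exprMn.
  by rewrite lerXn2r ?nnegrE// mulr_ge0// sqrtr_ge0.
apply: ler_addeps_all => e e0.
have s0 : 0 <= Num.sqrt (nr l * nr g) by exact: sqrtr_ge0.
(* sqrt is 1/2-Hoelder: (sqrt A + c)^2 >= A + c^2 *)
pose c := e / (2 * (h + 1)); have h1 : 0 < 2 * (h + 1) by lra.
have c0 : 0 < c by exact: divr_gt0.
have ch : h * c <= e / 2.
  have -> : e / 2 = (h + 1) * c by rewrite /c; field; lra.
  by rewrite ler_wpM2r ?(ltW c0)// lerDl.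
have K1 : 0 < nr l + nr g + 1 + 2 by have := n0 l; have := n0 g; lra.
pose dl := Num.min 1 (Num.min (e / 4) (c ^+ 2 / (nr l + nr g + 1 + 2))).
have dl0 : 0 < dl by rewrite !lt_min ltr01 !divr_gt0// exprn_gt0.
have dl1 : dl <= 1 by rewrite ge_min lexx.
have dle : dl <= e / 4 by rewrite !ge_min lexx !orbT.
have dlc : (nr l + nr g + 1 + 2) * dl <= c ^+ 2.
  by rewrite mulrC -ler_pdivlMr// !ge_min lexx !orbT.
have [u [Hu ug ul]] := ap _ dl0.
have Hu2 := Sch_L2 Hu; have HL := Sch_L2 (Sch_Lp Hu).
have nu : nr u <= nr g + dl by have := nrmc_dist Hu2 Hg; have := ler_norm (nr u - nr g); lra.
have nL : nr (Lp u) <= nr l + dl by have := nrmc_dist HL Hl; have := ler_norm (nr (Lp u) - nr l); lra.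
have ipu : ip (Lp u) u <= nr l * nr g + c ^+ 2.
  apply: le_trans (ler_norm _) _; apply: le_trans (ipc_le HL Hu2) _.
  apply: (@le_trans _ _ ((nr l + dl) * (nr g + dl))); first by rewrite ler_pM.
  have : dl * dl <= 1 * dl by rewrite ler_wpM2r// ltW.
  have := n0 l; have := n0 g; move: dlc; rewrite !mulrDl; nra.
have tu : nr (tr h u - u) <= h * (Num.sqrt (nr l * nr g) + c).
  have t0 := mulr_ge0 h0 (addr_ge0 s0 (ltW c0)).
  suff : nr (tr h u - u) ^+ 2 <= (h * (Num.sqrt (nr l * nr g) + c)) ^+ 2 by rewrite ler_sqr ?nnegrE.
  rewrite exprMn; apply: le_trans (tr_sub h0 Hu) _; apply: (ler_wpM2l (sqr_ge0 h)).
  rewrite sqrrD sqr_sqrtr ?mulr_ge0//; apply: le_trans ipu _; rewrite addrAC lerDl.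
  exact: (mulrn_wge0 2 (mulr_ge0 s0 (ltW c0))).
have tgu : nr (tr h g - g) <= nr (tr h u - u) + 2 * dl.
  have Hd := L2cB Hu2 Hg; have Ht := L2cB (L2_tr h Hd) Hd.
  have -> : tr h g - g = (tr h u - u) - (tr h (u - g) - (u - g)).
    rewrite tr_B; apply/funext => x; rewrite !fctE.
    by move: (tr h g x) (tr h u x) (u x) (g x) => p q r s; ring.
  apply: le_trans (nrmcB (L2cB (L2_tr h Hu2) Hu2) Ht) _; rewrite lerD2l.
  by apply: le_trans (nrmcB (L2_tr h Hd) Hd) _; rewrite nr_tr//; lra.
by apply: le_trans tgu _; move: tu; rewrite mulrDr; lra.
Qed.

Variables (A : operator T R) (K : R).
Local Notation nm f := (fun x => ComplexField.Normc.normc (f x)).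
Hypothesis K0 : 0 <= K.
Hypothesis A_sum : forall g h, A g h -> exists l w,
  [/\ L2 l, L2 w, L2 g /\ L2 h, eqL2 mu h (l + w) & approx g l].
Hypothesis A_D : forall chi, Sch chi -> A (D chi) (Lp (D chi) + chi).
Hypothesis kernel_Sch : forall u f (eta : R), Sch u -> L2 f ->
  mu.-integrable [set: T] (EFin \o nm f) -> 0 < eta -> eta <= 1 ->
  `|ip u f| <= eta * (nr (Lp u) + nr u) * nr f +
    K * (nr (Lp u) + nr u + eta^-1 * (nr (tr eta (Lp u) - Lp u) + nr (tr eta u - u))) *
    \int[mu]_x nm f x.

(** Symmetry of A is tested on D chi, where A (D chi) = L (D chi) + chi: from <l + w, D chi> = <g, L
    (D chi)> + <g, chi> the terms with L cancel by [approx_sym], leaving the weak equation. *)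
Lemma A_triple g h : A g h -> (forall f a, A f a -> ip h f = ip g a) -> exists l w,
  [/\ triple g l w, L2 h & eqL2 mu h (l + w)].
Proof.
move=> Agh Hsym; have [l [w [Hl Hw [Hg Hh] hlw ap]]] := A_sum Agh; exists l, w; split => //; split => //.
move=> chi Hc; have HD := Sch_D Hc; have L2D := Sch_L2 HD.
have := Hsym _ _ (A_D Hc).
rewrite (ipc_eq Hh (L2cD Hl Hw) L2D hlw) (ipcDl Hl Hw L2D).
rewrite (ipcDr (Sch_L2 (Sch_Lp HD)) (Sch_L2 Hc) Hg) (approx_sym Hg Hl ap HD); lra.
Qed.

(** The estimate for Schwartz functions passes to the closure at fixed eta, because it involves only
    norms of the function, of its image under L and of their translates, all continuous in the graph
    norm. The constant C collects the errors per unit of dl. *)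
Lemma kernel_approx g l f (eta : R) : L2 g -> L2 l -> approx g l -> L2 f ->
  mu.-integrable [set: T] (EFin \o nm f) -> 0 < eta -> eta <= 1 ->
  `|ip g f| <= eta * (nr l + nr g) * nr f +
    K * (nr l + nr g + eta^-1 * (nr (tr eta l - l) + nr (tr eta g - g))) * \int[mu]_x nm f x.
Proof.
move=> Hg Hl ap Hf fi eta0 eta1; apply: ler_addeps_all => e e0.
set I := \int[mu]_x nm f x.
have I0 : 0 <= I by apply: Rintegral_ge0 => x _; exact: normc_nneg.
pose C := nr f + 2 * eta * nr f + K * (2 + 4 * eta^-1) * I.
have iet : 0 <= eta^-1 by rewrite invr_ge0 ltW.
have n0 := nrmc_ge0 mu.
have C0 : 0 <= C.
  have := n0 f; have t1 := mulr_ge0 (ltW eta0) (n0 f); have t2 : 0 <= K * (2 + 4 * eta^-1) * I.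
    by rewrite mulr_ge0// mulr_ge0//; lra.
  by rewrite /C; lra.
have C1 : 0 < C + 1 by lra.
have dl0 := divr_gt0 e0 C1; have [u [Hu ug ul]] := ap _ dl0.
set dl := e / (C + 1) in dl0 ug ul.
have Ce : C * dl <= e.
  have -> : e = (C + 1) * dl by rewrite mulrC divfK ?gt_eqF.
  by rewrite ler_wpM2r ?(ltW dl0)// lerDl.
have Hu2 := Sch_L2 Hu; have HL := Sch_L2 (Sch_Lp Hu).
have near1 (a b : T -> R[i]) : L2 a -> L2 b -> nr (a - b) <= dl -> nr a <= nr b + dl.
  by move=> Ha Hb ab; have := nrmc_dist Ha Hb; have := ler_norm (nr a - nr b); lra.
have near2 (a b : T -> R[i]) : L2 a -> L2 b -> nr (a - b) <= dl ->
    nr (tr eta a - a) <= nr (tr eta b - b) + 2 * dl.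
  move=> Ha Hb ab; have Hd := L2cB Ha Hb.
  have -> : tr eta a - a = (tr eta b - b) + (tr eta (a - b) - (a - b)).
    by rewrite tr_B (subrBB (tr eta a)) [RHS]addrC subrK.
  apply: le_trans (nrmcD (L2cB (L2_tr eta Hb) Hb) (L2cB (L2_tr eta Hd) Hd)) _; rewrite lerD2l.
  by apply: le_trans (nrmcB (L2_tr eta Hd) Hd) _; rewrite nr_tr//; lra.
have a1 := near1 _ _ HL Hl ul; have a2 := near1 _ _ Hu2 Hg ug.
have a3 := near2 _ _ HL Hl ul; have a4 := near2 _ _ Hu2 Hg ug.
have -> : ip g f = ip u f - ip (u - g) f by rewrite (ipcBl Hu2 Hg Hf) subKr.
apply: le_trans (ler_normB _ _) _.
have b1 : `|ip (u - g) f| <= dl * nr f.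
  by apply: le_trans (ipc_le (L2cB Hu2 Hg) Hf) _; rewrite ler_wpM2r.
have b2 : eta * (nr (Lp u) + nr u) * nr f <= eta * (nr l + nr g + 2 * dl) * nr f.
  by rewrite ler_wpM2r// ler_wpM2l ?(ltW eta0)//; lra.
have b3 : K * (nr (Lp u) + nr u + eta^-1 * (nr (tr eta (Lp u) - Lp u) + nr (tr eta u - u))) * I <=
    K * (nr l + nr g + 2 * dl + eta^-1 * (nr (tr eta l - l) + nr (tr eta g - g) + 4 * dl)) * I.
  rewrite ler_wpM2r// ler_wpM2l//; apply: lerD; first by lra.
  by rewrite ler_wpM2l//; lra.
have := kernel_Sch Hu Hf fi eta0 eta1; rewrite -/I.
move: b1 b2 b3 Ce; rewrite /C.
move: (`|ip u f|) (`|ip (u - g) f|) (nr (tr eta l - l) + nr (tr eta g - g)) => X Y Z.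
move: (K * (nr (Lp u) + nr u + _) * I) (eta * (nr (Lp u) + nr u) * nr f) => P Q.
move: (nr l) (nr g) (nr f) (eta^-1) => p q r s b1 b2 b3 Ce b4.
apply: le_trans (lerD (le_trans b4 (lerD b2 b3)) b1) _.
rewrite [leRHS]addrC -subr_ge0; apply: le_trans (_ : 0 <= e - (r + 2 * eta * r + K * (2 + 4 * s) * I) * dl) _.
  by rewrite subr_ge0.
by rewrite le_eqVlt; apply/orP; left; apply/eqP; ring.
Qed.

Variable E : set R -> fT -> fT.
Hypothesis sE : spectral_measure mu E.
Hypothesis AE : forall f g, A f g <-> spectral_integral mu E id f g.
Local Notation range s g := (eqL2 mu (E `[0, s[%classic g) g).

Lemma range_bounds (s : R) g : 0 < s -> L2 g -> range s g -> exists l w h,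
  [/\ triple g l w, L2 h /\ range s h, eqL2 mu h (l + w), nr h <= s * nr g & 2 * nr g ^+ 2 <= nr h ^+ 2].
Proof.
move=> s0 Hg gs; have [h [Agh Hh hs hg sym]] := bounded_on_range sE AE s0 Hg gs.
have [l [w [tp _ hlw]]] := A_triple Agh sym; exists l, w, h; split => //.
have := triple_le tp; have := triple_g tp; have [_ Hl Hw _ _] := tp.
rewrite (nrmc_eq Hh (L2cD Hl Hw) hlw); have := sqr_ge0 (nr l - nr w).
by move: (nr g ^+ 2) (nr (l + w) ^+ 2) (nr l) (nr w) => p q r t; rewrite sqrrB; lra.
Qed.

Lemma range_l (s : R) g l w h : triple g l w -> L2 h -> eqL2 mu h (l + w) -> nr l <= nr h.
Proof.
move=> tp Hh hlw; have := triple_le tp; have [_ Hl Hw _ _] := tp.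
rewrite -(nrmc_eq Hh (L2cD Hl Hw) hlw) => H.
rewrite -(@ler_sqr R) ?nnegrE ?nrmc_ge0//; apply: le_trans H; rewrite lerDl sqr_ge0//.
Qed.

(** On this range |A g| <= |g| while 2 |g|^2 <= |A g|^2, so g vanishes. *)
Lemma below_one f : L2 f -> ip (E `[0, 1[%classic f) f = 0.
Proof.
move=> Hf; have m1 : measurable (`[0, 1[%classic : set R) by exact: measurable_itv.
have Hg := E_L2 sE m1 Hf; set g := E _ f in Hg *.
have gs : range 1 g.
  apply: eqL2_ip => //; first exact: (E_L2 sE m1 Hg).
  move=> h Hh; rewrite (E_sym sE)// /g (E_setI sE)// setIid//.
have [l [w [h [_ _ _ h1 h2]]]] := range_bounds ltr01 Hg gs.
rewrite -(nr_E_sqr sE)// -/g; move: h1; rewrite mul1r => h1.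
have n0 := nrmc_ge0 mu; have : nr h ^+ 2 <= nr g ^+ 2 by rewrite lerXn2r ?nnegrE.
by have := sqr_ge0 (nr g); lra.
Qed.

Lemma le_sqr_of (a b : R) : 0 <= b -> a ^+ 2 <= b ^+ 2 -> a <= b.
Proof. by move=> b0 ab; have [a0|/ltW a0] := leP 0 a; [rewrite -(@ler_sqr R) ?nnegrE|exact: le_trans b0]. Qed.

(** The bracket of [kernel_approx] has four terms: |l|, |g| and the two difference quotients, at
    most t^2, 1, t^3 and t times |g|. Each is at most t^3 |g|, whence the 4; the remaining term
    vanishes with eta. *)
Lemma range_kernel (t : R) g f : 1 <= t -> L2 g -> range (t ^+ 2) g -> L2 f ->
  mu.-integrable [set: T] (EFin \o nm f) -> `|ip g f| <= 4 * K * t ^+ 3 * nr g * \int[mu]_x nm f x.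
Proof.
move=> t1 Hg gs Hf fi; have t0 : 0 < t by lra.
have s0 : 0 < t ^+ 2 by rewrite exprn_gt0.
have n0 := nrmc_ge0 mu.
have [l [w [h [tp [Hh hs] hlw hg _]]]] := range_bounds s0 Hg gs.
have [_ Hl Hw ap _] := tp.
have lh := range_l (t ^+ 2) tp Hh hlw.
have lg : nr l <= t ^+ 2 * nr g := le_trans lh hg.
(* h = A g lies in the same subspace, so it has a triple of its own; this controls the increments of
   h. *)
have [l' [w' [h' [tp' [Hh' _] hlw' hg' _]]]] := range_bounds s0 Hh hs.
have lh' := le_trans (range_l (t ^+ 2) tp' Hh' hlw') hg'.
have sub_g (eta : R) : 0 < eta -> nr (tr eta g - g) <= eta * (t * nr g).
  move=> eta0; apply: le_sqr_of; first by rewrite !mulr_ge0// ltW.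
  apply: le_trans (triple_sub (ltW eta0) tp) _; rewrite exprMn ler_wpM2l ?sqr_ge0//.
  by rewrite exprMn [nr g ^+ 2]expr2 mulrA ler_wpM2r.
have sub_h (eta : R) : 0 < eta -> nr (tr eta h - h) <= eta * (t ^+ 3 * nr g).
  move=> eta0; apply: le_sqr_of; first by rewrite !mulr_ge0 ?exprn_ge0 ?(ltW eta0) ?(ltW t0).
  apply: le_trans (triple_sub (ltW eta0) tp') _; rewrite exprMn ler_wpM2l ?sqr_ge0//.
  apply: (@le_trans _ _ (t ^+ 2 * nr h * nr h)); first by rewrite ler_wpM2r.
  have -> : (t ^+ 3 * nr g) ^+ 2 = t ^+ 2 * ((t ^+ 2 * nr g) * (t ^+ 2 * nr g)) by ring.
  by rewrite -mulrA ler_wpM2l ?(ltW s0)// ler_pM.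
(* The increments of l and w add up to that of h up to equality in L2, and form a triple with the
   increment of g, so [triple_le] bounds the increment of l by that of h. *)
have sub_l (eta : R) : 0 < eta -> nr (tr eta l - l) <= eta * (t ^+ 3 * nr g).
  move=> eta0; apply: le_trans (sub_h _ eta0).
  have tp2 := triple_tr eta tp; have Hlw := L2cD Hl Hw.
  have Hd := L2cB Hh Hlw.
  have d0 : nr (h - (l + w)) = 0 := hlw.
  have H2 := L2cB (L2_tr eta Hd) Hd.
  have z : nr (tr eta (h - (l + w)) - (h - (l + w))) = 0.
    by apply/le_anti; rewrite n0 andbT (le_trans (nrmcB (L2_tr eta Hd) Hd))// nr_tr// d0 addr0.
  have e1 : nr (tr eta h - h) = nr ((tr eta l - l) + (tr eta w - w)).
    have [_ A1 A2 _ _] := tp2; apply: nrmc_eq; [exact: (L2cB (L2_tr eta Hh) Hh)|exact: L2cD|].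
    rewrite /eqL2 -z; congr nr; rewrite tr_B.
    have -> : tr eta (l + w) = tr eta l + tr eta w.
      have := tr_B eta (l + w) w; rewrite addrK => ->; by rewrite subrK.
    apply/funext => x; rewrite !fctE.
    by move: (tr eta h x) (h x) (tr eta l x) (l x) (tr eta w x) (w x) => a b c a' b' c'; ring.
  rewrite e1; apply: le_sqr_of; first exact: n0.
  by apply: le_trans (triple_le tp2); rewrite lerDl sqr_ge0.
set I := \int[mu]_x nm f x.
have I0 : 0 <= I by apply: Rintegral_ge0 => x _; exact: normc_nneg.
apply: ler_addeps_all => e e0.
pose C := (nr l + nr g) * nr f.
have C0 : 0 <= C by rewrite mulr_ge0// addr_ge0.
have C1 : 0 < C + 1 by lra.
pose eta := Num.min 1 (e / (C + 1)).
have eta0 : 0 < eta by rewrite lt_min ltr01 divr_gt0.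
have eta1 : eta <= 1 by rewrite ge_min lexx.
have eC : eta * C <= e.
  apply: (@le_trans _ _ (eta * (C + 1))); first by rewrite ler_wpM2l ?(ltW eta0)// lerDl.
  by rewrite -ler_pdivlMr// ge_min lexx orbT.
apply: le_trans (kernel_approx Hg Hl ap Hf fi eta0 eta1) _; rewrite addrC lerD//; last by rewrite -mulrA.
rewrite -/I ler_wpM2r// -!mulrA mulrCA ler_wpM2l//.
have q1 : eta^-1 * (nr (tr eta l - l) + nr (tr eta g - g)) <= t ^+ 3 * nr g + t * nr g.
  rewrite ler_pdivrMl// mulrDr lerD//; [exact: sub_l|exact: sub_g].
have p0 := n0 g.
have k1 : 1 * nr g <= t ^+ 3 * nr g by rewrite ler_wpM2r// exprn_ege1.
have k2 : t * nr g <= t ^+ 3 * nr g by rewrite ler_wpM2r// -[leLHS]expr1 ler_weXn2l.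
have k3 : t ^+ 2 * nr g <= t ^+ 3 * nr g by rewrite ler_wpM2r// ler_weXn2l.
by lra.
Qed.

(** Here t^2 = 2^(j+1) is the right end of [dyad j], so t^6 = 8 8^j; squaring 4 K t^3 gives 16 times
    8, that is 128. *)
Lemma energy_kernel_bound : kernel_bound mu E (128 * K ^+ 2).
Proof.
split; first exact: below_one.
move=> j f Hf fi; have mD : measurable (dyad j : set R) by exact: measurable_dyad.
 have Hg := E_L2 sE mD Hf.
set g := E (dyad j) f in Hg *; set I := \int[mu]_x _.
have I0 : 0 <= I by apply: Rintegral_ge0 => x _; exact: normc_nneg.
pose t : R := Num.sqrt (2 ^+ j.+1).
have p2 : 1 <= 2 ^+ j.+1 :> R by rewrite exprn_ege1 ?ler1n.
have t2 : t ^+ 2 = 2 ^+ j.+1 by rewrite sqr_sqrtr// (le_trans ler01).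
have t1 : 1 <= t by rewrite -[leLHS]sqrtr1 ler_sqrt// (lt_le_trans ltr01).
have gs : range (t ^+ 2) g.
  rewrite t2; have mI : measurable (`[0, 2 ^+ j.+1[%classic : set R) by exact: measurable_itv.
  apply: eqL2_ip => //; first exact: (E_L2 sE mI Hg).
  move=> h Hh; rewrite (E_sym sE)// /g (E_setI sE)//.
  have -> : dyad j `&` `[0, 2 ^+ j.+1[%classic = dyad j :> set R.
    apply/setIidPl => x; rewrite /dyad /= !in_itv/= => /andP[jx ->]; rewrite andbT.
    by apply: le_trans jx; rewrite exprn_ge0.
  by [].
have := range_kernel t1 Hg gs Hf fi; rewrite -/I.
(* As g is the projection of f, pairing it with f gives |g|^2, and one factor |g| cancels: the dual
   form of a sup bound on the range becomes an L1 to L2 bound. *)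
have -> : ip g f = nr g ^+ 2 by rewrite (nr_E_sqr sE).
rewrite ger0_norm ?sqr_ge0// => H.
have [->|gn0] := eqVneq (nr g) 0.
  by rewrite expr0n !mulr_ge0 ?sqr_ge0 ?exprn_ge0.
have gp : 0 < nr g by rewrite lt_neqAle eq_sym gn0 nrmc_ge0.
have H2 : nr g <= 4 * K * t ^+ 3 * I.
  by move: H; rewrite expr2 -mulrA (mulrC (nr g) I) mulrA ler_pM2r.
have t6 : (t ^+ 3) ^+ 2 = 8 * 8 ^+ j.
  by rewrite -exprM mulnC exprM t2 -exprM mulnC exprM -natrX exprS.
have -> : 128 * K ^+ 2 * 8 ^+ j * I ^+ 2 = (4 * K * t ^+ 3 * I) ^+ 2.
  by rewrite [RHS]exprMn [(4 * K * t ^+ 3) ^+ 2]exprMn t6; ring.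
rewrite lerXn2r ?nnegrE ?nrmc_ge0//; apply: le_trans H2; exact: nrmc_ge0.
Qed.

End EnergyArgument.

(** * The partial Fourier transform of Schwartz functions *)

Section PartialFourier.
Context (R : realType).
Local Notation V := (R * R * R * R)%type.
Local Notation mR := (measurableTypeR R).
Local Notation mV := (mR * mR * mR * mR)%type.
Local Notation leb := (@lebesgue_measure R).
Local Notation e4 := (@Defs.basis R i4).
Local Notation SW := (@real_schwartz R).
Implicit Types (u v : V -> R) (x y : V) (b : bool) (t lam : R) (n : nat).

(** One boolean covers both parts of the exponential, so that integration by parts, which exchanges
    them, is done once; [sgnb] is the sign in the derivative. *)
Definition trig b : R -> R := if b then cos else sin.
Definition sgnb b : R := if b then -1 else 1.

Lemma trig_le1 b t : `|trig b t| <= 1.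
Proof. by rewrite ler_norml; case: b => /=; rewrite ?cos_le1 ?cos_geN1 ?sin_le1 ?sin_geN1. Qed.

Lemma is_derive_trig b t : is_derive t 1 (trig b) (sgnb b * trig (~~ b) t).
Proof.
by case: b => /=; rewrite ?mulN1r ?mul1r; [exact: is_derive_cos|exact: is_derive_sin].
Qed.

Lemma trig_lip b s t : `|trig b s - trig b t| <= `|s - t|.
Proof.
have D (r : R) := is_derive_trig b r.
have cont (p q : R) : {within `[p, q], continuous (trig b)}.
  apply: continuous_subspaceT => r; apply: differentiable_continuous.
  by apply/derivable1_diffP; case: (D r).
have H p q : p <= q -> `|trig b q - trig b p| <= `|q - p|.
  move=> pq; have [c _ ->] := MVT_segment pq (fun r _ => D r) (cont p q).
  rewrite normrM ler_piMl// normrM; apply: mulr_ile1 => //; last exact: trig_le1.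
  by case: b {D cont} => /=; rewrite ?normrN1 ?normr1.
by have [st|/ltW ts] := leP s t; [rewrite distrC [leRHS]distrC|]; exact: H.
Qed.

Definition pt4 x t : V := (x.1.1.1, x.1.1.2, x.1.2, t).
Definition wt3 x : R := wt1 x.1.1.1 * wt1 x.1.1.2 * wt1 x.1.2.

Lemma wt1_le1 t : wt1 t <= 1.
Proof. by rewrite invf_le1 ?lerDl ?sqr_ge0// ltr_pwDl// sqr_ge0. Qed.

Lemma wt3_gt0 x : 0 < wt3 x. Proof. by rewrite !mulr_gt0 ?wt1_gt0. Qed.

Lemma wt3_le1 x : wt3 x <= 1.
Proof.
have w t : 0 <= wt1 t <= 1 by rewrite wt1_le1 ltW// wt1_gt0.
have /andP[a0 a1] := w x.1.1.1; have /andP[b0 b1] := w x.1.1.2; have /andP[c0 c1] := w x.1.2.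
by rewrite /wt3 !mulr_ile1 ?mulr_ge0.
Qed.

(** The gain over [wt1] makes the tail outside [-n, n] at most [wt1 t] / (n + 1), which is the rate
    of convergence of the truncated transforms. *)
Definition wtt t : R := wt1 t / (1 + `|t|).

Lemma wtt_gt0 t : 0 < wtt t.
Proof. by rewrite divr_gt0 ?wt1_gt0// ltr_pwDl. Qed.

Lemma wtt_le t : wtt t <= wt1 t.
Proof. by rewrite ler_pdivrMr ?ltr_pwDl// ler_peMr ?(ltW (wt1_gt0 t))// lerDl. Qed.

Lemma slice_bound u : SW u -> exists2 M : R, 0 <= M & forall x t, `|u (pt4 x t)| <= M * wt3 x * wtt t.
Proof.
(* Eight powers for [Wt], one more for the factor 1 / (1 + |t|). *)
move=> /SW_rapid/rapidP/(_ 9%N)[M M0 HM]; exists M => // x t.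
have := HM (pt4 x t); set z := pt4 x t; have z0 := onepnorm_gt0 z.
rewrite exprSr => H.
have tz : 1 + `|t| <= 1 + `|z|.
  by rewrite lerD2l /z /pt4 !prod_normE /= !le_max lexx !orbT.
have Wz : Wt z <= wt3 x * wt1 t := Wt_le z.
have t0 : 0 < 1 + `|t| by rewrite ltr_pwDl.
rewrite /wtt mulrA ler_pdivlMr// -mulrA.
apply: le_trans (_ : M * Wt z <= _); last by rewrite ler_wpM2l.
rewrite /Wt ler_pdivlMr ?exprn_gt0//; apply: le_trans H.
move: (exprn_ge0 8 (ltW z0)); move: ((1 + `|z|) ^+ 8) => X X0.
have -> : `|u z| * (1 + `|t|) * X = X * `|u z| * (1 + `|t|) by ring.
by rewrite [leRHS]mulrAC ler_wpM2l// mulr_ge0.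
Qed.

Lemma pt4_line x t : pt4 x t = pt4 x 0 + t *: e4.
Proof. by rewrite (basis_i4 R) scaleV !mulr0 mulr1 addV !addr0 add0r. Qed.

Lemma slice_derive u x t : SW u -> is_derive t 1 (fun t => u (pt4 x t)) (pderiv i4 u (pt4 x t)).
Proof.
move=> Hu; have := @is_derive_line R u i4 (pt4 x 0) t (@SW_derivable R _ Hu i4 _).
rewrite -pt4_line (_ : (fun s => u (pt4 x 0 + s *: e4)) = (fun s => u (pt4 x s)))//.
by apply/funext => s; rewrite -pt4_line.
Qed.

Definition osc b u x t : R := u (pt4 x t) * trig b (x.2 * t).

Lemma is_derive_osc b u x t : SW u ->
  is_derive t 1 (osc b u x) (osc b (pderiv i4 u) x t + sgnb b * x.2 * osc (~~ b) u x t).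
Proof.
move=> Hu; have d1 := slice_derive x t Hu.
have d2 : is_derive t 1 (fun s => trig b (x.2 * s)) (sgnb b * trig (~~ b) (x.2 * t) * x.2).
  have dl : is_derive t 1 (fun s : R => x.2 * s) x.2.
    by have := is_deriveZ x.2 (is_derive_id t (1 : R)); rewrite -[x.2 *: 1]/(x.2 * 1) mulr1.
  have dt := is_derive_trig b (x.2 * t).
  exact: (is_derive1_comp dt dl).
have := is_deriveM d1 d2.
rewrite (_ : u (pt4 x t) *: _ + _ *: _ = osc b (pderiv i4 u) x t + sgnb b * x.2 * osc (~~ b) u x t)//.
rewrite /osc -[X in X + _]/(u (pt4 x t) * _) -[X in _ + X]/(_ * pderiv i4 u (pt4 x t)); ring.
Qed.

Lemma continuous_osc b u x : SW u -> continuous (osc b u x).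
Proof.
move=> Hu t; apply: differentiable_continuous; apply/derivable1_diffP.
by case: (is_derive_osc b x t Hu).
Qed.

Lemma osc_le b u x t : `|osc b u x t| <= `|u (pt4 x t)|.
Proof. by rewrite normrM ler_piMr// trig_le1. Qed.

Lemma integrable_wt1 (k : R) : leb.-integrable setT (EFin \o (fun t => k * wt1 t)).
Proof.
have mw : measurable_fun [set: mR] (fun t => (wt1 t)%:E) by apply/measurable_EFinP; exact: measurable_wt1.
suff i1 : leb.-integrable setT (EFin \o @wt1 R) by have := integrableZl measurableT k i1.
apply/integrableP; split => //.
have -> : (\int[leb]_t `|(EFin \o @wt1 R) t| = \int[leb]_t (wt1 t)%:E)%E.
  by apply: eq_integral => t _ /=; rewrite gtr0_norm// wt1_gt0.
by rewrite integral_wt1 ltry.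
Qed.

Lemma Rintegral_wt1_le (f : R -> R) (k : R) : measurable_fun [set: mR] f ->
  (forall t, `|f t| <= k * wt1 t) ->
  leb.-integrable setT (EFin \o f) /\ `|\int[leb]_t f t| <= k * pi.
Proof.
move=> mf fk.
have fi : leb.-integrable setT (EFin \o f).
  apply: le_integrable (integrable_wt1 k) => //; first by apply/measurable_EFinP.
  by move=> t _ /=; rewrite lee_fin (le_trans (fk t))// ler_norm.
split => //; apply: le_trans (le_normr_Rintegral measurableT fi) _.
have -> : k * pi = \int[leb]_t (k * wt1 t).
  have i1 := integrable_wt1 1.
  rewrite (_ : (fun t => 1 * wt1 t) = @wt1 R) in i1; last by apply/funext => t; rewrite mul1r.
  by rewrite RintegralZl//; congr (_ * _); rewrite /Rintegral integral_wt1.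
apply: le_Rintegral => //; [exact: (integrable_abse fi)|exact: integrable_wt1].
Qed.

Definition Tn n b u x : R := \int[leb]_(t in `[- n%:R, n%:R]) osc b u x t.
Definition Tf b u x : R := \int[leb]_t osc b u x t.

Lemma measurable_osc b u x : SW u -> measurable_fun [set: mR] (osc b u x).
Proof. by move=> Hu; apply: (@continuous_measurable_fun R); exact: continuous_osc. Qed.

Lemma Tf_bounds u : SW u -> exists2 M : R, 0 <= M & forall b x,
  `|Tf b u x| <= M * wt3 x /\ forall n, `|Tn n b u x - Tf b u x| <= M * wt3 x / n.+1%:R.
Proof.
move=> Hu; have [M M0 HM] := slice_bound Hu; exists (M * pi); first by rewrite mulr_ge0// pi_ge0.
move=> b x; have mo := measurable_osc b x Hu.
have w3 := ltW (wt3_gt0 x); have Mw := mulr_ge0 M0 w3.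
have ole t : `|osc b u x t| <= M * wt3 x * wtt t := le_trans (osc_le b u x t) (HM x t).
have [oi ob] : leb.-integrable setT (EFin \o osc b u x) /\ `|Tf b u x| <= M * wt3 x * pi.
  apply: Rintegral_wt1_le => // t; apply: le_trans (ole t) _.
  exact: (ler_wpM2l Mw (wtt_le t)).
split; first by rewrite mulrAC.
move=> n; pose B : set mR := `[- n%:R, n%:R]%classic.
have mB : measurable B by exact: measurable_itv.
have mr : measurable_fun [set: mR] (osc b u x \_ B).
  by apply/(measurable_restrictT _ mB); apply: measurable_funTS.
have n0 : 0 < n.+1%:R :> R by [].
have dl t : `|(osc b u x \_ B) t - osc b u x t| <= M * wt3 x / n.+1%:R * wt1 t.
  rewrite patchE; case: ifPn => [_|tB].
    rewrite subrr normr0; exact: (mulr_ge0 (divr_ge0 Mw (ltW n0)) (ltW (wt1_gt0 t))).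
  rewrite sub0r normrN; apply: le_trans (ole t) _.
  rewrite -[leRHS]mulrA; apply: (ler_wpM2l Mw).
  rewrite /wtt mulrC; apply: (ler_wpM2r (ltW (wt1_gt0 t))).
  rewrite lef_pV2 ?posrE ?ltr_pwDl// -natr1 addrC lerD2l.
  move: tB; rewrite notin_setE /B /= in_itv/= => /negP; rewrite -ler_norml -ltNge => /ltW //.
have mri : leb.-integrable setT (EFin \o (osc b u x \_ B)).
  apply: (le_integrable _ _ _ oi) => //; first by apply/measurable_EFinP.
  by move=> t _ /=; rewrite lee_fin patchE; case: ifP => _; rewrite ?normr0.
have -> : Tn n b u x - Tf b u x = \int[leb]_t ((osc b u x \_ B) t - osc b u x t).
  by rewrite RintegralB// -Rintegral_mkcond.
have [_ h] := Rintegral_wt1_le (measurable_funB mr mo) dl.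
by apply: le_trans h _; rewrite le_eqVlt; apply/orP; left; apply/eqP; ring.
Qed.

Lemma Tn_parts n b u x : SW u ->
  Tn n b (pderiv i4 u) x + sgnb b * x.2 * Tn n (~~ b) u x =
  osc b u x n%:R - osc b u x (- n%:R).
Proof.
move=> Hu; have nn : - n%:R <= n%:R :> R by rewrite ge0_cp.
have c1 := @continuous_osc b _ x (SW_pderiv i4 Hu); have c2 := @continuous_osc (~~ b) _ x Hu.
have c3 : continuous (fun t => osc b (pderiv i4 u) x t + sgnb b * x.2 * osc (~~ b) u x t).
  by move=> t; apply: cvgD; [exact: c1|apply: cvgMr; exact: c2].
rewrite -(itv_FTC nn c3 (fun t => is_derive_osc b x t Hu)).
rewrite /Tn addrC -(itv_lin (sgnb b * x.2) (- n%:R) n%:R c2 c1).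
by apply: eq_Rintegral => t _; rewrite addrC.
Qed.

Lemma boundary_bound u : SW u -> exists2 M : R, 0 <= M & forall n b x,
  `|osc b u x n%:R - osc b u x (- n%:R)| <= M * wt3 x / n.+1%:R.
Proof.
move=> Hu; have [M M0 HM] := slice_bound Hu; exists (M + M); first by rewrite addr_ge0.
move=> n b x; have w3 := ltW (wt3_gt0 x); have Mw := mulr_ge0 M0 w3.
have B (t : R) : `|t| = n%:R -> `|osc b u x t| <= M * wt3 x / n.+1%:R.
  move=> tn; apply: le_trans (osc_le b u x t) _; apply: le_trans (HM x t) _.
  apply: (ler_wpM2l Mw); rewrite /wtt tn -natr1 (addrC 1).
  by rewrite ler_pdivrMr ?ltr_pwDr// mulVf ?gt_eqF ?ltr_pwDr// wt1_le1.
apply: le_trans (ler_normB _ _) _; rewrite !mulrDl.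
by apply: lerD; apply: B; rewrite ?normrN ger0_norm.
Qed.

Lemma ler_div_swap (a b c : R) : 0 < b -> 0 < c -> a / c <= b -> a / b <= c.
Proof. by move=> b0 c0; rewrite !ler_pdivrMr// mulrC. Qed.

Lemma nat_small_eq0 (X K : R) : (forall n, `|X| <= K / n.+1%:R) -> X = 0.
Proof.
move=> H; apply/eqP; rewrite -normr_le0; apply/ler_addgt0Pl => eps eps0; rewrite addr0.
have K0 : 0 <= K by have := le_trans (normr_ge0 _) (H 0); rewrite divr1.
pose n := Num.truncn (K / eps); apply: le_trans (H n) _.
by rewrite ler_pdivrMr// mulrC -ler_pdivrMr// ltW// truncnS_gt.
Qed.

Lemma Tf_parts b u x : SW u -> Tf b (pderiv i4 u) x = - (sgnb b * x.2 * Tf (~~ b) u x).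
Proof.
move=> Hu; apply/eqP; rewrite -subr_eq0 opprK; apply/eqP.
have [M1 M10 H1] := Tf_bounds (SW_pderiv i4 Hu); have [M2 M20 H2] := Tf_bounds Hu.
have [M3 M30 H3] := boundary_bound Hu.
apply: (@nat_small_eq0 _ ((M1 + `|sgnb b * x.2| * M2 + M3) * wt3 x)) => n.
have -> : Tf b (pderiv i4 u) x + sgnb b * x.2 * Tf (~~ b) u x =
    (osc b u x n%:R - osc b u x (- n%:R)) - (Tn n b (pderiv i4 u) x - Tf b (pderiv i4 u) x) -
    sgnb b * x.2 * (Tn n (~~ b) u x - Tf (~~ b) u x).
  by rewrite -(Tn_parts n b x Hu); ring.
have [_ h1] := H1 b x; have [_ h2] := H2 (~~ b) x.
apply: le_trans (ler_normB _ _) _; apply: le_trans (lerD (ler_normB _ _) (lexx _)) _.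
rewrite normrM; have k2 := ler_wpM2l (normr_ge0 (sgnb b * x.2)) (h2 n).
apply: le_trans (lerD (lerD (H3 n b x) (h1 n)) k2) _.
by rewrite le_eqVlt; apply/orP; left; apply/eqP; ring.
Qed.

Lemma Tf_parts2 b u x : SW u -> Tf b (pderiv i4 (pderiv i4 u)) x = - (x.2 ^+ 2 * Tf b u x).
Proof.
move=> Hu; rewrite (Tf_parts b x (SW_pderiv i4 Hu)) (Tf_parts (~~ b) x Hu) negbK.
by case: b => /=; ring.
Qed.

Lemma sgnb_norm b : `|sgnb b| = 1. Proof. by case: b; rewrite /= ?normrN1 ?normr1. Qed.
Lemma sgnb_sq b : sgnb b * sgnb b = 1. Proof. by case: b => /=; ring. Qed.

(** The factor 1 + |lambda| makes the transform square integrable in the frequency. It is gained by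
    integrating by parts, which trades lambda for a derivative; on truncated integrals this leaves
    boundary terms of order 1 / (n + 1). *)
Lemma Tf_weight u : SW u -> exists2 M : R, 0 <= M & forall b x,
  (1 + `|x.2|) * `|Tf b u x| <= M * wt3 x /\
  forall n, (1 + `|x.2|) * `|Tn n b u x - Tf b u x| <= M * wt3 x / n.+1%:R.
Proof.
move=> Hu.
have [M1 M10 H1] := Tf_bounds (SW_pderiv i4 Hu); have [M2 M20 H2] := Tf_bounds Hu.
have [M3 M30 H3] := boundary_bound Hu.
exists (M2 + M1 + M3); first by rewrite !addr_ge0.
move=> b x; have w3 := ltW (wt3_gt0 x).
have [h2 h2n] := H2 b x; have [h1 h1n] := H1 (~~ b) x.
have lamT : `|x.2| * `|Tf b u x| = `|Tf (~~ b) (pderiv i4 u) x|.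
  by rewrite (Tf_parts (~~ b) x Hu) negbK normrN !normrM sgnb_norm mul1r.
split=> [|n]; rewrite mulrDl mul1r.
  rewrite lamT; apply: le_trans (lerD h2 h1) _.
  by rewrite -mulrDl ler_wpM2r// lerDl.
have E : x.2 * (Tn n b u x - Tf b u x) = sgnb (~~ b) * ((osc (~~ b) u x n%:R - osc (~~ b) u x (- n%:R)) -
    (Tn n (~~ b) (pderiv i4 u) x - Tf (~~ b) (pderiv i4 u) x)).
  have := Tn_parts n (~~ b) x Hu; have := Tf_parts (~~ b) x Hu; rewrite negbK => -> <-.
  have s2 := sgnb_sq (~~ b); move: (sgnb (~~ b)) s2 => s s2.
  transitivity (s * s * (x.2 * (Tn n b u x - Tf b u x))); first by rewrite s2 mul1r.
  by ring.
rewrite -[X in _ + X]normrM E normrM sgnb_norm mul1r.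
apply: le_trans (lerD (h2n n) (ler_normB _ _)) _.
apply: le_trans (lerD (lexx _) (lerD (H3 n (~~ b) x) (h1n n))) _.
by rewrite le_eqVlt; apply/orP; left; apply/eqP; ring.
Qed.

Lemma Tn_lip n b u : SW u -> exists C : R, forall x y, `|y - x| <= 1 ->
  `|Tn n b u y - Tn n b u x| <= C * `|y - x|.
Proof.
move=> Hu; have [M M0 HM] := SW_lip4 Hu; have [K K0 HK] := slice_bound Hu.
have nn : - n%:R <= n%:R :> R by rewrite ge0_cp.
exists ((M + K * n%:R) * (n%:R - - n%:R)) => x y yx.
have cy := @continuous_osc b _ y Hu; have cx := @continuous_osc b _ x Hu.
rewrite /Tn -(itv_sub _ _ cy cx) mulrAC.
apply: itv_bound => //; first by move=> t; apply: cvgB; [exact: cy|exact: cx].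
move=> t tn; have tn' : `|t| <= n%:R by rewrite ler_norml.
have -> : osc b u y t - osc b u x t = (u (pt4 y t) - u (pt4 x t)) * trig b (y.2 * t) +
    u (pt4 x t) * (trig b (y.2 * t) - trig b (x.2 * t)) by rewrite /osc; ring.
have dpt : `|pt4 y t - pt4 x t| <= `|y - x| /\ `|y.2 - x.2| <= `|y - x|.
  have := lexx `|y - x|; case: x y {yx cy cx} => [[[a1 b1] c1] d1] [[[a2 b2] c2] d2].
  rewrite {1}(normV (a2 - a1) (b2 - b1) (c2 - c1) (d2 - d1))// => /and4P[h1 h2 h3 h4]; split => //.
  by rewrite /pt4 /= (normV (a2 - a1) (b2 - b1) (c2 - c1) (t - t))// h1 h2 h3 subrr normr0 normr_ge0.
have [dp dy] := dpt.
apply: le_trans (ler_normD _ _) _; rewrite [leRHS]mulrDl !normrM; apply: lerD.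
  rewrite -[leRHS]mulr1 ler_pM ?trig_le1//.
  by apply: le_trans (HM _ _ (le_trans dp yx)) _; rewrite ler_wpM2l.
rewrite -mulrA ler_pM//.
  apply: le_trans (HK x t) _; rewrite -mulrA ler_piMr//.
  apply: mulr_ile1; [exact: ltW (wt3_gt0 x)|exact: ltW (wtt_gt0 t)|exact: wt3_le1|].
  exact: le_trans (wtt_le t) (wt1_le1 t).
apply: le_trans (trig_lip _ _ _) _; rewrite -mulrBl normrM mulrC ler_pM//.
Qed.

Lemma measurable_Tn n b u : SW u -> measurable_fun [set: mV] (Tn n b u : mV -> R).
Proof.
move=> Hu; apply: continuous_measurable_R4; apply: lip_continuous => x.
by have [C HC] := Tn_lip n b Hu; exists C => y; exact: HC.
Qed.

Lemma measurable_Tf b u : SW u -> measurable_fun [set: mV] (Tf b u : mV -> R).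
Proof.
move=> Hu; apply: (@measurable_fun_cvg _ mV R _ (fun n => Tn n b u : mV -> R)).
  by move=> n; exact: measurable_Tn.
move=> x _; have [M M0 HM] := Tf_bounds Hu; have [_ h] := HM b x.
apply/cvgrPdist_le => eps eps0; exists (Num.truncn (M * wt3 (x : V) / eps)) => // n /= Nn.
rewrite distrC; apply: le_trans (h n) _.
have N1 : M * wt3 (x : V) / eps <= n.+1%:R.
  by apply: ltW; apply: lt_le_trans (truncnS_gt _) _; rewrite ler_nat ltnS.
have n0 : 0 < n.+1%:R :> R by [].
have e0 : 0 < (eps : R) := eps0.
exact: (ler_div_swap n0 e0 N1).
Qed.

Local Notation mu := (engel_measure R).

Lemma integrable_wt4 : mu.-integrable [set: mV] (EFin \o @wt4 R).
Proof.
apply/integrableP; split; first by apply/measurable_EFinP; exact: measurable_wt4.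
have -> : (\int[mu]_x `|(EFin \o @wt4 R) x| = \int[mu]_x (wt4 x)%:E)%E.
  by apply: eq_integral => x _ /=; rewrite gtr0_norm// wt4_gt0.
exact: integral_wt4.
Qed.

Lemma weight_L2 (f : mV -> R) (c : R) : measurable_fun setT f ->
  (forall x, (1 + `|x.2|) * `|f x| <= c * wt3 (x : V)) ->
  L2r mu f /\ ipr mu f f <= c ^+ 2 * \int[mu]_x (@wt4 R) x.
Proof.
move=> mf fc.
have fle x : f x ^+ 2 <= c ^+ 2 * wt4 x.
  have w3 := wt3_gt0 (x : V); have l0 : 0 < 1 + `|x.2| by rewrite ltr_pwDl.
  have k0 := mulr_ge0 (ltW l0) (normr_ge0 (f x)).
  have h : ((1 + `|x.2|) * `|f x|) ^+ 2 <= (c * wt3 (x : V)) ^+ 2.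
    by rewrite lerXn2r ?nnegrE// (le_trans k0 (fc x)).
  rewrite (exprMn 2 (1 + `|x.2|)) (exprMn 2 c) real_normK ?num_real// in h.
  have l2 : 1 + x.2 ^+ 2 <= (1 + `|x.2|) ^+ 2.
    by rewrite sqrrD expr1n mul1r real_normK ?num_real// addrAC lerDl mulrn_wge0.
  have p2 : 0 < 1 + x.2 ^+ 2 by rewrite ltr_pwDl// sqr_ge0.
  have -> : c ^+ 2 * wt4 x = c ^+ 2 * wt3 (x : V) / (1 + x.2 ^+ 2) by rewrite /wt4 mulrA.
  rewrite ler_pdivlMr// mulrC; apply: (@le_trans _ _ ((1 + `|x.2|) ^+ 2 * f x ^+ 2)).
    by rewrite ler_wpM2r// sqr_ge0.
  apply: le_trans h _; apply: (ler_wpM2l (sqr_ge0 c)).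
  by rewrite expr2 (ler_piMr (ltW w3) (wt3_le1 (x : V))).
have iw := integrableZ_real (c ^+ 2) integrable_wt4.
have Lf : L2r mu f.
  split => //; apply: (le_integrable_real _ _ iw); first exact: measurable_funX.
  by move=> x; rewrite ger0_norm ?sqr_ge0.
split => //; rewrite -RintegralZl//; last exact: integrable_wt4.
by apply: le_Rintegral => //; [exact: L2r_mul|move=> x _; rewrite -expr2].
Qed.

End PartialFourier.

(** * The transform of - X4^2 f for Schwartz f *)

Section FourierSchwartz.
Context (R : realType).
Local Notation V := (R * R * R * R)%type.
Local Notation mR := (measurableTypeR R).
Local Notation mV := (mR * mR * mR * mR)%type.
Local Notation leb := (@lebesgue_measure R).
Local Notation SW := (@real_schwartz R).
Local Notation mu := (engel_measure R).
Local Notation Ref f := (fun x => complex.Re (f x)).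
Local Notation Imf f := (fun x => complex.Im (f x)).
Implicit Types (u v : V -> R) (f g : V -> R[i]) (x y : V) (b : bool) (n : nat).

Lemma fourier4_truncE n f x : schwartz f -> fourier4_trunc n f x =
  Complex (Tn n true (Ref f) x + Tn n false (Imf f) x) (Tn n true (Imf f) x - Tn n false (Ref f) x).
Proof.
move=> [Hr Hi].
have c1 := @continuous_osc R true _ x Hr; have c2 := @continuous_osc R false _ x Hi.
have c3 := @continuous_osc R true _ x Hi; have c4 := @continuous_osc R false _ x Hr.
have E1 := itv_lin 1 (- n%:R) n%:R c1 c2; have E2 := itv_sub (- n%:R) n%:R c3 c4.
rewrite mul1r in E1.
rewrite /fourier4_trunc /cintegral; congr Complex.
  rewrite -[RHS]E1; apply: eq_Rintegral => t _; rewrite /osc /pt4 /= mul1r.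
  by case: (f _) => a c /=; rewrite mulrN opprK.
rewrite -[RHS]E2; apply: eq_Rintegral => t _; rewrite /osc /pt4 /=.
by case: (f _) => a c /=; rewrite mulrN addrC.
Qed.

Definition FT f : V -> R[i] := fun x =>
  Complex (Tf true (Ref f) x + Tf false (Imf f) x) (Tf true (Imf f) x - Tf false (Ref f) x).

(** A pointwise bound strong enough for square integrability on R^4 ([weight_L2]) and stable under
    sums, with the constants adding up. *)
Definition wbd (h : V -> R) (c : R) : Prop := measurable_fun [set: mV] (h : mV -> R) /\
  forall x, (1 + `|x.2|) * `|h x| <= c * wt3 x.

Lemma wbdD (h k : V -> R) (c c' : R) : wbd h c -> wbd k c' -> wbd (fun x => h x + k x) (c + c').
Proof.
move=> [mh Hh] [mk Hk]; split=> [|x]; first exact: measurable_funD.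
have l0 : 0 <= 1 + `|x.2| by rewrite addr_ge0.
apply: le_trans (ler_wpM2l l0 (ler_normD _ _)) _; rewrite mulrDr [leRHS]mulrDl.
exact: (lerD (Hh x) (Hk x)).
Qed.

Lemma wbdN (h : V -> R) (c : R) : wbd h c -> wbd (fun x => - h x) c.
Proof.
move=> [mh Hh]; split=> [|x]; first by apply: measurableT_comp.
by rewrite normrN; exact: Hh.
Qed.

Lemma wbd_Tf u : SW u -> exists2 M : R, 0 <= M & forall b, wbd (Tf b u) M /\
  forall n, wbd (fun x => Tn n b u x - Tf b u x) (M / n.+1%:R).
Proof.
move=> Hu; have [M M0 HM] := Tf_weight Hu; exists M => // b; split=> [|n]; split.
- exact: measurable_Tf.
- by move=> x; have [] := HM b x.
- by apply: measurable_funB; [exact: measurable_Tn|exact: measurable_Tf].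
- by move=> x; have [_ h] := HM b x; rewrite mulrAC; exact: h.
Qed.

Lemma squeeze_inv (a : nat -> R) (K : R) : (forall n, 0 <= a n) ->
  (forall n, a n <= K / n.+1%:R) -> a n @[n --> \oo] --> 0.
Proof.
move=> a0 aK; apply/cvgrPdist_le => eps eps0; exists (Num.truncn (K / eps)) => // n /= Nn.
rewrite sub0r normrN ger0_norm//; apply: le_trans (aK n) _.
have n0 : 0 < n.+1%:R :> R by [].
apply: (ler_div_swap n0 eps0); apply: ltW.
by apply: lt_le_trans (truncnS_gt _) _; rewrite ler_nat ltnS.
Qed.

Lemma wbd_L2c f (c : R) : 0 <= c -> wbd (Ref f) c -> wbd (Imf f) c ->
  L2c mu f /\ nrmc mu f <= Num.sqrt (2 * \int[mu]_x (@wt4 R) x) * c.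
Proof.
move=> c0 [m1 h1] [m2 h2].
have [L1 n1] := weight_L2 m1 h1; have [L2 n2] := weight_L2 m2 h2.
split; first by split.
rewrite -[X in _ * X](ger0_norm c0) -sqrtr_sqr -sqrtrM; last first.
  rewrite mulr_ge0//; apply: fine_ge0; apply: integral_ge0 => x _.
  by rewrite lee_fin ltW// wt4_gt0.
apply: ler_wsqrtr; apply: le_trans (lerD n1 n2) _.
by rewrite le_eqVlt; apply/orP; left; apply/eqP; ring.
Qed.

Lemma schwartz_L2 f : schwartz f -> L2c mu f.
Proof. by move=> [Hr Hi]; split; apply: SW_L2 => //; exact: engel_Wt. Qed.

Lemma fourier4_schwartz f : schwartz f -> fourier4 f (FT f).
Proof.
move=> Hf; have [Hr Hi] := Hf; have [M1 M10 B1] := wbd_Tf Hr; have [M2 M20 B2] := wbd_Tf Hi.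
have [LF _] : L2c mu (FT f) /\ nrmc mu (FT f) <= Num.sqrt (2 * \int[mu]_x (@wt4 R) x) * (M1 + M2).
  apply: wbd_L2c; first exact: addr_ge0.
  - by apply: wbdD; [have [] := B1 true|have [] := B2 false].
  - by rewrite addrC; apply: wbdD; [have [] := B2 true|apply: wbdN; have [] := B1 false].
have D n : L2c mu (fourier4_trunc n f - FT f) /\ nrmc mu (fourier4_trunc n f - FT f) <=
    Num.sqrt (2 * \int[mu]_x (@wt4 R) x) * ((M1 + M2) / n.+1%:R).
  apply: wbd_L2c; first by rewrite divr_ge0// addr_ge0.
  - rewrite ReBE (_ : (fun x => _ - _) = (fun x => (Tn n true (Ref f) x - Tf true (Ref f) x) +
      (Tn n false (Imf f) x - Tf false (Imf f) x))); last first.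
      by apply/funext => x; rewrite fourier4_truncE//= opprD addrACA.
    by rewrite mulrDl; apply: wbdD; [have [_] := B1 true|have [_] := B2 false].
  - rewrite ImBE (_ : (fun x => _ - _) = (fun x => (Tn n true (Imf f) x - Tf true (Imf f) x) +
      - (Tn n false (Ref f) x - Tf false (Ref f) x))); last first.
      by apply/funext => x; rewrite fourier4_truncE//= !opprD addrACA.
    by rewrite addrC mulrDl; apply: wbdD; [have [_] := B2 true|apply: wbdN; have [_] := B1 false].
have Lt n : L2c mu (fourier4_trunc n f).
  by have [d _] := D n; have := L2cD d LF; rewrite subrK.
split; [by apply/memL2P; exact: schwartz_L2|by apply/memL2P|].
apply/(cvgL2P Lt LF); apply: (@squeeze_inv _ (Num.sqrt (2 * \int[mu]_x (@wt4 R) x) * (M1 + M2))).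
  by move=> n; exact: nrmc_ge0.
by move=> n; rewrite -mulrA; have [] := D n.
Qed.

Definition D4 f : V -> R[i] := fun x =>
  Complex (- Y4 (Y4 (Ref f)) x) (- Y4 (Y4 (Imf f)) x).

Lemma SW_opp u : SW u -> SW (fun x => - u x). Proof. exact: SWN. Qed.

Lemma schwartz_D4 f : schwartz f -> schwartz (D4 f).
Proof. by move=> [Hr Hi]; split; apply: SW_opp; do 2 apply: SW_Y4. Qed.

Lemma integrable_osc b u x : SW u -> leb.-integrable setT (EFin \o osc b u x).
Proof.
move=> Hu; have [M M0 HM] := slice_bound Hu.
have [] // := @Rintegral_wt1_le R (osc b u x) (M * wt3 x) (measurable_osc b x Hu).
move=> t; apply: le_trans (osc_le b u x t) _; apply: le_trans (HM x t) _.
exact: (ler_wpM2l (mulr_ge0 M0 (ltW (wt3_gt0 x))) (wtt_le t)).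
Qed.

Lemma TfN b u x : SW u -> Tf b (fun y => - u y) x = - Tf b u x.
Proof.
move=> Hu; rewrite /Tf -mulN1r -RintegralZl//; last exact: integrable_osc.
by apply: eq_Rintegral => t _; rewrite /osc mulN1r mulNr.
Qed.

Lemma Tf_D4 b u x : SW u -> Tf b (fun y => - Y4 (Y4 u) y) x = x.2 ^+ 2 * Tf b u x.
Proof.
move=> Hu; have H4 := SW_Y4 (SW_Y4 Hu).
apply: (etrans (TfN b x H4)); apply: (etrans (congr1 -%R (Tf_parts2 b x Hu))).
exact: opprK.
Qed.

Lemma complex_scale4 (s a b c d a' b' c' d' : R) : a' = s * a -> b' = s * b -> c' = s * c ->
  d' = s * d -> Complex (a' + b') (c' - d') = (s%:C)%C * Complex (a + b) (c - d).
Proof.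
move=> -> -> -> ->; apply/eqP; rewrite eq_complex /= !mul0r subr0 addr0 mulrDr mulrBr.
by rewrite !eqxx.
Qed.

Lemma FT_D4 f x : schwartz f -> FT (D4 f) x = ((x.2 ^+ 2)%:C)%C * FT f x.
Proof.
move=> [Hr Hi]; exact: (complex_scale4 (Tf_D4 true x Hr) (Tf_D4 false x Hi)
  (Tf_D4 true x Hi) (Tf_D4 false x Hr)).
Qed.

(** At frequency 0 the inverse square is 0 by convention, so cancelling it against the square of the
    frequency is possible only off this null set. *)
Lemma x4_neq0 : {ae mu, forall x : mV, x.2 != 0}.
Proof.
exists [set x : mV | x.2 = 0]; split.
- rewrite (_ : [set x : mV | x.2 = 0] = (snd : mV -> mR) @^-1` [set 0])//.
  by rewrite -[X in measurable X]setTI; apply: measurable_snd => //; exact: measurable_set1.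
- have mS : measurable [set x : mV | x.2 = 0].
    rewrite (_ : [set x : mV | x.2 = 0] = (snd : mV -> mR) @^-1` [set 0])//.
    by rewrite -[X in measurable X]setTI; apply: measurable_snd => //; exact: measurable_set1.
  have mi : measurable_fun [set: mV] (fun x => (\1_[set x : mV | x.2 = 0] x)%:E : \bar R).
    by apply/measurable_EFinP; exact: measurable_indic.
  rewrite -[X in mu X]setIT -(integral_indic mu measurableT mS) (integral_R4 mi); last first.
    by move=> x; rewrite lee_fin.
  rewrite integral0_eq// => a _; rewrite integral0_eq// => c _; rewrite integral0_eq// => e _.
  rewrite (_ : (fun d => _) = (fun d : mR => (\1_[set 0 : mR] d)%:E)); last first.
    by apply/funext => d; rewrite !indicE; congr (_%:R%:E); apply/idP/idP; rewrite !inE.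
  have m0 : measurable ([set 0] : set mR) by exact: measurable_set1.
  rewrite (integral_indic leb measurableT m0) setIT; exact: lebesgue_measure_set1.
- by move=> x /= /negP; rewrite negbK => /eqP.
Qed.

Lemma opp_X4_inv2_D4 f : schwartz f -> opp_X4_inv2 (D4 f) f.
Proof.
move=> Hf; exists (FT (D4 f)), (FT f); split.
- by apply: fourier4_schwartz; exact: schwartz_D4.
- exact: fourier4_schwartz.
- apply: filterS x4_neq0 => x x0 _; rewrite (FT_D4 _ Hf) mulrA -rmorphM /= mulVf ?mul1r//.
  by rewrite expf_neq0.
Qed.

End FourierSchwartz.

(** * The operator A *)

Section ComplexOperators.
Context (R : realType).
Local Notation V := (R * R * R * R)%type.
Local Notation mR := (measurableTypeR R).
Local Notation mV := (mR * mR * mR * mR)%type.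
Local Notation e4 := (@Defs.basis R i4).
Local Notation SW := (@real_schwartz R).
Local Notation mu := (engel_measure R).
Local Notation Ref f := (fun x => complex.Re (f x)).
Local Notation Imf f := (fun x => complex.Im (f x)).
Local Notation ip := (@ipr _ mV R mu).
Local Notation N f := (ip f f).
Local Notation nr := (@nrmc _ mV R mu).
Local Notation ipC := (@ipc _ mV R mu).
Implicit Types (u v : V -> R) (f g : V -> R[i]) (x y : V) (h k : R) (n : nat).

Definition cmap (P : (V -> R) -> V -> R) f : V -> R[i] := fun x => Complex (P (Ref f) x) (P (Imf f) x).
Definition cLap := cmap (@Lap R).
Definition ctau h f : V -> R[i] := tau (h *: e4) f.
Definition cS h := cmap (S4 h).
(** The segment integral followed by its adjoint, as computed in [S4_adjoint]. *)
Definition SSr h u : V -> R := tau (- (h *: e4)) (S4 h (S4 h u)).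
Definition cSS h := cmap (SSr h).

Lemma complex_fun_eq f g : Ref f = Ref g -> Imf f = Imf g -> f = g.
Proof.
move=> er ei; apply/funext => x; have := congr1 (@^~ x) er; have := congr1 (@^~ x) ei => /=.
by case: (f x) (g x) => a b [c d] /= -> ->.
Qed.

Lemma nrmc2 f : nr f ^+ 2 = N (Ref f) + N (Imf f).
Proof. exact: nrmc_sqr. Qed.

Lemma nrmc_le2 f g : N (Ref f) <= N (Ref g) -> N (Imf f) <= N (Imf g) -> nr f <= nr g.
Proof. by move=> a b; apply: ler_wsqrtr; exact: lerD. Qed.

Lemma SW_lap u : SW u -> SW (Lap u). Proof. exact: SW_Lap. Qed.

Lemma schwartz_cLap f : schwartz f -> schwartz (cLap f).
Proof. by move=> [a b]; split; exact: SW_lap. Qed.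

Lemma schwartz_ctau h f : schwartz f -> schwartz (ctau h f).
Proof. by move=> [a b]; split; [exact: (SW_tau (h *: e4) a)|exact: (SW_tau (h *: e4) b)]. Qed.

Lemma schwartz_cS h f : 0 <= h -> schwartz f -> schwartz (cS h f).
Proof. by move=> h0 [a b]; split; [exact: (SW_S4 h0 a)|exact: (SW_S4 h0 b)]. Qed.

Lemma schwartz_cSS h f : 0 <= h -> schwartz f -> schwartz (cSS h f).
Proof.
move=> h0 [a b]; split; first exact: (SW_tau _ (SW_S4 h0 (SW_S4 h0 a))).
exact: (SW_tau _ (SW_S4 h0 (SW_S4 h0 b))).
Qed.

Lemma schwartzB f g : schwartz f -> schwartz g -> schwartz (f - g).
Proof.
move=> [a b] [c d]; split; first exact: (eq_ind_r SW (SWB a c) (ReBE f g)).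
exact: (eq_ind_r SW (SWB b d) (ImBE f g)).
Qed.

Lemma schwartzZ k f : schwartz f -> schwartz (scr k f).
Proof.
move=> [a b]; split; first exact: (eq_ind_r SW (SWZ k a) (ReZE k f)).
exact: (eq_ind_r SW (SWZ k b) (ImZE k f)).
Qed.

Lemma L2_ctau h (f : mV -> R[i]) : L2c mu f -> L2c mu (ctau h f).
Proof. by move=> [a b]; split; [exact: (L2_tau (@engel_shift R) _ a)|exact: (L2_tau (@engel_shift R) _ b)]. Qed.

Lemma nrmc_ctau h (f : mV -> R[i]) : L2c mu f -> nr (ctau h f) = nr f.
Proof.
move=> [a b]; congr Num.sqrt.
exact: (congr2 +%R (ip_tau (@engel_shift R) _ a a) (ip_tau (@engel_shift R) _ b b)).
Qed.

Lemma ctauB h (f g : mV -> R[i]) : ctau h (f - g) = ctau h f - ctau h g.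
Proof. by []. Qed.

Lemma ctau_adj h (f g : mV -> R[i]) : L2c mu f -> L2c mu g -> ipC (ctau h f) g = ipC f (ctau (- h) g).
Proof.
move=> [a b] [c d]; rewrite /ctau scaleNr.
exact: (congr2 +%R (ip_tau_adj (@engel_shift R) _ a c) (ip_tau_adj (@engel_shift R) _ b d)).
Qed.

Lemma cLap_sym f g : schwartz f -> schwartz g -> ipC (cLap f) g = ipC f (cLap g).
Proof.
move=> [a b] [c d].
exact: (congr2 +%R (Lap_sym (@engel_shift R) (@engel_Wt R) a c) (Lap_sym (@engel_shift R) (@engel_Wt R) b d)).
Qed.

Lemma cLap_ctau h f : schwartz f -> cLap (ctau h f) = ctau h (cLap f).
Proof. by move=> _; apply: complex_fun_eq; [exact: (Lap_tau h (Ref f))|exact: (Lap_tau h (Imf f))]. Qed.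

Lemma cLapB f g : schwartz f -> schwartz g -> cLap (f - g) = cLap f - cLap g.
Proof.
move=> [a b] [c d]; apply: complex_fun_eq.
  apply: (etrans (congr1 (@Lap R) (ReBE f g))); apply: (etrans (LapB a c)); exact: (esym (ReBE (cLap f) (cLap g))).
apply: (etrans (congr1 (@Lap R) (ImBE f g))); apply: (etrans (LapB b d)); exact: (esym (ImBE (cLap f) (cLap g))).
Qed.

Lemma D4r_tau h u : (fun x => - Y4 (Y4 (tau (h *: e4) u)) x) = tau (h *: e4) (fun x => - Y4 (Y4 u) x).
Proof.
have E := etrans (congr1 (@Y4 R) (Y4_tau h u)) (Y4_tau h (Y4 u)).
by apply/funext => x; exact: (congr1 (fun F : V -> R => - F x) E).
Qed.

Lemma D4_ctau h f : schwartz f -> D4 (ctau h f) = ctau h (D4 f).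
Proof. by move=> _; apply: complex_fun_eq; [exact: (D4r_tau h (Ref f))|exact: (D4r_tau h (Imf f))]. Qed.

Lemma ipNN (u v : mV -> R) : ip (fun x => - u x) (fun x => - v x) = ip u v.
Proof. by apply: eq_Rintegral => x _; rewrite mulrNN. Qed.

Lemma D4_le f : schwartz f -> nr (D4 f) <= nr (cLap f).
Proof.
move=> [a b]; apply: nrmc_le2.
  apply: le_trans (D4_le_Lap (@engel_shift R) (@engel_Wt R) a).
  by rewrite ipNN.
apply: le_trans (D4_le_Lap (@engel_shift R) (@engel_Wt R) b).
by rewrite ipNN.
Qed.

Lemma ctau_sub h f : 0 <= h -> schwartz f -> nr (ctau h f - f) ^+ 2 <= h ^+ 2 * ipC (cLap f) f.
Proof.
move=> h0 [a b]; rewrite nrmc2 ReBE ImBE mulrDr.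
exact: (lerD (tau_sub_le (@engel_shift R) (@engel_Wt R) h0 a) (tau_sub_le (@engel_shift R) (@engel_Wt R) h0 b)).
Qed.

Lemma Lap_SSr h u : 0 <= h -> SW u -> Lap (SSr h u) = SSr h (Lap u).
Proof.
move=> h0 Hu; rewrite /SSr -scaleNr.
apply: (etrans (Lap_tau _ _)); congr tau.
exact: (etrans (Lap_S4 h0 (SW_S4 h0 Hu)) (congr1 (S4 h) (Lap_S4 h0 Hu))).
Qed.

Lemma cLap_cSS h f : 0 <= h -> schwartz f -> cLap (cSS h f) = cSS h (cLap f).
Proof. by move=> h0 [a b]; apply: complex_fun_eq; [exact: (Lap_SSr h0 a)|exact: (Lap_SSr h0 b)]. Qed.

Lemma Y4_S4 h u : 0 <= h -> SW u -> Y4 (S4 h u) = (fun x => tau (h *: e4) u x - u x).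
Proof. by move=> h0 Hu; exact: (etrans (pderiv_S4 i4 h0 Hu) (S4_d4 h0 Hu)). Qed.

Lemma Y4B u v : SW u -> SW v -> Y4 (fun x => u x - v x) = (fun x => Y4 u x - Y4 v x).
Proof. exact: pderivB. Qed.

(** Each X4 consumes one of the two segment integrals and leaves a difference; the back translation
    centres the resulting second difference. *)
Lemma D4_SSr h u : 0 <= h -> SW u -> (fun x => - Y4 (Y4 (SSr h u)) x) =
  (fun x => u x + u x - tau (h *: e4) u x - tau ((- h) *: e4) u x).
Proof.
move=> h0 Hu; have HS := SW_S4 h0 Hu.
have E1 : Y4 (S4 h (S4 h u)) = (fun x => tau (h *: e4) (S4 h u) x - S4 h u x) := Y4_S4 h0 HS.
have E2 : Y4 (Y4 (S4 h (S4 h u))) = (fun x => (tau (h *: e4) u (x + h *: e4) - u (x + h *: e4)) -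
    (tau (h *: e4) u x - u x)).
  apply: (etrans (congr1 (@Y4 R) E1)); apply: (etrans (Y4B (SW_tau _ HS) HS)).
  apply/funext => x; congr (_ - _); last exact: (congr1 (@^~ x) (Y4_S4 h0 Hu)).
  apply: (etrans (congr1 (@^~ x) (Y4_tau h (S4 h u)))).
  exact: (congr1 (@^~ (x + h *: e4)) (Y4_S4 h0 Hu)).
rewrite /SSr -scaleNr; apply: (etrans (D4r_tau (- h) _)).
apply/funext => x; rewrite {1}/tau.
apply: (etrans (congr1 (fun F : V -> R => - F (x + (- h) *: e4)) E2)).
rewrite /tau scaleNr -!addrA addNr addr0 (addrA (- _)) addNr add0r.
move: (u x) (u (x + h *: e4)) (u (x + - (h *: e4))) => p q r; ring.
Qed.

Lemma complex_sub4 (p q r : R[i]) :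
  complex.Re p + complex.Re p - complex.Re q - complex.Re r = complex.Re (p + p - q - r) /\
  complex.Im p + complex.Im p - complex.Im q - complex.Im r = complex.Im (p + p - q - r).
Proof. by case: p q r => ? ? [? ?] [? ?]. Qed.

Lemma D4_cSS h (f : mV -> R[i]) : 0 <= h -> schwartz f -> D4 (cSS h f) = f + f - ctau h f - ctau (- h) f.
Proof.
move=> h0 [a b]; apply: complex_fun_eq.
  apply: (etrans (D4_SSr h0 a)); apply/funext => x.
  by have [] := complex_sub4 (f x) (ctau h f x) (ctau (- h) f x).
apply: (etrans (D4_SSr h0 b)); apply/funext => x.
by have [] := complex_sub4 (f x) (ctau h f x) (ctau (- h) f x).
Qed.

(** With S the segment integral, which commutes with L, moving the adjoint across gives <L (S u), S
    u>. *)
Lemma SSr_pos h u : 0 <= h -> SW u -> 0 <= ip (Lap u) (SSr h u).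
Proof.
move=> h0 Hu; have HS := SW_S4 h0 Hu.
rewrite -(S4_adjoint (@engel_shift R) (@engel_Wt R) h0 (SW_lap Hu) HS) -(Lap_S4 h0 Hu).
exact: (Lap_ge0 (@engel_shift R) (@engel_Wt R) HS).
Qed.

Lemma cSS_pos h f : 0 <= h -> schwartz f -> 0 <= ipC (cLap f) (cSS h f).
Proof. by move=> h0 [a b]; exact: (addr_ge0 (SSr_pos h0 a) (SSr_pos h0 b)). Qed.

Lemma SSr_le h u : 0 <= h -> SW u -> N (SSr h u) <= (h ^+ 2) ^+ 2 * N u.
Proof.
move=> h0 Hu; have HS := SW_S4 h0 Hu; have HSS := SW_S4 h0 HS.
have L := SW_L2 (@engel_Wt R) HSS; rewrite (ip_tau (@engel_shift R) _ L L).
apply: le_trans (S4_norm (@engel_shift R) (@engel_Wt R) h0 HS) _.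
apply: le_trans (ler_wpM2l (sqr_ge0 h) (S4_norm (@engel_shift R) (@engel_Wt R) h0 Hu)) _.
by rewrite mulrA -expr2.
Qed.

Lemma cSS_le h f : 0 <= h -> schwartz f -> nr (cSS h f) <= h ^+ 2 * nr f.
Proof.
move=> h0 [a b]; apply: le_sqr_of; first exact: (mulr_ge0 (sqr_ge0 h) (nrmc_ge0 _ _)).
rewrite exprMn !nrmc2 mulrDr; exact: (lerD (SSr_le h0 a) (SSr_le h0 b)).
Qed.

Lemma complex_field2 (a b s c d t e f : R) :
  Complex a b - (s%:C)%C * Complex c d + (t%:C)%C * Complex e f =
  Complex (a - s * c + t * e) (b - s * d + t * f).
Proof. by apply/eqP; rewrite eq_complex /= !mul0r !subr0 !addr0 !eqxx. Qed.

Lemma complex_field3 (a b s c d : R) :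
  Complex a b - (s%:C)%C * Complex c d = Complex (a - s * c) (b - s * d).
Proof. by apply/eqP; rewrite eq_complex /= !mul0r !subr0 !addr0 !eqxx. Qed.

Lemma X2E f : X2 f = cmap (@Y2 R) f.
Proof. by apply/funext => x; exact: complex_field2. Qed.

Lemma X3E f : X3 f = cmap (@Y3 R) f.
Proof. by apply/funext => x; exact: complex_field3. Qed.

Lemma complex_sum4 (a b c d a' b' c' d' : R) :
  - (Complex a a' + Complex b b' + Complex c c' + Complex d d') =
  Complex (- (a + b + c + d)) (- (a' + b' + c' + d')).
Proof. by []. Qed.

Lemma sum_squaresE f : (fun x => - sum_squares f x) = cLap f.
Proof.
apply/funext => x; rewrite /sum_squares.
rewrite (congr1 (@X2 R) (X2E f)) (congr1 (@X3 R) (X3E f)) (X2E (cmap _ f)) (X3E (cmap _ f)).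
exact: complex_sum4.
Qed.

End ComplexOperators.

Lemma ipr_sup_le (d : measure_display) (T : measurableType d) (R : realType)
    (mu : {measure set T -> \bar R}) (w f m : T -> R) (c : R) : 0 <= c ->
  measurable_fun setT w -> (forall x, `|w x| <= c) ->
  measurable_fun setT f -> (forall x, `|f x| <= m x) ->
  mu.-integrable setT (EFin \o m) -> `|ipr mu w f| <= c * \int[mu]_x m x.
Proof.
move=> c0 mw wc mf fm im; have icm := integrableZ_real c im.
have le x : `|w x * f x| <= c * m x by rewrite normrM ler_pM.
have iwf : mu.-integrable setT (EFin \o (fun x => w x * f x)).
  by apply: (le_integrable_real _ le icm); exact: measurable_funM.
apply: le_trans (le_normr_Rintegral measurableT iwf) _.
rewrite -RintegralZl//; apply: le_Rintegral => //; exact: (integrable_abse iwf).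
Qed.

(** * The kernel estimate on the Engel group *)

Section EngelKernel.
Context (R : realType).
Local Notation V := (R * R * R * R)%type.
Local Notation mR := (measurableTypeR R).
Local Notation mV := (mR * mR * mR * mR)%type.
Local Notation e4 := (@Defs.basis R i4).
Local Notation SW := (@real_schwartz R).
Local Notation mu := (engel_measure R).
Local Notation Ref f := (fun x => complex.Re (f x)).
Local Notation Imf f := (fun x => complex.Im (f x)).
Local Notation ip := (@ipr _ mV R mu).
Local Notation N f := (ip f f).
Local Notation nr := (@nrmc _ mV R mu).
Local Notation ipC := (@ipc _ mV R mu).
Local Notation nm f := (fun x => ComplexField.Normc.normc (f x)).
Implicit Types (u v : V -> R) (f g : V -> R[i]) (x y : V) (h k : R) (n : nat).

Definition far n : mV -> R := fun x => (n%:R < `|x.2|)%R%:R.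

Lemma measurable_far n : measurable_fun [set: mV] (far n).
Proof.
have E : far n = \1_[set x : mV | n%:R < `|x.2|].
  by apply/funext => x; rewrite indicE /far mem_setE.
rewrite E; apply: measurable_indic.
have m2 : measurable_fun [set: mV] (fun x : mV => `|x.2| : mR).
  by apply: measurableT_comp => //; exact: measurable_snd.
have := m2 measurableT _ (measurable_itv `]n%:R, +oo[).
by rewrite setTI; congr measurable; apply/seteqP; split=> x /=; rewrite in_itv/= andbT.
Qed.

Lemma far_le1 n x : `|far n x| <= 1.
Proof. by rewrite /far; case: (_ < _); rewrite ?normr1 ?normr0. Qed.

Lemma L2_far n (w : mV -> R) : L2r mu w -> L2r mu (fun x => w x * far n x).
Proof.
move=> Hw; apply: (L2r_le _ _ Hw).
  by apply: measurable_funM; [exact: L2r_measurable Hw|exact: measurable_far].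
by move=> x; rewrite normrM ler_piMr// far_le1.
Qed.

Lemma tail_small (w : mV -> R) (dl : R) : 0 < dl -> L2r mu w ->
  exists n, N (fun x => w x * far n x) <= dl.
Proof.
move=> dl0 Hw; have [mw iw] := Hw.
have [] := @dominated_convergence _ mV R mu setT measurableT
  (fun n x => ((w x * far n x) * (w x * far n x))%:E) (cst 0%E) (EFin \o (fun x => w x ^+ 2)).
- by move=> n; apply/measurable_EFinP; have [m _] := L2_far n Hw; apply: measurable_funM.
- exact: measurable_cst.
- apply/aeW => x _; apply: cvg_near_cst; exists (Num.truncn `|x.2|).+1 => // n /= Nn.
  have xn : (n%:R < `|x.2|)%R = false.
    by apply/negbTE; rewrite -leNgt ltW// (lt_le_trans (truncnS_gt _))// ler_nat.
  by rewrite /far xn !mulr0.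
- exact: iw.
- apply/aeW => x n _ /=; rewrite lee_fin normrM -expr2 real_normK ?num_real// exprMn.
  by rewrite ler_piMr ?sqr_ge0// /far; case: (_ < _); rewrite ?expr1n ?expr0n.
move=> _ _; rewrite integral_cst// mul0e => /fine_cvgP[_ /cvgrPdist_le/(_ dl dl0)[n _ Hn]].
exists n; have := Hn n (leqnn n); rewrite /= sub0r normrN; apply: le_trans; exact: ler_norm.
Qed.

Lemma far_split (p q a h : R) n m : n%:R + m%:R < `|h| ->
  (p - p * (n%:R < `|a|)%R%:R) * q = (p - p * (n%:R < `|a|)%R%:R) * (q * (m%:R < `|a + h|)%R%:R).
Proof.
move=> Hh; have [_|an] := ltP n%:R `|a|; first by rewrite mulr1 subrr !mul0r.
have [_|am] := ltP m%:R `|a + h|; first by rewrite mulr1.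
have := ler_normB (a + h) a; rewrite addrAC subrr add0r; lra.
Qed.

(** Cut w to |x4| <= n and f to |x4| <= m, leaving little norm outside. Once |h| exceeds n + m, the
    cut w and the translate of the cut f have disjoint supports. *)
Lemma tau_decay (w f : mV -> R) (eps : R) : L2r mu w -> L2r mu f -> 0 < eps ->
  exists2 H, 0 <= H & forall h, H < `|h| -> `|ip w (tau (h *: e4) f)| <= eps.
Proof.
move=> Hw Hf eps0; pose A := N w + N f + 1; have Nw := ipr_ge0 mu w; have Nf := ipr_ge0 mu f.
have A1 : 1 <= A by rewrite /A; lra.
have A0 : 0 < A by lra.
have AA : A <= A ^+ 2 by rewrite expr2 ler_peMl// ltW.
pose dl := eps / (2 * A); have dl0 : 0 < dl by rewrite divr_gt0// mulr_gt0.
have [n hn] := tail_small (exprn_gt0 2 dl0) Hw; have [m hm] := tail_small (exprn_gt0 2 dl0) Hf.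
exists (n%:R + m%:R); first by rewrite addr_ge0.
move=> h Hh; set T := tau (h *: e4).
have Lw2 := L2_far n Hw; have Lf2 := L2_far m Hf.
have Lw1 := L2rB Hw Lw2; have LT := L2_tau (@engel_shift R) (h *: e4) Hf.
have LT2 := L2_tau (@engel_shift R) (h *: e4) Lf2.
have split : ip w (T f) = ip (fun x => w x * far n x) (T f) +
    ip (fun x => w x - w x * far n x) (T (fun x => f x * far m x)).
  have E : (fun x => w x * far n x + (w x - w x * far n x)) = w.
    by apply/funext => x; move: (w x) (far n x) => p q; ring.
  apply: (etrans (esym (congr1 (fun F => ip F (T f)) E))); apply: (etrans (iprDl Lw2 Lw1 LT)).
  congr (_ + _); apply: eq_Rintegral => x _.
  rewrite /T /tau /far.
  have -> : (x + h *: e4).2 = x.2 + h by case: x => [[[a b] c] d]; rewrite (basis_i4 R) scaleV addV /= mulr1.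
  exact: far_split.
rewrite split; apply: le_trans (ler_normD _ _) _.
have b1 : `|ip (fun x => w x * far n x) (T f)| <= dl * A.
  apply: (ip_bound Lw2 LT (ltW dl0) (ltW A0) hn).
  by rewrite (ip_tau (@engel_shift R) _ Hf Hf); apply: le_trans AA; rewrite /A; lra.
have b2 : `|ip (fun x => w x - w x * far n x) (T (fun x => f x * far m x))| <= A * dl.
  apply: (ip_bound Lw1 LT2 (ltW A0) (ltW dl0)); last first.
    by rewrite (ip_tau (@engel_shift R) _ Lf2 Lf2).
  apply: le_trans (_ : N w <= _); last by apply: le_trans AA; rewrite /A; lra.
  apply: le_Rintegral => //; [exact: (L2r_mul Lw1 Lw1)|exact: (L2r_mul Hw Hw)|].
  by move=> x _; rewrite /far; case: (_ < _); rewrite ?mulr1 ?mulr0 ?subrr ?subr0 ?mul0r// -expr2 sqr_ge0.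
have dA : dl * A + A * dl = eps by rewrite /dl; field; rewrite gt_eqF.
by rewrite -dA; exact: lerD.
Qed.

Lemma ctau_decay (w f : mV -> R[i]) (eps : R) : L2c mu w -> L2c mu f -> 0 < eps ->
  exists2 h, 0 <= h & `|ipC w (ctau h f)| <= eps /\ `|ipC w (ctau (- h) f)| <= eps.
Proof.
move=> [wr wi] [fr fi] eps0; have e2 : 0 < eps / 2 by rewrite divr_gt0.
have [H1 H10 h1] := tau_decay wr fr e2; have [H2 H20 h2] := tau_decay wi fi e2.
have B h : H1 + H2 < `|h| -> `|ipC w (ctau h f)| <= eps.
  move=> hh; apply: le_trans (ler_normD _ _) _.
  have k1 : H1 < `|h| by lra.
  have k2 : H2 < `|h| by lra.
  by apply: le_trans (lerD (h1 h k1) (h2 h k2)) _; rewrite -splitr.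
exists (H1 + H2 + 1); first by rewrite !addr_ge0.
by split; apply: B; rewrite ?normrN ger0_norm ?addr_ge0// ltrDl.
Qed.

Lemma cS_double k f : 0 <= k -> schwartz f ->
  cS (k + k) f - scr (k + k) f = (cS k f - scr k f) + ctau k (cS k f - scr k f) + scr k (ctau k f - f).
Proof.
move=> k0 [a b]; apply/funext => x; pose y := x + k *: e4.
have E : cS (k + k) f x = cS k f x + cS k f y.
  apply/eqP; rewrite eq_complex; apply/andP; split; apply/eqP.
    exact: (congr1 (@^~ x) (S4_double k0 a)).
  exact: (congr1 (@^~ x) (S4_double k0 b)).
have Ek : ((k + k)%:C)%C = (k%:C)%C + (k%:C)%C :> R[i] by rewrite rmorphD.
apply: (etrans (congr2 (fun p q => p - q * f x) E Ek)).
apply: (@etrans _ _ ((cS k f x - (k%:C)%C * f x) + (cS k f y - (k%:C)%C * f y) + (k%:C)%C * (f y - f x))).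
  by move: (cS k f x) (cS k f y) (f x) (f y) ((k%:C)%C : R[i]) => p q r s t; ring.
by [].
Qed.

Lemma cS_sub_small f : schwartz f -> exists2 X : R, 0 <= X & forall k, 0 <= k -> k <= 1 ->
  nr (cS k f - scr k f) <= X * k ^+ 2.
Proof.
move=> [a b]; have [X1 X10 H1] := N_S4sub (@engel_Wt R) a.
have [X2 X20 H2] := N_S4sub (@engel_Wt R) b.
exists (X1 + X2); first exact: addr_ge0.
move=> k k0 k1; apply: le_sqr_of; first by rewrite mulr_ge0 ?addr_ge0// sqr_ge0.
have er : Ref (cS k f - scr k f) = (fun x => S4 k (Ref f) x - k * complex.Re (f x)).
  by apply/funext => x; rewrite ReD ReN Re_scr.
have ei : Imf (cS k f - scr k f) = (fun x => S4 k (Imf f) x - k * complex.Im (f x)).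
  by apply/funext => x; rewrite ImD ImN Im_scr.
rewrite nrmc2 er ei; apply: le_trans (lerD (H1 k k0 k1) (H2 k k0 k1)) _.
rewrite !exprMn -mulrDl; apply: ler_wpM2r; first exact: sqr_ge0.
have := mulr_ge0 X10 X20; move: X1 X2 {H1 H2 X10 X20} => p q pq; rewrite sqrrD; lra.
Qed.

Lemma ctau_sub_sqrt h f : 0 <= h -> schwartz f ->
  nr (ctau h f - f) <= h * Num.sqrt (ipC (cLap f) f).
Proof.
move=> h0 Hf; have L0 : 0 <= ipC (cLap f) f.
  case: Hf => a b; exact: (addr_ge0 (Lap_ge0 (@engel_shift R) (@engel_Wt R) a)
    (Lap_ge0 (@engel_shift R) (@engel_Wt R) b)).
apply: le_sqr_of; first by rewrite mulr_ge0// sqrtr_ge0.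
by apply: le_trans (ctau_sub h0 Hf) _; rewrite exprMn (sqr_sqrtr L0).
Qed.

Lemma dyadic_step (k a c e e1 t : R) : 0 <= a -> e1 <= 2 * e + k * t -> t <= k * a -> 0 <= k ->
  e <= k ^+ 2 * a + c -> e1 <= (k + k) ^+ 2 * a + 2 * c.
Proof.
move=> a0 h1 h2 k0 h3; have := ler_wpM2l k0 h2; have := mulr_ge0 (sqr_ge0 k) a0.
rewrite mulrA -!expr2 => A B; have -> : (k + k) ^+ 2 * a = 4 * (k ^+ 2 * a) by ring.
move: (k ^+ 2 * a) (k * t) A B h1 h3 => p q; lra.
Qed.

Lemma cS_sub_double k f : 0 <= k -> schwartz f -> nr (cS (k + k) f - scr (k + k) f) <=
  2 * nr (cS k f - scr k f) + k * nr (ctau k f - f).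
Proof.
move=> k0 Hf; rewrite cS_double//.
have HE := schwartzB (schwartz_cS k0 Hf) (schwartzZ k Hf).
have HT := schwartz_L2 (schwartzB (schwartz_ctau k Hf) Hf).
have LE := schwartz_L2 HE; have LT := L2_ctau k LE.
apply: le_trans (nrmcD (L2cD LE LT) (L2cZ k HT)) _; rewrite nrmcZ// (ger0_norm k0).
apply: lerD => //; apply: le_trans (nrmcD LE LT) _; rewrite nrmc_ctau//.
by rewrite -mulr2n mulr_natl.
Qed.

(** By halving. With a the root of <L f, f>, a defect k^2 a becomes on doubling at most 2 k^2 a + k
    (k a), which is at most (2 k)^2 a, so the bound reproduces itself. The crude starting error X
    k^2 contributes 2^n X k^2 = X h k with k = h / 2^n, which tends to 0. *)
Lemma cS_sub h f : 0 <= h -> schwartz f ->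
  nr (cS h f - scr h f) <= h ^+ 2 * Num.sqrt (ipC (cLap f) f).
Proof.
move=> h0 Hf; set a := Num.sqrt _; have a0 : 0 <= a by rewrite sqrtr_ge0.
have [X X0 HX] := cS_sub_small Hf.
have step n c : nr (cS (h / 2 ^+ n) f - scr (h / 2 ^+ n) f) <= (h / 2 ^+ n) ^+ 2 * a + c ->
    nr (cS h f - scr h f) <= h ^+ 2 * a + 2 ^+ n * c.
  elim: n c => [|n IH] c; first by rewrite expr0 divr1 mul1r.
  have k0 := dyadic_ge0 n.+1 h0 => H.
  have := IH (2 * c); rewrite -(halves h n) => /(_ _)/le_trans; apply.
    exact: (dyadic_step a0 (cS_sub_double k0 Hf) (ctau_sub_sqrt k0 Hf) k0 H).
  have -> : 2 ^+ n.+1 * c = 2 ^+ n * (2 * c) by rewrite exprSr -mulrA.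
  exact: lexx.
apply: ler_addeps_all => eps eps0.
have [n [n1 n2]] := exists_dyadic (X * h) h0 eps0.
apply: le_trans (step n (X * (h / 2 ^+ n) ^+ 2) _) _.
  apply: le_trans (HX _ (dyadic_ge0 n h0) n1) _.
  by rewrite lerDr mulr_ge0// sqr_ge0.
rewrite lerD2l; apply: le_trans n2; rewrite le_eqVlt; apply/orP; left; apply/eqP.
by field; rewrite expf_neq0.
Qed.

Lemma ipC_sqrt_le f : schwartz f -> Num.sqrt (ipC (cLap f) f) <= nr (cLap f) + nr f.
Proof.
move=> Hf; have n1 := nrmc_ge0 mu (cLap f); have n2 := nrmc_ge0 mu f.
have := ipc_le (schwartz_L2 (schwartz_cLap Hf)) (schwartz_L2 Hf).
move=> /(le_trans (ler_norm _)) H.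
apply: le_sqr_of; first exact: addr_ge0.
have [L0|L0] := leP 0 (ipC (cLap f) f); last by rewrite ltr0_sqrtr// expr0n sqr_ge0.
rewrite (sqr_sqrtr L0); apply: le_trans H _.
move: (nr _) (nr _) n1 n2 => p q p0 q0; nra.
Qed.

Lemma sqrt_scale (K B : R) : 0 <= K -> 0 <= B -> Num.sqrt K * B = Num.sqrt (K * B ^+ 2).
Proof. by move=> K0 B0; rewrite sqrtrM// sqrtr_sqr ger0_norm. Qed.

(** This is [sobolev] for the segment integral of u: the terms without X4 gain the factor h through
    [S4_norm], and those with X4 are increments along x4. *)
Lemma S4_sup h u (B : R) : 0 <= h -> SW u -> 0 <= B ->
  h ^+ 2 * (N (Lap u) + N u) + (N (fun x => tau (h *: e4) (Lap u) x - Lap u x) +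
    N (fun x => tau (h *: e4) u x - u x)) <= B ^+ 2 ->
  forall x, `|S4 h u x| <= Num.sqrt (sobK R) * B.
Proof.
move=> h0 Hu B0 HB x; have HS := SW_S4 h0 Hu; have HL := SW_lap Hu.
have k0 := ltW (sobK_gt0 R).
have n1 := S4_norm (@engel_shift R) (@engel_Wt R) h0 Hu.
have n2 := S4_norm (@engel_shift R) (@engel_Wt R) h0 HL.
have e1 := Lap_S4 h0 Hu; have e2 := Y4_S4 h0 Hu.
have e3 : Lap (Y4 (S4 h u)) = (fun x => tau (h *: e4) (Lap u) x - Lap u x).
  apply: (etrans (congr1 (@Lap R) e2)); apply: (etrans (LapB (SW_tau _ Hu) Hu)).
  exact: (congr1 (fun F : V -> R => (fun y => F y - Lap u y)) (Lap_tau h u)).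
have S := sobolev x HS.
have e1N := congr1 (fun F => N F) e1; have e2N := congr1 (fun F => N F) e2; have e3N := congr1 (fun F => N F) e3.
rewrite (sqrt_scale k0 B0).
apply: ler_sqrt_sqr; first by rewrite mulr_ge0// sqr_ge0.
apply: le_trans S _; apply: ler_wpM2l => //; apply: le_trans HB.
rewrite mulrDr; apply: lerD; last by rewrite -e2N -e3N.
by apply: lerD => //; apply: le_trans n2; rewrite -e1N.
Qed.

Lemma engel_kernel_alg (eta p q s t P Q S T : R) : 0 <= eta -> 0 <= P -> 0 <= Q -> 0 <= S -> 0 <= T ->
  p <= P ^+ 2 -> q <= Q ^+ 2 -> s <= S ^+ 2 -> t <= T ^+ 2 ->
  eta ^+ 2 * (p + q) + (s + t) <= (eta * (P + Q) + (S + T)) ^+ 2.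
Proof.
move=> e0 P0 Q0 S0 T0 hp hq hs ht.
have h1 := ler_wpM2l (sqr_ge0 eta) (lerD hp hq).
have h2 := mulr_ge0 (sqr_ge0 eta) (mulr_ge0 P0 Q0); have h3 := mulr_ge0 S0 T0.
have h4 := mulr_ge0 (mulr_ge0 e0 (addr_ge0 P0 Q0)) (addr_ge0 S0 T0).
have -> : (eta * (P + Q) + (S + T)) ^+ 2 = eta ^+ 2 * (P ^+ 2 + Q ^+ 2) + 2 * (eta ^+ 2 * (P * Q)) +
  (S ^+ 2 + T ^+ 2 + 2 * (S * T)) + 2 * (eta * (P + Q) * (S + T)) by ring.
move: (eta ^+ 2 * (p + q)) (eta ^+ 2 * (P ^+ 2 + Q ^+ 2)) (eta ^+ 2 * (P * Q)) (S ^+ 2) (T ^+ 2)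
  (S * T) (eta * (P + Q) * (S + T)) hs ht h1 h2 h3 h4 => a b c d e f g; lra.
Qed.

Lemma Nre_le f : N (Ref f) <= nr f ^+ 2.
Proof. by rewrite nrmc2 lerDl ipr_ge0. Qed.

Lemma Nim_le f : N (Imf f) <= nr f ^+ 2.
Proof. by rewrite nrmc2 lerDr ipr_ge0. Qed.

Lemma NreB_le f g : N (fun x => complex.Re (f x) - complex.Re (g x)) <= nr (f - g) ^+ 2.
Proof. exact: (eq_ind _ (fun F => N F <= nr (f - g) ^+ 2) (Nre_le (f - g)) _ (ReBE f g)). Qed.

Lemma NimB_le f g : N (fun x => complex.Im (f x) - complex.Im (g x)) <= nr (f - g) ^+ 2.
Proof. exact: (eq_ind _ (fun F => N F <= nr (f - g) ^+ 2) (Nim_le (f - g)) _ (ImBE f g)). Qed.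

(** The factor 2 adds the real and the imaginary part. *)
Definition kernelK : R := 2 * Num.sqrt (sobK R).

Lemma cS_ip (g f : mV -> R[i]) (eta : R) : 0 <= eta -> schwartz g -> L2c mu f ->
  mu.-integrable [set: mV] (EFin \o nm f) ->
  `|ipC (cS eta g) f| <= kernelK * (eta * (nr (cLap g) + nr g) +
    (nr (ctau eta (cLap g) - cLap g) + nr (ctau eta g - g))) * \int[mu]_x nm f x.
Proof.
move=> e0 Hg Lf fi; have [a b] := Hg; have [Lr Li] := Lf.
set B := _ + (_ + _); set I := \int[mu]_x _.
have n0 := nrmc_ge0 mu.
have B0 : 0 <= B by rewrite !addr_ge0// mulr_ge0// addr_ge0.
have s1 := S4_sup e0 a B0 (engel_kernel_alg e0 (n0 _) (n0 _) (n0 _) (n0 _) (Nre_le (cLap g)) (Nre_le g)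
  (NreB_le (ctau eta (cLap g)) (cLap g)) (NreB_le (ctau eta g) g)).
have s2 := S4_sup e0 b B0 (engel_kernel_alg e0 (n0 _) (n0 _) (n0 _) (n0 _) (Nim_le (cLap g)) (Nim_le g)
  (NimB_le (ctau eta (cLap g)) (cLap g)) (NimB_le (ctau eta g) g)).
have c0 := mulr_ge0 (sqrtr_ge0 (sobK R)) B0.
have k1 := ipr_sup_le c0 (SW_measurable (SW_S4 e0 a)) s1 (L2r_measurable Lr) (fun x => Re_le_normc (f x)) fi.
have k2 := ipr_sup_le c0 (SW_measurable (SW_S4 e0 b)) s2 (L2r_measurable Li) (fun x => Im_le_normc (f x)) fi.
apply: le_trans (ler_normD _ _) _; apply: le_trans (lerD k1 k2) _.
by rewrite /kernelK -/I le_eqVlt; apply/orP; left; apply/eqP; ring.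
Qed.

(** Write eta g as its segment integral less a defect. The first is paired with f by the sup bound
    of [cS_ip], the second in L2 by [cS_sub]; then divide by eta. *)
Lemma engel_kernel_Sch (g f : mV -> R[i]) (eta : R) : schwartz g -> L2c mu f ->
  mu.-integrable [set: mV] (EFin \o nm f) -> 0 < eta -> eta <= 1 ->
  `|ipC g f| <= eta * (nr (cLap g) + nr g) * nr f +
    kernelK * (nr (cLap g) + nr g + eta^-1 * (nr (ctau eta (cLap g) - cLap g) + nr (ctau eta g - g))) *
      \int[mu]_x nm f x.
Proof.
move=> Hg Lf fi e0 _; have h1 := cS_ip (ltW e0) Hg Lf fi.
have Lg := schwartz_L2 Hg; have LS := schwartz_L2 (schwartz_cS (ltW e0) Hg); have Lz := L2cZ eta Lg.
have h2 := ipc_le (L2cB LS Lz) Lf.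
have h3 := le_trans (cS_sub (ltW e0) Hg) (ler_wpM2l (sqr_ge0 eta) (ipC_sqrt_le Hg)).
have h4 := le_trans h2 (ler_wpM2r (nrmc_ge0 mu f) h3).
have E : eta * ipC g f = ipC (cS eta g) f - ipC (cS eta g - scr eta g) f.
  by rewrite (ipcBl LS Lz Lf) (ipcZl eta Lg Lf) opprB addrC subrK.
have h5 : eta * `|ipC g f| <= kernelK * (eta * (nr (cLap g) + nr g) +
    (nr (ctau eta (cLap g) - cLap g) + nr (ctau eta g - g))) * \int[mu]_x nm f x +
    eta ^+ 2 * (nr (cLap g) + nr g) * nr f.
  rewrite -{1}(gtr0_norm e0) -normrM E; apply: le_trans (ler_normB _ _) _; exact: lerD.
rewrite -(ler_pM2l e0); apply: le_trans h5 _.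
move: (nr (cLap g) + nr g) (nr _ + nr _) (\int[mu]_x nm f x) (nr f) kernelK => p q r s t.
by rewrite le_eqVlt; apply/orP; left; apply/eqP; field; rewrite gt_eqF.
Qed.

Lemma engel_A_sum (g h : mV -> R[i]) : engelA R g h -> exists l w,
  [/\ L2c mu l, L2c mu w, L2c mu g /\ L2c mu h, eqL2 mu h (l + w) & approx mu (@schwartz R) (@cLap R) g l].
Proof.
move=> [/memL2P Lh [l [w [[/memL2P Lg /memL2P Ll [u [v [uv cu cv]]]] [F [G [_ [/memL2P Lw _ _] _]]] hlw]]]].
exists l, w; split => //; first by apply/(eqL2P Lh (L2cD Ll Lw)).
have Su n : schwartz (u n) by have [] := uv n.
have Ev n : v n = cLap (u n) by have [_ ->] := uv n; exact: sum_squaresE.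
have Lu n := schwartz_L2 (Su n).
have Lv n : L2c mu (v n) by rewrite Ev; exact: (schwartz_L2 (schwartz_cLap (Su n))).
move/(cvgL2P Lu Lg): cu => cu; move/(cvgL2P Lv Ll): cv => cv dl dl0.
have /cvgrPdist_le/(_ dl dl0)[n1 _ H1] := cu; have /cvgrPdist_le/(_ dl dl0)[n2 _ H2] := cv.
exists (u (maxn n1 n2)); split => //.
  have := H1 _ (leq_maxl n1 n2); rewrite /= sub0r normrN; apply: le_trans; exact: ler_norm.
have := H2 _ (leq_maxr n1 n2); rewrite /= sub0r normrN Ev; apply: le_trans; exact: ler_norm.
Qed.

Lemma cvgL2_cst (f : mV -> R[i]) : L2c mu f -> cvgL2 mu (fun=> f) f.
Proof.
move=> Lf; apply/cvgL2P => //; rewrite subrr.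
have -> : nr 0 = 0 by have := eqL2_refl Lf; rewrite /eqL2 subrr.
exact: cvg_cst.
Qed.

(** Provides the test functions on which the symmetry of A is exploited: constant sequences realise
    the closure, and [opp_X4_inv2_D4] gives the other summand. *)
Lemma engel_A_D (f : mV -> R[i]) : schwartz f -> engelA R (D4 f) (cLap (D4 f) + f).
Proof.
move=> Hf; have HD := schwartz_D4 Hf; have HL := schwartz_cLap HD.
have LD := schwartz_L2 HD; have LL := schwartz_L2 HL; have Lf := schwartz_L2 Hf.
split; first by apply/memL2P; exact: L2cD.
exists (cLap (D4 f)), f; split; last by apply/aeW.
  split; [by apply/memL2P|by apply/memL2P|].
  exists (fun=> D4 f), (fun=> cLap (D4 f)); split; try exact: cvgL2_cst.
  by move=> _; split => //; exact: (esym (sum_squaresE (D4 f))).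
exact: opp_X4_inv2_D4.
Qed.

Theorem engel_kernel_bound (E : set R -> (mV -> R[i]) -> mV -> R[i]) :
  spectral_measure_of mu (engelA R) E -> kernel_bound mu E (128 * kernelK ^+ 2).
Proof.
move=> [sE AE].
have K0 : 0 <= kernelK by rewrite /kernelK mulr_ge0// sqrtr_ge0.
exact: (@energy_kernel_bound _ mV R mu (@schwartz R) (@cLap R) (@D4 R) (@ctau R) (@cSS R)
  (@schwartz_L2 R) (@schwartz_cLap R) (@schwartz_D4 R) (@schwartz_ctau R) (@schwartz_cSS R)
  (@schwartzB R) (@L2_ctau R) (@nrmc_ctau R) (@ctauB R) (@ctau_adj R) (@cLap_sym R) (@cLap_ctau R)
  (@cLapB R) (@D4_ctau R) (@D4_le R) (@ctau_sub R) (@cLap_cSS R) (@D4_cSS R) (@cSS_pos R) (@cSS_le R)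
  ctau_decay (engelA R) kernelK K0 engel_A_sum engel_A_D engel_kernel_Sch E sE AE).
Qed.

End EngelKernel.

(** * The multiplier theorem *)

Lemma decreasing_ge0 (R : realType) (phi : R -> R) :
  (forall s t : R, 0 <= s -> s <= t -> phi t <= phi s) -> phi s @[s --> +oo] --> 0 ->
  forall s, 0 <= s -> 0 <= phi s.
Proof.
move=> dec lim s s0; rewrite leNgt; apply/negP => ps.
have e0 : 0 < - phi s by rewrite oppr_gt0.
have /cvgrPdist_lt/(_ _ e0)[A [Areal HA]] := lim.
pose t := Num.max s (A + 1).
have At : A < t by rewrite lt_max ltrDl ltr01 orbT.
have := HA t At; rewrite sub0r normrN => h.
have st : s <= t by rewrite le_max lexx.
have := dec s t s0 st; have := ler_norm (- phi t); rewrite normrN => h1 h2.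
have := le_lt_trans h1 h; rewrite ltrN2 => h3.
by have := lt_le_trans h3 h2; rewrite ltxx.
Qed.

Lemma measurable_patch (R : realType) (phi : R -> R) : measurable_fun (`[0, +oo[%classic : set R) phi ->
  measurable_fun [set: R] (phi \_ `[0, +oo[).
Proof.
have mI : measurable (`[0, +oo[%classic : set R) by exact: measurable_itv.
by move=> m; apply/(measurable_restrictT _ mI).
Qed.

Section Multipliers.
Context (R : realType) (d : measure_display) (T : measurableType d).
Variables (mu : {measure set T -> \bar R}) (E : set R -> (T -> R[i]) -> T -> R[i]).
Hypothesis sE : spectral_measure mu E.

Lemma FC_spectral_integral h f g : FC mu E h f g -> spectral_integral mu E h f g.
Proof.
move=> H; have [[mh _] Hf _ _] := H.
apply: (FC_spectral sE H measurableT mh) => //.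
by rewrite setCT; exact: (E_set0_ip sE Hf Hf).
Qed.

Variables (p q C K : R).
Hypothesis K0 : 0 < K.
Hypothesis bound : forall (theta : R -> R) (f g : T -> R[i]) (M : R), FC mu E theta f g ->
  (forall t : R, t < 0 -> theta t = 0) -> 0 <= M ->
  (forall t : R, 1 <= t -> `|theta t| * t `^ (3 * (p^-1 - q^-1)) <= M) ->
  memL mu p f -> (cLnorm mu q g <= (K * M * fine (cLnorm mu p f))%:E)%E.

Lemma patch_lt0 (phi : R -> R) (t : R) : t < 0 -> (phi \_ `[0, +oo[) t = 0.
Proof. by move=> t0; rewrite patchE; case: ifPn => //; rewrite inE /= in_itv/= andbT leNgt t0. Qed.

Lemma patch_ge0 (phi : R -> R) (t : R) : 0 <= t -> (phi \_ `[0, +oo[) t = phi t.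
Proof. by move=> t0; rewrite patchE mem_set//= in_itv/= t0. Qed.

Lemma opnorm_multiplier (phi : R -> R) (M : R) : measurable_fun [set: R] (phi \_ `[0, +oo[) ->
  (forall t, 0 <= t -> 0 <= phi t <= 1) -> 0 <= M ->
  (forall t, 1 <= t -> phi t * t `^ (3 * (p^-1 - q^-1)) <= M) ->
  (opnorm mu p q (fcalc mu E phi) <= (K * M)%:E)%E.
Proof.
move=> mphi phi01 M0 HM; apply: ge_ereal_sup => _ [f [Hp /memL2P H2 _] <-].
have bt : bdd (phi \_ `[0, +oo[).
  split => //; exists 1 => t; have [t0|t0] := leP 0 t; last by rewrite patch_lt0// normr0.
  by rewrite patch_ge0//; have /andP[a b] := phi01 t t0; rewrite ger0_norm.
have [g Hg] := FC_exists sE bt H2.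
have Ig := FC_spectral_integral Hg.
have Bg : (cLnorm mu q g <= (K * M * fine (cLnorm mu p f))%:E)%E.
  apply: (bound Hg) => //; first by move=> t; exact: patch_lt0.
  move=> t t1; have t0 : 0 <= t by lra.
  by rewrite patch_ge0//; have /andP[a _] := phi01 t t0; rewrite ger0_norm//; exact: HM.
set F := fine _ in Bg *.
have F0 : 0 <= F by apply: fine_ge0; exact: Lnorm_ge0.
have Ig' : (image_norm mu q (fcalc mu E phi) f <= (K * M * F)%:E)%E.
  by apply: le_trans Bg; apply: ereal_inf_lbound; exists g.
apply: le_trans (lee_wpmul2r _ Ig') _; first by rewrite lee_fin invr_ge0.
rewrite -EFinM lee_fin -(mulrA (K * M)); have KM := mulr_ge0 (ltW K0) M0.
(* The inverse of 0 is 0, so the quotient vanishes when F does. *)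
by have [->|Fn] := eqVneq F 0; [rewrite mul0r mulr0|rewrite divff// mulr1].
Qed.

(** Factor (1 + A)^b as (1 + A)^(b - a) after (1 + A)^a. The multiplier (1 + s)^(b - a) times s^r is
    at most (1 + s)^(b - a + r), hence at most 1, so the general bound applies with M = 1. *)
Lemma image_norm_multiplier (a b : R) f : 0 <= 3 * (p^-1 - q^-1) -> 3 * (p^-1 - q^-1) <= a - b -> L2c mu f ->
  (image_norm mu q (fcalc mu E (fun s => ((1 + s) `^ b)%R)) f <=
   K%:E * image_norm mu p (fcalc mu E (fun s => ((1 + s) `^ a)%R)) f)%E.
Proof.
set r := 3 * _ => r0 rab Hf.
have mpow (c : R) : measurable_fun [set: R] ((fun s => (1 + s) `^ c) \_ `[0, +oo[).
  apply: measurable_patch; apply: measurable_funTS; apply: (measurableT_comp (measurable_powR c)).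
  by apply: measurable_funD.
(* It suffices to bound from below the norm of each g related to f. If f is outside the domain there
   is no such g and the infimum is +oo. *)
rewrite -lee_pdivrMl//; apply: le_ereal_inf_tmp => _ [g Hg <-].
have [gfin|ginf] := boolP (cLnorm mu p g < +oo)%E; last first.
  by move: ginf; rewrite -leNgt leye_eq => /eqP ->; rewrite leey.
have [_ /memL2P Lg _] := Hg.
have Hgp : memL mu p g by split => //; have [] := (memL2P mu g).2 Lg.
pose th : R -> R := (fun s => (1 + s) `^ (b - a)) \_ `[0, +oo[.
have ba : b - a <= 0 by lra.
have th1 t : `|th t| <= 1.
  have [t0|t0] := leP 0 t; last by rewrite /th patch_lt0// normr0.
  rewrite /th patch_ge0// ger0_norm ?powR_ge0//.
  have t1 : 1 <= 1 + t by rewrite lerDl.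
  by have := ler_powR t1 ba; rewrite powRr0.
have bt : bdd th by split; [exact: mpow|exists 1].
have [g' Hg'] := FC_exists sE bt Lg.
have Ig := spectral_integral_mul sE Hg (mpow a) Hf Hg'.
have Bg : (cLnorm mu q g' <= (K * 1 * fine (cLnorm mu p g))%:E)%E.
  apply: (bound Hg') => //; first by move=> t; exact: patch_lt0.
  move=> t t1; have t0 : 0 <= t by lra.
  rewrite /th patch_ge0// ger0_norm ?powR_ge0// -/r.
  have t2 : 1 <= 1 + t by lra.
  have h1 : t `^ r <= (1 + t) `^ r by apply: ge0_ler_powR => //; rewrite ?nnegrE; lra.
  apply: le_trans (ler_wpM2l (powR_ge0 _ _) h1) _.
  rewrite -powRD; last by apply/implyP => _; lra.
  have e0 : b - a + r <= 0 by lra.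
  by have := ler_powR t2 e0; rewrite powRr0.
rewrite lee_pdivrMl//.
apply: (@le_trans _ _ (cLnorm mu q g')).
  apply: ereal_inf_lbound; exists g' => //; rewrite /fcalc.
  rewrite (_ : _ \_ _ = (fun t => th t * ((fun s => (1 + s) `^ a) \_ `[0, +oo[) t))//.
  apply/funext => t; have [t0|t0] := leP 0 t; last by rewrite !patch_lt0// mulr0.
  rewrite /th !patch_ge0// -powRD ?subrK//; apply/implyP => _; lra.
apply: le_trans Bg _; rewrite mulr1 EFinM fineK// fin_numElt gfin andbT.
by apply: lt_le_trans (Lnorm_ge0 _ _ _); rewrite ltNyr.
Qed.

End Multipliers.

Theorem mainTheorem1 (R : realType) (p q : R)
    (hp1 : 1 < p) (hp2 : p <= 2) (hq : 2 <= q) :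
  (exists2 C : R, 0 < C &
    forall E : set R -> (engel R -> R[i]) -> engel R -> R[i],
      spectral_measure_of (engel_measure R) (engelA R) E ->
    forall phi : R -> R,
      {within `[0, +oo[, continuous phi} ->
      (forall s t : R, 0 <= s -> s <= t -> phi t <= phi s) ->
      phi 0 = 1 ->
      phi s @[s --> +oo] --> 0 ->
      (opnorm (engel_measure R) p q (fcalc (engel_measure R) E phi) <=
       C%:E * ereal_sup [set (phi s * s `^ (3 * (p^-1 - q^-1)))%:E
                        | s in [set s : R | (0 < s)%R]])%E) /\
  (forall a b : R, 3 * (p^-1 - q^-1) <= a - b ->
   exists2 C : R, 0 < C &
    forall E : set R -> (engel R -> R[i]) -> engel R -> R[i],
      spectral_measure_of (engel_measure R) (engelA R) E ->
    forall f : engel R -> R[i], schwartz f ->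
      (image_norm (engel_measure R) q
         (fcalc (engel_measure R) E (fun s => ((1 + s) `^ b)%R)) f <=
       C%:E * image_norm (engel_measure R) p
         (fcalc (engel_measure R) E (fun s => ((1 + s) `^ a)%R)) f)%E).
Proof.
have C0 : 0 <= 128 * kernelK R ^+ 2 by rewrite mulr_ge0// sqr_ge0.
have [K K0 HK] := spectral_multiplier_bound (engel_measure R) hp1 hp2 hq C0.
have p0 : 0 < p by lra.
have q0 : 0 < q by lra.
have r0 : 0 <= 3 * (p^-1 - q^-1).
  by rewrite mulr_ge0// subr_ge0 lef_pV2 ?posrE//; lra.
split=> [|a b rab].
  exists K => // E HE phi cphi dphi phi1 lphi; have kE := engel_kernel_bound HE; have [sE _] := HE.
  have phi0 := decreasing_ge0 dphi lphi.
  set S := ereal_sup _.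
  have Sub t : 0 < t -> ((phi t * t `^ (3 * (p^-1 - q^-1)))%:E <= S)%E.
    by move=> t0; apply: ereal_sup_ubound; exists t.
  have S0 : (0 <= S)%E.
    apply: le_trans (Sub 1 ltr01); rewrite lee_fin mulr_ge0 ?powR_ge0//; exact: phi0.
  (* An infinite supremum makes the right-hand side +oo because K > 0, and -oo is excluded by S >=
     0. *)
  case: S S0 Sub => [M|_ _|//]; last by rewrite gt0_muley ?leey// lte_fin.
  rewrite lee_fin => M0 Sub; rewrite -EFinM.
  apply: (opnorm_multiplier sE K0 (HK E sE kE)) => //.
  - apply: measurable_patch.
    by apply: subspace_continuous_measurable_fun => //; exact: measurable_itv.
  - by move=> t t0; rewrite phi0// -phi1 dphi.
  - by move=> t t1; rewrite -lee_fin; apply: Sub; lra.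
exists K => // E HE f Hf; have kE := engel_kernel_bound HE; have [sE _] := HE.
exact: (image_norm_multiplier sE K0 (HK E sE kE) r0 rab (schwartz_L2 Hf)).
Qed.
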